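(* Let $\mathscr L$ be a vertex Lie algebra with an action of $\Gamma$ (given by an automorphism $\sigma$ with $\sigma^T=\mathrm{id}$), let $\mathbf z=\{z_1,\dots,z_N\}\subset\mathbb C^\times$ have pairwise disjoint $\Gamma$-orbits, let $M_{z_i}$ be a smooth module over $\mathsf L(\mathscr L)_{z_i}$ for each $i=1,\dots,N$, and let $M_0$ be a smooth module over $\mathsf L(\mathscr L)^\Gamma$. Then there is a linear isomorphism $$\Big(\bigotimes_{i=1}^N M_{z_i}\otimes M_0\Big)\Big/\mathsf L^\Gamma_{\mathbf z,0}(\mathbb V(\mathscr L))\;\cong_{\mathbb C}\;\Big(\bigotimes_{i=1}^N M_{z_i}\otimes M_0\Big)\Big/\mathsf L^\Gamma_{\mathbf z,0}(\mathscr L).$$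
   Context: Everything is over $\mathbb C$. A vertex Lie algebra is a $\mathbb C[\mathcal D]$-module $\mathscr L$ with bilinear products $(a,b)\mapsto a_{(n)}b$ ($n\in\mathbb Z_{\ge0}$), where for given $a,b$ one has $a_{(n)}b=0$ for $n\gg0$, such that $(\mathcal Da)_{(n)}b=-n\,a_{(n-1)}b$, $a_{(n)}b=-\sum_{k\ge0}\frac{(-1)^{n+k}}{k!}\mathcal D^k(b_{(n+k)}a)$ and $a_{(m)}(b_{(n)}c)-b_{(n)}(a_{(m)}c)=\sum_{k\ge0}\binom mk(a_{(k)}b)_{(m+n-k)}c$. It is assumed that $\ker\mathcal D=\mathbb C\mathsf c$ is one-dimensional, $\mathsf c\notin\operatorname{im}\mathcal D$, and $\mathscr L=\bigoplus_{n\ge0}\mathscr L_{(n)}$ is graded with $\mathcal D$ of degree $1$, $\deg\mathsf c=0$, $\deg(a_{(n)}b)=\deg a+\deg b-n-1$. Fix a subspace $\mathscr L^o$ with $\mathscr L=\mathscr L^o\oplus\mathbb C\mathsf c\oplus\operatorname{im}\mathcal D$. $\Gamma\subset\mathbb C^\times$ is the group of $T$-th roots of unity ($T\ge1$) with generator $\omega$, acting on $\mathbb C$ by multiplication. $\sigma$ is an automorphism of $\mathscr L$ (degree-preserving linear bijection commuting with $\mathcal D$ and all products, $\sigma(\mathsf c)=\mathsf c$) with $\sigma^T=\mathrm{id}$; $R_{\omega^k}a:=\omega^{k\deg a}\sigma^k(a)$ for homogeneous $a$. For a commutative associative algebra $\mathcal A$ with derivation $\delta$, $\mathrm{Lie}_{\mathcal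 A}\mathscr L:=(\mathscr L\otimes\mathcal A)/\operatorname{im}(\mathcal D\otimes1+1\otimes\delta)$, with quotient map $\rho$, is a Lie algebra with $[\rho(a\otimes f),\rho(b\otimes g)]=\sum_{n\ge0}\frac1{n!}\rho(a_{(n)}b\otimes(\delta^nf)g)$. For functions of $t$, $\delta=\partial_t$. $\mathsf L(\mathscr L):=\mathrm{Lie}_{\mathbb C((t))}\mathscr L$, $a(n):=\rho(a\otimes t^n)$; $\mathsf L(\mathscr L)_z:=\mathrm{Lie}_{\mathbb C((t-z))}\mathscr L\cong\mathsf L(\mathscr L)$, $a(n)_z:=\rho(a\otimes(t-z)^n)$. $\Gamma$ acts by automorphisms $\alpha.\rho(a\otimes f(t))=\rho(\alpha^{-1}R_\alpha a\otimes f(\alpha^{-1}t))$ on $\mathsf L(\mathscr L)$ and on the Lie algebras built from rational functions below; $\mathsf L(\mathscr L)^\Gamma$ is the subalgebra of invariants and $a^\Gamma(n):=\sum_{\alpha\in\Gamma}\alpha^{-n-1}(R_\alpha a)(n)$. For finite $S\subset\mathbb C$, $\mathbb C^\infty_S(t)$ is the algebra of rational functions vanishing at $\infty$ with poles at most in $S$. $\mathsf L^\Gamma_{\mathbf z,0}(\mathscr L)$ is the Lie algebra of $\Gamma$-invariants in the image of $\rho(\mathscr L^o\otimes\mathbb C^\infty_{\Gamma\mathbf z\cup\{0\}}(t))$ in $\mathrm{Lie}_{\mathbb C^\infty_{\Gamma\mathbf z\cup\{0\}}(t)}\mathscr L/I_{\Gamma\mathbf z,0}$, where $I_{\Gamma\mathbf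 z,0}$ is the ideal spanned by $\sum_{\alpha\in\Gamma}\rho(\mathsf c\otimes\frac1{t-\alpha z_i})-T\rho(\mathsf c\otimes\frac1t)$, $1\le i\le N$. All modules over $\mathsf L(\mathscr L)_{z_i}$ have level $1$ ($\mathsf c(-1)$ acts as $1$) and all modules over $\mathsf L(\mathscr L)^\Gamma$ have level $1/T$ ($\mathsf c(-1)$ acts as $1/T$). An $\mathsf L(\mathscr L)$-module is smooth if for all $v$ and $a\in\mathscr L$, $a(n)v=0$ for $n\gg0$ (formal sums $\sum_{n\ge K}f_na(n)$ act termwise); smoothness for $\mathsf L(\mathscr L)^\Gamma$ is the same with $a^\Gamma(n)$. $\mathsf L^\Gamma_{\mathbf z,0}(\mathscr L)$ acts on $\bigotimes_iM_{z_i}\otimes M_0$ by taking the Laurent expansions at $z_1,\dots,z_N$ and $0$ and letting them act on the respective tensor factors (and summing). For a module $V$ over a Lie algebra $\mathfrak g$, $V/\mathfrak g:=V/\mathfrak g.V$ (coinvariants). $\mathbb V(\mathscr L):=U(\mathsf L(\mathscr L))\otimes_{U(\mathsf L^+(\mathscr L))}\mathbb C|0\rangle$, where $\mathsf L^+(\mathscr L)=\rho(\mathscr L\otimes\mathbb C[[t]])+\mathbb C\mathsf c(-1)$, $\rho(\mathscr L\otimes\mathbb C[[t]])|0\rangle=0$, $\mathsf c(-1)|0\rangle=|0\rangle$. For series put $F(x)_+=\sum_{n<0}F_nx^{-n-1}$, $F(x)_-=\sum_{n\ge0}F_nx^{-n-1}$, $:\!F(x)G(x)\!:\,=F(x)_+G(x)+G(x)F(x)_-$.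 $\mathbb V(\mathscr L)$ is a vertex algebra with vacuum $|0\rangle$ and state-field map $Y(A,x)=\sum_nA_{(n)}x^{-n-1}$ determined by $Y(|0\rangle,x)=\mathrm{id}$, $Y(a(-1)|0\rangle,x)=\sum_na(n)x^{-n-1}$, $Y(a(-1)B,x)=\,:\!Y(a(-1)|0\rangle,x)Y(B,x)\!:$. For a smooth $\mathsf L(\mathscr L)$-module $M$, $Y_M(A,x)=\sum_nA^M_{(n)}x^{-n-1}$ is determined by the same formulas with $a(n)$ acting on $M$. For a smooth $\mathsf L(\mathscr L)^\Gamma$-module $M_0$, $Y_W(A,x)=\sum_nA^W_{(n)}x^{-n-1}$ is the map determined by $Y_W(|0\rangle,x)=\mathrm{id}$, $Y_W(a(-1)|0\rangle,x)=\sum_na^\Gamma(n)x^{-n-1}$ and $Y_W(a(-1)B,x)=\,:\!Y_W(a(-1)|0\rangle,x)Y_W(B,x)\!:+\sum_{\alpha\in\Gamma\setminus\{1\}}\sum_{n\ge0}\frac{1}{((\alpha-1)x)^{n+1}}Y_W((R_\alpha a)(n)B,x)$, for $a\in\mathscr L$, $B\in\mathbb V(\mathscr L)$. With its products $A_{(n)}B$, $n\ge0$, with $\mathcal DA=A_{(-2)}|0\rangle$, central element $|0\rangle$, grading $\deg(a_1(-n_1)\cdots a_j(-n_j)|0\rangle)=\sum_i(\deg a_i+n_i-1)$ and $\sigma(a_1(-n_1)\cdots a_j(-n_j)|0\rangle)=(\sigma a_1)(-n_1)\cdots(\sigma a_j)(-n_j)|0\rangle$, $\mathbb V(\mathscr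 L)$ is itself a vertex Lie algebra with automorphism. So the `big' Lie algebras $\mathsf L(\mathbb V(\mathscr L))_{z}$, $\mathsf L(\mathbb V(\mathscr L))^\Gamma$, $\mathsf L^\Gamma_{\mathbf z,0}(\mathbb V(\mathscr L))$ are defined by the same recipe with $\mathsf c$ replaced by $|0\rangle$ and $\mathscr L^o$ replaced by $\mathbb V(\mathscr L)^o$, a choice of complement of $\operatorname{im}\mathcal D\oplus\mathbb C|0\rangle$ in $\mathbb V(\mathscr L)$. The big Lie algebras act as follows: $A(n)_{z_i}$ acts on $M_{z_i}$ as $A^M_{(n)}$, $A^\Gamma(n):=\sum_{\alpha\in\Gamma}\alpha^{-n-1}(R_\alpha A)(n)$ acts on $M_0$ as $A^W_{(n)}$, and $\mathsf L^\Gamma_{\mathbf z,0}(\mathbb V(\mathscr L))$ acts on $\bigotimes_iM_{z_i}\otimes M_0$ by Laurent expansion.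
   Formalization: For arbitrary complements the claim fails (e.g. if V(L)^o contains b(-1)|0>+|0>), so it is assumed that L^o is graded and σ-stable, and that V(L)^o is graded and lies in the span of the monomials a_1(-n_1)...a_j(-n_j)|0> with j≥1 and all a_i in L^o. *)

(* Defs.v *)
Set Warnings "-all".
From HB Require Import structures.
From mathcomp Require Import all_boot all_order all_algebra.
From mathcomp Require Import generic_quotient fraction finmap.
From mathcomp Require Import boolp classical_sets functions cardinality fsbigop.
From mathcomp Require Import reals.
From mathcomp.real_closed Require Import complex.
From mathcomp.multinomials Require Import monalg.

Set Implicit Arguments.
Unset Strict Implicit.
Unset Printing Implicit Defensive.

Import Order.TTheory GRing.Theory Num.Theory.

Local Open Scope classical_set_scope.
Local Open Scope quotient_scope.
Local Open Scope ring_scope.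

Definition lspan (K : fieldType) (V : lmodType K) (S : set V) : set V :=
  [set x | exists n (c : 'I_n -> K) (s : 'I_n -> V),
     (forall i, S (s i)) /\ x = \sum_i c i *: s i].

Definition subspace (K : fieldType) (V : lmodType K) (S : set V) : Prop :=
  S 0 /\ forall (c : K) x y, S x -> S y -> S (c *: x + y).

Section Quotient.
Context {K : fieldType} {V : lmodType K}.
Implicit Types (S : set V) (x y : V) (c : K).

Lemma lspan_subspace S : subspace (lspan S).
Proof.
split; first by exists 0%N, (fun=> 0), (fun=> 0); split=> [[]//|]; rewrite big_ord0.
move=> c _ _ [n [a [s [Ss ->]]]] [m [b [t [St ->]]]].
exists (n + m)%N, (fun i : 'I_(n + m) => match fintype.split i with inl j => c * a j | inr j => b j end),
  (fun i : 'I_(n + m) => match fintype.split i with inl j => s j | inr j => t j end).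
split=> [i|]; first by case: (fintype.split i).
rewrite big_split_ord /= scaler_sumr; congr (_ + _); apply: eq_bigr => i _.
  by rewrite (unsplitK (inl i)) scalerA.
by rewrite (unsplitK (inr i)).
Qed.

Lemma lspan_incl S x : S x -> lspan S x.
Proof.
by move=> Sx; exists 1%N, (fun=> 1), (fun=> x); split=> //; rewrite big_ord1 scale1r.
Qed.

Definition quot_rel S : rel V := fun x y => `[< lspan S (x - y) >].

Lemma quot_rel_refl S : reflexive (quot_rel S).
Proof. by move=> x; apply/asboolP; rewrite subrr; case: (lspan_subspace S). Qed.

Lemma quot_rel_sym S : symmetric (quot_rel S).
Proof.
suff H x y : quot_rel S x y -> quot_rel S y x by move=> x y; apply/idP/idP; apply: H.
move=> /asboolP Sxy; apply/asboolP; case: (lspan_subspace S) => S0 SP.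
by rewrite -opprB -scaleN1r -[_ *: _]addr0; apply: SP.
Qed.

Lemma quot_rel_trans S : transitive (quot_rel S).
Proof.
move=> y x z /asboolP Sxy /asboolP Syz; apply/asboolP; case: (lspan_subspace S) => _ SP.
by rewrite -(subrK y x) -addrA -[x - y]scale1r; apply: SP.
Qed.

Canonical quot_equiv S :=
  EquivRel (quot_rel S) (@quot_rel_refl S) (@quot_rel_sym S) (@quot_rel_trans S).

(* the quotient of V by the span of S *)
Definition quot S := {eq_quot (quot_equiv S)}.
HB.instance Definition _ S := Choice.on (quot S).
HB.instance Definition _ S := EqQuotient.on (quot S).

Definition qpi S (x : V) : quot S := \pi x.

Lemma qpiP S x y : qpi S x = qpi S y <-> lspan S (x - y).
Proof. by split=> [/eqmodP/asboolP|h]; [|apply/eqmodP/asboolP]. Qed.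

Lemma qpiK S (q : quot S) : qpi S (repr q) = q.
Proof. exact: reprK. Qed.

Lemma qpi_lin S c x y x' y' : qpi S x = qpi S x' -> qpi S y = qpi S y' ->
  qpi S (c *: x + y) = qpi S (c *: x' + y').
Proof.
move=> /qpiP Sx /qpiP Sy; apply/qpiP; case: (lspan_subspace S) => _ SP.
by rewrite opprD addrACA -scalerBr; apply: SP.
Qed.

Definition quot_add S (q r : quot S) := qpi S (repr q + repr r).
Definition quot_opp S (q : quot S) := qpi S (- repr q).
Definition quot_scale S c (q : quot S) := qpi S (c *: repr q).

Lemma quot_addE S x y : quot_add (qpi S x) (qpi S y) = qpi S (x + y).
Proof.
by rewrite /quot_add -[repr _ + _](congr2 +%R (scale1r _) erefl)
  -[x + y](congr2 +%R (scale1r _) erefl); apply: qpi_lin; rewrite qpiK.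
Qed.
Lemma quot_scaleE S c x : quot_scale c (qpi S x) = qpi S (c *: x).
Proof. by rewrite /quot_scale -[c *: _]addr0 -[c *: x]addr0; apply: qpi_lin; rewrite ?qpiK. Qed.
Lemma quot_oppE S x : quot_opp (qpi S x) = qpi S (- x).
Proof. by rewrite -scaleN1r -quot_scaleE /quot_scale scaleN1r. Qed.

Fact quot_addA S : associative (@quot_add S).
Proof. by move=> p q r; rewrite -(qpiK p) -(qpiK q) -(qpiK r) !quot_addE addrA. Qed.
Fact quot_addC S : commutative (@quot_add S).
Proof. by move=> p q; rewrite -(qpiK p) -(qpiK q) !quot_addE addrC. Qed.
Fact quot_add0 S : left_id (qpi S 0) (@quot_add S).
Proof. by move=> p; rewrite -(qpiK p) quot_addE add0r. Qed.
Fact quot_addN S : left_inverse (qpi S 0) (@quot_opp S) (@quot_add S).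
Proof. by move=> p; rewrite -(qpiK p) quot_oppE quot_addE addNr. Qed.
HB.instance Definition _ S := GRing.isZmodule.Build (quot S)
  (@quot_addA S) (@quot_addC S) (@quot_add0 S) (@quot_addN S).

Fact quot_scaleA S c d (q : quot S) : quot_scale c (quot_scale d q) = quot_scale (c * d) q.
Proof. by rewrite -(qpiK q) !quot_scaleE scalerA. Qed.
Fact quot_scale1 S : left_id 1 (@quot_scale S).
Proof. by move=> q; rewrite -(qpiK q) quot_scaleE scale1r. Qed.
Fact quot_scaleDr S : right_distributive (@quot_scale S) +%R.
Proof.
move=> c p q; rewrite -(qpiK p) -(qpiK q) [_ + qpi S _]quot_addE.
by rewrite !quot_scaleE [RHS]quot_addE scalerDr.
Qed.
Fact quot_scaleDl S (q : quot S) : {morph (@quot_scale S)^~ q : c d / c + d}.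
Proof.
by move=> c d; rewrite -(qpiK q) !quot_scaleE scalerDl [RHS]quot_addE.
Qed.
HB.instance Definition _ S := GRing.Zmodule_isLmodule.Build K (quot S)
  (@quot_scaleA S) (@quot_scale1 S) (@quot_scaleDr S) (@quot_scaleDl S).

Fact qpi_linear S : linear (qpi S).
Proof. by move=> c x y; rewrite -quot_addE -quot_scaleE. Qed.
HB.instance Definition _ S := GRing.isLinear.Build K V (quot S) *:%R (qpi S) (qpi_linear S).

End Quotient.

(* The linear map {malg K[X]} -> W determined by h on the basis X. *)
Definition free_lift (K : fieldType) (X : choiceType) (W : lmodType K)
    (h : X -> W) (g : {malg K[X]}) : W :=
  \sum_(x <- msupp g) g@_x *: h x.

(* The map on a quotient of {malg K[X]} induced by h, computed on a
   representative; it is the linear map sending the class of << x >> to h x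
   as soon as free_lift h kills the relations S. *)
Definition quot_lift (K : fieldType) (X : choiceType) (S : set {malg K[X]})
    (W : lmodType K) (h : X -> W) (q : quot S) : W :=
  free_lift h (repr q).

Lemma free_lift_linear (K : fieldType) (X : choiceType) (W : lmodType K) (h : X -> W) :
  linear (free_lift h).
Proof.
have E (D : {fset X}) (g : {malg K[X]}) : (msupp g `<=` D)%fset ->
    free_lift h g = \sum_(x <- D) g@_x *: h x.
  move=> sD; rewrite /free_lift; apply: big_fset_incl => // x _ nx.
  by rewrite (mcoeff_outdom nx) scale0r.
move=> c f g; pose D := (msupp f `|` msupp g `|` msupp (c *: f + g))%fset.
rewrite !(E D); last by rewrite /D fsubsetUr.
- rewrite scaler_sumr -big_split /=; apply: eq_bigr => x _.
  by rewrite mcoeffD mcoeffZ scalerDl scalerA.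
- by rewrite /D -fsetUA fsetUCA fsubsetUl.
- by rewrite /D -fsetUA fsubsetUl.
Qed.

Lemma free_liftU (K : fieldType) (X : choiceType) (W : lmodType K) (h : X -> W) x :
  free_lift h (<< x >> : {malg K[X]}) = h x.
Proof. by rewrite /free_lift msuppU oner_eq0 big_seq_fset1 mcoeffU eqxx scale1r. Qed.

Lemma quot_liftE (K : fieldType) (X : choiceType) (S : set {malg K[X]})
    (W : lmodType K) (h : X -> W) (g : {malg K[X]}) :
  (forall r, S r -> free_lift h r = 0) -> quot_lift h (qpi S g) = free_lift h g.
Proof.
move=> hS; have fD := free_lift_linear h.
pose F : {malg K[X]} -> W := free_lift h.
pose m := GRing.isLinear.Build K {malg K[X]} W *:%R F fD.
pose L : {linear {malg K[X]} -> W} := HB.pack F m.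
have /qpiP[n [c [s [Ss E]]]] : qpi S (repr (qpi S g)) = qpi S g by rewrite qpiK.
apply/eqP; rewrite -subr_eq0; apply/eqP; rewrite -[LHS](raddfB L) E raddf_sum.
rewrite big1 // => i _; apply: (etrans (linearZ_LR L _ _)).
by rewrite /= /F hS ?scaler0.
Qed.

Section Tensor.
Context {K : fieldType}.

Definition tensor_rels (U V : lmodType K) : set {malg K[(U * V)%type]} :=
  [set r | exists c (u u' : U) (v : V),
     r = << (c *: u + u', v) >> - c *: << (u, v) >> - << (u', v) >>] `|`
  [set r | exists c (u : U) (v v' : V),
     r = << (u, c *: v + v') >> - c *: << (u, v) >> - << (u, v') >>].

Definition tensor (U V : lmodType K) := quot (@tensor_rels U V).
Definition tens (U V : lmodType K) (u : U) (v : V) : tensor U V :=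
  qpi _ << (u, v) >>.
Definition tensor_lift (U V W : lmodType K) (b : U -> V -> W)
  (t : tensor U V) : W := quot_lift (fun p => b p.1 p.2) t.

Context {I : finType} (M : I -> lmodType K).

Definition mtensor_rels : set {malg K[forall i, M i]} :=
  [set r | exists (v : forall i, M i) i c (x y : M i),
     r = << dfwith v (c *: x + y) >> - c *: << dfwith v x >> - << dfwith v y >>].

Definition mtensor := quot mtensor_rels.
Definition mtens (v : forall i, M i) : mtensor := qpi _ << v >>.
Definition mtensor_op i (phi : M i -> M i) (t : mtensor) : mtensor :=
  quot_lift (fun v => mtens (dfwith v (phi (v i)))) t.

End Tensor.

(* A commutative associative algebra with derivation, together with the
   substitutions f(t) |-> f(c t), c <> 0 (operations only). *)
Record dalg (K : fieldType) := DAlg {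
  dcar :> lmodType K;
  dmul : dcar -> dcar -> dcar;
  dder : dcar -> dcar;
  dsub : K -> dcar -> dcar }.

Section Laurent.
Context {K : fieldType}.

Definition lbounded : {pred int -> K^o} :=
  fun f => `[< exists d : int, forall n, (n < d)%R -> f n = 0 >].

Fact lbounded_submod : submod_closed lbounded.
Proof.
split; first by apply/asboolP; exists 0.
move=> c f g /asboolP[d fd] /asboolP[e ge]; apply/asboolP.
exists (Num.min d e) => n; rewrite lt_min => /andP[nd ne].
by change (c *: f n + g n = 0); rewrite fd // ge // addr0 scaler0.
Qed.
HB.instance Definition _ :=
  GRing.isSubmodClosed.Build K (int -> K^o) lbounded lbounded_submod.

(* K((t)); the coefficient of t^n in f is f n *)
Record laurent := Laurent { lcoef :> int -> K^o; _ : lcoef \in lbounded }.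
HB.instance Definition _ := [isSub for lcoef].
HB.instance Definition _ := [Choice of laurent by <:].
HB.instance Definition _ := [SubChoice_isSubLmodule of laurent by <:].

(* the Laurent series with coefficients f (0 if the support of f is not
   bounded below) *)
Definition mklaurent (f : int -> K) : laurent := insubd 0 f.

Definition lmono (n : int) : laurent := mklaurent (fun m => (m == n)%:R).
Definition lmul (f g : laurent) : laurent :=
  mklaurent (fun n => \sum_(m \in [set: int]) f m * g (n - m)).
Definition lder (f : laurent) : laurent :=
  mklaurent (fun n => (n + 1)%:~R * f (n + 1)).
Definition lsub (c : K) (f : laurent) : laurent :=
  mklaurent (fun n => c ^ n * f n).
Definition lpoly (p : {poly K}) : laurent :=
  mklaurent (fun n => if (0 <= n)%R then p`_`|n|%N else 0).

Definition laurent_dalg : dalg K := @DAlg K laurent lmul lder lsub.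

End Laurent.
Arguments laurent : clear implicits.
Arguments laurent_dalg : clear implicits.

Section Rational.
Context {K : fieldType}.

Local Notation "p %:F" := (@FracField.tofrac {poly K} p).

Definition ratfun := {fraction {poly K}}.
HB.instance Definition _ := GRing.Field.on ratfun.

Definition rscale (c : K) (f : ratfun) : ratfun := (c%:P)%:F * f.
Fact rscaleA c d f : rscale c (rscale d f) = rscale (c * d) f.
Proof. by rewrite /rscale mulrA -rmorphM -polyCM. Qed.
Fact rscale1 : left_id 1 rscale.
Proof. by move=> f; rewrite /rscale polyC1 rmorph1 mul1r. Qed.
Fact rscaleDr : right_distributive rscale +%R.
Proof. by move=> c f g; rewrite /rscale mulrDr. Qed.
Fact rscaleDl f : {morph rscale^~ f : c d / c + d}.
Proof. by move=> c d; rewrite /rscale polyCD rmorphD mulrDl. Qed.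
HB.instance Definition _ := GRing.Zmodule_isLmodule.Build K ratfun
  rscaleA rscale1 rscaleDr rscaleDl.

Definition rnum (f : ratfun) : {poly K} := \n_(repr f).
Definition rden (f : ratfun) : {poly K} := \d_(repr f).

Definition rder (f : ratfun) : ratfun :=
  ((rnum f)^`() * rden f - rnum f * (rden f)^`())%:F / (rden f ^+ 2)%:F.
Definition rsub (c : K) (f : ratfun) : ratfun :=
  (rnum f \Po (c *: 'X))%:F / (rden f \Po (c *: 'X))%:F.

(* rational functions vanishing at infinity with poles at most in S *)
Definition rinfp (S : seq K) : {pred ratfun} :=
  fun f => `[< exists k (p : {poly K}),
    let q := (\prod_(s <- S) ('X - s%:P)) ^+ k in
    (size p < size q)%N /\ f = p%:F / q%:F >].

Fact rinfp_submod S : submod_closed (rinfp S).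
Proof.
set Q := \prod_(s <- S) ('X - s%:P).
have Qm k : Q ^+ k \is monic by rewrite monic_exp // monic_prod_XsubC.
have Q0 k : (Q ^+ k)%:F != 0 by rewrite tofrac_eq0 monic_neq0.
split.
  apply/asboolP; exists 0%N, 0; rewrite -/Q /= size_poly0 expr0 size_poly1.
  by split=> //; rewrite rmorph0 mul0r.
move=> c f g /asboolP[k [p [sp ->]]] /asboolP[l [r [sr ->]]].
apply/asboolP; exists (k + l)%N, (c *: (p * Q ^+ l) + r * Q ^+ k).
rewrite -/Q /= in sp sr *; split.
  rewrite exprD (size_monicM _ (monic_neq0 (Qm l))) //.
  have h (u : {poly K}) m : (size (u * Q ^+ m)%R <= (size u + size (Q ^+ m)%R).-1)%N.
    exact: size_polyMleq.
  have s0 m : (0 < size (Q ^+ m)%R)%N by rewrite size_poly_gt0 monic_neq0.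
  apply: (leq_ltn_trans (size_polyD _ _)); rewrite gtn_max; apply/andP; split.
    apply: (leq_ltn_trans (size_scale_leq _ _)); apply: (leq_ltn_trans (h _ _)).
    by rewrite -(prednK (s0 l)) !addnS /= ltn_add2r.
  apply: (leq_ltn_trans (h _ _)).
  by rewrite addnC -(prednK (s0 k)) !addSn /= ltn_add2l.
rewrite exprD rmorphD rmorphM -mul_polyC !rmorphM /= /GRing.scale /= /rscale.
rewrite mulrDl -!mulrA; congr (_ * (_ * _) + _ * _).
  by rewrite invfM mulrCA divff ?mulr1.
by rewrite invfM mulVKf.
Qed.
HB.instance Definition _ S :=
  GRing.isSubmodClosed.Build K ratfun (rinfp S) (rinfp_submod S).

Record rinf (S : seq K) := RInf { rval :> ratfun; _ : rval \in rinfp S }.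
HB.instance Definition _ S := [isSub for @rval S].
HB.instance Definition _ S := [Choice of rinf S by <:].
HB.instance Definition _ S := [SubChoice_isSubLmodule of rinf S by <:].

(* The element of rinf S given by a rational function (0 if it has other poles
   or does not vanish at infinity). *)
Definition mkrinf S (f : ratfun) : rinf S := insubd 0 f.

Definition rinf_dalg (S : seq K) : dalg K := @DAlg K (rinf S)
  (fun f g => mkrinf S (rval f * rval g)) (fun f => mkrinf S (rder f))
  (fun c f => mkrinf S (rsub c f)).

(* 1/(t - s) *)
Definition rpole S (s : K) : rinf S := mkrinf S (('X - s%:P)%:F)^-1.

(* The Laurent expansion at z: the unique g(u) in K((u)) with
   q(z + u) g(u) = p(z + u), where f = p/q. *)
Definition expand (z : K) (f : ratfun) : laurent K :=
  xget 0 [set g | lmul (lpoly (rden f \Po ('X + z%:P))) g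
                  = lpoly (rnum f \Po ('X + z%:P))].

End Rational.
Arguments ratfun : clear implicits.

(* The operations of a vertex Lie algebra with automorphism: the translation
   operator, the products (a, b) |-> a_(n) b, the central element, the
   homogeneous subspaces L_(n) and the automorphism. The axioms are stated
   separately in vertex_lie_algebra and vla_automorphism. *)
Record vla (K : fieldType) := VLA {
  vcar :> lmodType K;
  vD : vcar -> vcar;
  vprod : vcar -> nat -> vcar -> vcar;
  vc : vcar;
  vhomog : nat -> set vcar;
  vsigma : vcar -> vcar }.

Section VertexLieAlgebra.
Context {K : fieldType} (L : vla K).

(* h n is the component of degree n of a *)
Definition homog_decomp (a : L) (h : nat -> L) : Prop :=
  (forall n, vhomog n (h n)) /\
  exists d, (forall n, (d <= n)%N -> h n = 0) /\ a = \sum_(n < d) h n.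

Record vertex_lie_algebra : Prop := {
  vD_linear : linear (@vD _ L);
  vprod_linearl : forall n (b : L), linear (fun a : L => vprod a n b);
  vprod_linearr : forall (a : L) n, linear (vprod a n);
  vprod_trunc : forall a b : L, exists m, forall n, (m <= n)%N -> vprod a n b = 0;
  vprod_D : forall (a : L) n b, vprod (vD a) n b = - (n%:R *: vprod a n.-1 b);
  vprod_skew : forall (a : L) n b,
    vprod a n b = - \sum_(k \in [set: nat])
      ((-1) ^+ (n + k) / k`!%:R) *: iter k (@vD _ L) (vprod b (n + k) a);
  vprod_comm : forall (a b c : L) m n,
    vprod a m (vprod b n c) - vprod b n (vprod a m c) =
    \sum_(k < m.+1) 'C(m, k)%:R *: vprod (vprod a k b) (m + n - k) c;
  vD_ker : forall a : L, vD a = 0 <-> exists l : K, a = l *: vc L;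
  vc_neq0 : vc L <> 0;
  vc_notin_im : forall a : L, vD a <> vc L;
  vhomog_subspace : forall n, subspace (@vhomog _ L n);
  homog_decomp_ex : forall a : L, exists h, homog_decomp a h;
  homog_decomp_uniq : forall (a : L) h h',
    homog_decomp a h -> homog_decomp a h' -> h =1 h';
  vhomog_c : vhomog 0 (vc L);
  vhomog_D : forall n (a : L), vhomog n a -> vhomog n.+1 (vD a);
  vhomog_prod : forall p q n r (a b : L), vhomog p a -> vhomog q b ->
    (p + q = r + n.+1)%N -> vhomog r (vprod a n b);
  vhomog_prod0 : forall p q n (a b : L), vhomog p a -> vhomog q b ->
    (p + q < n.+1)%N -> vprod a n b = 0 }.

Record vla_automorphism (T : nat) : Prop := {
  vsigma_linear : linear (@vsigma _ L);
  vsigma_bij : bijective (@vsigma _ L);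
  vsigma_homog : forall n (a : L), vhomog n a -> vhomog n (vsigma a);
  vsigma_D : forall a : L, vsigma (vD a) = vD (vsigma a);
  vsigma_prod : forall (a : L) n b,
    vsigma (vprod a n b) = vprod (vsigma a) n (vsigma b);
  vsigma_c : vsigma (vc L) = vc L;
  vsigma_order : forall a : L, iter T (@vsigma _ L) a = a }.

(* S (+) K c (+) im D = L *)
Record vla_complement (S : set L) : Prop := {
  compl_subspace : subspace S;
  compl_sum : forall a : L, exists s (l : K) b, S s /\ a = s + l *: vc L + vD b;
  compl_direct : forall s (l : K) (b : L), S s ->
    s + l *: vc L + vD b = 0 -> [/\ s = 0, l *: vc L = 0 & vD b = 0] }.

Definition vla_graded (S : set L) : Prop :=
  forall s, S s -> exists h, homog_decomp s h /\ forall n, S (h n).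

Definition vcomp (a : L) : nat -> L := xget (fun=> 0) (homog_decomp a).

(* R_{w^k} *)
Definition vR (w : K) (k : nat) (a : L) : L :=
  \sum_(n \in [set: nat]) w ^+ (k * n) *: iter k (@vsigma _ L) (vcomp a n).

End VertexLieAlgebra.

Section Lie.
Context {K : fieldType} (L : vla K) (A : dalg K).

Definition lie_rels : set (tensor L A) :=
  [set t | exists (a : L) (f : A), t = tens (vD a) f + tens a (dder f)].

Definition lie := quot lie_rels.
Definition rho (a : L) (f : A) : lie := qpi _ (tens a f).

Definition lie_lift (W : lmodType K) (b : L -> A -> W) (x : lie) : W :=
  tensor_lift b (repr x).

Definition lie_br (x y : lie) : lie :=
  lie_lift (fun a f => lie_lift (fun b g =>
    \sum_(n \in [set: nat])
      (n`!%:R)^-1 *: rho (vprod a n b) (dmul (iter n (@dder _ A) f) g)) y) x.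

(* the action of w^k in Gamma *)
Definition gact (w : K) (k : nat) (x : lie) : lie :=
  lie_lift (fun a f => (w ^+ k)^-1 *: rho (vR w k a) (dsub (w ^+ k)^-1 f)) x.

End Lie.

Definition loop (K : fieldType) (L : vla K) := lie L (laurent_dalg K).

Section Modules.
Context {K : fieldType} (L : vla K) (T : nat) (w : K).

(* a(n) *)
Definition mode (a : L) (n : int) : loop L := rho a (lmono n : laurent_dalg K).

Definition loopG : set (loop L) := [set x | forall k, gact w k x = x].

Definition modeG (a : L) (n : int) : loop L :=
  \sum_(k < T) (w ^+ k) ^ (- n - 1) *: mode (vR w k a) n.

(* M is a module over the Lie subalgebra G of g; the values of act outside G
   are irrelevant *)
Definition lie_module (g : lmodType K) (br : g -> g -> g) (G : set g)
    (M : lmodType K) (act : g -> M -> M) : Prop :=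
  [/\ forall (c : K) x y v, G x -> G y -> act (c *: x + y) v = c *: act x v + act y v,
      forall x, G x -> linear (act x) &
      forall x y v, G x -> G y ->
        act (br x y) v = act x (act y v) - act y (act x v)].

(* sum_n f_n u_n *)
Definition termwise (M : lmodType K) (f : laurent K) (u : int -> M) : M :=
  \sum_(n \in [set: int]) (lcoef f n : K) *: u n.

(* smooth L(L)-modules of level 1 *)
Record smooth_module (M : lmodType K) (act : loop L -> M -> M) : Prop := {
  sm_module : lie_module (@lie_br _ L (laurent_dalg K)) setT act;
  sm_level : forall v, act (mode (vc L) (-1)) v = v;
  sm_smooth : forall a v, exists d : int, forall n, d <= n -> act (mode a n) v = 0;
  sm_termwise : forall a (f : laurent_dalg K) v,
    act (rho a f) v = termwise f (fun n => act (mode a n) v) }.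

(* smooth L(L)^Gamma-modules of level 1/T *)
Record smooth_moduleG (M : lmodType K) (act : loop L -> M -> M) : Prop := {
  smG_module : lie_module (@lie_br _ L (laurent_dalg K)) loopG act;
  smG_level : forall v, act (mode (vc L) (-1)) v = T%:R^-1 *: v;
  smG_smooth : forall a v, exists d : int, forall n, d <= n -> act (modeG a n) v = 0;
  smG_termwise : forall a (f : laurent_dalg K) v,
    act (\sum_(k < T) gact w k (rho a f)) v =
    termwise f (fun n => act (modeG a n) v) }.

End Modules.

Section Vacuum.
Context {K : fieldType} (L : vla K).

(* U(g) (x)_{U(h)} K_chi as a quotient of the free vector space on words in g,
   the word x_1 ... x_n standing for x_1 ... x_n (x) 1; (x, c) \in h means that
   x \in h and chi(x) = c. *)
Definition ind_rels (g : lmodType K) (br : g -> g -> g) (h : set (g * K)) :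
    set {malg K[seq g]} :=
  [set r | exists (u v : seq g) c (x y : g),
     r = << u ++ (c *: x + y) :: v >> - c *: << u ++ x :: v >> - << u ++ y :: v >>] `|`
  [set r | exists (u v : seq g) (x y : g),
     r = << u ++ [:: x, y & v] >> - << u ++ [:: y, x & v] >> - << u ++ br x y :: v >>] `|`
  [set r | exists (u : seq g) x c, h (x, c) /\ r = << rcons u x >> - c *: << u >>].

Definition vac_char : set (loop L * K) :=
  [set p | exists (a : L) (f : laurent_dalg K),
     (forall n : int, n < 0 -> lcoef f n = 0) /\ p = (rho a f, 0)] `|`
  [set (mode (vc L) (-1), 1)].

Definition vac_rels := ind_rels (@lie_br _ L (laurent_dalg K)) vac_char.
Definition vacm := quot vac_rels.

Definition vword (u : seq (loop L)) : vacm := qpi _ << u >>.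
Definition vacuum : vacm := vword [::].
Definition vact (x : loop L) (A : vacm) : vacm :=
  quot_lift (fun u => vword (x :: u)) A.

Definition vac_sigma (A : vacm) : vacm :=
  quot_lift (fun u => vword [seq lie_lift (fun a f => rho (vsigma a) f) x | x <- u]) A.

(* the monomials a_1(-n_1) ... a_j(-n_j)|0> of degree d, with homogeneous a_i *)
Inductive vac_monomial : nat -> vacm -> Prop :=
| vac_mono0 : vac_monomial 0 vacuum
| vac_monoS p n d (a : L) A : vhomog p a -> vac_monomial d A ->
    vac_monomial (p + n + d) (vact (mode a (- n.+1%:Z)) A).

(* The monomials a_1(-n_1) ... a_j(-n_j)|0> with j >= 1 and all a_i in S. For
   S = L^o their span is a complement of the line of |0> which contains im D.
   V(L)^o has to be taken inside this span: |0> (x) 1/t acts as a nonzero scalar,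
   so replacing A in V(L)^o by A + c|0> changes the coinvariants. *)
Inductive vac_pos (S : set L) : vacm -> Prop :=
| vac_pos1 n (a : L) : S a -> vac_pos S (vact (mode a (- n.+1%:Z)) vacuum)
| vac_posS n (a : L) A : S a -> vac_pos S A ->
    vac_pos S (vact (mode a (- n.+1%:Z)) A).

(* the coefficient of x^(-m-1) in :F(x)G(x): v *)
Definition normal_prod (M : lmodType K) (F G : int -> M -> M) (m : int) (v : M) : M :=
  \sum_(n \in [set n : int | n < 0]) F n (G (m - n - 1) v) +
  \sum_(n \in [set n : int | 0 <= n]) G (m - n - 1) (F n v).

(* What Y_M and Y_W have in common: fields : L -> End(M)[[x, x^-1]] are the
   fields of the states a(-1)|0>, and extra a B m v is the coefficient of
   x^(-m-1) in (Y(a(-1)B, x) - :Y(a(-1)|0>, x) Y(B, x):) v. *)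
Definition is_state_field (M : lmodType K) (fields : L -> int -> M -> M)
    (extra : (vacm -> int -> M -> M) -> L -> vacm -> int -> M -> M)
    (Y : vacm -> int -> M -> M) : Prop :=
  (forall n v, linear (fun A => Y A n v)) /\
  (forall A n, linear (Y A n)) /\
  (forall A v, exists d : int, forall n, d <= n -> Y A n v = 0) /\
  (forall n v, Y vacuum n v = if n == -1 then v else 0) /\
  (forall a n v, Y (vact (mode a (-1)) vacuum) n v = fields a n v) /\
  (forall a B m v, Y (vact (mode a (-1)) B) m v =
     normal_prod (Y (vact (mode a (-1)) vacuum)) (Y B) m v + extra Y a B m v).

(* YM act A n = A^M_(n) *)
Definition YM (M : lmodType K) (act : loop L -> M -> M) : vacm -> int -> M -> M :=
  xget (fun _ _ => 0) [set Y | is_state_field (fun a n v => act (mode a n) v)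
                                 (fun _ _ _ _ => 0) Y].

(* YW T w act A n = A^W_(n) *)
Definition YW (T : nat) (w : K) (M : lmodType K) (act : loop L -> M -> M) :
    vacm -> int -> M -> M :=
  xget (fun _ _ => 0) [set Y | is_state_field (fun a n v => act (modeG T w a n) v)
    (fun Y a B m v => \sum_(k < T | (0 < k)%N) \sum_(n \in [set: nat])
       ((w ^+ k - 1) ^+ n.+1)^-1 *: Y (vact (mode (vR w k a) n) B) (m - n%:Z - 1) v) Y].

Definition vac_vla : vla K := @VLA K vacm
  (fun A => YM vact A (- 2) vacuum) (fun A n B => YM vact A n B) vacuum
  (fun d => lspan (vac_monomial d)) vac_sigma.

Definition big_act (M : lmodType K) (act : loop L -> M -> M)
    (x : loop vac_vla) (v : M) : M :=
  lie_lift (fun (A : vac_vla) (f : laurent_dalg K) =>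
    termwise f (fun n => YM act A n v)) x.

(* For x in L(V(L))^Gamma, x = T^-1 sum_(alpha in Gamma) alpha.x, and
   sum_(alpha in Gamma) alpha.A(n) = A^Gamma(n), which acts as A^W_(n). *)
Definition big_actG (T : nat) (w : K) (M : lmodType K) (act : loop L -> M -> M)
    (x : loop vac_vla) (v : M) : M :=
  T%:R^-1 *: lie_lift (fun (A : vac_vla) (f : laurent_dalg K) =>
    termwise f (fun n => YW T w act A n v)) x.

End Vacuum.

Section Coinvariants.
Context {K : fieldType} (L : vla K) (Lo : set L) (T : nat) (w : K).
Context {N : nat} (z : 'I_N -> K).

(* Gamma z \cup {0} *)
Definition poles : seq K :=
  0 :: [seq w ^+ nat_of_ord k * z i | k <- enum 'I_T, i <- enum 'I_N].

Definition glob := lie L (rinf_dalg poles).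

Definition glob_ideal : set glob :=
  [set x | exists i, x =
     \sum_(k < T) rho (vc L) (rpole poles (w ^+ k * z i) : rinf_dalg poles)
     - T%:R *: rho (vc L) (rpole poles 0 : rinf_dalg poles)].

Definition globI := quot glob_ideal.

Definition globG : set globI :=
  [set q | lspan [set r | exists a f, Lo a /\ r = qpi _ (rho a f)] q /\
           forall k, qpi _ (gact w k (repr q)) = q].

Definition glob_expand (s : K) (x : glob) : loop L :=
  lie_lift (fun a (f : rinf_dalg poles) => rho a (expand s (rval f) : laurent_dalg K)) x.

Context (M : 'I_N -> lmodType K) (M0 : lmodType K).

Definition factor (o : option 'I_N) : lmodType K :=
  if o is Some i then M i else M0.

Context (act : forall i, loop L -> M i -> M i) (act0 : loop L -> M0 -> M0).

Definition glob_act (q : globI) (t : mtensor factor) : mtensor factor :=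
  \sum_(i < N) mtensor_op (M := factor) (i := Some i)
                 (@act i (glob_expand (z i) (repr q))) t
  + mtensor_op (M := factor) (i := None) (act0 (glob_expand 0 (repr q))) t.

Definition coinvariants :=
  quot [set s | exists q t, globG q /\ s = glob_act q t].

End Coinvariants.

(* Main.v *)
Require Import Defs.
Set Warnings "-all".
From HB Require Import structures.
From mathcomp Require Import all_boot all_order all_algebra.
From mathcomp Require Import generic_quotient fraction finmap.
From mathcomp Require Import boolp classical_sets functions cardinality fsbigop.
From mathcomp Require Import reals.
From mathcomp.real_closed Require Import complex.
From mathcomp.multinomials Require Import monalg.
From mathcomp Require Import zify ring ssrAC.

Set Implicit Arguments.
Unset Strict Implicit.
Unset Printing Implicit Defensive.

Import Order.TTheory GRing.Theory Num.Theory.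
Local Open Scope classical_set_scope.
Local Open Scope ring_scope.

(* Both spaces of coinvariants are quotients of the same tensor product, and the two
   subspaces divided out coincide. By averaging over Gamma, the invariant global elements
   act as linear combinations of the operators Omega_A(f), the sum over the points r of
   Gamma z and 0 of the residues at r of f(t) Y_r(A, t), where Y_r comes from Y_M, twisted
   by R, or from Y_W. Since Omega_(a(-1)|0>)(f) = Omega_a(f), the small subspace S lies in
   the big one; here a linear functional on V(L) which is 1 on |0> and vanishes on the
   span of vac_pos and on im D shows that states in this span need no |0> component modulo
   im D.

   The other inclusion goes by induction on the length of a word a(-1)B. At a point r
   the creation part of the field of a in :Y_r(a) Y_r(B): is the polar part at r of
   Omega_a(1/(t - r)^(p+1)), so modulo S it may be replaced by annihilation operators of
   a at the points s <> r. Moving these to the right past Y_r(B) yields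
   Omega_B(f/(t - s)^(q+1)) applied to vectors, and commutators coming from the points s
   in the orbit of r. These commutators, for r <> 0, and the extra terms of Y_W, for
   r = 0, are the summands of Omega_((R_alpha a)(j)B)(f/t^(j+1)). All words have become
   shorter, all functions now vanish to order two at infinity, and Omega_|0>(g), the sum of the
   residues of such a function g at its poles, is zero. *)

(** [YM] and [YW] are chosen by [xget], so nothing is known of them before a map with the required
    recursion exists and is unique. Existence is the long part. For a field phi(x) on a module and a
    rational function f(s), consider Res_y f(y/x) [a(y), phi(x)], with f expanded at s = infinity in
    the first product and at s = 0 in the second. If phi is local, this depends only on the jets of
    f at the points of Gamma. Taking for f the germ (s - 1)^n at s = 1, extended by 0 to the other
    roots of unity, gives operators with untwisted commutation relations: the whole loop algebra
    acts on local fields, although the module is one over its invariants only. The identity field is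
    a vacuum vector of level 1, and the universal property of V(L) produces the map. The extra terms
    of Y_W arise because 1/(s - 1) does not vanish at the other points of Gamma; for T = 1 they are
    absent and the map is Y_M. The functional on V(L) is the other obstacle: it is defined on words
    by a recursion and checked against the relations of the induced module, with no
    Poincare-Birkhoff-Witt basis involved. *)

(** * Sums of finite support over infinite index types *)

Definition fins (I : choiceType) (V : zmodType) (F : I -> V) :=
  exists r : seq I, forall i, i \notin r -> F i = 0.

Section FiniteSums.
Context {I : choiceType} {V : zmodType}.

(** A sum over [[set: I]] is 0 by convention when infinitely many terms are nonzero, so every
    rewriting of one needs a finite set carrying the support. That is the purpose of [fins]. *)
Lemma fsumE (r : seq I) (F : I -> V) : uniq r -> (forall i, i \notin r -> F i = 0) ->
  \sum_(i \in [set: I]) F i = \sum_(i <- r) F i.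
Proof.
move=> ur hr; rewrite (@fsbigE _ _ _ _ setT r) //; last by move=> i _; exact: hr.
by apply: eq_bigl => i; rewrite in_setT.
Qed.

Lemma finsP (F : I -> V) : fins F -> exists r : seq I, uniq r /\ forall i, i \notin r -> F i = 0.
Proof. by move=> [r hr]; exists (undup r); split=> [|i]; rewrite ?undup_uniq // mem_undup => /hr. Qed.

Lemma fins_common (F G : I -> V) : fins F -> fins G ->
  exists r : seq I, [/\ uniq r, forall i, i \notin r -> F i = 0 & forall i, i \notin r -> G i = 0].
Proof.
move=> [r hr] [s hs]; exists (undup (r ++ s)); split; rewrite ?undup_uniq // => i;
  by rewrite mem_undup mem_cat negb_or => /andP[/hr + /hs].
Qed.

Lemma fsumD (F G : I -> V) : fins F -> fins G ->
  \sum_(i \in [set: I]) (F i + G i) = \sum_(i \in [set: I]) F i + \sum_(i \in [set: I]) G i.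
Proof.
move=> fF fG; have [r [ur hF hG]] := fins_common fF fG.
rewrite !(fsumE (r := r)) // ?big_split // => i ir; by rewrite hF // hG // addr0.
Qed.

Lemma finsD (F G : I -> V) : fins F -> fins G -> fins (fun i => F i + G i).
Proof.
move=> fF fG; have [r [ur hF hG]] := fins_common fF fG.
by exists r => i ir; rewrite hF // hG // addr0.
Qed.

Lemma fins_sum (A : Type) (s : seq A) (P : pred A) (F : A -> I -> V) :
  (forall a, fins (F a)) -> fins (fun i => \sum_(a <- s | P a) F a i).
Proof.
move=> fF; elim: s => [|a s [r hr]]; first by exists [::] => i _; rewrite big_nil.
have [r' hr'] := fF a; exists (r' ++ r) => i; rewrite mem_cat negb_or big_cons => /andP[h /hr ->].
by rewrite hr' // addr0; case: ifP.
Qed.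

Lemma fsum_sum (A : Type) (s : seq A) (P : pred A) (F : A -> I -> V) :
  (forall a, fins (F a)) ->
  \sum_(i \in [set: I]) \sum_(a <- s | P a) F a i = \sum_(a <- s | P a) \sum_(i \in [set: I]) F a i.
Proof.
move=> fF; elim: s => [|a s IH].
  by rewrite big_nil fsbig1 // => i _; rewrite big_nil.
rewrite big_cons -IH; case E: (P a).
  rewrite -fsumD //; last exact: fins_sum.
  by apply: eq_fsbigr => i _; rewrite big_cons E.
by apply: eq_fsbigr => i _; rewrite big_cons E.
Qed.

Lemma fsum0 (F : I -> V) : (forall i, F i = 0) -> \sum_(i \in [set: I]) F i = 0.
Proof. by move=> h; apply: fsbig1. Qed.

Lemma eq_fsum (F G : I -> V) : F =1 G ->
  \sum_(i \in [set: I]) F i = \sum_(i \in [set: I]) G i.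
Proof. by move=> h; apply: eq_fsbigr. Qed.

Lemma fsum_only (j : I) (F : I -> V) : (forall i, i != j -> F i = 0) ->
  \sum_(i \in [set: I]) F i = F j.
Proof.
move=> h; rewrite (fsumE (r := [:: j])) ?big_seq1 // => i; rewrite inE; exact: h.
Qed.

End FiniteSums.

Section FiniteDoubleSums.
Context {I J : choiceType} {V : zmodType}.

Lemma fsum_bij (h : I -> J) (h' : J -> I) (F : J -> V) : cancel h h' -> cancel h' h ->
  \sum_(j \in [set: J]) F j = \sum_(i \in [set: I]) F (h i).
Proof. by move=> hK h'K; apply: reindex_fsbigT; exists h'. Qed.

(** Finite rows and finite columns do not suffice for the exchange: the support has to lie in a
    finite box r x s. Most boundedness arguments below serve to exhibit such a box. *)
Lemma exchange_fsum (F : I -> J -> V) (r : seq I) (s : seq J) :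
  (forall i j, i \notin r -> F i j = 0) -> (forall i j, j \notin s -> F i j = 0) ->
  \sum_(i \in [set: I]) \sum_(j \in [set: J]) F i j
  = \sum_(j \in [set: J]) \sum_(i \in [set: I]) F i j.
Proof.
move=> hr hs.
rewrite (fsumE (undup_uniq r)); last first.
  by move=> i; rewrite mem_undup => ir; apply: fsum0 => j; exact: hr.
rewrite [RHS](fsumE (undup_uniq s)); last first.
  by move=> j; rewrite mem_undup => js; apply: fsum0 => i; exact: hs.
transitivity (\sum_(i <- undup r) \sum_(j <- undup s) F i j).
  by apply: eq_bigr => i _; apply: fsumE; rewrite ?undup_uniq // => j; rewrite mem_undup; exact: hs.
rewrite exchange_big /=; apply: eq_bigr => j _; apply/esym/fsumE; rewrite ?undup_uniq // => i.
by rewrite mem_undup; exact: hr.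
Qed.

End FiniteDoubleSums.

Lemma additive_fsum (I : choiceType) (U V : zmodType) (f : U -> V) (F : I -> U) :
  f 0 = 0 -> {morph f : x y / x + y} -> fins F ->
  f (\sum_(i \in [set: I]) F i) = \sum_(i \in [set: I]) f (F i).
Proof.
move=> f0 fD /finsP[r [ur hr]]; rewrite !(fsumE (r := r)) //; last by move=> i /hr ->.
by rewrite (big_morph f fD f0).
Qed.

Lemma fins_map (I : choiceType) (U V : zmodType) (f : U -> V) (F : I -> U) :
  f 0 = 0 -> fins F -> fins (fun i => f (F i)).
Proof. by move=> f0 [r hr]; exists r => i /hr ->. Qed.

(** * Linearity as a predicate on functions *)

Section LinearMaps.
Context {K : fieldType}.

Lemma lin0 (U V : lmodType K) (f : U -> V) : linear f -> f 0 = 0.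
Proof. by move=> fl; have := fl (-1) 0 0; rewrite addr0 scaler0 scaleN1r addNr. Qed.
Lemma linD (U V : lmodType K) (f : U -> V) : linear f -> {morph f : x y / x + y}.
Proof. by move=> fl x y; have := fl 1 x y; rewrite !scale1r. Qed.
Lemma linZ (U V : lmodType K) (f : U -> V) : linear f -> forall c x, f (c *: x) = c *: f x.
Proof. by move=> fl c x; have := fl c x 0; rewrite !addr0 (lin0 fl) addr0. Qed.
Lemma linN (U V : lmodType K) (f : U -> V) : linear f -> {morph f : x / - x}.
Proof. by move=> fl x; rewrite -scaleN1r (linZ fl) scaleN1r. Qed.
Lemma linB (U V : lmodType K) (f : U -> V) : linear f -> {morph f : x y / x - y}.
Proof. by move=> fl x y; rewrite (linD fl) (linN fl). Qed.
Lemma lin_sum (U V : lmodType K) (f : U -> V) (A : Type) (s : seq A) (P : pred A) (F : A -> U) :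
  linear f -> f (\sum_(i <- s | P i) F i) = \sum_(i <- s | P i) f (F i).
Proof. by move=> fl; rewrite (big_morph f (linD fl) (lin0 fl)). Qed.
Lemma lin_fsum (U V : lmodType K) (f : U -> V) (I : choiceType) (F : I -> U) :
  linear f -> fins F -> f (\sum_(i \in [set: I]) F i) = \sum_(i \in [set: I]) f (F i).
Proof. by move=> fl; apply: additive_fsum; [apply: lin0 | apply: linD]. Qed.
Lemma scaler_fsum (V : lmodType K) (I : choiceType) (c : K) (F : I -> V) :
  fins F -> c *: (\sum_(i \in [set: I]) F i) = \sum_(i \in [set: I]) c *: F i.
Proof. by apply: additive_fsum; [rewrite scaler0 | move=> x y; rewrite scalerDr]. Qed.
Lemma scaler_fsuml (V : lmodType K) (I : choiceType) (v : V) (F : I -> K) :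
  fins F -> (\sum_(i \in [set: I]) F i) *: v = \sum_(i \in [set: I]) F i *: v.
Proof. by apply: (@additive_fsum I K V (fun c => c *: v)); [rewrite scale0r | move=> x y; rewrite scalerDl]. Qed.

Lemma lin_comp (U V W : lmodType K) (f : V -> W) (g : U -> V) :
  linear f -> linear g -> linear (fun x => f (g x)).
Proof. by move=> fl gl c x y; rewrite gl fl. Qed.
Lemma lin_id (U : lmodType K) : linear (fun x : U => x).
Proof. by []. Qed.
Lemma lin_cst0 (U V : lmodType K) : linear (fun _ : U => 0 : V).
Proof. by move=> c x y; rewrite scaler0 addr0. Qed.
Lemma lin_scale (U V : lmodType K) (f : U -> V) c : linear f -> linear (fun x => c *: f x).
Proof. by move=> fl d x y; rewrite fl scalerDr !scalerA mulrC. Qed.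
Lemma lin_add (U V : lmodType K) (f g : U -> V) :
  linear f -> linear g -> linear (fun x => f x + g x).
Proof. by move=> fl gl c x y; rewrite fl gl scalerDr addrACA. Qed.
Lemma lin_opp (U V : lmodType K) (f : U -> V) : linear f -> linear (fun x => - f x).
Proof. by move=> fl c x y; rewrite fl opprD scalerN. Qed.
Lemma lin_bigsum (U V : lmodType K) (A : Type) (s : seq A) (P : pred A) (F : A -> U -> V) :
  (forall a, linear (F a)) -> linear (fun x => \sum_(a <- s | P a) F a x).
Proof.
move=> Fl c x y; rewrite scaler_sumr -big_split; apply: eq_bigr => a _; exact: Fl.
Qed.
Lemma lin_bigfsum (U V : lmodType K) (I : choiceType) (F : I -> U -> V) :
  (forall a, linear (F a)) -> (forall x, fins (fun i => F i x)) ->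
  linear (fun x => \sum_(i \in [set: I]) F i x).
Proof.
move=> Fl fF c x y; rewrite scaler_fsum // -fsumD //; last first.
  by have [r hr] := fF x; exists r => i /hr ->; rewrite scaler0.
by apply: eq_fsum => i; rewrite Fl.
Qed.

End LinearMaps.

(** * Sums over the integers *)

Section IntRange.
Context {V : zmodType}.

Definition irange (a b : int) : seq int := [seq a + i%:Z | i <- iota 0 `|b - a|%N].

Lemma mem_irange (a b n : int) : a <= n -> n < b -> n \in irange a b.
Proof.
move=> an nb; apply/mapP; exists `|n - a|%N; first by rewrite mem_iota; lia.
by lia.
Qed.

Lemma fins_int (F : int -> V) (a b : int) :
  (forall n, n < a -> F n = 0) -> (forall n, b <= n -> F n = 0) -> fins F.
Proof.
move=> ha hb; exists (irange a b) => n nr.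
case: (ltP n a) => [/ha //|an]; case: (leP b n) => [/hb //|nb].
by rewrite mem_irange in nr.
Qed.

Lemma fins_nat (F : nat -> V) (b : nat) : (forall n, (b <= n)%N -> F n = 0) -> fins F.
Proof.
move=> hb; exists (iota 0 b) => n; rewrite mem_iota /= add0n -leqNgt; exact: hb.
Qed.

Lemma fsum_shift (F : int -> V) (k : int) :
  \sum_(n \in [set: int]) F n = \sum_(n \in [set: int]) F (n + k).
Proof. by apply: (fsum_bij (h' := fun n => n - k)) => n; rewrite ?addrK ?subrK. Qed.

Lemma fsum_opp (F : int -> V) (k : int) :
  \sum_(n \in [set: int]) F n = \sum_(n \in [set: int]) F (k - n).
Proof. by apply: (fsum_bij (h' := fun n => k - n)) => n; rewrite subKr. Qed.

Lemma fsum_ord (F : nat -> V) (b : nat) : (forall n, (b <= n)%N -> F n = 0) ->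
  \sum_(n \in [set: nat]) F n = \sum_(n < b) F n.
Proof.
move=> hb; rewrite (fsumE (iota_uniq 0 b)); last first.
  by move=> n; rewrite mem_iota /= add0n -leqNgt => /hb.
by rewrite -(big_mkord xpredT) /index_iota subn0.
Qed.

End IntRange.

Lemma fsum_int_pos (V : zmodType) (F : int -> V) : (forall n : int, n < 0 -> F n = 0) ->
  \sum_(n \in [set: int]) F n = \sum_(n \in [set: nat]) F n%:Z.
Proof.
move=> h; rewrite -(@fsbig_widen _ _ _ _ [set n : int | 0 <= n] setT) //; last first.
  by move=> n [_ /= /negP]; rewrite -ltNge => /h.
apply: (@reindex_fsbig _ _ _ nat int Posz); split=> //.
- by move=> m n _ _ [].
- by move=> n /= n0; exists `|n|%N => //; lia.
Qed.

(** * Laurent series *)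

Section LaurentSeries.
Context {K : fieldType}.
Implicit Types f g h : laurent K.

Definition ico f (n : int) : K := lcoef f n.

Lemma ico_bounded f : exists d : int, forall n, n < d -> ico f n = 0.
Proof. by case: f => f /= /asboolP. Qed.

Lemma laurentP f g : (forall n, ico f n = ico g n) -> f = g.
Proof. by move=> h; apply: val_inj; apply/funext. Qed.

Lemma icoE (F : int -> K) d n : (forall n, n < d -> F n = 0) -> ico (mklaurent F) n = F n.
Proof.
move=> h; rewrite /ico /mklaurent /insubd insubT //.
by apply/asboolP; exists d.
Qed.

Lemma ico0 n : ico 0 n = 0. Proof. by []. Qed.
Lemma icoD f g n : ico (f + g) n = ico f n + ico g n. Proof. by []. Qed.
Lemma icoZ c f n : ico (c *: f) n = c * ico f n. Proof. by []. Qed.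
Lemma icoN f n : ico (- f) n = - ico f n. Proof. by []. Qed.
Lemma icoB f g n : ico (f - g) n = ico f n - ico g n. Proof. by []. Qed.
Lemma ico_lin n : linear (fun f => ico f n : K^o). Proof. by []. Qed.
Lemma ico_sum (A : Type) (s : seq A) (P : pred A) (F : A -> laurent K) n :
  ico (\sum_(i <- s | P i) F i) n = \sum_(i <- s | P i) ico (F i) n.
Proof. exact: (lin_sum s P F (ico_lin n)). Qed.

Lemma ico_mono m n : ico (lmono m : laurent K) n = (n == m)%:R.
Proof. by rewrite /lmono (icoE (d := m)) // => k; case: eqP => // ->; rewrite ltxx. Qed.

Lemma ico_der f n : ico (lder f) n = (n + 1)%:~R * ico f (n + 1).
Proof.
have [d hd] := ico_bounded f; rewrite /lder (icoE (d := d - 1)) // => k kd.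
by rewrite -/(ico f _) hd ?mulr0 //; lia.
Qed.

Lemma ico_sub c f n : ico (lsub c f) n = c ^ n * ico f n.
Proof.
by have [d hd] := ico_bounded f; rewrite /lsub (icoE (d := d)) // => k /hd; rewrite /ico => ->; rewrite mulr0.
Qed.

Lemma ico_poly (p : {poly K}) n : ico (lpoly p) n = if 0 <= n then p`_`|n|%N else 0.
Proof. by rewrite /lpoly (icoE (d := 0)) // => k; rewrite ltNge => /negbTE ->. Qed.

Lemma ico_mul_fins f g n : fins (fun m => ico f m * ico g (n - m)).
Proof.
have [d hd] := ico_bounded f; have [e he] := ico_bounded g.
apply: (fins_int (a := d) (b := n - e + 1)) => m mn; first by rewrite hd // mul0r.
by rewrite he ?mulr0 //; lia.
Qed.

Lemma ico_mul f g n : ico (lmul f g) n = \sum_(m \in [set: int]) ico f m * ico g (n - m).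
Proof.
have [d hd] := ico_bounded f; have [e he] := ico_bounded g.
rewrite /lmul (icoE (d := d + e)) // => k kd; apply: fsum0 => m.
rewrite -!/(ico _ _); case: (ltP m d) => [/hd -> | dm]; first by rewrite mul0r.
by rewrite he ?mulr0 //; lia.
Qed.

End LaurentSeries.

Section LaurentField.
Context {K : fieldType}.
Implicit Types f g h : laurent K.

(** The orders of f and g bound i and j from below and B bounds i + j from above, so the support of
    the double sum lies in a triangle and the sums may be exchanged. *)
Lemma fsum_conv (V : lmodType K) f g (G : int -> V) (B : int) :
  (forall n, B <= n -> G n = 0) ->
  \sum_(n \in [set: int]) ico (lmul f g) n *: G n
  = \sum_(i \in [set: int]) \sum_(j \in [set: int]) (ico f i * ico g j) *: G (i + j).
Proof.
move=> hB; have [d hd] := ico_bounded f; have [e he] := ico_bounded g.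
transitivity (\sum_(n \in [set: int]) \sum_(i \in [set: int])
   (ico f i * ico g (n - i)) *: G n).
  by apply: eq_fsum => n; rewrite ico_mul scaler_fsuml //; apply: ico_mul_fins.
rewrite (exchange_fsum (r := irange (d + e) B) (s := irange d (B - e))).
- apply: eq_fsum => i; rewrite (fsum_shift _ i); apply: eq_fsum => j.
  by rewrite addrK [i + j]addrC.
- move=> n i nr; case: (leP B n) => [/hB ->|nB]; first by rewrite scaler0.
  case: (ltP n (d + e)) => [nd|dn]; last by rewrite mem_irange in nr.
  case: (ltP i d) => [/hd ->|di]; first by rewrite mul0r scale0r.
  by rewrite he ?mulr0 ?scale0r //; lia.
- move=> n i ir; case: (leP B n) => [/hB ->|nB]; first by rewrite scaler0.
  case: (ltP i d) => [/hd ->|di]; first by rewrite mul0r scale0r.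
  case: (ltP i (B - e)) => [iB|Bi]; first by rewrite mem_irange in ir.
  by rewrite he ?mulr0 ?scale0r //; lia.
Qed.

Fact lmulA : associative (@lmul K).
Proof.
move=> f g h; apply: laurentP => n; rewrite [RHS]ico_mul.
have [e he] := ico_bounded h.
rewrite (@fsum_conv K^o f g (fun m => ico h (n - m)) (n - e + 1)); last by move=> m ?; apply: he; lia.
rewrite ico_mul; apply: eq_fsum => i; rewrite ico_mul mulr_fsumr; apply: eq_fsum => j.
by rewrite mulrA opprD addrA.
Qed.

Fact lmulC : commutative (@lmul K).
Proof.
move=> f g; apply: laurentP => n; rewrite !ico_mul (fsum_opp _ n).
by apply: eq_fsum => i; rewrite subKr mulrC.
Qed.

Fact lmul1 : left_id (lmono 0) (@lmul K).
Proof.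
move=> f; apply: laurentP => n; rewrite ico_mul (fsum_only (j := 0)) ?ico_mono ?eqxx ?mul1r ?subr0 //.
by move=> i /negbTE i0; rewrite ico_mono i0 mul0r.
Qed.

Fact lmulD : left_distributive (@lmul K) +%R.
Proof.
move=> f g h; apply: laurentP => n; rewrite icoD !ico_mul -fsumD; try exact: ico_mul_fins.
by apply: eq_fsum => i; rewrite icoD mulrDl.
Qed.

Fact lone_neq0 : lmono 0 != 0 :> laurent K.
Proof.
apply/eqP => /(congr1 (fun f => ico f 0)) /eqP.
by rewrite ico_mono eqxx ico0 oner_eq0.
Qed.

HB.instance Definition _ := GRing.Zmodule_isComNzRing.Build (laurent K)
  lmulA lmulC lmul1 lmulD lone_neq0.

Lemma lmulE f g : lmul f g = f * g. Proof. by []. Qed.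
Lemma lmono0 : lmono 0 = 1 :> laurent K. Proof. by []. Qed.

Lemma lscalerAl c f g : c *: f * g = c *: (f * g).
Proof.
apply: laurentP => n; rewrite -!lmulE icoZ !ico_mul mulr_fsumr.
by apply: eq_fsum => i; rewrite icoZ mulrA.
Qed.

Lemma lscalerAr c f g : f * (c *: g) = c *: (f * g).
Proof. by rewrite mulrC lscalerAl mulrC. Qed.

Lemma ico_mulmono m f n : ico (lmono m * f) n = ico f (n - m).
Proof.
rewrite -lmulE ico_mul (fsum_only (j := m)) ?ico_mono ?eqxx ?mul1r //.
by move=> i /negbTE im; rewrite ico_mono im mul0r.
Qed.

Lemma lmonoD m n : lmono m * lmono n = lmono (m + n) :> laurent K.
Proof. by apply: laurentP => k; rewrite ico_mulmono !ico_mono subr_eq addrC. Qed.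

(* The sequence b solves [sum_(i <= n) a_i b_(n-i) = (n == 0)]. *)
Fixpoint inv_seq (a : nat -> K) n : seq K :=
  if n is n'.+1 then
    rcons (inv_seq a n')
      ((a 0%N)^-1 * ((n' == 0)%:R - \sum_(i < n') a (n' - i)%N * (inv_seq a n')`_i))
  else [::].

Lemma inv_seq_ex (a : nat -> K) : a 0%N != 0 ->
  exists b : nat -> K, forall n, \sum_(i < n.+1) a i * b (n - i)%N = (n == 0)%:R.
Proof.
move=> a0; pose b n := (inv_seq a n.+1)`_n; exists b.
have sz n : size (inv_seq a n) = n by elim: n => //= n IH; rewrite size_rcons IH.
have st n m : (m < n)%N -> (inv_seq a n)`_m = b m.
  elim: n => // n IH; rewrite ltnS leq_eqVlt => /orP[/eqP -> //|mn].
  by rewrite /= nth_rcons sz mn IH.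
have bE n : b n = (a 0%N)^-1 * ((n == 0)%:R - \sum_(i < n) a (n - i)%N * b i).
  rewrite {1}/b /= nth_rcons sz ltnn eqxx; congr (_ * (_ - _)).
  by apply: eq_bigr => i _; rewrite st.
move=> n; rewrite big_ord_recl subn0 {1}bE mulVKf //.
suff -> : \sum_(i < n) a (lift ord0 i) * b (n - lift ord0 i)%N
  = \sum_(i < n) a (n - i)%N * b i by rewrite subrK.
rewrite (reindex_inj rev_ord_inj) /=; apply: eq_bigr => i _.
rewrite /bump leq0n add1n; have il := ltn_ord i.
by congr (a _ * b _); lia.
Qed.

(** If d is the order of f, then t^(-d) f is a power series with nonzero constant term, which
    [inv_seq] inverts. *)
Lemma laurent_inv_ex f : f != 0 -> exists g, f * g = 1.
Proof.
move=> f0; have [d0 hd0] := ico_bounded f.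
have [d [fd hd]] : exists d, ico f d != 0 /\ forall n, n < d -> ico f n = 0.
  have ex : exists n : nat, ico f (d0 + n%:Z) != 0.
    apply: contrapT => H; move/eqP: f0; apply; apply: laurentP => n; rewrite ico0.
    case: (ltP n d0) => [/hd0 //|dn]; apply/eqP; apply: contrapT => /negP nz.
    apply: H; exists `|n - d0|%N; suff -> : d0 + `|n - d0|%N%:Z = n by [].
    by lia.
  case: (ex_minnP ex) => m hm mmin; exists (d0 + m%:Z); split=> // n nd.
  case: (ltP n d0) => [/hd0 //|dn]; apply/eqP; apply: contrapT => /negP nz.
  have := mmin `|n - d0|%N; have -> : d0 + `|n - d0|%N%:Z = n by lia.
  by move/(_ nz); lia.
have [b hb] := @inv_seq_ex (fun n => ico f (d + n%:Z)) (eq_ind _ (fun x => ico f x != 0) fd _ (esym (addr0 d))).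
exists (mklaurent (fun n => if - d <= n then b `|(n + d)%R|%N else 0)).
have ig n : ico (mklaurent (fun n => if - d <= n then b `|(n + d)%R|%N else 0)) n
     = if - d <= n then b `|(n + d)%R|%N else 0.
  by rewrite (icoE (d := - d)) // => k; rewrite ltNge => /negbTE ->.
apply: laurentP => n; rewrite -lmulE ico_mul -lmono0 ico_mono (fsum_shift _ d).
rewrite fsum_int_pos; last by move=> k k0; rewrite hd ?mul0r //; lia.
case: (ltP n 0) => [n0|n0].
  rewrite fsum0; first by have -> : (n == 0) = false by lia.
  by move=> k; rewrite ig ifF ?mulr0 //; apply/negP => ?; lia.
rewrite (@fsum_ord _ _ `|n|.+1); last by move=> k kn; rewrite ig ifF ?mulr0 //; apply/negP => ?; lia.
have -> : (n == 0) = (`|n|%N == 0)%N by lia.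
rewrite -hb; apply: eq_bigr => i _; have il := ltn_ord i.
rewrite ig ifT; last by lia.
by rewrite [i%:Z + d]addrC; congr (_ * b _); lia.
Qed.

(** Once K((t)) is a field, expanding a fraction means dividing two expanded polynomials, and
    expansions respect products and inverses by construction. *)
Definition linv f := if f == 0 then 0 else xget 0 [set g | g * f = 1].

Fact lmulVf f : f != 0 -> linv f * f = 1.
Proof.
move=> f0; rewrite /linv (negbTE f0); have [g hg] := laurent_inv_ex f0.
by apply: (@xgetPex _ 0 [set g | g * f = 1]); exists g; rewrite /= mulrC.
Qed.
Fact linv0 : linv 0 = 0. Proof. by rewrite /linv eqxx. Qed.
HB.instance Definition _ := GRing.ComNzRing_isField.Build (laurent K) lmulVf linv0.

Lemma lmono_neq0 m : lmono m != 0 :> laurent K.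
Proof.
by apply/eqP => /(congr1 (fun f => ico f m)) /eqP; rewrite ico_mono eqxx ico0 oner_eq0.
Qed.

Lemma lmonoX m n : lmono m ^+ n = lmono (m *+ n) :> laurent K.
Proof. by elim: n => // n IH; rewrite exprS IH lmonoD mulrS. Qed.

Lemma lmonoV m : (lmono m)^-1 = lmono (- m) :> laurent K.
Proof.
by apply: (mulfI (lmono_neq0 m)); rewrite divff ?lmono_neq0 // lmonoD subrr.
Qed.

Lemma ico_mulE f g n : ico (f * g) n = \sum_(m \in [set: int]) ico f m * ico g (n - m).
Proof. exact: ico_mul. Qed.

Lemma lder_linear : linear (@lder K).
Proof. by move=> c f g; apply: laurentP => n; rewrite ico_der !icoD !icoZ !ico_der mulrDr mulrCA. Qed.

Lemma lderM f g : lder (f * g) = lder f * g + f * lder g.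
Proof.
apply: laurentP => n; rewrite icoD ico_der !ico_mulE mulr_fsumr.
rewrite [X in _ = X + _](fsum_shift _ (-1)).
rewrite -fsumD; last 2 first.
- have := @ico_mul_fins _ (lder f) g n; case=> r hr.
  exists [seq x + 1 | x <- r] => m mr; apply: hr; apply: contra mr => mr.
  by apply/mapP; exists (m - 1); rewrite ?subrK.
- exact: ico_mul_fins.
apply: eq_fsum => m; rewrite !ico_der subrK.
have -> : n - (m - 1) = n + 1 - m by lia.
have -> : n - m + 1 = n + 1 - m by lia.
(* The two terms of the Leibniz rule come from n + 1 = m + (n + 1 - m). *)
have -> : (n + 1)%:~R = m%:~R + (n + 1 - m)%:~R :> K by rewrite -intrD; congr (_%:~R); lia.
by rewrite mulrDl mulrA; congr (_ + _); rewrite mulrCA.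
Qed.

Lemma lsub_linear c : linear (@lsub K c).
Proof. by move=> d f g; apply: laurentP => n; rewrite ico_sub !icoD !icoZ !ico_sub mulrDr mulrCA. Qed.

Lemma lsubM c f g : c != 0 -> lsub c (f * g) = lsub c f * lsub c g.
Proof.
move=> c0; apply: laurentP => n; rewrite ico_sub !ico_mulE mulr_fsumr.
apply: eq_fsum => m; rewrite !ico_sub mulrACA -expfzDr //; congr (_ ^ _ * _); lia.
Qed.

Lemma lsub1 c : lsub c 1 = 1 :> laurent K.
Proof.
by apply: laurentP => n; rewrite ico_sub -lmono0 ico_mono; case: eqP => [->|_]; rewrite ?expr0z ?mulr1 ?mulr0.
Qed.

Lemma lsub_mono c m : lsub c (lmono m) = c ^ m *: lmono m :> laurent K.
Proof.
apply: laurentP => n; rewrite ico_sub icoZ !ico_mono.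
by case: eqP => [->|_]; rewrite ?mulr0.
Qed.

Lemma lder_mono m : lder (lmono m) = m%:~R *: lmono (m - 1) :> laurent K.
Proof.
apply: laurentP => n; rewrite ico_der icoZ !ico_mono eq_sym -subr_eq eq_sym.
by case: eqP => [->|_]; rewrite ?mulr0 // subrK.
Qed.

Lemma lsub_der c f : c != 0 -> lsub c (lder f) = c^-1 *: lder (lsub c f).
Proof.
move=> c0; apply: laurentP => n; rewrite icoZ ico_sub !ico_der ico_sub expfzDr // expr1z.
by field.
Qed.

End LaurentField.

Global Opaque mklaurent lmono lmul lder lsub lpoly linv.

Local Notation "p %:F" := (@FracField.tofrac {poly _} p).

(** * Rational functions and their expansions *)

Section PolyEval.
Context {K : fieldType}.

Definition lconst (c : K) : laurent K := c *: (1 : laurent K).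
Fact lconst_zmod : zmod_morphism lconst.
Proof. by move=> c d; rewrite /lconst scalerBl. Qed.
Fact lconst_monoid : monoid_morphism lconst.
Proof. by split=> [|c d]; rewrite /lconst ?scale1r // lscalerAl mul1r scalerA. Qed.
HB.instance Definition _ := GRing.isZmodMorphism.Build K (laurent K) lconst lconst_zmod.
HB.instance Definition _ := GRing.isMonoidMorphism.Build K (laurent K) lconst lconst_monoid.

(** Substitution of a series for X. With u = [lmono 1] it gives the expansion at 0, with u =
    [lmono (-1)] the expansion at infinity in the parameter 1/t. *)
Definition evl (u : laurent K) := horner_morph (fun c => mulrC u (lconst c)).

HB.instance Definition _ u := GRing.RMorphism.on (evl u).

Lemma evlE u (p : {poly K}) : evl u p = \sum_(i < size p) p`_i *: u ^+ i.
Proof.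
rewrite /evl /horner_morph (horner_coef_wide _ (n := size p)); last first.
  by rewrite size_map_poly.
by apply: eq_bigr => i _; rewrite coef_map /= /lconst lscalerAl mul1r.
Qed.

Lemma ico_evl1 (p : {poly K}) n : ico (evl (lmono 1) p) n = if 0 <= n then p`_`|n|%N else 0.
Proof.
rewrite evlE ico_sum; under eq_bigr do rewrite icoZ lmonoX ico_mono natz.
case: (leP 0 n) => n0; last first.
  by rewrite big1 // => i _; rewrite (_ : (_ == _) = false) ?mulr0 //; lia.
case: (ltnP `|n| (size p)) => np; last first.
  rewrite nth_default // big1 // => i _; have il := ltn_ord i.
  by rewrite (_ : (_ == _) = false) ?mulr0 //; lia.
rewrite (bigD1 (Ordinal np)) //= (_ : n == _) ?mulr1 ?big1 ?addr0 //; last by lia.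
move=> i ni; rewrite (_ : (_ == _) = false) ?mulr0 //; apply/eqP => e.
by move/eqP: ni; apply; apply: val_inj => /=; lia.
Qed.

Lemma ico_evlN1 (p : {poly K}) n : ico (evl (lmono (-1)) p) n = if n <= 0 then p`_`|n|%N else 0.
Proof.
rewrite evlE ico_sum; under eq_bigr do rewrite icoZ lmonoX ico_mono mulNrn natz.
case: (leP n 0) => n0; last first.
  by rewrite big1 // => i _; rewrite (_ : (_ == _) = false) ?mulr0 //; lia.
case: (ltnP `|n| (size p)) => np; last first.
  rewrite nth_default // big1 // => i _; have il := ltn_ord i.
  by rewrite (_ : (_ == _) = false) ?mulr0 //; lia.
rewrite (bigD1 (Ordinal np)) //= (_ : n == _) ?mulr1 ?big1 ?addr0 //; last by lia.
move=> i ni; rewrite (_ : (_ == _) = false) ?mulr0 //; apply/eqP => e.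
by move/eqP: ni; apply; apply: val_inj => /=; lia.
Qed.

Lemma lpolyE (p : {poly K}) : lpoly p = evl (lmono 1) p.
Proof. by apply: laurentP => n; rewrite ico_poly ico_evl1. Qed.

Lemma evl1_neq0 (p : {poly K}) : p != 0 -> evl (lmono 1) p != 0.
Proof.
apply: contraNneq => h; apply/eqP/polyP => i; have := ico_evl1 p i.
by rewrite h ico0 coef0.
Qed.

Lemma evlN1_neq0 (p : {poly K}) : p != 0 -> evl (lmono (-1)) p != 0.
Proof.
apply: contraNneq => h; apply/eqP/polyP => i; have := ico_evlN1 p (- i%:Z).
by rewrite h ico0 coef0 abszN absz_nat ifT //; lia.
Qed.

Lemma evlC u c : evl u c%:P = c *: (1 : laurent K).
Proof. by rewrite /evl horner_morphC. Qed.
Lemma evlX u : evl u 'X = u.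
Proof. by rewrite /evl horner_morphX. Qed.

End PolyEval.

Section QuotientRules.
Context {F : fieldType}.
Implicit Types p q dp dq : F.

(** The quotient rules are isolated over an abstract field, where [field] applies; fractions of
    polynomials are reached afterwards through the morphism [tofrac]. *)
Lemma quot_rule_add p q dp dq p' q' dp' dq' : q != 0 -> q' != 0 ->
  ((dp * q' + p * dq' + (dp' * q + p' * dq)) * (q * q') -
     (p * q' + p' * q) * (dq * q' + q * dq')) / (q * q') ^+ 2 =
  (dp * q - p * dq) / q ^+ 2 + (dp' * q' - p' * dq') / q' ^+ 2.
Proof. by move=> q0 q'0; field; rewrite q0 q'0. Qed.

Lemma quot_rule_mul p q dp dq p' q' dp' dq' : q != 0 -> q' != 0 ->
  ((dp * p' + p * dp') * (q * q') - p * p' * (dq * q' + q * dq')) / (q * q') ^+ 2 =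
  (dp * q - p * dq) / q ^+ 2 * (p' / q') + p / q * ((dp' * q' - p' * dq') / q' ^+ 2).
Proof. by move=> q0 q'0; field; rewrite q0 q'0. Qed.

Lemma inv_rule (f df : F) : f != 0 -> f * (- df / f ^+ 2) = - (df / f).
Proof. by move=> f0; field. Qed.

End QuotientRules.

Section RatFun.
Context {K : fieldType}.
Implicit Types f g : ratfun K.

Lemma rden_neq0 f : rden f != 0. Proof. exact: denom_ratioP. Qed.

Lemma ratfun_repr f : f = (rnum f)%:F / (rden f)%:F.
Proof.
rewrite -{1}[f]reprK /rnum /rden; set r := repr f; have r0 := denom_ratioP r.
rewrite -{1}[r]Ratio_numden; unlock FracField.tofrac.
rewrite -[(_)^-1]FracField.pi_inv -[RHS]FracField.pi_mul; apply: congr1.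
by rewrite /FracField.mulf /FracField.invf !numden_Ratio ?oner_eq0 // mulr1 mul1r.
Qed.

Lemma ratfun_cross (p q p' q' : {poly K}) : q != 0 -> q' != 0 ->
  p%:F / q%:F = p'%:F / q'%:F -> p * q' = p' * q.
Proof.
move=> q0 q'0 /eqP; rewrite eqr_div ?tofrac_eq0 // -!tofracM tofrac_eq => /eqP ->.
by [].
Qed.

Lemma ratfun_ind (P : ratfun K -> Prop) :
  (forall p q : {poly K}, q != 0 -> P (p%:F / q%:F)) -> forall f, P f.
Proof. by move=> h f; rewrite [f]ratfun_repr; apply/h/rden_neq0. Qed.

Section Extension.
Context {F : fieldType} (psi : {rmorphism {poly K} -> F}).
Hypothesis psi0 : forall p, p != 0 -> psi p != 0.

(** The extension of an injective ring morphism from polynomials to their fractions. It is computed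
    on the chosen representative, and [extFE] shows that any other gives the same value. *)
Definition extF f : F := psi (rnum f) / psi (rden f).

Lemma extFE (p q : {poly K}) : q != 0 -> extF (p%:F / q%:F) = psi p / psi q.
Proof.
move=> q0; rewrite /extF; pose f : ratfun K := p%:F / q%:F; rewrite -/f.
have := ratfun_cross q0 (rden_neq0 f) (ratfun_repr f) => h.
by apply/eqP; rewrite eqr_div ?psi0 ?rden_neq0 // -!rmorphM -h.
Qed.

Lemma extF_poly p : extF p%:F = psi p.
Proof. by rewrite -[p%:F]divr1 -tofrac1 extFE ?oner_eq0 // rmorph1 divr1. Qed.

Fact extF_zmod : zmod_morphism extF.
Proof.
elim/ratfun_ind => p q q0; elim/ratfun_ind => p' q' q'0.
rewrite -mulNr addf_div ?tofrac_eq0 // -tofracN -!tofracM -tofracD.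
rewrite !extFE ?mulf_neq0 // -[- (_ / _)]mulNr addf_div ?psi0 //.
by rewrite !rmorphM rmorphD !rmorphM rmorphN.
Qed.

Fact extF_monoid : monoid_morphism extF.
Proof.
split; first by rewrite -tofrac1 extF_poly rmorph1.
elim/ratfun_ind => p q q0; elim/ratfun_ind => p' q' q'0.
by rewrite mulf_div -!tofracM !extFE ?mulf_neq0 // mulf_div !rmorphM.
Qed.

End Extension.

(** [rder] refers to the chosen numerator a and denominator b. Differentiating the cross relation p
    b = a q shows that every other representative gives the same quotient. *)
Lemma rderE (p q : {poly K}) : q != 0 ->
  rder (p%:F / q%:F) = (p^`() * q - p * q^`())%:F / (q ^+ 2)%:F.
Proof.
move=> q0; rewrite /rder; pose f : ratfun K := p%:F / q%:F; rewrite -/f; set a := rnum f; set b := rden f.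
have b0 : b != 0 by apply: rden_neq0.
have h : p * b = a * q := ratfun_cross q0 b0 (ratfun_repr f).
apply/eqP; rewrite eqr_div ?tofrac_eq0 ?expf_neq0 // -!tofracM tofrac_eq; apply/eqP.
have h' : p^`() * b + p * b^`() = a^`() * q + a * q^`() by rewrite -!derivM h.
have e1 : (a^`() * b - a * b^`()) * q ^+ 2 = b * q * (a^`() * q) - (a * q) * (b^`() * q) by ring.
have e2 : (p^`() * q - p * q^`()) * b ^+ 2 = b * q * (p^`() * b) - (p * b) * (q^`() * b) by ring.
rewrite e1 e2 h.
have -> : a^`() * q = p^`() * b + p * b^`() - a * q^`() by rewrite h' addrK.
rewrite mulrBr mulrDr; have -> : b * q * (p * b^`()) = a * q * (b^`() * q).
  by rewrite -h; ring.
by ring.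
Qed.

Lemma rder_poly p : rder p%:F = p^`()%:F :> ratfun K.
Proof.
rewrite -[p%:F]divr1 -tofrac1 rderE ?oner_eq0 //.
by rewrite -polyC1 derivC mulr0 subr0 mulr1 expr1n tofrac1 divr1.
Qed.

Lemma rderD f g : rder (f + g) = rder f + rder g.
Proof.
elim/ratfun_ind: f => p q q0; elim/ratfun_ind: g => p' q' q'0.
have Q : q%:F != 0 by rewrite tofrac_eq0.
have Q' : q'%:F != 0 by rewrite tofrac_eq0.
rewrite (addf_div _ _ Q Q') -!tofracM -tofracD (rderE _ (mulf_neq0 q0 q'0)) !rderE //.
rewrite !derivD !derivM.
have := quot_rule_add p%:F (p^`())%:F (q^`())%:F p'%:F (p'^`())%:F (q'^`())%:F Q Q'.
by rewrite !(tofracXn, tofracM, tofracD, tofracN).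
Qed.

Lemma rderM f g : rder (f * g) = rder f * g + f * rder g.
Proof.
elim/ratfun_ind: f => p q q0; elim/ratfun_ind: g => p' q' q'0.
have Q : q%:F != 0 by rewrite tofrac_eq0.
have Q' : q'%:F != 0 by rewrite tofrac_eq0.
rewrite mulf_div -!tofracM (rderE _ (mulf_neq0 q0 q'0)) !rderE // !derivM.
have := quot_rule_mul p%:F (p^`())%:F (q^`())%:F p'%:F (p'^`())%:F (q'^`())%:F Q Q'.
by rewrite !(tofracXn, tofracM, tofracD, tofracN).
Qed.

Lemma ratZ c f : c *: f = (c%:P)%:F * f. Proof. by []. Qed.

Lemma rder_linear : linear (@rder K).
Proof. by move=> c f g; rewrite rderD !ratZ rderM rder_poly derivC tofrac0 mul0r add0r. Qed.

Lemma rder1 : rder 1 = 0 :> ratfun K.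
Proof. by rewrite -tofrac1 rder_poly -polyC1 derivC tofrac0. Qed.

Lemma rderX f n : rder (f ^+ n) = n%:R * f ^+ n.-1 * rder f.
Proof.
elim: n => [|n IH]; first by rewrite expr0 rder1 !mul0r.
rewrite exprS rderM IH /=; case: n {IH} => [|n] /=.
  by rewrite expr0 !mul0r mulr0 addr0 mulr1 !mul1r.
rewrite [in RHS]mulrS mulrDl mul1r mulrDl; congr (_ + _); first by rewrite mulrC.
by rewrite [f ^+ n.+1]exprS !mulrA [f * _]mulrC.
Qed.

Lemma rderV f : f != 0 -> rder f^-1 = - rder f / f ^+ 2.
Proof.
move=> f0; apply: (mulfI f0); have := rderM f f^-1; rewrite divff // rder1.
move/esym/eqP; rewrite addrC addr_eq0 => /eqP ->.
by rewrite inv_rule.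
Qed.

Lemma rsubE c (p q : {poly K}) : c != 0 -> q != 0 ->
  rsub c (p%:F / q%:F) = (p \Po (c *: 'X))%:F / (q \Po (c *: 'X))%:F.
Proof.
move=> c0 q0; rewrite /rsub; pose f : ratfun K := p%:F / q%:F; rewrite -/f.
have h := ratfun_cross q0 (rden_neq0 f) (ratfun_repr f).
have sz : size (c *: 'X : {poly K}) = 2%N by rewrite size_scale // size_polyX.
have nz r : r != 0 -> r \Po (c *: 'X) != 0 by rewrite -!size_poly_eq0 size_comp_poly2.
apply/eqP; rewrite eqr_div ?tofrac_eq0 ?nz ?rden_neq0 //.
by rewrite -!tofracM -!comp_polyM h.
Qed.

Lemma comp_scaleX_neq0 c (q : {poly K}) : c != 0 -> q != 0 -> q \Po (c *: 'X) != 0.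
Proof.
move=> c0; rewrite -!size_poly_eq0 size_comp_poly2 //; by rewrite size_scale // size_polyX.
Qed.

Lemma rsubD c f g : c != 0 -> rsub c (f + g) = rsub c f + rsub c g.
Proof.
move=> c0; elim/ratfun_ind: f => p q q0; elim/ratfun_ind: g => p' q' q'0.
have nz := comp_scaleX_neq0 c0.
rewrite addf_div ?tofrac_eq0 // -!tofracM -tofracD !rsubE ?mulf_neq0 // addf_div ?tofrac_eq0 ?nz //.
by rewrite comp_polyD !comp_polyM !(tofracD, tofracM).
Qed.

Lemma rsubM c f g : c != 0 -> rsub c (f * g) = rsub c f * rsub c g.
Proof.
move=> c0; elim/ratfun_ind: f => p q q0; elim/ratfun_ind: g => p' q' q'0.
by rewrite mulf_div -!tofracM !rsubE ?mulf_neq0 // mulf_div !comp_polyM !tofracM.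
Qed.

Lemma rsub_poly (c : K) (p : {poly K}) : c != 0 ->
  rsub c p%:F = (p \Po (c *: 'X))%:F.
Proof.
move=> c0; rewrite -{1}[p%:F]divr1 -tofrac1 rsubE ?oner_eq0 //.
by rewrite -polyC1 comp_polyC polyC1 tofrac1 divr1.
Qed.

Lemma rsub1 (c : K) : c != 0 -> rsub c 1 = 1.
Proof. by move=> c0; rewrite -tofrac1 rsub_poly // -polyC1 comp_polyC. Qed.

Lemma rsub_linear c : c != 0 -> linear (@rsub K c).
Proof. by move=> c0 d f g; rewrite rsubD // !ratZ rsubM // rsub_poly // comp_polyC. Qed.

Lemma rsubX c f n : c != 0 -> rsub c (f ^+ n) = rsub c f ^+ n.
Proof. by move=> c0; elim: n => [|n IH]; rewrite ?rsub1 // !exprS rsubM // IH. Qed.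

Lemma rsubV c f : c != 0 -> rsub c f^-1 = (rsub c f)^-1.
Proof.
move=> c0; elim/ratfun_ind: f => p q q0; rewrite invf_div.
have [->|p0] := eqVneq p 0; first by rewrite tofrac0 !invr0 !mulr0 mul0r -tofrac0 rsub_poly // comp_poly0 tofrac0 invr0.
by rewrite !rsubE // invf_div.
Qed.

Lemma rsub_comp c d f : c != 0 -> d != 0 -> rsub c (rsub d f) = rsub (c * d) f.
Proof.
move=> c0 d0; elim/ratfun_ind: f => p q q0.
rewrite !rsubE ?mulf_neq0 // ?comp_scaleX_neq0 // -!comp_polyA comp_polyZ comp_polyX scalerA [d * c]mulrC.
by [].
Qed.

Lemma rsub_id f : rsub 1 f = f.
Proof.
by rewrite [RHS]ratfun_repr {1}[f]ratfun_repr rsubE ?oner_eq0 ?rden_neq0 // scale1r !comp_polyXr.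
Qed.

Lemma rsub_der c f : c != 0 -> rder (rsub c f) = c *: rsub c (rder f).
Proof.
move=> c0; elim/ratfun_ind: f => p q q0.
rewrite rsubE // !rderE ?comp_scaleX_neq0 // rsubE ?expf_neq0 // !deriv_comp derivZ derivX.
rewrite ratZ mulrA -tofracM !expr2 comp_polyM; congr (_%:F / _).
rewrite comp_polyB !comp_polyM alg_polyC; ring.
Qed.

End RatFun.

Section Expansions.
Context {K : fieldType}.
Implicit Types f g : ratfun K.

Definition shiftX (z : K) : {poly K} := 'X + z%:P.

Definition psiz (z : K) : {poly K} -> laurent K := evl (lmono 1) \o comp_poly (shiftX z).
HB.instance Definition _ z := GRing.RMorphism.on (psiz z).

Lemma shiftX_neq0 z (q : {poly K}) : q != 0 -> q \Po shiftX z != 0.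
Proof. by rewrite -!size_poly_eq0 size_comp_poly2 //; rewrite size_XaddC. Qed.

Lemma psiz_neq0 z p : p != 0 -> psiz z p != 0.
Proof. by move=> p0; apply/evl1_neq0/shiftX_neq0. Qed.

Definition expz z f : laurent K := extF (psiz z) f.
Definition expinf f : laurent K := extF (evl (lmono (-1))) f.

HB.instance Definition _ z := GRing.isZmodMorphism.Build (ratfun K) (laurent K)
  (expz z) (extF_zmod (@psiz_neq0 z)).
HB.instance Definition _ z := GRing.isMonoidMorphism.Build (ratfun K) (laurent K)
  (expz z) (extF_monoid (@psiz_neq0 z)).
HB.instance Definition _ := GRing.isZmodMorphism.Build (ratfun K) (laurent K)
  expinf (extF_zmod (@evlN1_neq0 K)).
HB.instance Definition _ := GRing.isMonoidMorphism.Build (ratfun K) (laurent K)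
  expinf (extF_monoid (@evlN1_neq0 K)).

Lemma expz_poly z p : expz z p%:F = psiz z p.
Proof. exact/extF_poly/psiz_neq0. Qed.
Lemma expinf_poly p : expinf p%:F = evl (lmono (-1)) p.
Proof. exact/extF_poly/evlN1_neq0. Qed.

(** In the field K((u)) the equation q g = p that characterises [expand] has exactly one solution,
    so the choice made by [xget] is the quotient of the two expanded polynomials. *)
Lemma expandE z f : expand z f = expz z f.
Proof.
rewrite /expand !lpolyE.
set A := evl _ _; set B := evl _ _.
have A0 : A != 0 by apply: (@psiz_neq0 z); apply: rden_neq0.
have E : lmul A (expz z f) = B.
  by rewrite /expz /extF lmulE -/(psiz z _) mulrC divfK.
have := @xgetPex _ 0 [set g | lmul A g = B] (ex_intro _ _ E) => /= h.
by apply: (mulfI A0); rewrite -!lmulE h E.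
Qed.

Lemma expz_linear z : linear (expz z).
Proof.
by move=> c f g; rewrite rmorphD ratZ rmorphM /= expz_poly /psiz /= comp_polyC evlC lscalerAl mul1r.
Qed.

Lemma expinf_linear : linear expinf.
Proof. by move=> c f g; rewrite rmorphD ratZ rmorphM /= expinf_poly evlC lscalerAl mul1r. Qed.

Lemma lder_evl (u : laurent K) (d : laurent K -> laurent K) : linear d ->
  (forall a b, d (a * b) = d a * b + a * d b) ->
  forall p, d (evl u p) = evl u p^`() * d u.
Proof.
move=> dl dM.
have d1 : d 1 = 0.
  by have /esym/eqP := dM 1 1; rewrite !mulr1 mul1r -subr_eq0 addrK => /eqP.
have dX n : d (u ^+ n.+1) = (n.+1%:R * u ^+ n) * d u.
  elim: n => [|n IH]; first by rewrite expr0 expr1 !mul1r.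
  rewrite exprS dM IH [n.+2%:R]mulrS !mulrDl mul1r mulrC; congr (_ + _).
  by rewrite exprS !mulrA [u * _]mulrC.
elim/poly_ind => [|p c IH].
  by rewrite deriv0 !rmorph0 mul0r (lin0 dl).
rewrite rmorphD rmorphM /= evlX evlC (linD dl) dM IH (linZ dl) d1 scaler0 addr0.
rewrite derivD derivC addr0 derivM derivX mulr1 rmorphD rmorphM /= evlX mulrDl.
by congr (_ + _); rewrite mulrAC.
Qed.

Lemma derivation_extF (psi : {rmorphism {poly K} -> laurent K}) (d : laurent K -> laurent K) :
  linear d -> (forall a b, d (a * b) = d a * b + a * d b) ->
  (forall p, p != 0 -> psi p != 0) -> (forall p, d (psi p) = psi p^`()) ->
  forall f, d (extF psi f) = extF psi (rder f).
Proof.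
move=> dl dM psi0 dpsi f; elim/(@ratfun_ind K): f => p q q0.
rewrite rderE // !extFE ?expf_neq0 //.
have Q := psi0 _ q0.
have h : d (psi p) = d (psi p / psi q) * psi q + psi p / psi q * d (psi q).
  by rewrite -dM divfK.
move: h; rewrite !dpsi => /eqP; rewrite -subr_eq => /eqP h.
apply: (mulIf Q); rewrite -h rmorphB expr2 !rmorphM.
by rewrite invfM mulrA divfK // mulrBl mulfK // mulrAC.
Qed.

Lemma expz_der z f : expz z (rder f) = lder (expz z f).
Proof.
rewrite /expz; apply/esym/derivation_extF; first exact: lder_linear.
- exact: lderM.
- exact: psiz_neq0.
move=> p; rewrite /psiz /= (lder_evl _ lder_linear lderM) lder_mono subrr lmono0.
by rewrite scale1r mulr1 deriv_comp derivD derivX derivC addr0 mulr1.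
Qed.

(* d/dt on series in u = 1/t, that is, - u^2 d/du. *)
Definition lderinf (f : laurent K) : laurent K := - (lmono 2 * lder f).

Lemma ico_derinf (f : laurent K) n : ico (lderinf f) n = (1 - n)%:~R * ico f (n - 1).
Proof.
rewrite /lderinf icoN ico_mulmono ico_der -mulNr -mulrNz.
by congr (_%:~R * ico f _); lia.
Qed.

Lemma lderinf_linear : linear lderinf.
Proof.
by move=> c f g; rewrite /lderinf lder_linear mulrDr lscalerAr opprD scalerN.
Qed.

Lemma lderinfM (f g : laurent K) : lderinf (f * g) = lderinf f * g + f * lderinf g.
Proof. by rewrite /lderinf lderM mulrDr opprD mulNr mulrN !mulrA [f * _]mulrC. Qed.

Lemma expinf_der f : expinf (rder f) = lderinf (expinf f).
Proof.
rewrite /expinf; apply/esym/derivation_extF; first exact: lderinf_linear.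
- exact: lderinfM.
- exact: evlN1_neq0.
move=> p; rewrite (lder_evl _ lderinf_linear lderinfM) /lderinf lder_mono.
rewrite lscalerAr lmonoD -scaleNr.
by rewrite (_ : 2 + (-1 - 1) = 0 :> int) // lmono0 rmorphN opprK scale1r mulr1.
Qed.

Lemma lsub_evl (c : K) (u : laurent K) p : c != 0 -> lsub c (evl u p) = evl (lsub c u) p.
Proof.
move=> c0; elim/poly_ind: p => [|p d IH]; first by rewrite !rmorph0 (lin0 (lsub_linear c)).
by rewrite !rmorphD !rmorphM /= !evlX !evlC (linD (lsub_linear c)) lsubM // IH (linZ (lsub_linear c)) lsub1.
Qed.

Lemma evl_scale (c : K) (u : laurent K) p : evl u (p \Po (c *: 'X)) = evl (c *: u) p.
Proof.
elim/poly_ind: p => [|p d IH]; first by rewrite comp_poly0 !rmorph0.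
rewrite comp_polyD comp_polyM comp_polyX comp_polyC !rmorphD !rmorphM /= IH !evlC evlX.
by rewrite -mul_polyC rmorphM /= evlC evlX lscalerAl mul1r.
Qed.

Lemma lsubV c (f : laurent K) : c != 0 -> lsub c f^-1 = (lsub c f)^-1.
Proof.
move=> c0; have [->|f0] := eqVneq f 0; first by rewrite invr0 (lin0 (lsub_linear c)) invr0.
have h : lsub c f * lsub c f^-1 = 1 by rewrite -lsubM // divff // lsub1.
have l0 : lsub c f != 0 by apply/eqP => e; move/eqP: h; rewrite e mul0r eq_sym oner_eq0.
by apply: (mulfI l0); rewrite h divff.
Qed.

Lemma expz_sub c z f : c != 0 -> expz z (rsub c f) = lsub c (expz (c * z) f).
Proof.
move=> c0; elim/(@ratfun_ind K): f => p q q0.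
rewrite rsubE // /expz !extFE ?comp_scaleX_neq0 //; try exact: psiz_neq0.
have h r : psiz z (r \Po (c *: 'X)) = lsub c (psiz (c * z) r).
  rewrite /psiz /= lsub_evl // lsub_mono expr1z -evl_scale -!comp_polyA; congr (evl _ (_ \Po _)).
  by rewrite comp_polyZ comp_polyX comp_polyD comp_polyX comp_polyC scalerDr scale_polyC.
by rewrite /= !h lsubM // lsubV.
Qed.

Lemma expinf_sub c f : c != 0 -> expinf (rsub c f) = lsub c^-1 (expinf f).
Proof.
move=> c0; elim/(@ratfun_ind K): f => p q q0.
rewrite rsubE // /expinf !extFE ?comp_scaleX_neq0 //; try exact: evlN1_neq0.
have h r : evl (lmono (-1)) (r \Po (c *: 'X)) = lsub c^-1 (evl (lmono (-1)) r).
  by rewrite lsub_evl ?invr_neq0 // lsub_mono exprN1 invrK evl_scale.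
by rewrite /= !h lsubM ?invr_neq0 // lsubV ?invr_neq0.
Qed.

End Expansions.

Global Opaque expz expinf rder rsub.

Local Notation "p %:F" := (@FracField.tofrac {poly _} p).

(** * Spans and subspaces *)

Section Span.
Context {K : fieldType}.

Lemma subspace_lspan (V : lmodType K) (S : set V) (P : set V) :
  subspace P -> (forall x, S x -> P x) -> forall x, lspan S x -> P x.
Proof.
move=> [P0 PD] SP x [n [c [s [hs ->]]]].
elim: n c s hs => [|n IH] c s hs; first by rewrite big_ord0.
by rewrite big_ord_recl; apply: PD; [exact/SP/hs | apply: IH => i; apply: hs].
Qed.

Lemma lspan0 (V : lmodType K) (S : set V) : lspan S 0.
Proof. by case: (lspan_subspace S). Qed.
Lemma lspanD (V : lmodType K) (S : set V) x y : lspan S x -> lspan S y -> lspan S (x + y).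
Proof. by case: (lspan_subspace S) => _ h hx hy; rewrite -[x]scale1r; apply: h. Qed.
Lemma lspanZ (V : lmodType K) (S : set V) c x : lspan S x -> lspan S (c *: x).
Proof. by case: (lspan_subspace S) => h0 h hx; rewrite -[_ *: _]addr0; apply: h. Qed.
Lemma lspanN (V : lmodType K) (S : set V) x : lspan S x -> lspan S (- x).
Proof. by rewrite -scaleN1r; apply: lspanZ. Qed.
Lemma lspanB (V : lmodType K) (S : set V) x y : lspan S x -> lspan S y -> lspan S (x - y).
Proof. by move=> hx hy; apply/lspanD/lspanN. Qed.
Lemma lspan_sum (V : lmodType K) (S : set V) (A : Type) (s : seq A) (P : pred A) (F : A -> V) :
  (forall a, P a -> lspan S (F a)) -> lspan S (\sum_(a <- s | P a) F a).
Proof. by move=> h; elim/big_ind: _ => //; [exact: lspan0 | exact: lspanD]. Qed.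
Lemma lspan_fsum (V : lmodType K) (S : set V) (A : choiceType) (F : A -> V) :
  (forall a, lspan S (F a)) -> lspan S (\sum_(a \in [set: A]) F a).
Proof. by move=> h; apply: lspan_sum. Qed.
Lemma lspan_sub (V : lmodType K) (S S' : set V) x :
  (forall y, S y -> lspan S' y) -> lspan S x -> lspan S' x.
Proof. by move=> h; apply: subspace_lspan => //; apply: lspan_subspace. Qed.

Lemma subspace_preim (V W : lmodType K) (f : V -> W) (P : set W) :
  linear f -> subspace P -> subspace [set x | P (f x)].
Proof.
move=> fl [P0 PD]; split=> [|c x y Px Py] /=; first by rewrite (lin0 fl).
by rewrite fl; apply: PD.
Qed.

Lemma subspace_sum (V : lmodType K) (P : set V) (A : Type) (s : seq A) (Q : pred A) (F : A -> V) :
  subspace P -> (forall a, Q a -> P (F a)) -> P (\sum_(a <- s | Q a) F a).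
Proof.
move=> [P0 PD] h; elim/big_ind: _ => // x y Px Py.
by rewrite -[x]scale1r; apply: PD.
Qed.

Lemma lspan_lin (V W : lmodType K) (f : V -> W) (S : set V) (S' : set W) x :
  linear f -> (forall y, S y -> lspan S' (f y)) -> lspan S x -> lspan S' (f x).
Proof.
move=> fl h; apply: (subspace_lspan (P := [set x | lspan S' (f x)])) => //.
by apply: subspace_preim => //; apply: lspan_subspace.
Qed.

Lemma lin_eq_span (V W : lmodType K) (f g : V -> W) (S : set V) x :
  linear f -> linear g -> (forall y, S y -> f y = g y) -> lspan S x -> f x = g x.
Proof.
move=> fl gl h; apply: (subspace_lspan (P := [set x | f x = g x])) => //.
split=> [|c y z /= hy hz]; first by rewrite /= (lin0 fl) (lin0 gl).
by rewrite fl gl hy hz.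
Qed.

End Span.

Lemma partial_fraction (F : fieldType) (a b c : F) : a != 0 -> b != 0 -> c != 0 ->
  b - a = c -> a^-1 * b^-1 = c^-1 * (a^-1 - b^-1).
Proof.
move=> a0 b0 c0 e; apply: (mulfI c0); rewrite mulVKf // -e.
by field; rewrite a0 b0.
Qed.

(** * Partial fractions and the residue theorem *)

Section Poles.
Context {K : numFieldType}.
Implicit Types (f g : ratfun K) (s z a c : K).

Definition rpw s (k : nat) : ratfun K := (('X - s%:P)%:F)^-1 ^+ k.

Lemma Xs_neq0 s : ('X - s%:P)%:F != 0 :> ratfun K.
Proof. by rewrite tofrac_eq0 polyXsubC_eq0. Qed.

Lemma rpwS s k : rpw s k.+1 = rpw s k * rpw s 1.
Proof. by rewrite /rpw expr1 exprSr. Qed.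

Lemma expz_Xs z s : expz z ('X - s%:P)%:F = lmono 1 + (z - s) *: (1 : laurent K).
Proof.
rewrite expz_poly /psiz /= comp_polyB comp_polyX comp_polyC /shiftX.
by rewrite rmorphB rmorphD /= evlX !evlC -addrA -scalerBl.
Qed.

Lemma expinf_Xs s : expinf ('X - s%:P)%:F = lmono (-1) - s *: (1 : laurent K).
Proof. by rewrite expinf_poly rmorphB /= evlX evlC. Qed.

Lemma expz_rpw_diag s k : expz s (rpw s k) = lmono (- k%:Z).
Proof.
rewrite rmorphXn fmorphV /= expz_Xs subrr scale0r addr0 lmonoV lmonoX.
by congr lmono; rewrite mulNrn natz.
Qed.

(** The binomial series of (u + a)^(-k-1). For a = z - s it is the expansion at z of 1/(t -
    s)^(k+1). *)
Definition geo a (k : nat) : laurent K := mklaurent (fun l =>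
  if 0 <= l then (-1) ^+ `|l| * 'C(k + `|l|, `|l|)%:R * a^-1 ^+ (k + `|l|).+1 else 0).

Lemma ico_geo a k l : ico (geo a k) l =
  if 0 <= l then (-1) ^+ `|l| * 'C(k + `|l|, `|l|)%:R * a^-1 ^+ (k + `|l|).+1 else 0.
Proof. by rewrite (icoE (d := 0)) // => n; rewrite ltNge => /negbTE ->. Qed.

Lemma ico_lin_mul a (g : laurent K) n :
  ico ((lmono 1 + a *: (1 : laurent K)) * g) n = ico g (n - 1) + a * ico g n.
Proof. by rewrite mulrDl icoD ico_mulmono lscalerAl icoZ mul1r. Qed.

Lemma geo0 a : a != 0 -> (lmono 1 + a *: (1 : laurent K)) * geo a 0 = 1.
Proof.
move=> a0; apply: laurentP => n; rewrite ico_lin_mul !ico_geo -lmono0 ico_mono.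
case: n => [[|n]|n].
- by rewrite /= expr0 bin0 !mul1r expr1 divff // add0r.
- have -> : n.+1%:Z - 1 = n%:Z by lia.
  by rewrite /= !add0n !binn !exprS; field.
- have -> : Negz n - 1 = Negz n.+1 by lia.
  by rewrite /= mulr0 addr0.
Qed.

Lemma geoS a k : a != 0 -> (lmono 1 + a *: (1 : laurent K)) * geo a k.+1 = geo a k.
Proof.
move=> a0; apply: laurentP => n; rewrite ico_lin_mul !ico_geo.
case: n => [[|n]|n].
- by rewrite /= !expr0 !bin0 !mul1r !addn0 add0r exprS mulrA divff // mul1r.
- have -> : n.+1%:Z - 1 = n%:Z by lia.
  rewrite /= !addSn !addnS binS natrD !exprS; field; exact: a0.
- have -> : Negz n - 1 = Negz n.+1 by lia.
  by rewrite /= mulr0 addr0.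
Qed.

Lemma expz_rpw z s k : z != s -> expz z (rpw s k.+1) = geo (z - s) k.
Proof.
rewrite -subr_eq0 => zs; have h : lmono 1 + (z - s) *: (1 : laurent K) != 0.
  by apply/eqP => e; have /eqP := geo0 zs; rewrite e mul0r eq_sym oner_eq0.
have hV : expz z (rpw s 1) = (lmono 1 + (z - s) *: (1 : laurent K))^-1.
  by rewrite /rpw expr1 fmorphV /= expz_Xs.
elim: k => [|k IH]; first by apply: (mulfI h); rewrite hV divff // geo0.
by rewrite rpwS rmorphM /= IH hV; apply: (mulfI h); rewrite geoS // mulrCA divff // mulr1.
Qed.

(** This is the residue theorem for 1/((t - s)^(k+1) (t - z)^(l+1)), whose residues at z and at s
    add up to 0. It later trades a pole at one point for a pole at another. *)
Lemma expz_rpw_sym z s k l : z != s ->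
  ico (expz z (rpw s k.+1)) l%:Z = - ico (expz s (rpw z l.+1)) k%:Z.
Proof.
move=> zs; rewrite !expz_rpw // 1?eq_sym // !ico_geo /= addnC.
have -> : 'C(l + k, k) = 'C(l + k, l) by rewrite -(bin_sub (leq_addl _ _)) addnK.
have -> : (s - z)^-1 = -1 * (z - s)^-1 by rewrite mulN1r -invrN opprB.
rewrite exprMn [(-1) ^+ (l + k).+1]exprS exprD.
have h : (-1) ^+ k * (-1) ^+ k = 1 :> K by rewrite -exprMn mulrNN mul1r expr1n.
move: h; move: ((-1) ^+ k) ((-1) ^+ l) (_ ^-1 ^+ _) (_%:R) => a b x C h.
by transitivity (a * a * (b * C * x)); [rewrite h mul1r | ring].
Qed.

Definition ordge (f : laurent K) (d : int) := forall n, n < d -> ico f n = 0.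

Lemma ordgeM (f g : laurent K) d e : ordge f d -> ordge g e -> ordge (f * g) (d + e).
Proof.
move=> hf hg n nd; rewrite ico_mulE; apply: fsum0 => m.
by case: (ltP m d) => [/hf ->|dm]; rewrite ?mul0r // hg ?mulr0 //; lia.
Qed.

Lemma ico_mul_lead (f g : laurent K) d e : ordge f d -> ordge g e ->
  ico (f * g) (d + e) = ico f d * ico g e.
Proof.
move=> hf hg; rewrite ico_mulE (fsum_only (j := d)).
  by rewrite (_ : d + e - d = e) //; lia.
move=> m md; case: (ltP m d) => [/hf ->|dm]; rewrite ?mul0r // hg ?mulr0 //; lia.
Qed.

Definition ginf s : laurent K := mklaurent (fun i => if 1 <= i then s ^+ `|i|.-1 else 0).

Lemma ico_expinf_rpw1 s i : ico (expinf (rpw s 1)) i = if 1 <= i then s ^+ `|i|.-1 else 0.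
Proof.
have ig n : ico (ginf s) n = if 1 <= n then s ^+ `|n|.-1 else 0.
  by rewrite (icoE (d := 1)) // => m m1; rewrite ifF //; apply/negP => ?; lia.
rewrite -ig; congr ico; rewrite /rpw expr1 fmorphV /= expinf_Xs.
set x := lmono (-1) - _.
have h : x * ginf s = 1.
  apply: laurentP => n; rewrite mulrBl icoB ico_mulmono lscalerAl icoZ mul1r !ig -lmono0 ico_mono.
  case: n => [[|n]|n].
  - by rewrite /= mulr0 subr0.
  - have -> : n.+1%:Z - -1 = n.+2%:Z by lia.
    by rewrite /= exprS subrr.
  - by rewrite ifF ?ifF ?mulr0 ?subr0 //; apply/negP => /=; lia.
have x0 : x != 0 by apply/eqP => e; move/eqP: h; rewrite e mul0r eq_sym oner_eq0.
by apply: (mulfI x0); rewrite h divff.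
Qed.

Lemma ordge_expinf_rpw s k : ordge (expinf (rpw s k)) k%:Z.
Proof.
elim: k => [|k IH].
  by rewrite /rpw expr0 rmorph1 => n n0; rewrite -lmono0 ico_mono; case: eqP => // e; lia.
rewrite rpwS rmorphM (_ : k.+1%:Z = k%:Z + 1); last by lia.
apply: ordgeM => // n n1; rewrite ico_expinf_rpw1 ifF //; apply/negP => ?; lia.
Qed.

Definition rbasis (S : seq K) : set (ratfun K) :=
  [set f | exists s k, s \in S /\ f = rpw s k.+1].

(** For two different poles the product 1/((t - s')(t - s)) is a multiple of 1/(t - s') - 1/(t - s);
    higher powers of 1/(t - s') follow by induction on the exponent. *)
Lemma lspan_mul_rpw1 (S : seq K) s f : s \in S ->
  lspan (rbasis S) f -> lspan (rbasis S) (f * rpw s 1).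
Proof.
move=> sS; apply: (lspan_lin (f := fun f => f * rpw s 1)).
  by move=> c x y; rewrite mulrDl !ratZ mulrA.
move=> _ [s' [k [s'S ->]]]; have [->|ne] := eqVneq s' s.
  by apply: lspan_incl; rewrite -rpwS; exists s, k.+1.
have e : rpw s' 1 * rpw s 1 = (s' - s)^-1 *: (rpw s' 1 - rpw s 1).
  have h : (s' - s)%:P%:F != 0 :> ratfun K by rewrite tofrac_eq0 polyC_eq0 subr_eq0.
  have -> : (s' - s)^-1 *: (rpw s' 1 - rpw s 1) = ((s' - s)%:P%:F)^-1 * (rpw s' 1 - rpw s 1).
    rewrite ratZ; congr (_ * _); apply: (mulfI h).
    by rewrite -tofracM -polyCM !divff ?tofrac1 ?subr_eq0.
  rewrite /rpw !expr1; apply: partial_fraction; rewrite ?Xs_neq0 //.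
  by rewrite -tofracB polyCB; congr (_%:F); rewrite opprD opprK addrACA subrr add0r addrC.
elim: k => [|k IH]; first by rewrite e; apply/lspanZ/lspanB; apply: lspan_incl; [exists s', 0%N|exists s, 0%N].
rewrite rpwS -mulrA e mulrC ratZ -mulrA -ratZ mulrBl; apply/lspanZ/lspanB.
  by rewrite mulrC -rpwS; apply: lspan_incl; exists s', k.+1.
by rewrite mulrC.
Qed.

Lemma lspan_mul_rpw (S : seq K) s k f : s \in S ->
  lspan (rbasis S) f -> lspan (rbasis S) (f * rpw s k).
Proof.
move=> sS; elim: k f => [|k IH] f hf; first by rewrite /rpw expr0 mulr1.
by rewrite rpwS mulrA; apply/lspan_mul_rpw1/IH.
Qed.

(** Dividing p by X - s leaves a quotient over the shorter product, which still vanishes at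
    infinity, and the constant p(s) over the full product, to which one more factor 1/(t - s) is
    multiplied. *)
Lemma lspan_frac (S : seq K) (ss : seq K) (p : {poly K}) : {subset ss <= S} ->
  (size p < size (\prod_(s <- ss) ('X - s%:P))%R)%N ->
  lspan (rbasis S) (p%:F / (\prod_(s <- ss) ('X - s%:P))%:F).
Proof.
elim: ss p => [|s ss IH] p sS.
  rewrite big_nil size_poly1 ltnS leqn0 size_poly_eq0 => /eqP ->.
  by rewrite tofrac0 mul0r; apply: lspan0.
have sS' : {subset ss <= S} by move=> x xs; apply: sS; rewrite inE xs orbT.
rewrite big_cons; set Q := \prod_(_ <- ss) _ => sz.
have Qm : Q \is monic by apply: monic_prod_XsubC.
have Q0 : Q%:F != 0 :> ratfun K by rewrite tofrac_eq0 monic_neq0.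
have szQ : size (('X - s%:P) * Q) = (size Q).+1 by rewrite size_monicM ?monicXsubC ?monic_neq0 // size_XsubC.
rewrite szQ ltnS in sz.
have [->|p0] := eqVneq p 0; first by rewrite tofrac0 mul0r; apply: lspan0.
have e : p = p %/ ('X - s%:P) * ('X - s%:P) + (p.[s])%:P.
  by rewrite {1}(divp_eq p ('X - s%:P)) modp_XsubC.
have sd : (size (p %/ ('X - s%:P))%R < size Q)%N.
  rewrite size_divp ?polyXsubC_eq0 // size_XsubC; apply: leq_trans sz.
  by rewrite subn1 ltn_predL size_poly_gt0.
rewrite {1}e tofracD mulrDl !tofracM; apply: lspanD.
  rewrite invfM mulrA mulfK ?Xs_neq0 //; exact: IH.
rewrite invfM -/(rpw s 1) mulrA mulrAC.
have -> : ('X - s%:P)%:F^-1 = rpw s 1 by rewrite /rpw expr1.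
have ss1 : s \in S by apply: sS; rewrite inE eqxx.
(* For Q = 1 a constant over Q does not vanish at infinity, so the induction hypothesis says
   nothing; the term is then itself a multiple of 1/(t - s). *)
case: (ltnP 1 (size Q)) => sQ1.
  by apply: lspan_mul_rpw1 => //; apply: IH => //; apply: leq_ltn_trans (size_polyC_leq1 _) sQ1.
have -> : Q = 1.
  have /size_poly1P [c c0 e1] : size Q == 1%N by rewrite eqn_leq sQ1 size_poly_gt0 monic_neq0.
  by move: Qm; rewrite e1 monicE lead_coefC => /eqP ->.
rewrite tofrac1 invr1 mulr1; apply/lspanZ/lspan_incl; by exists s, 0%N.
Qed.

(** The predicate [rinfp] uses one common denominator, which is awkward for closure properties. On
    the partial fractions 1/(t - s)^(k+1) products, derivatives, rotations and residues become
    explicit. *)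
Lemma rinfpP (S : seq K) f : f \in rinfp S <-> lspan (rbasis S) f.
Proof.
split=> [/asboolP[k [p [sp ->]]]|].
  have E : (\prod_(s <- S) ('X - s%:P)) ^+ k = \prod_(s <- flatten (nseq k S)) ('X - s%:P).
    by elim: k {sp} => [|k IH]; rewrite ?big_nil // exprS IH big_cat.
  rewrite E in sp *; apply: lspan_frac => // x /flattenP[t /nseqP[-> _]] //.
apply: (subspace_lspan (P := [set f | f \in rinfp S])).
  by split=> [|c x y hx hy] /=; [exact: rpred0 | apply: rpredD => //; apply: rpredZ].
move=> _ [s [k [sS ->]]]; apply/asboolP.
exists k.+1, ((\prod_(s <- rem s S) ('X - s%:P)) ^+ k.+1) => q.
have Q0 (r : seq K) m : (\prod_(s <- r) ('X - s%:P)) ^+ m != 0 :> {poly K}.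
  by rewrite monic_neq0 // monic_exp // monic_prod_XsubC.
have eq : q = ('X - s%:P) ^+ k.+1 * (\prod_(s <- rem s S) ('X - s%:P)) ^+ k.+1.
  by rewrite /q (perm_big _ (perm_to_rem sS)) big_cons exprMn.
split.
  rewrite eq size_monicM ?monic_exp ?monicXsubC //.
  rewrite size_exp_XsubC addSn /= addnC.
  by rewrite -[X in (X < _)%N]addn0 ltn_add2l.
rewrite eq tofracM invfM mulrCA divff ?tofrac_eq0 ?Q0 // mulr1.
by rewrite /rpw tofracXn exprVn.
Qed.

Lemma rinfM (S : seq K) f g : f \in rinfp S -> g \in rinfp S -> f * g \in rinfp S.
Proof.
move=> /rinfpP hf /rinfpP hg; apply/rinfpP.
apply: (lspan_lin (f := fun g => f * g)) hg.
  by move=> c x y; rewrite mulrDr !ratZ mulrCA.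
by move=> _ [s [k [sS ->]]]; apply: lspan_mul_rpw.
Qed.

Lemma rder_rpw s k : rder (rpw s k) = - (k%:R *: rpw s k.+1).
Proof.
case: k => [|k]; first by rewrite scale0r oppr0 /rpw expr0 rder1.
rewrite /rpw rderX rderV ?Xs_neq0 // rder_poly derivXsubC tofrac1 mulN1r mulrN; congr (- _).
rewrite /= ratZ -mulrA -exprVn -exprD addn2; congr (_ * _).
by rewrite polyC_natr tofracMn.
Qed.

Lemma rinf_der (S : seq K) f : f \in rinfp S -> rder f \in rinfp S.
Proof.
move=> /rinfpP hf; apply/rinfpP; apply: lspan_lin hf; first exact: rder_linear.
move=> _ [s [k [sS ->]]]; rewrite rder_rpw; apply/lspanN/lspanZ/lspan_incl.
by exists s, k.+1.
Qed.

Lemma rsub_rpw c s k : c != 0 -> rsub c (rpw s k) = (c ^- k) *: rpw (s / c) k.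
Proof.
move=> c0; rewrite /rpw rsubX // rsubV // rsub_poly // comp_polyB comp_polyX comp_polyC.
have -> : c *: 'X - s%:P = c%:P * ('X - (s / c)%:P) :> {poly K}.
  by rewrite mulrBr mul_polyC -polyCM mulrCA divff // mulr1.
rewrite tofracM invfM exprMn ratZ; congr (_ * _).
by rewrite -exprVn polyC_exp tofracXn; congr (_ ^+ _); apply: (mulfI (_ : c%:P%:F != 0));
  rewrite ?divff -?tofracM -?polyCM ?divff ?tofrac_eq0 ?polyC_eq0 // tofrac1.
Qed.

Lemma rinf_sub (S : seq K) c f : c != 0 -> (forall s, s \in S -> s / c \in S) ->
  f \in rinfp S -> rsub c f \in rinfp S.
Proof.
move=> c0 hS /rinfpP hf; apply/rinfpP; apply: lspan_lin hf; first exact: rsub_linear.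
move=> _ [s [k [sS ->]]]; rewrite rsub_rpw //; apply/lspanZ/lspan_incl.
by exists (s / c), k; split=> //; apply: hS.
Qed.

Lemma rpw_in (S : seq K) s k : s \in S -> rpw s k.+1 \in rinfp S.
Proof. by move=> sS; apply/rinfpP/lspan_incl; exists s, k. Qed.

Lemma mkrinfE (S : seq K) f : f \in rinfp S -> rval (mkrinf S f) = f.
Proof. by move=> h; rewrite /mkrinf /insubd insubT. Qed.

Lemma rval_in (S : seq K) (f : rinf S) : rval f \in rinfp S.
Proof. by case: f. Qed.

Lemma rval_linear (S : seq K) : linear (@rval K S).
Proof. by []. Qed.

Lemma rinf_ordge (S : seq K) f : f \in rinfp S -> ordge (expinf f) 1.
Proof.
move=> /rinfpP; apply: (subspace_lspan (P := [set f | ordge (expinf f) 1])).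
  split=> [n _ | c x y /= hx hy n n1]; first by rewrite rmorph0 ico0.
  rewrite (expinf_linear c x y) (icoD (c *: expinf x)) (icoZ c (expinf x)).
  by rewrite (hx n n1) (hy n n1) mulr0 addr0.
by move=> _ [s [k [sS ->]]] n n1; apply: ordge_expinf_rpw; lia.
Qed.

(** The sum of the residues is the coefficient of 1/t at infinity. On partial fractions only a
    simple pole contributes, and by the same amount to both sides. *)
Lemma residues (S r : seq K) f : uniq r -> {subset S <= r} -> f \in rinfp S ->
  \sum_(z <- r) ico (expz z f) (-1) = ico (expinf f) 1.
Proof.
move=> ur Sr /rinfpP; apply: (@lin_eq_span _ _ K^o (fun f => \sum_(z <- r) ico (expz z f) (-1)) (fun f => ico (expinf f) 1)).
- by apply: lin_bigsum => z c x y; rewrite expz_linear.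
- by move=> c x y; rewrite expinf_linear.
move=> _ [s [k [/Sr sr ->]]]; rewrite (bigD1_seq s) //= expz_rpw_diag ico_mono big1; last first.
  by move=> z zs; rewrite expz_rpw // ico_geo.
rewrite addr0; case: k => [|k]; first by rewrite ico_expinf_rpw1.
by rewrite ordge_expinf_rpw //; case: eqP => // e; lia.
Qed.

End Poles.

(** * Double sums over the natural numbers *)

Section NatSums.
Context {V : zmodType}.

Lemma fsum_nat_shift (F : nat -> V) n : (forall m, (m < n)%N -> F m = 0) ->
  \sum_(m \in [set: nat]) F m = \sum_(k \in [set: nat]) F (k + n)%N.
Proof.
move=> h; rewrite -(@fsbig_widen _ _ _ _ [set m | (n <= m)%N] setT) //; last first.
  by move=> m [_ /= /negP]; rewrite -ltnNge => /h.
apply: (@reindex_fsbig _ _ _ nat nat (fun k => (k + n)%N)); split=> //.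
- by move=> m; rewrite /= leq_addl.
- by move=> i j _ _ /addIn.
- by move=> m /= nm; exists (m - n)%N => //; rewrite subnK.
Qed.

Lemma fsum_natS (F : nat -> V) : fins F ->
  \sum_(m \in [set: nat]) F m = F 0%N + \sum_(m \in [set: nat]) F m.+1.
Proof.
move=> fF; pose G m := if m == 0%N then F 0%N else 0.
have -> : F 0%N = \sum_(m \in [set: nat]) G m by rewrite (fsum_only (j := 0%N)) // => i /negbTE i0; rewrite /G i0.
have -> : \sum_(m \in [set: nat]) F m.+1 = \sum_(m \in [set: nat]) (if m == 0%N then 0 else F m).
  rewrite [RHS](@fsum_nat_shift _ 1); last by case.
  by apply: eq_fsum => m; rewrite addn1.
rewrite -fsumD; last 2 first.
- by exists [:: 0%N] => i; rewrite inE /G => /negbTE ->.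
- by have [r hr] := fF; exists r => i /hr ->; case: ifP.
by apply: eq_fsum => -[|m]; rewrite /G /= ?addr0 ?add0r.
Qed.

Lemma fsum_diag (G : nat -> nat -> V) B : (forall n k, (B <= n + k)%N -> G n k = 0) ->
  \sum_(n \in [set: nat]) \sum_(k \in [set: nat]) G n k
  = \sum_(N \in [set: nat]) \sum_(n < N.+1) G n (N - n)%N.
Proof.
move=> hB; transitivity (\sum_(N \in [set: nat]) \sum_(n \in [set: nat])
    (if (n <= N)%N then G n (N - n)%N else 0)).
  rewrite [RHS](exchange_fsum (r := iota 0 B) (s := iota 0 B)).
  - apply: eq_fsum => n; rewrite [RHS](@fsum_nat_shift _ n).
      by apply: eq_fsum => k; rewrite leq_addl addnK.
    by move=> m; rewrite ltnNge => /negbTE ->.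
  - move=> N n; rewrite mem_iota /= add0n -leqNgt => BN; case: leqP => // nN.
    by rewrite hB // subnKC.
  - move=> N n; rewrite mem_iota /= add0n -leqNgt => Bn; case: leqP => // nN.
    by rewrite hB // subnKC // (leq_trans Bn).
apply: eq_fsum => N; rewrite (@fsum_ord _ _ N.+1).
  by apply: eq_bigr => i _; rewrite -ltnS ltn_ord.
by move=> n; rewrite ltnNge => /negbTE ->.
Qed.

(** The bound on m depends on n, but only finitely many n are left by the uniform bound, so a
    maximum can be taken. *)
Lemma fins_box (G : nat -> nat -> V) : 
  (exists N, forall m n, (N <= n)%N -> G m n = 0) ->
  (forall n, exists M, forall m, (M <= m)%N -> G m n = 0) ->
  exists B, forall m n, (B <= m)%N || (B <= n)%N -> G m n = 0.
Proof.
move=> [N hN] h.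
have [M hM] : exists M, forall n m, (n < N)%N -> (M <= m)%N -> G m n = 0.
  elim: N {hN} => [|N [M IH]]; first by exists 0%N.
  have [M' hM'] := h N; exists (maxn M M') => n m; rewrite ltnS leq_eqVlt geq_max => /orP[/eqP ->|nN] /andP[m1 m2].
    exact: hM'.
  exact: IH.
exists (maxn M N) => m n; case: (ltnP n N) => [nN|/hN -> //].
rewrite !geq_max (leqNgt N n) nN andbF orbF => /andP[Mm _]; exact: hM.
Qed.

End NatSums.

(** * Maps out of quotients, tensor products and Lie_A(L) *)

Section Lifts.
Context {K : fieldType}.

(** All lifts are evaluated on a chosen representative. This is the point where killing the
    relations makes the value independent of that choice. *)
Lemma repr_qpi (V W : lmodType K) (S : set V) (f : V -> W) x :
  linear f -> (forall r, S r -> f r = 0) -> f (repr (qpi S x)) = f x.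
Proof.
move=> fl h; have /qpiP : qpi S (repr (qpi S x)) = qpi S x by rewrite qpiK.
move=> hs; apply/eqP; rewrite -subr_eq0 -(linB fl); apply/eqP.
exact: (lin_eq_span fl (@lin_cst0 K V W) _ hs).
Qed.

Lemma qpiD (V : lmodType K) (S : set V) x y : qpi S (x + y) = qpi S x + qpi S y.
Proof. exact: (linD (qpi_linear S)). Qed.
Lemma qpi0 (V : lmodType K) (S : set V) x : lspan S x -> qpi S x = 0.
Proof. by move=> h; rewrite -(lin0 (qpi_linear S)); apply/qpiP; rewrite subr0. Qed.
Lemma quot_ex (V : lmodType K) (S : set V) (q : quot S) : exists x, q = qpi S x.
Proof. by exists (repr q); rewrite qpiK. Qed.

Lemma malg_span (X : choiceType) (g : {malg K[X]}) : lspan [set << x >> | x in [set: X]] g.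
Proof.
rewrite [g]monalgE; apply: lspan_sum => x _.
have -> : << g@_x *g x >> = g@_x *: (<< x >> : {malg K[X]}).
  by apply/malgP => y; rewrite mcoeffZ !mcoeffU mulr_natr.
by apply/lspanZ/lspan_incl; exists x.
Qed.

Lemma quot_lift_linear (X : choiceType) (S : set {malg K[X]}) (W : lmodType K) (h : X -> W) :
  (forall r, S r -> free_lift h r = 0) -> linear (quot_lift (S := S) h).
Proof.
move=> hS c q q'; have [x ->] := quot_ex q; have [y ->] := quot_ex q'.
rewrite -(linZ (qpi_linear S)) -qpiD !quot_liftE // -free_lift_linear.
by congr free_lift.
Qed.

Lemma quot_liftU (X : choiceType) (S : set {malg K[X]}) (W : lmodType K) (h : X -> W) x :
  (forall r, S r -> free_lift h r = 0) -> quot_lift h (qpi S << x >>) = h x.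
Proof. by move=> hS; rewrite quot_liftE // free_liftU. Qed.

Lemma free_lift_rel (X : choiceType) (W : lmodType K) (h : X -> W) c (x y z : X) :
  free_lift h (<< x >> - c *: << y >> - << z >>) = h x - c *: h y - h z.
Proof.
have fl := free_lift_linear h.
by rewrite !(linB fl) (linZ fl) !free_liftU.
Qed.

Lemma quot_malg_span (X : choiceType) (S : set {malg K[X]}) q :
  lspan [set qpi S << x >> | x in [set: X]] q.
Proof.
have [g ->] := quot_ex q; apply: (lspan_lin (qpi_linear S) _ (malg_span g)).
by move=> _ [x _ <-]; apply: lspan_incl; exists x.
Qed.

Definition bilin (U V W : lmodType K) (b : U -> V -> W) :=
  (forall v, linear (fun u => b u v)) /\ (forall u, linear (b u)).

Section TensorLift.
Context {U V W : lmodType K} (b : U -> V -> W).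
Hypothesis hb : bilin b.

Lemma tensor_lift_rels r : tensor_rels r -> free_lift (fun p => b p.1 p.2) r = 0.
Proof.
case: hb => bl br; case=> [[c [u [u' [v ->]]]]|[c [u [v [v' ->]]]]].
  by rewrite free_lift_rel /= bl -addrA -opprD subrr.
by rewrite free_lift_rel /= br -addrA -opprD subrr.
Qed.

Lemma tensor_liftE u v : tensor_lift b (tens u v) = b u v.
Proof. by rewrite /tensor_lift /tens quot_liftU //; exact: tensor_lift_rels. Qed.

Lemma tensor_lift_linear : linear (tensor_lift b).
Proof. by apply: quot_lift_linear; exact: tensor_lift_rels. Qed.

End TensorLift.

Lemma tens_bilin (U V : lmodType K) : bilin (@tens K U V).
Proof.
split=> [v c u u'|u c v v']; rewrite /tens -(linZ (qpi_linear _)) -qpiD; apply/qpiP/lspan_incl.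
  by left; exists c, u, u', v; rewrite opprD addrA.
by right; exists c, u, v, v'; rewrite opprD addrA.
Qed.

Lemma tensor_span (U V : lmodType K) (t : tensor U V) :
  lspan [set x | exists u v, x = tens u v] t.
Proof.
apply: lspan_sub (quot_malg_span t) => _ [[u v] _ <-].
by apply: lspan_incl; exists u, v.
Qed.

End Lifts.

Section LieLift.
Context {K : fieldType} {L : vla K} {A : dalg K}.
Local Notation rho := (@rho K L A).

(** The maps that factor through Lie_A(L): bilinear, and compatible with Da (x) f = - a (x) f'. *)
Definition liebil (W : lmodType K) (b : L -> A -> W) :=
  bilin b /\ forall a f, b (vD a) f + b a (dder f) = 0.

Lemma lie_liftE (W : lmodType K) (b : L -> A -> W) a f :
  liebil b -> lie_lift b (rho a f) = b a f.
Proof.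
move=> [hb hD]; rewrite /lie_lift /rho repr_qpi; first exact: tensor_liftE.
  exact: tensor_lift_linear.
by move=> _ [a' [f' ->]]; rewrite (linD (tensor_lift_linear hb)) !tensor_liftE.
Qed.

Lemma lie_lift_linear (W : lmodType K) (b : L -> A -> W) :
  liebil b -> linear (lie_lift b).
Proof.
move=> [hb hD] c q q'; have [x ->] := quot_ex q; have [y ->] := quot_ex q'.
have tl := tensor_lift_linear hb.
have h r : lie_rels r -> tensor_lift b r = 0.
  by move=> [a' [f' ->]]; rewrite (linD tl) !tensor_liftE.
by rewrite -(linZ (qpi_linear _)) -qpiD /lie_lift !(repr_qpi _ tl h) tl.
Qed.

Lemma rho_liebil : liebil rho.
Proof.
have [tl tr] := tens_bilin L A.
have ql := @qpi_linear _ _ (@lie_rels K L A).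
split; first by split=> [f c a a'|a c f f']; rewrite /rho ?tl ?tr ql.
move=> a f; rewrite /rho -qpiD; apply/qpi0/lspan_incl.
by exists a, f.
Qed.

Lemma rho_linl f : linear (fun a => rho a f). Proof. by case: rho_liebil => [[]]. Qed.
Lemma rho_linr a : linear (rho a). Proof. by case: rho_liebil => [[]]. Qed.
Lemma rho_D a f : rho (vD a) f = - rho a (dder f).
Proof. by apply/eqP; rewrite -addr_eq0; case: rho_liebil => _ ->. Qed.

Lemma lie_span (x : lie L A) : lspan [set y | exists a f, y = rho a f] x.
Proof.
have [t ->] := quot_ex x; apply: (lspan_lin (qpi_linear _) _ (tensor_span t)).
by move=> _ [a [f ->]]; apply: lspan_incl; exists a, f.
Qed.

Lemma lie_eq_lin (W : lmodType K) (f g : lie L A -> W) : linear f -> linear g ->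
  (forall a h, f (rho a h) = g (rho a h)) -> f =1 g.
Proof. by move=> fl gl h x; apply: (lin_eq_span fl gl _ (lie_span x)) => _ [a [k ->]]. Qed.

Lemma lie_ind (P : lie L A -> Prop) : subspace P -> (forall a f, P (rho a f)) -> forall x, P x.
Proof. by move=> hP h x; apply: (subspace_lspan hP _ (lie_span x)) => _ [a [f ->]]. Qed.

End LieLift.

Global Opaque qpi quot_add quot_opp quot_scale quot_lift free_lift tensor_lift lie_lift rho.

(** * The Lie bracket on the loop algebra *)

Section VertexLieFacts.
Context {K : numFieldType} {L : vla K} (hL : vertex_lie_algebra L).

Lemma vprod0l n (b : L) : vprod 0 n b = 0.
Proof. exact: (lin0 (vprod_linearl hL n b)). Qed.
Lemma vprod0r (a : L) n : vprod a n 0 = 0.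
Proof. exact: (lin0 (vprod_linearr hL a n)). Qed.

Lemma vD_c : vD (vc L) = 0.
Proof. by apply/(vD_ker hL); exists 1; rewrite scale1r. Qed.

(** Since Dc = 0, the rule for (Dc)_(n+1) b forces (n + 1) c_(n) b = 0, and the characteristic is
    0. *)
Lemma vprod_cl n (b : L) : vprod (vc L) n b = 0.
Proof.
have := vprod_D hL (vc L) n.+1 b; rewrite vD_c vprod0l => /esym/eqP.
by rewrite oppr_eq0 scaler_eq0 pnatr_eq0 => /eqP.
Qed.

Lemma vprod_skew_fins (a : L) n b :
  fins (fun k => ((-1) ^+ (n + k) / k`!%:R) *: iter k (@vD _ L) (vprod b (n + k) a)).
Proof.
have [m hm] := vprod_trunc hL b a; apply: (fins_nat (b := m)) => k mk.
rewrite hm ?(leq_trans mk) ?leq_addl //.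
have -> : iter k (@vD _ L) 0 = 0 by elim: k {mk} => //= k ->; rewrite (lin0 (vD_linear hL)).
by rewrite scaler0.
Qed.

(** By skew-symmetry a_(n)(Db) becomes a series in D^k (b_(n+k-1) a) whose coefficients carry a
    factor n + k. The part with n is n a_(n-1) b, and the part with k, after a shift of k, is
    D(a_(n) b). *)
Lemma vprod_Dr (a : L) n b :
  vprod a n (vD b) = vD (vprod a n b) + n%:R *: vprod a n.-1 b.
Proof.
have Dl := vD_linear hL.
have Dl' k : linear (iter k (@vD _ L)) by elim: k => //= k IH; exact: (lin_comp Dl IH).
pose X c k := c k *: iter k (@vD _ L) (vprod b (n + k).-1 a).
pose c0 (k : nat) : K := (-1) ^+ (n + k) / k`!%:R.
have [m hm] := vprod_trunc hL b a.
have fX c : fins (X c).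
  apply: (fins_nat (b := m.+1)) => -[|k] // mk.
  have h0 : vprod b (n + k) a = 0 by apply: hm; apply: leq_trans (leq_addl _ _).
  by rewrite /X addnS /= h0 (lin0 (Dl' k)) (lin0 Dl) scaler0.
have eN : forall F : nat -> L, fins F ->
    - (\sum_(k \in [set: nat]) F k) = \sum_(k \in [set: nat]) - F k.
  by move=> F fF; apply: (@additive_fsum _ _ _ (fun x => - x)); rewrite ?oppr0 // => x y; rewrite opprD.
have -> : vprod a n (vD b) = \sum_(k \in [set: nat]) X (fun k => c0 k * (n%:R + k%:R)) k.
  rewrite (vprod_skew hL) eN; last exact: vprod_skew_fins.
  apply: eq_fsum => k; rewrite (vprod_D hL) (linN (Dl' k)) (linZ (Dl' k)) scalerN opprK scalerA.
  by rewrite /X /c0 -natrD.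
have -> : \sum_(k \in [set: nat]) X (fun k => c0 k * (n%:R + k%:R)) k
    = \sum_(k \in [set: nat]) X (fun k => c0 k * n%:R) k + \sum_(k \in [set: nat]) X (fun k => c0 k * k%:R) k.
  by rewrite -fsumD //; apply: eq_fsum => k; rewrite /X -scalerDl mulrDr.
rewrite addrC; congr (_ + _).
  rewrite fsum_natS // /X mulr0 scale0r add0r (vprod_skew hL).
  rewrite (linN Dl) (lin_fsum Dl); last exact: vprod_skew_fins.
  rewrite eN; last by apply: fins_map; [exact: (lin0 Dl) | exact: vprod_skew_fins].
  apply: eq_fsum => k; rewrite (linZ Dl) -scaleNr addnS /=; congr (_ *: _).
  rewrite /c0 addnS exprS factS natrM invfM mulN1r !mulNr -mulrA; congr (- (_ * _)).
  by rewrite mulrAC mulVf ?mul1r // pnatr_eq0.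
case: n @X @c0 fX => [|n] X c0 fX.
  by rewrite scale0r fsum0 // => k; rewrite /X mulr0 scale0r.
rewrite /= (vprod_skew hL) scalerN -scaleNr scaler_fsum; last exact: vprod_skew_fins.
apply: eq_fsum => k; rewrite /X /c0 scalerA addSn /= exprS; congr (_ *: _).
by rewrite mulN1r !mulNr mulrC.
Qed.

End VertexLieFacts.

(** * Binomial coefficients of integers and iterated derivatives *)

Section BinZ.
Context {K : numFieldType}.

Definition binz (m : int) (k : nat) : K := (\prod_(j < k) (m%:~R - j%:R)) / k`!%:R.

Lemma invf_bin (n N : nat) : (n <= N)%N ->
  (N`!%:R)^-1 * 'C(N, n)%:R = (n`!%:R)^-1 * ((N - n)`!%:R)^-1 :> K.
Proof.
move=> nN; rewrite -(bin_fact nN) !natrM !invfM mulrAC mulVf ?mul1r //.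
by rewrite pnatr_eq0 -lt0n bin_gt0.
Qed.

Lemma binz0 m : binz m 0 = 1.
Proof. by rewrite /binz big_ord0 fact0 divr1. Qed.

Lemma binz_fact m k : k`!%:R * binz m k = \prod_(j < k) (m%:~R - j%:R).
Proof. by rewrite /binz mulrCA divff ?mulr1 // pnatr_eq0 -lt0n fact_gt0. Qed.

Lemma binzS m k : k.+1%:R * binz m k.+1 = (m%:~R - k%:R) * binz m k.
Proof.
apply: (@mulfI _ (k`!%:R)); first by rewrite pnatr_eq0 -lt0n fact_gt0.
rewrite mulrA -natrM -[(k`! * _)%N]mulnC -factS binz_fact mulrCA binz_fact.
by rewrite big_ord_recr /= mulrC.
Qed.

Lemma binzS_rec m k : m%:~R * binz (m - 1) k = k.+1%:R * binz m k.+1.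
Proof.
elim: k => [|k IH]; first by rewrite binzS !binz0 subr0.
rewrite binzS; apply: (@mulfI _ (k.+1%:R)); first by rewrite pnatr_eq0.
rewrite mulrCA binzS [RHS]mulrCA -IH rmorphB /= -natr1; ring.
Qed.

Lemma binz_nat (n k : nat) : binz n%:Z k = 'C(n, k)%:R.
Proof.
elim: k n => [|k IH] n; first by rewrite binz0 bin0.
case: n => [|n].
  rewrite bin0n /=; apply: (@mulfI _ (k.+1%:R)); first by rewrite pnatr_eq0.
  by rewrite -binzS_rec mul0r mulr0.
apply: (@mulfI _ (k.+1%:R)); first by rewrite pnatr_eq0.
rewrite -binzS_rec; have -> : n.+1%:Z - 1 = n%:Z by lia.
by rewrite IH -[_%:~R]/(n.+1%:R) -!natrM mul_bin_diag.
Qed.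

Lemma iter_lder (f : laurent K) k n :
  ico (iter k lder f) n = k`!%:R * binz (n + k%:Z) k * ico f (n + k%:Z).
Proof.
elim: k n => [|k IH] n; first by rewrite /= fact0 binz0 !mul1r addr0.
rewrite /= ico_der IH; have -> : n + 1 + k%:Z = n + k.+1%:Z by lia.
rewrite mulrA; congr (_ * _).
have := binzS (n + k.+1%:Z) k; have -> : (n + k.+1%:Z)%:~R - k%:R = (n + 1)%:~R :> K.
  by rewrite -[k%:R]/(k%:Z%:~R) -rmorphB /=; congr (_%:~R); lia.
by move=> h; rewrite mulrCA -h factS natrM mulrCA mulrA.
Qed.

Lemma iter_lder_mono m k : iter k lder (lmono m : laurent K) = (k`!%:R * binz m k) *: lmono (m - k%:Z).
Proof.
apply: laurentP => n; rewrite iter_lder icoZ !ico_mono.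
have -> : (n + k == m) = (n == m - k%:Z) by lia.
by case: eqP => [->|_]; rewrite ?mulr0 // subrK.
Qed.

Lemma iter_lder_linear k : linear (iter k (@lder K)).
Proof. by elim: k => //= k IH; apply: (lin_comp lder_linear IH). Qed.

Lemma iter_lderM (f g : laurent K) q :
  iter q lder (f * g) = \sum_(i < q.+1) 'C(q, i)%:R *: (iter i lder f * iter (q - i) lder g).
Proof.
elim: q => [|q IH]; first by rewrite big_ord1 bin0 scale1r.
rewrite iterS IH (lin_sum _ _ _ lder_linear).
under eq_bigr do rewrite (linZ lder_linear) lderM scalerDr -!iterS.
rewrite big_split /= [RHS]big_ord_recl bin0 scale1r [X in _ + X]big_ord_recl bin0 scale1r.
rewrite !subn0 addrCA; congr (_ + _).
under [RHS]eq_bigr => i _ do rewrite lift0 binS natrD scalerDl subSS.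
rewrite big_split /= addrC; congr (_ + _).
rewrite [RHS]big_ord_recr /= bin_small // scale0r addr0.
by apply: eq_bigr => i _; rewrite /bump leq0n add1n add0n -(subnSK (ltn_ord i)).
Qed.

(** Repeated integration by parts, starting from g f^(N+1) = (g f^(N))' - g' f^(N). It matches the
    skew-symmetry of the products with the antisymmetry of the bracket. *)
Lemma lder_skew (g f : laurent K) N :
  \sum_(n < N.+1) ((-1) ^+ n * 'C(N, n)%:R) *: iter (N - n) lder (iter n lder g * f)
  = g * iter N lder f.
Proof.
elim: N g f => [|N IH] g f; first by rewrite big_ord1 bin0 mulr1 scale1r.
have E : g * iter N.+1 lder f = lder (g * iter N lder f) - lder g * iter N lder f.
  by rewrite lderM addrC addKr.
rewrite E -IH -IH (lin_sum _ _ _ lder_linear).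
under [X in _ = X - _]eq_bigr do rewrite (linZ lder_linear) -iterS.
rewrite [LHS]big_ord_recl [X in _ = X - _]big_ord_recl !bin0 !subn0 -addrA; congr (_ + _).
under [LHS]eq_bigr => i _ do rewrite lift0 binS natrD mulrDr scalerDl subSS.
rewrite big_split /=; congr (_ + _).
  rewrite big_ord_recr /= bin_small // mulr0 scale0r addr0.
  by apply: eq_bigr => i _; rewrite /bump leq0n add1n add0n -(subnSK (ltn_ord i)).
rewrite -sumrN; apply: eq_bigr => i _.
by rewrite exprS mulN1r mulNr scaleNr -iterSr.
Qed.

End BinZ.

Lemma fsumN (V : zmodType) (I : choiceType) (F : I -> V) : fins F ->
  - (\sum_(k \in [set: I]) F k) = \sum_(k \in [set: I]) - F k.
Proof.
by move=> fF; apply: (@additive_fsum _ _ _ (fun x => - x)); rewrite ?oppr0 // => x y; rewrite opprD.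
Qed.

Lemma finsN (V : zmodType) (I : choiceType) (F : I -> V) : fins F -> fins (fun i => - F i).
Proof. by move=> [r hr]; exists r => i /hr ->; rewrite oppr0. Qed.

Local Notation "f ^{( n )}" := (iter n lder f) (at level 2, format "f ^{( n )}").

(* The bracket is computed in an arbitrary target W of a bilinear map
   satisfying the defining relation of Lie_A L. *)
Section BracketFormula.
Context {K : numFieldType} {L : vla K} (hL : vertex_lie_algebra L).
Context {W : lmodType K} (r : L -> laurent K -> W).
Hypothesis r_linl : forall f, linear (fun a => r a f).
Hypothesis r_linr : forall a, linear (r a).
Hypothesis r_D : forall a f, r (vD a) f = - r a (lder f).
Implicit Types (a b c : L) (f g h : laurent K).
Local Notation D := (@vD _ L).

Lemma r0l f : r 0 f = 0. Proof. exact: (lin0 (r_linl f)). Qed.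
Lemma r_iterD k a f : r (iter k D a) f = (-1) ^+ k *: r a (iter k lder f).
Proof.
elim: k a f => [|k IH] a f; first by rewrite scale1r.
by rewrite iterS r_D IH -scalerN iterSr exprS mulN1r scaleNr scalerN.
Qed.

Definition brb a f b g : W :=
  \sum_(n \in [set: nat]) (n`!%:R)^-1 *: r (vprod a n b) (f^{(n)} * g).

Lemma brb_fins0 a b (F : nat -> laurent K) : fins (fun n => (n`!%:R)^-1 *: r (vprod a n b) (F n)).
Proof.
have [m hm] := vprod_trunc hL a b; apply: (fins_nat (b := m)) => n mn.
by rewrite hm // r0l scaler0.
Qed.

Lemma brb_fins1 a b (F : nat -> laurent K) :
  fins (fun n => (n`!%:R)^-1 *: r (n%:R *: vprod a n.-1 b) (F n)).
Proof.
have [m hm] := vprod_trunc hL a b; apply: (fins_nat (b := m.+1)) => -[|n] // mn.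
by rewrite hm // scaler0 r0l scaler0.
Qed.

Lemma brb_shift a f b g :
  \sum_(n \in [set: nat]) (n`!%:R)^-1 *: r (n%:R *: vprod a n.-1 b) (f^{(n)} * g)
  = \sum_(n \in [set: nat]) (n`!%:R)^-1 *: r (vprod a n b) (f^{(n.+1)} * g).
Proof.
rewrite [LHS](fsum_natS (brb_fins1 a b _)).
rewrite scale0r r0l scaler0 add0r; apply: eq_fsum => n.
rewrite (linZ (r_linl _)) scalerA; congr (_ *: _).
by rewrite factS natrM invfM mulrC mulrA divff ?mul1r // pnatr_eq0.
Qed.

Lemma brb_lina f b g : linear (fun a => brb a f b g).
Proof.
apply: lin_bigfsum; last by move=> a; apply: brb_fins0.
by move=> n; apply: lin_scale; apply: (lin_comp (r_linl _)); exact: (vprod_linearl hL).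
Qed.

Lemma brb_linb a f g : linear (fun b => brb a f b g).
Proof.
apply: lin_bigfsum; last by move=> b; apply: brb_fins0.
by move=> n; apply: lin_scale; apply: (lin_comp (r_linl _)); exact: (vprod_linearr hL).
Qed.

Lemma brb_linf a b g : linear (fun f => brb a f b g).
Proof.
apply: lin_bigfsum; last by move=> f; apply: brb_fins0.
move=> n; apply: lin_scale; apply: (lin_comp (r_linr _)) => k x y.
by rewrite iter_lder_linear mulrDl lscalerAl.
Qed.

Lemma brb_ling a f b : linear (brb a f b).
Proof.
apply: lin_bigfsum; last by move=> g; apply: brb_fins0.
move=> n; apply: lin_scale; apply: (lin_comp (r_linr _)) => k x y.
by rewrite mulrDr lscalerAr.
Qed.

(** With [brb_Douter], this makes the bracket descend to the quotient in each argument. The term n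
    a_(n-1) b of [vprod_Dr] cancels, after a shift of the index, against the derivative falling on
    f^(n). *)
Lemma brb_Dinner a f b g : brb a f (D b) g + brb a f b (lder g) = 0.
Proof.
have e n : (n`!%:R)^-1 *: r (vprod a n (D b)) (f^{(n)} * g)
    = (n`!%:R)^-1 *: r (n%:R *: vprod a n.-1 b) (f^{(n)} * g)
      - (n`!%:R)^-1 *: r (vprod a n b) (f^{(n.+1)} * g)
      - (n`!%:R)^-1 *: r (vprod a n b) (f^{(n)} * lder g).
  rewrite (vprod_Dr hL) (linD (r_linl _)) r_D lderM (linD (r_linr _)) -!scalerBr.
  by congr (_ *: _); rewrite addrC opprD addrA.
rewrite /brb (eq_fsum e) fsumD; last 2 first.
- by apply: finsD; [exact: brb_fins1 | apply/finsN/brb_fins0].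
- exact/finsN/brb_fins0.
rewrite fsumD; [|exact: brb_fins1 | exact/finsN/brb_fins0].
rewrite -!fsumN; try exact: brb_fins0.
by rewrite brb_shift subrr add0r addNr.
Qed.

Lemma brb_Douter a f b g : brb (D a) f b g + brb a (lder f) b g = 0.
Proof.
rewrite /brb; under eq_fsum do rewrite (vprod_D hL) (linN (r_linl _)) scalerN.
rewrite -fsumN; last exact: brb_fins1.
rewrite brb_shift addrC; apply/eqP; rewrite subr_eq0; apply/eqP; apply: eq_fsum => n.
by rewrite -iterSr.
Qed.

(** Skew-symmetry turns the left side into a double sum over n and k in which D^k moves, with sign
    (-1)^k, onto f^(n) g. For fixed N = n + k the sum over n is [lder_skew]. *)
Lemma brb_antisym a f b g : brb a f b g = - brb b g a f.
Proof.
have [m hm] := vprod_trunc hL b a.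
pose G n k := ((-1) ^+ n / (n`!%:R * k`!%:R)) *: r (vprod b (n + k) a) (iter k lder (f^{(n)} * g)).
have -> : brb a f b g = - \sum_(n \in [set: nat]) \sum_(k \in [set: nat]) G n k.
  rewrite /brb [RHS]fsumN; last first.
    exists (iota 0 m) => n; rewrite mem_iota /= add0n -leqNgt => mn.
    apply: fsum0 => k; rewrite /G hm ?r0l ?scaler0 //; exact: leq_trans mn (leq_addr _ _).
  apply: eq_fsum => n; rewrite (vprod_skew hL) (linN (r_linl _)) scalerN; congr (- _).
  rewrite (lin_fsum (r_linl _)); last exact: vprod_skew_fins.
  rewrite scaler_fsum; last exact: (@fins_map _ _ _ (fun x => r x (f^{(n)} * g)) _ (r0l _) (vprod_skew_fins hL a n b)).
  apply: eq_fsum => k; rewrite (linZ (r_linl _)) r_iterD !scalerA /G; congr (_ *: _).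
  rewrite exprD invfM -!mulrA mulrCA; congr (_ * (_ * _)).
  by rewrite mulrCA -exprMn mulrNN mul1r expr1n mulr1.
congr (- _); rewrite [LHS](fsum_diag (B := m)); last first.
  by move=> n k nk; rewrite /G hm // r0l scaler0.
apply: eq_fsum => N; rewrite mulrC -lder_skew (lin_sum _ _ _ (r_linr _)) scaler_sumr.
apply: eq_bigr => n _; have nN : (n <= N)%N by rewrite -ltnS.
rewrite /G (linZ (r_linr _)) scalerA subnKC //.
congr (_ *: _); rewrite mulrCA; congr (_ * _).
by rewrite invf_bin // invfM.
Qed.

Lemma fins_box2 (G : nat -> nat -> W) :
  (exists B, forall m n, (B <= m)%N || (B <= n)%N -> G m n = 0) ->
  exists s : seq nat, (forall m n, m \notin s -> G m n = 0) /\ (forall m n, n \notin s -> G m n = 0).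
Proof.
move=> [B hB]; exists (iota 0 B).
by split=> m n; rewrite mem_iota /= add0n -leqNgt => h; rewrite hB // h ?orbT.
Qed.

(** On the left the commutator axiom produces (a_(k) b)_(m+n-k) c, on the right the Leibniz rule
    expands the derivatives of f^(k) g. Both sides are the same sum over triples with weights 1/(k!
    i! n!). *)
Lemma brb_jacobi a f b g c h :
  (\sum_(n \in [set: nat]) (n`!%:R)^-1 *: brb a f (vprod b n c) (g^{(n)} * h))
  - (\sum_(n \in [set: nat]) (n`!%:R)^-1 *: brb b g (vprod a n c) (f^{(n)} * h))
  = \sum_(n \in [set: nat]) (n`!%:R)^-1 *: brb (vprod a n b) (f^{(n)} * g) c h.
Proof.
have [N1 hN1] := vprod_trunc hL b c; have [N2 hN2] := vprod_trunc hL a c.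
have [N3 hN3] := vprod_trunc hL a b.
pose cf (m n : nat) : K := (m`!%:R)^-1 * (n`!%:R)^-1.
pose F1 m n := cf m n *: r (vprod a m (vprod b n c)) (f^{(m)} * g^{(n)} * h).
pose F2 m n := cf m n *: r (vprod b n (vprod a m c)) (f^{(m)} * g^{(n)} * h).
have [B1 hB1] : exists B, forall m n, (B <= m)%N || (B <= n)%N -> F1 m n = 0.
  apply: fins_box; first by exists N1 => m n /hN1 h0; rewrite /F1 h0 vprod0r // r0l scaler0.
  move=> n; have [M hM] := vprod_trunc hL a (vprod b n c); exists M => m /hM h0.
  by rewrite /F1 h0 r0l scaler0.
have [B2 hB2] : exists B, forall m n, (B <= m)%N || (B <= n)%N -> F2 m n = 0.
  have [B hB] : exists B, forall n m, (B <= n)%N || (B <= m)%N -> F2 m n = 0.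
    apply: fins_box; first by exists N2 => m n /hN2 h0; rewrite /F2 h0 vprod0r // r0l scaler0.
    move=> n; have [M hM] := vprod_trunc hL b (vprod a n c); exists M => m /hM h0.
    by rewrite /F2 h0 r0l scaler0.
  by exists B => m n; rewrite orbC; exact: hB.
have -> : \sum_(n \in [set: nat]) (n`!%:R)^-1 *: brb a f (vprod b n c) (g^{(n)} * h)
   = \sum_(m \in [set: nat]) \sum_(n \in [set: nat]) F1 m n.
  have [s [h1 h2]] := fins_box2 (ex_intro _ B1 hB1).
  rewrite [RHS](exchange_fsum h1 h2); apply: eq_fsum => n.
  rewrite /brb scaler_fsum; last exact: brb_fins0.
  by apply: eq_fsum => m; rewrite scalerA /F1 mulrA mulrC.
have -> : \sum_(n \in [set: nat]) (n`!%:R)^-1 *: brb b g (vprod a n c) (f^{(n)} * h)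
   = \sum_(m \in [set: nat]) \sum_(n \in [set: nat]) F2 m n.
  apply: eq_fsum => m; rewrite /brb scaler_fsum; last exact: brb_fins0.
  by apply: eq_fsum => n; rewrite scalerA /F2 mulrA [f^{(m)} * _]mulrC.
pose X k q m n := r (vprod (vprod a k b) q c) (f^{(m)} * g^{(n)} * h).
pose ct (k i n : nat) : K := (k`!%:R)^-1 * (i`!%:R)^-1 * (n`!%:R)^-1.
pose Y k i n := ct k i n *: X k (i + n)%N (k + i)%N n.
have [Q hQ] : exists Q, forall k q, (Q <= k)%N || (Q <= q)%N -> vprod (vprod a k b) q c = 0.
  have [Q hQ] : exists B, forall q k, (B <= q)%N || (B <= k)%N -> vprod (vprod a k b) q c = 0.
    apply: fins_box; first by exists N3 => m n /hN3 h0; rewrite h0 vprod0l.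
    by move=> n; have [M hM] := vprod_trunc hL (vprod a n b) c; exists M.
  by exists Q => k q; rewrite orbC; exact: hQ.
have Y0 k i n : (Q <= k)%N || (Q <= i + n)%N -> Y k i n = 0.
  by move=> h0; rewrite /Y /X hQ // r0l scaler0.
(* The common value, with i = m - k on the left and with i the number of further derivatives falling
   on f^(k) on the right. *)
transitivity (\sum_(n \in [set: nat]) \sum_(k \in [set: nat]) \sum_(i \in [set: nat]) Y k i n).
  rewrite fsumN; last by exists (iota 0 B2) => m; rewrite mem_iota /= add0n -leqNgt => Bm;
    apply: fsum0 => n; rewrite hB2 // Bm.
  rewrite -fsumD; last 2 first.
  - by exists (iota 0 B1) => m; rewrite mem_iota /= add0n -leqNgt => Bm; apply: fsum0 => n; rewrite hB1 // Bm.
  - by apply: finsN; exists (iota 0 B2) => m; rewrite mem_iota /= add0n -leqNgt => Bm; apply: fsum0 => n; rewrite hB2 // Bm.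
  transitivity (\sum_(m \in [set: nat]) \sum_(n \in [set: nat]) (F1 m n - F2 m n)).
    apply: eq_fsum => m; rewrite fsumN; last by exists (iota 0 B2) => n; rewrite mem_iota /= add0n -leqNgt => Bm; rewrite hB2 // Bm orbT.
    rewrite fsumD //.
    - by exists (iota 0 B1) => n; rewrite mem_iota /= add0n -leqNgt => Bm; rewrite hB1 // Bm orbT.
    - by apply: finsN; exists (iota 0 B2) => n; rewrite mem_iota /= add0n -leqNgt => Bm; rewrite hB2 // Bm orbT.
  have [s [h1 h2]] : exists s : seq nat, (forall m n, m \notin s -> F1 m n - F2 m n = 0) /\ (forall m n, n \notin s -> F1 m n - F2 m n = 0).
    apply: fins_box2; exists (maxn B1 B2) => m n h0; rewrite hB1 ?hB2 ?subr0 //.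
      by move: h0; rewrite !geq_max => /orP[/andP[_ ->]|/andP[_ ->]]; rewrite ?orbT.
    by move: h0; rewrite !geq_max => /orP[/andP[-> _]|/andP[-> _]]; rewrite ?orbT.
  rewrite (exchange_fsum h1 h2); apply: eq_fsum => n.
  rewrite [RHS](fsum_diag (B := Q + Q)); last first.
    move=> k i ki; apply: Y0; case: (leqP Q k) => //= kQ; lia.
  apply: eq_fsum => m; rewrite /F1 /F2 -scalerBr -(linB (r_linl _)) (vprod_comm hL).
  rewrite (lin_sum _ _ _ (r_linl _)) scaler_sumr; apply: eq_bigr => k _.
  have km : (k <= m)%N by rewrite -ltnS.
  rewrite (linZ (r_linl _)) scalerA /Y /X subnKC //.
  have -> : (m + n - k = m - k + n)%N by lia.
  congr (_ *: _); rewrite /cf /ct mulrAC; congr (_ * _).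
  rewrite -(bin_fact km) !natrM invfM mulrC mulrA divff ?mul1r ?invfM //.
  by rewrite pnatr_eq0 -lt0n bin_gt0.
rewrite (exchange_fsum (r := iota 0 Q) (s := iota 0 Q)); last 2 first.
- move=> n k; rewrite mem_iota /= add0n -leqNgt => Qn; apply: fsum0 => i; apply: Y0.
  by rewrite (leq_trans Qn (leq_addl _ _)) orbT.
- by move=> n k; rewrite mem_iota /= add0n -leqNgt => Qk; apply: fsum0 => i; apply: Y0; rewrite Qk.
apply: eq_fsum => k.
rewrite (exchange_fsum (r := iota 0 Q) (s := iota 0 Q)); last 2 first.
- move=> n i; rewrite mem_iota /= add0n -leqNgt => Qn; apply: Y0.
  by rewrite (leq_trans Qn (leq_addl _ _)) orbT.
- move=> n i; rewrite mem_iota /= add0n -leqNgt => Qn; apply: Y0.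
  by rewrite (leq_trans Qn (leq_addr _ _)) orbT.
rewrite (fsum_diag (B := Q)); last by move=> i n h0; apply: Y0; rewrite h0 orbT.
rewrite /brb scaler_fsum; last exact: brb_fins0.
apply: eq_fsum => q; rewrite iter_lderM mulr_suml (lin_sum _ _ _ (r_linr _)) !scaler_sumr.
apply: eq_bigr => i _; have iq : (i <= q)%N by rewrite -ltnS.
rewrite lscalerAl (linZ (r_linr _)) !scalerA /Y /X subnKC // -iterD [(i + k)%N]addnC.
congr (_ *: _); rewrite /ct -!mulrA; congr (_ * _).
by rewrite invf_bin.
Qed.

End BracketFormula.

Section LoopBracket.
Context {K : numFieldType} {L : vla K} (hL : vertex_lie_algebra L).
Implicit Types (a b c : L) (f g h : laurent K).

Definition lrho : L -> laurent K -> loop L := locked (@rho K L (laurent_dalg K)).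

Lemma lrhoE a f : lrho a f = @rho K L (laurent_dalg K) a f.
Proof. by rewrite /lrho -lock. Qed.
Lemma lrho_linl f : linear (fun a => lrho a f).
Proof. rewrite /lrho -lock; exact: rho_linl. Qed.
Lemma lrho_linr a : linear (lrho a).
Proof. rewrite /lrho -lock; exact: (@rho_linr _ _ (laurent_dalg K)). Qed.
Lemma lrho_D a f : lrho (vD a) f = - lrho a (lder f).
Proof. rewrite /lrho -lock; exact: rho_D. Qed.
Lemma modeE a n : mode a n = lrho a (lmono n).
Proof. by rewrite lrhoE. Qed.

Lemma loop_ind (P : loop L -> Prop) : subspace P -> (forall a f, P (lrho a f)) -> forall x, P x.
Proof. by rewrite /lrho -lock; apply: lie_ind. Qed.

Lemma loop_eq_lin (W : lmodType K) (f g : loop L -> W) : linear f -> linear g ->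
  (forall a h, f (lrho a h) = g (lrho a h)) -> f =1 g.
Proof. by rewrite /lrho -lock; apply: lie_eq_lin. Qed.

Definition lbrb := brb lrho.

Lemma lbrb_bil_inner a f : liebil (lbrb a f : L -> laurent_dalg K -> loop L).
Proof.
split; first split.
- move=> g; exact: (brb_linb hL lrho_linl).
- move=> b; exact: (brb_ling hL lrho_linl lrho_linr).
move=> b g; exact: (brb_Dinner hL lrho_linl lrho_linr lrho_D).
Qed.

Definition lbr : loop L -> loop L -> loop L := locked (@lie_br _ L (laurent_dalg K)).

Definition lbrb1 y a f : loop L := lie_lift (lbrb a f : L -> laurent_dalg K -> loop L) y.

Lemma lbrb1_lin a f : linear (fun y => lbrb1 y a f).
Proof. exact: (lie_lift_linear (lbrb_bil_inner a f)). Qed.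

Lemma lbrb1E b g a f : lbrb1 (lrho b g) a f = lbrb a f b g.
Proof. rewrite [lrho b g]lrhoE; exact: (lie_liftE _ _ (lbrb_bil_inner a f)). Qed.

Lemma lbrb1_bil y : liebil (lbrb1 y : L -> laurent_dalg K -> loop L).
Proof.
split; first split.
- move=> f k a a'; move: y; apply: loop_eq_lin; first exact: lbrb1_lin.
    by apply: lin_add; [apply: lin_scale|]; exact: lbrb1_lin.
  move=> b g; rewrite !lbrb1E; exact: (brb_lina hL lrho_linl).
- move=> a k f f'; move: y; apply: loop_eq_lin; first exact: lbrb1_lin.
    by apply: lin_add; [apply: lin_scale|]; exact: lbrb1_lin.
  move=> b g; rewrite !lbrb1E; exact: (brb_linf hL lrho_linl lrho_linr).
move=> a f; move: y; apply: loop_eq_lin.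
- by apply: lin_add; exact: lbrb1_lin.
- exact: lin_cst0.
move=> b g; rewrite (lbrb1E b g (vD a) f) (lbrb1E b g a (lder f)).
exact: (brb_Douter hL lrho_linl).
Qed.

Lemma lbr_def x y : lbr x y = lie_lift (lbrb1 y : L -> laurent_dalg K -> loop L) x.
Proof.
have E : (fun (a : L) (f : laurent_dalg K) => lie_lift (fun (b : L) (g : laurent_dalg K) => \sum_(n \in [set: nat])
      (n`!%:R)^-1 *: @rho K L (laurent_dalg K) (vprod a n b)
        (dmul (iter n (@dder _ (laurent_dalg K)) f) g)) y)
    = (lbrb1 y : L -> laurent_dalg K -> loop L).
  by apply/funext => a; apply/funext => f; rewrite /lbrb1 /lbrb /brb /lrho -lock.
by rewrite -E /lbr -lock.
Qed.

Lemma lbr_rho_l a f y : lbr (lrho a f) y = lbrb1 y a f.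
Proof. rewrite lbr_def lrhoE; exact: (lie_liftE _ _ (lbrb1_bil y)). Qed.

Lemma lbrE a f b g : lbr (lrho a f) (lrho b g) = lbrb a f b g.
Proof. by rewrite lbr_rho_l lbrb1E. Qed.

Lemma lbr_linl y : linear (fun x => lbr x y).
Proof.
have h := lie_lift_linear (lbrb1_bil y); move=> k u v; rewrite !lbr_def; exact: h.
Qed.

Lemma lbr_linr x : linear (lbr x).
Proof.
move=> k u v; move: x; apply: loop_eq_lin; first exact: lbr_linl.
  by apply: lin_add; [apply: lin_scale|]; exact: lbr_linl.
move=> a f; rewrite !lbr_rho_l; exact: lbrb1_lin.
Qed.

Lemma lbr_antisym x y : lbr x y = - lbr y x.
Proof.
move: x; apply: loop_eq_lin; [exact: lbr_linl | by apply: lin_opp; exact: lbr_linr|].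
move=> a f; move: y; apply: loop_eq_lin; [exact: lbr_linr | by apply: lin_opp; exact: lbr_linl|].
move=> b g; rewrite (lbrE a f b g) (lbrE b g a f); exact: (brb_antisym hL lrho_linl lrho_linr lrho_D).
Qed.

Lemma lbr_jacobi_rho a f b g c h :
  lbr (lrho a f) (lbr (lrho b g) (lrho c h)) - lbr (lrho b g) (lbr (lrho a f) (lrho c h))
  = lbr (lbr (lrho a f) (lrho b g)) (lrho c h).
Proof.
rewrite (lbrE b g c h) (lbrE a f c h) (lbrE a f b g).
have fi := brb_fins0 hL lrho_linl.
have e1 a1 f1 b1 g1 c1 h1 : lbr (lrho a1 f1) (lbrb b1 g1 c1 h1) =
    \sum_(n \in [set: nat]) (n`!%:R)^-1 *: lbrb a1 f1 (vprod b1 n c1) (iter n lder g1 * h1).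
  rewrite [LHS](lin_fsum (lbr_linr _) (fi _ _ _)).
  apply: eq_fsum => n; rewrite (linZ (lbr_linr _)); congr (_ *: _); exact: lbrE.
have e2 : lbr (lbrb a f b g) (lrho c h) =
    \sum_(n \in [set: nat]) (n`!%:R)^-1 *: lbrb (vprod a n b) (iter n lder f * g) c h.
  rewrite [LHS](lin_fsum (lbr_linl _) (fi _ _ _)).
  apply: eq_fsum => n; rewrite (linZ (lbr_linl _)); congr (_ *: _); exact: lbrE.
rewrite (e1 a f b g c h) (e1 b g a f c h) e2; exact: (brb_jacobi hL lrho_linl lrho_linr).
Qed.

Lemma lbr_jacobi x y z : lbr x (lbr y z) - lbr y (lbr x z) = lbr (lbr x y) z.
Proof.
have lc := lin_comp; have ll := lbr_linl; have lr := lbr_linr.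
move: x; apply: loop_eq_lin; last first.
  move=> a f; move: y; apply: loop_eq_lin; last first.
    move=> b g; move: z; apply: loop_eq_lin; last by move=> c h; exact: lbr_jacobi_rho.
      apply: lin_add; first exact: (lc _ _ _ _ _ _ (lr _) (lr _)).
      apply: lin_opp; exact: (lc _ _ _ _ _ _ (lr _) (lr _)).
    exact: lr.
  - exact: (lc _ _ _ _ _ _ (ll _) (lr _)).
  - apply: lin_add; first exact: (lc _ _ _ _ _ _ (lr _) (ll _)).
    apply: lin_opp; exact: ll.
- exact: (lc _ _ _ _ _ _ (ll _) (ll _)).
- apply: lin_add; first exact: ll.
  apply: lin_opp; exact: (lc _ _ _ _ _ _ (lr _) (ll _)).
Qed.

Lemma lbr_modes a m b n : lbr (mode a m) (mode b n) =
  \sum_(k \in [set: nat]) binz m k *: mode (vprod a k b) (m + n - k%:Z).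
Proof.
rewrite !modeE lbrE; apply: eq_fsum => k.
rewrite modeE iter_lder_mono lscalerAl lmonoD (linZ (lrho_linr _)) scalerA mulKf.
  by rewrite addrAC.
by rewrite pnatr_eq0 -lt0n fact_gt0.
Qed.

End LoopBracket.

(** * Gradings and the operators R *)

Section Graded.
Context {K : numFieldType}.

(** What L and V(L) have in common: grading, translation, automorphism and central element. It
    suffices to define R_alpha and to work with Gamma-invariant global elements, so that this part
    of the argument runs once for both. *)
Record graded_vla (X : vla K) : Prop := {
  ga_sub : forall n, subspace (@vhomog _ X n);
  ga_ex : forall a : X, exists h, homog_decomp a h;
  ga_uniq : forall (a : X) h h', homog_decomp a h -> homog_decomp a h' -> h =1 h';
  ga_c : vhomog 0 (vc X);
  ga_Dlin : linear (@vD _ X);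
  ga_D : forall n (a : X), vhomog n a -> vhomog n.+1 (vD a);
  ga_Dc : vD (vc X) = 0;
  ga_slin : linear (@vsigma _ X);
  ga_shom : forall n (a : X), vhomog n a -> vhomog n (vsigma a);
  ga_sD : forall a : X, vsigma (vD a) = vD (vsigma a);
  ga_sc : vsigma (vc X) = vc X }.

Section Theory.
Context {X : vla K} (hX : graded_vla X).
Implicit Types (a b : X) (z : K).

Lemma homog0 n : vhomog n (0 : X). Proof. by case: (ga_sub hX n). Qed.

Lemma vcompP a : homog_decomp a (vcomp a).
Proof. exact: (@xgetPex _ (fun=> 0) (homog_decomp a) (ga_ex hX a)). Qed.

Lemma vcomp_homog a n : vhomog n (vcomp a n). Proof. by case: (vcompP a). Qed.

Lemma vcomp_eq a h : homog_decomp a h -> vcomp a =1 h.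
Proof. by move=> hh; apply: (ga_uniq hX) hh; exact: vcompP. Qed.

Lemma vcomp_fins a : fins (vcomp a).
Proof. by case: (vcompP a) => _ [d [hd _]]; apply: (fins_nat (b := d)). Qed.

Lemma vcomp_sum a : a = \sum_(n \in [set: nat]) vcomp a n.
Proof. by case: (vcompP a) => _ [d [hd {1}->]]; rewrite (fsum_ord hd). Qed.

Lemma homog_decompD a b h h' c : homog_decomp a h -> homog_decomp b h' ->
  homog_decomp (c *: a + b) (fun n => c *: h n + h' n).
Proof.
move=> [hh [d [hd ->]]] [hh' [e [he ->]]]; split=> [n|].
  by case: (ga_sub hX n) => _; apply.
exists (maxn d e); split=> [n|]; first by rewrite geq_max => /andP[/hd -> /he ->]; rewrite scaler0 addr0.
rewrite -(fsum_ord hd) -(fsum_ord he) scaler_fsum; last exact: (fins_nat hd).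
rewrite -fsumD; [|by apply: fins_map; [rewrite scaler0|exact: (fins_nat hd)] | exact: (fins_nat he)].
by apply: fsum_ord => n; rewrite geq_max => /andP[/hd -> /he ->]; rewrite scaler0 addr0.
Qed.

Lemma vcomp_linear n : linear (fun a => vcomp a n).
Proof. by move=> c a b; apply: (vcomp_eq (homog_decompD c (vcompP a) (vcompP b))). Qed.

Lemma homog_decomp_homog p a : vhomog p a -> homog_decomp a (fun n => if n == p then a else 0).
Proof.
move=> pa; split=> [n|]; first by case: eqP => [->|_] //; exact: homog0.
have h0 n : (p.+1 <= n)%N -> (if n == p then a else 0) = 0 by case: eqP => // ->; rewrite ltnn.
exists p.+1; split=> //; rewrite -(fsum_ord h0) (fsum_only (j := p)) ?eqxx //.
by move=> i /negbTE ->.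
Qed.

Lemma vcomp_homogE p a n : vhomog p a -> vcomp a n = if n == p then a else 0.
Proof. by move=> pa; rewrite (vcomp_eq (homog_decomp_homog pa)). Qed.

Lemma homog_ind (P : X -> Prop) : subspace P -> (forall n a, vhomog n a -> P a) -> forall a, P a.
Proof.
move=> hP h a; have [_ [d [_ ->]]] := vcompP a.
by apply: subspace_sum => // i _; apply: (h i); apply: vcomp_homog.
Qed.

Lemma homog_eq_lin (W : lmodType K) (f g : X -> W) : linear f -> linear g ->
  (forall n a, vhomog n a -> f a = g a) -> f =1 g.
Proof.
move=> fl gl h; apply: homog_ind => //; split=> [|c x y hx hy].
  by rewrite (lin0 fl) (lin0 gl).
by rewrite fl gl hx hy.
Qed.

Lemma homogZ p c a : vhomog p a -> vhomog p (c *: a).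
Proof. by move=> pa; rewrite -[_ *: _]addr0; case: (ga_sub hX p) => h0; apply. Qed.

(* The operator z^deg. *)
Definition vG z a : X := \sum_(n \in [set: nat]) z ^+ n *: vcomp a n.

Lemma vG_linear z : linear (vG z).
Proof.
apply: lin_bigfsum; first by move=> n; apply: lin_scale; exact: vcomp_linear.
by move=> a; have [r hr] := vcomp_fins a; exists r => i /hr ->; rewrite scaler0.
Qed.

Lemma vG_homog z p a : vhomog p a -> vG z a = z ^+ p *: a.
Proof.
move=> pa; rewrite /vG (fsum_only (j := p)) ?(vcomp_homogE _ pa) ?eqxx // => n /negbTE np.
by rewrite (vcomp_homogE _ pa) np scaler0.
Qed.

Lemma vsigma_iter_linear k : linear (iter k (@vsigma _ X)).
Proof. by elim: k => //= k IH; exact: lin_comp (ga_slin hX) IH. Qed.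

Lemma vRE w k a : vR w k a = iter k (@vsigma _ X) (vG (w ^+ k) a).
Proof.
have sl := vsigma_iter_linear k.
rewrite /vR /vG (lin_fsum sl); last first.
  by have [r hr] := vcomp_fins a; exists r => i /hr ->; rewrite scaler0.
by apply: eq_fsum => n; rewrite (linZ sl) exprM.
Qed.

Lemma vR_linear w k : linear (@vR _ X w k).
Proof.
move=> c a b; rewrite !vRE.
exact: (lin_comp (vsigma_iter_linear k) (vG_linear _)).
Qed.

Lemma vsigma_iter_homog p k a : vhomog p a -> vhomog p (iter k (@vsigma _ X) a).
Proof. by move=> pa; elim: k => //= k; exact: (ga_shom hX). Qed.

Lemma vR_homogE w k p a : vhomog p a -> vR w k a = w ^+ (k * p) *: iter k (@vsigma _ X) a.
Proof. by move=> pa; rewrite vRE (vG_homog _ pa) (linZ (vsigma_iter_linear k)) exprM. Qed.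

Lemma vR_homog w k p a : vhomog p a -> vhomog p (vR w k a).
Proof. by move=> pa; rewrite (vR_homogE _ _ pa); apply/homogZ/vsigma_iter_homog. Qed.

Lemma vG_D z a : vG z (vD a) = z *: vD (vG z a).
Proof.
move: a; apply: homog_eq_lin.
- exact: (lin_comp (vG_linear z) (ga_Dlin hX)).
- by apply: lin_scale; exact: (lin_comp (ga_Dlin hX) (vG_linear z)).
move=> n a na; rewrite (vG_homog _ na) (vG_homog _ (ga_D hX na)).
by rewrite (linZ (ga_Dlin hX)) scalerA exprS.
Qed.

Lemma vsigma_iter_D k a : iter k (@vsigma _ X) (vD a) = vD (iter k (@vsigma _ X) a).
Proof. by elim: k => //= k ->; rewrite (ga_sD hX). Qed.

Lemma vR_D w k a : vR w k (vD a) = w ^+ k *: vD (vR w k a).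
Proof. by rewrite !vRE vG_D (linZ (vsigma_iter_linear k)) vsigma_iter_D. Qed.

Lemma vR_comp w j k a : vR w j (vR w k a) = vR w (j + k) a.
Proof.
move: a; apply: homog_eq_lin.
- exact: (lin_comp (vR_linear _ _) (vR_linear _ _)).
- exact: vR_linear.
move=> p a pa; rewrite (vR_homogE _ _ (vR_homog w k pa)) !(vR_homogE _ _ pa).
by rewrite (linZ (vsigma_iter_linear j)) scalerA -exprD -mulnDl iterD.
Qed.

Lemma vR0 w a : vR w 0 a = a.
Proof.
move: a; apply: homog_eq_lin; [exact: vR_linear | exact: lin_id|].
by move=> p a pa; rewrite (vR_homogE _ _ pa) mul0n expr0 scale1r.
Qed.

Lemma vR_c w k : vR w k (vc X) = vc X.
Proof.
rewrite (vR_homogE _ _ (ga_c hX)) muln0 expr0 scale1r.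
by elim: k => //= k ->; rewrite (ga_sc hX).
Qed.

Lemma vR_order w T k a : w ^+ T = 1 -> (forall a : X, iter T (@vsigma _ X) a = a) ->
  vR w (k * T) a = a.
Proof.
move=> wT sT; have h b : vR w T b = b.
  move: b; apply: homog_eq_lin; [exact: vR_linear | exact: lin_id|].
  by move=> p b pb; rewrite (vR_homogE _ _ pb) exprM wT expr1n scale1r sT.
elim: k a => [|k IH] a; first by rewrite mul0n vR0.
by rewrite mulSn -vR_comp IH h.
Qed.

(* Iterating the decomposition of a graded complement; it stops since D raises degrees. *)
Lemma complement_span (S : set X) : vla_complement S -> vla_graded S -> forall a,
  lspan ([set x | exists k s, S s /\ x = iter k (@vD _ X) s] `|` [set vc X]) a.
Proof.
move=> hS gS; set U := _ `|` _.
have UD x : lspan U x -> lspan U (vD x).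
  apply: (lspan_lin (ga_Dlin hX)) => y [[k [s [Ss ->]]]|->].
    by apply: lspan_incl; left; exists k.+1, s.
  by rewrite (ga_Dc hX); exact: lspan0.
apply: homog_ind; first exact: lspan_subspace.
elim/ltn_ind => n IH a na.
have [s [l [b [Ss e]]]] := compl_sum hS a.
have [h [hh Sh]] := gS _ Ss.
have -> : a = h n + (l *: vcomp (vc X) n + (if n is m.+1 then vD (vcomp b m) else 0)).
  rewrite -[LHS](_ : vcomp a n = a); last by rewrite (vcomp_homogE _ na) eqxx.
  rewrite e -addrA (linD (vcomp_linear n)) (vcomp_eq hh); congr (_ + _).
  rewrite vcomp_linear; congr (_ + _).
  rewrite {1}(vcomp_sum b) (lin_fsum (ga_Dlin hX) (vcomp_fins b)).
  rewrite (lin_fsum (vcomp_linear n)); last by apply: fins_map; [exact: (lin0 (ga_Dlin hX)) | exact: vcomp_fins].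
  have E m : vcomp (vD (vcomp b m)) n = if n == m.+1 then vD (vcomp b m) else 0.
    by rewrite (vcomp_homogE _ (ga_D hX (vcomp_homog b m))).
  under eq_fsum do rewrite E.
  case: n {IH na E} => [|n]; first by rewrite fsum0.
  rewrite (fsum_only (j := n)) ?eqxx // => i /negbTE ni.
  by rewrite eqSS eq_sym ni.
apply: lspanD.
  by apply: lspan_incl; left; exists 0%N, (h n).
apply: lspanD.
  apply: lspanZ; rewrite (vcomp_homogE _ (ga_c hX)); case: eqP => _; last exact: lspan0.
  by apply: lspan_incl; right.
case: n IH {na} => [|n] IH; first exact: lspan0.
by apply/UD/(IH n) => //; exact: vcomp_homog.
Qed.

End Theory.

Lemma vla_graded_vla (L : vla K) T : vertex_lie_algebra L -> vla_automorphism L T -> graded_vla L.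
Proof.
move=> hL hS; split; [exact: (vhomog_subspace hL) | exact: (homog_decomp_ex hL) |
  exact: (homog_decomp_uniq hL) | exact: (vhomog_c hL) | exact: (vD_linear hL) |
  exact: (vhomog_D hL) | exact: vD_c | exact: (vsigma_linear hS) | exact: (vsigma_homog hS) |
  exact: (vsigma_D hS) | exact: (vsigma_c hS)].
Qed.

End Graded.

Section TwistedAutomorphism.
Context {K : numFieldType} {L : vla K} (hL : vertex_lie_algebra L).
Implicit Types (a b : L) (f g : laurent K) (z : K).

(* theta scales degrees by z: examples are R_alpha (z = alpha), sigma (z = 1) and z^deg. *)
Record zaut z (theta : L -> L) : Prop := {
  zaut_neq0 : z != 0;
  zaut_lin : linear theta;
  zaut_D : forall a, theta (vD a) = z *: vD (theta a);
  zaut_prod : forall a n b, z ^+ n.+1 *: theta (vprod a n b) = vprod (theta a) n (theta b);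
  zaut_c : theta (vc L) = vc L }.

(** The automorphism a (x) f(t) -> z^(-1) theta(a) (x) f(t/z) of the loop algebra. For z = w^k and
    theta = R_(w^k) it is the action of w^k in Gamma, by [gactE]. *)
Definition LA z (theta : L -> L) : loop L -> loop L :=
  locked (lie_lift (fun a (f : laurent_dalg K) =>
    z^-1 *: @rho K L (laurent_dalg K) (theta a) (dsub z^-1 f))).

Section LA.
Context z theta (ht : zaut z theta).

Lemma LA_bil : liebil (fun a (f : laurent_dalg K) =>
    z^-1 *: @rho K L (laurent_dalg K) (theta a) (dsub z^-1 f)).
Proof.
have tl := zaut_lin ht.
split; first split.
- move=> f; apply: lin_scale; exact: (lin_comp (rho_linl _) tl).
- move=> a; apply: lin_scale.
  exact: (lin_comp (@rho_linr _ _ (laurent_dalg K) _) (@lsub_linear K z^-1)).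
move=> a f; rewrite -scalerDr (zaut_D ht) (linZ (rho_linl _)) (rho_D (theta a)) /=.
rewrite (lsub_der _ (invr_neq0 (zaut_neq0 ht))) invrK.
by rewrite (linZ (@rho_linr _ _ (laurent_dalg K) _)) scalerN addNr scaler0.
Qed.

Lemma LA_linear : linear (LA z theta).
Proof. rewrite /LA -lock; exact: lie_lift_linear LA_bil. Qed.

Lemma LA_rho a f : LA z theta (lrho a f) = z^-1 *: lrho (theta a) (lsub z^-1 f).
Proof. rewrite /LA -lock !lrhoE; exact: (lie_liftE _ _ LA_bil). Qed.

Lemma LA_mode a n : LA z theta (mode a n) = z ^ (- n - 1) *: mode (theta a) n.
Proof.
rewrite !modeE LA_rho lsub_mono (linZ (lrho_linr _)) scalerA; congr (_ *: _).
rewrite exprz_inv -[z^-1]exprN1 -expfzDr ?(zaut_neq0 ht) //; congr (_ ^ _); lia.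
Qed.

(** The powers of z balance term by term: z^(-1) from the map and z^n from differentiating f(t/z) on
    the left, z^(-2) from the two arguments and z^(n+1) from theta(a)_(n) theta(b) on the right. *)
Lemma LA_hom x y : LA z theta (lbr x y) = lbr (LA z theta x) (LA z theta y).
Proof.
have Ll := LA_linear; have z0 := zaut_neq0 ht.
move: x; apply: loop_eq_lin; [exact: lin_comp Ll (lbr_linl hL _) | exact: lin_comp (lbr_linl hL _) Ll|].
move=> a f; move: y; apply: loop_eq_lin; [exact: lin_comp Ll (lbr_linr hL _) | exact: lin_comp (lbr_linr hL _) Ll|].
move=> b g; rewrite (LA_rho a f) (LA_rho b g) (linZ (lbr_linl hL _)) (linZ (lbr_linr hL _)).
rewrite (lbrE hL a f b g) (lbrE hL (theta a)).
have fi := brb_fins0 hL lrho_linl.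
rewrite [LHS](lin_fsum Ll (fi _ _ _)) [X in _ = _ *: (_ *: X)]/lbrb /brb scaler_fsum; last exact: fi.
rewrite scaler_fsum; last by apply: fins_map; [rewrite scaler0 | exact: fi].
apply: eq_fsum => n; rewrite (linZ Ll) LA_rho (lsubM _ _ (invr_neq0 z0)).
have -> : lsub z^-1 (iter n lder f) = z ^+ n *: iter n lder (lsub z^-1 f).
  elim: n => [|n IH]; first by rewrite scale1r.
  by rewrite !iterS (lsub_der _ (invr_neq0 z0)) invrK IH (linZ lder_linear) scalerA exprS.
rewrite lscalerAl (linZ (lrho_linr _)) -(zaut_prod ht) (linZ (lrho_linl _)) !scalerA.
congr (_ *: _); rewrite exprS.
have : n`!%:R != 0 :> K by rewrite pnatr_eq0 -lt0n fact_gt0.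
by move: (n`!%:R) => c c0; field; rewrite c0 z0.
Qed.

End LA.

Lemma zaut_vG (hX : graded_vla L) z : z != 0 -> zaut z (@vG _ L z).
Proof.
move=> z0; split=> //; [exact: vG_linear | exact: vG_D | | by rewrite (vG_homog _ _ (ga_c hX)) // expr0 scale1r].
move=> a n b; move: a; apply: (homog_eq_lin hX).
- by apply: lin_scale; exact: lin_comp (vG_linear hX z) (vprod_linearl hL n b).
- exact: lin_comp (vprod_linearl hL n _) (vG_linear hX z).
move=> p a pa; move: b; apply: (homog_eq_lin hX).
- by apply: lin_scale; exact: lin_comp (vG_linear hX z) (vprod_linearr hL a n).
- exact: lin_comp (vprod_linearr hL _ n) (vG_linear hX z).
move=> q b qb; rewrite (vG_homog hX z pa) (vG_homog hX z qb).
rewrite (linZ (vprod_linearl hL n _)) (linZ (vprod_linearr hL a n)) scalerA -exprD.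
case: (ltnP (p + q) n.+1) => h.
  by rewrite (vhomog_prod0 hL pa qb h) (lin0 (vG_linear hX z)) !scaler0.
have e : (p + q = (p + q - n.+1) + n.+1)%N by rewrite subnK.
by rewrite (vG_homog hX z (vhomog_prod hL pa qb e)) scalerA -exprD addnC -e.
Qed.

Lemma zaut_sigma T : vla_automorphism L T -> zaut 1 (@vsigma _ L).
Proof.
move=> hS; split; [exact: oner_neq0 | exact: (vsigma_linear hS) | | | exact: (vsigma_c hS)].
- by move=> a; rewrite scale1r (vsigma_D hS).
- by move=> a n b; rewrite expr1n scale1r (vsigma_prod hS).
Qed.

Lemma zaut_comp z z' t t' : zaut z t -> zaut z' t' -> zaut (z * z') (t \o t').
Proof.
move=> h h'; have tl := zaut_lin h; split=> [| | a|a n b|] /=.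
- by rewrite mulf_neq0 ?(zaut_neq0 h) ?(zaut_neq0 h').
- exact: (lin_comp tl (zaut_lin h')).
- by rewrite (zaut_D h') (linZ tl) (zaut_D h) scalerA mulrC.
- by rewrite exprMn -scalerA -(linZ tl) (zaut_prod h') (zaut_prod h).
- by rewrite (zaut_c h') (zaut_c h).
Qed.

Lemma zaut_vR T w k : vla_automorphism L T -> w != 0 -> zaut (w ^+ k) (@vR _ L w k).
Proof.
move=> hS w0; have hX := vla_graded_vla hL hS.
have hi : zaut 1 (iter k (@vsigma _ L)).
  elim: k => [|k IH]; last by have := zaut_comp (zaut_sigma hS) IH; rewrite mulr1.
  split=> //; first exact: oner_neq0; first by move=> a; rewrite scale1r.
  by move=> a n b; rewrite expr1n scale1r.
have := zaut_comp hi (zaut_vG hX (expf_neq0 k w0)); rewrite mul1r.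
by congr zaut; apply/funext => a; rewrite (vRE hX).
Qed.

Lemma gactE w k x : gact w k x = LA (w ^+ k) (@vR _ L w k) x.
Proof. by rewrite /LA -lock. Qed.

End TwistedAutomorphism.

(** * The vacuum module *)

Section VacuumModule.
Context {K : numFieldType} {L : vla K} (hL : vertex_lie_algebra L).
Implicit Types (a b : L) (f g : laurent K) (x y : loop L).

(** The interface through which V(L) is used: [vm_ind] stands for the spanning by words and
    [vm_univ] for the universal property of the induced module. The target in [vm_univ] has to be a
    module only on the subspace [good], because the local fields to which it is applied form a
    subspace of all sequences of maps. *)
Record vacuum_module (V : lmodType K) (va : loop L -> V -> V) (v0 : V) : Prop := {
  vm_linx : forall A, linear (fun x => va x A);
  vm_linA : forall x, linear (va x);
  vm_br : forall x y A, va (lbr x y) A = va x (va y A) - va y (va x A);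
  vm_pos : forall a f, ordge f 0 -> va (lrho a f) v0 = 0;
  vm_c : va (mode (vc L) (-1)) v0 = v0;
  vm_ind : forall P : V -> Prop, subspace P -> P v0 ->
    (forall x A, P A -> P (va x A)) -> forall A, P A;
  vm_univ : forall (W : lmodType K) (op : loop L -> W -> W) (w0 : W) (good : W -> Prop),
    subspace good -> good w0 -> (forall x w, good w -> good (op x w)) ->
    (forall c x y w, good w -> op (c *: x + y) w = c *: op x w + op y w) ->
    (forall x c w w', good w -> good w' -> op x (c *: w + w') = c *: op x w + op x w') ->
    (forall x y w, good w -> op (lbr x y) w = op x (op y w) - op y (op x w)) ->
    (forall a f, ordge f 0 -> op (lrho a f) w0 = 0) -> op (mode (vc L) (-1)) w0 = w0 ->
    exists Phi : V -> W, [/\ linear Phi, Phi v0 = w0,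
      forall x A, Phi (va x A) = op x (Phi A) & forall A, good (Phi A)] }.

Local Notation wd := (fun u : seq (loop L) => vword (L := L) u).

Lemma free_lift_rel2 (W : lmodType K) (X : choiceType) (h : X -> W) (x y z : X) :
  free_lift h (<< x >> - << y >> - << z >>) = h x - h y - h z.
Proof. by have fl := free_lift_linear h; rewrite !(linB fl) !free_liftU. Qed.

Lemma free_lift_rel1 (W : lmodType K) (X : choiceType) (h : X -> W) c (x y : X) :
  free_lift h (<< x >> - c *: << y >>) = h x - c *: h y.
Proof. by have fl := free_lift_linear h; rewrite (linB fl) (linZ fl) !free_liftU. Qed.

Lemma lbr_lie_br : lbr = @lie_br _ L (laurent_dalg K).
Proof. by rewrite /lbr -lock. Qed.

Lemma qpi_rel (V : lmodType K) (S : set V) r : S r -> qpi S r = 0.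
Proof. by move=> h; apply/qpi0/lspan_incl. Qed.

Lemma vword_lin u v c x y :
  vword (u ++ (c *: x + y) :: v) = c *: vword (u ++ x :: v) + vword (u ++ y :: v).
Proof.
apply/eqP; rewrite -subr_eq0; apply/eqP; have ql := @qpi_linear _ _ (@vac_rels K L).
rewrite /vword -ql -(linB ql) opprD addrA; apply: qpi_rel.
by left; left; exists u, v, c, x, y.
Qed.

Lemma vword_br u v x y :
  vword (u ++ [:: x, y & v]) = vword (u ++ [:: y, x & v]) + vword (u ++ lbr x y :: v).
Proof.
apply/eqP; rewrite -subr_eq0; apply/eqP; have ql := @qpi_linear _ _ (@vac_rels K L).
rewrite -[vword (u ++ [:: y, x & v])]scale1r /vword -ql -(linB ql) scale1r opprD addrA; apply: qpi_rel.
by left; right; exists u, v, x, y; rewrite lbr_lie_br.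
Qed.

Lemma vword_char u x c : vac_char (x, c) -> vword (rcons u x) = c *: vword u.
Proof.
move=> h; apply/eqP; rewrite -subr_eq0; apply/eqP; have ql := @qpi_linear _ _ (@vac_rels K L).
rewrite /vword -(linZ ql) -(linB ql); apply: qpi_rel.
by right; exists u, x, c.
Qed.

Lemma vact_rels x r : vac_rels r -> free_lift (fun u => vword (x :: u)) r = 0.
Proof.
case=> [[[u [v [c [y [z ->]]]]]|[u [v [y [z ->]]]]]|[u [y [c [h ->]]]]].
- by rewrite free_lift_rel -!cat_cons vword_lin -addrA -opprD subrr.
- by rewrite free_lift_rel2 -!cat_cons -lbr_lie_br vword_br -addrA -opprD subrr.
- by rewrite free_lift_rel1 -rcons_cons (vword_char _ h) subrr.
Qed.

Lemma vact_word x u : vact x (vword u) = vword (x :: u).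
Proof. by rewrite /vact /vword quot_liftU //; exact: vact_rels. Qed.

Lemma vact_lin x : linear (vact x : vacm L -> vacm L).
Proof. by apply: quot_lift_linear; exact: vact_rels. Qed.

Lemma vacm_span (A : vacm L) : lspan [set x | exists u, x = vword u] A.
Proof. by apply: lspan_sub (quot_malg_span A) => _ [u _ <-]; apply: lspan_incl; exists u. Qed.

Lemma vacm_univ (W : lmodType K) (op : loop L -> W -> W) (w0 : W) (good : W -> Prop) :
  subspace good -> good w0 -> (forall x w, good w -> good (op x w)) ->
  (forall c x y w, good w -> op (c *: x + y) w = c *: op x w + op y w) ->
  (forall x c w w', good w -> good w' -> op x (c *: w + w') = c *: op x w + op x w') ->
  (forall x y w, good w -> op (lbr x y) w = op x (op y w) - op y (op x w)) ->
  (forall a f, ordge f 0 -> op (lrho a f) w0 = 0) -> op (mode (vc L) (-1)) w0 = w0 ->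
  (forall r, vac_rels r -> free_lift (fun u => foldr op w0 u) r = 0) /\
  forall u, good (foldr op w0 u).
Proof.
move=> gS g0 gop olx olw obr opos oc.
have gf u w : good w -> good (foldr op w u) by elim: u => //= x u IH /IH; exact: gop.
have lf u c w w' : good w -> good w' ->
    foldr op (c *: w + w') u = c *: foldr op w u + foldr op w' u.
  elim: u => //= x u IH gw gw'; rewrite IH // olw //; exact: gf.
have gD c w w' : good w -> good w' -> good (c *: w + w') by case: gS => _; apply.
have zf u : foldr op 0 u = 0.
  have := lf u (-1) 0 0 gS.1 gS.1; rewrite scaler0 addr0 => {1}->.
  by rewrite scaleN1r addNr.
split; last by move=> u; exact: gf.
move=> r; case=> [[[u [v [c [x [y ->]]]]]|[u [v [x [y ->]]]]]|[u [x [c [h ->]]]]].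
- rewrite free_lift_rel !foldr_cat /= olx; last exact: gf.
  by rewrite lf; [rewrite -addrA -opprD subrr | exact/gop/gf ..].
- rewrite free_lift_rel2 !foldr_cat /= -lbr_lie_br.
  have gv := gf v _ g0; have -> : op x (op y (foldr op w0 v)) =
      1 *: op y (op x (foldr op w0 v)) + op (lbr x y) (foldr op w0 v).
    by rewrite scale1r obr // addrC subrK.
  by rewrite lf; [rewrite scale1r -addrA -opprD subrr | exact/gop/gop | exact: gop].
- rewrite free_lift_rel1 foldr_rcons.
  case: h => [[a [f [hf [-> ->]]]]|[-> ->]].
    rewrite -lrhoE opos ?zf ?scale0r ?subr0 // => n; exact: hf.
  by rewrite oc scale1r subrr.
Qed.

Lemma vacm_vacuum : vacuum_module (@vact _ L) (@vacuum _ L).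
Proof.
split.
- move=> A; move: A.
  move=> A c x y; apply: (lin_eq_span (f := fun A => vact (c *: x + y) A)
     (g := fun A => c *: vact x A + vact y A) _ _ _ (vacm_span A)).
  + exact: vact_lin.
  + by apply: lin_add; [apply: lin_scale|]; exact: vact_lin.
  by move=> _ [u ->]; rewrite !vact_word; exact: (vword_lin [::]).
- exact: vact_lin.
- move=> x y A; apply: (lin_eq_span (f := fun A => vact (lbr x y) A)
     (g := fun A => vact x (vact y A) - vact y (vact x A)) _ _ _ (vacm_span A)).
  + exact: vact_lin.
  + apply: lin_add; first exact: lin_comp (vact_lin _) (vact_lin _).
    by apply: lin_opp; exact: lin_comp (vact_lin _) (vact_lin _).
  move=> _ [u ->]; rewrite !vact_word; apply/eqP; rewrite eq_sym subr_eq addrC; apply/eqP.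
  exact: (vword_br [::]).
- move=> a f hf; rewrite /vacuum vact_word -[[:: _]]/(rcons [::] _) (@vword_char _ _ 0) ?scale0r //.
  by left; exists a, f; split; [exact: hf | rewrite lrhoE].
- rewrite /vacuum vact_word -[[:: _]]/(rcons [::] _) (@vword_char _ _ 1) ?scale1r //.
  by right.
- move=> P hP P0 hx A; apply: (subspace_lspan hP _ (vacm_span A)) => _ [u ->].
  elim: u => [|x u IH]; [exact: P0 | rewrite -vact_word; exact: hx].
- move=> W op w0 good h1 h2 h3 h4 h5 h6 h7 h8.
  have [hr hg] := vacm_univ h1 h2 h3 h4 h5 h6 h7 h8.
  pose Phi : vacm L -> W := quot_lift (fun u => foldr op w0 u).
  have Pl : linear Phi by apply: quot_lift_linear.
  have Pw u : Phi (vword u) = foldr op w0 u by rewrite /Phi /vword quot_liftU.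
  have Pg A : good (Phi A).
    apply: (subspace_lspan (P := fun A => good (Phi A)) _ _ (vacm_span A)).
      exact: (subspace_preim Pl h1).
    by move=> _ [u ->]; rewrite Pw.
  exists Phi; split=> //; first by rewrite /vacuum Pw.
  move=> x A; apply: (lin_eq_span (f := fun A => Phi (vact x A)) (g := fun A => op x (Phi A)) _ _ _ (vacm_span A)).
  + exact: lin_comp Pl (vact_lin _).
  + by move=> c B B'; rewrite Pl h5.
  by move=> _ [u ->]; rewrite vact_word !Pw.
Qed.

End VacuumModule.

Section LaurentSplit.
Context {K : numFieldType}.
Implicit Types (f g : laurent K).

Definition ltrunc f (d : int) : laurent K := mklaurent (fun n => if n < d then 0 else ico f n).

Lemma ico_ltrunc f d n : ico (ltrunc f d) n = if n < d then 0 else ico f n.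
Proof. by rewrite (icoE (d := d)) // => m ->. Qed.

Lemma ordge_ltrunc f d : ordge (ltrunc f d) d.
Proof. by move=> n nd; rewrite ico_ltrunc nd. Qed.

Lemma lhead_fins (V : zmodType) f d (F : int -> V) :
  (forall n, ico f n = 0 -> F n = 0) -> fins (fun n => if n < d then F n else 0).
Proof.
have [e he] := ico_bounded f => h; apply: (fins_int (a := e) (b := d)) => n nd.
  by rewrite h ?he //; case: ifP.
by rewrite ltNge nd.
Qed.

Lemma laurent_split f d :
  f = \sum_(n \in [set: int]) (if n < d then ico f n *: lmono n else 0) + ltrunc f d.
Proof.
have fF : fins (fun n => if n < d then ico f n *: lmono n else 0 : laurent K).
  by apply: (@lhead_fins _ f) => n ->; rewrite scale0r.
apply: laurentP => n; rewrite icoD ico_ltrunc (lin_fsum (ico_lin n) fF) (fsum_only (j := n)).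
  by case: ltP => _; rewrite ?icoZ ?ico_mono ?eqxx ?mulr1 ?addr0 // ico0 add0r.
by move=> i /negbTE ni; case: ifP => // _; rewrite icoZ ico_mono eq_sym ni mulr0.
Qed.

End LaurentSplit.

Section VacuumTheory.
Context {K : numFieldType} {L : vla K} (hL : vertex_lie_algebra L).
Context {V : lmodType K} {va : loop L -> V -> V} {v0 : V} (hV : vacuum_module va v0).
Implicit Types (a b : L) (f g : laurent K) (x y : loop L) (A B : V).

Lemma vm_eq_lin (W : lmodType K) (F G : V -> W) : linear F -> linear G -> F v0 = G v0 ->
  (forall x A, F A = G A -> F (va x A) = G (va x A)) -> F =1 G.
Proof.
move=> Fl Gl h0 h; apply: (vm_ind hV) => //.
by split=> [|c A B hA hB]; rewrite ?(lin0 Fl) ?(lin0 Gl) // Fl Gl hA hB.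
Qed.

Lemma va_comm x y A : va x (va y A) = va y (va x A) + va (lbr x y) A.
Proof. by rewrite (vm_br hV) addrC subrK. Qed.

Lemma vm_smooth a A : exists d : int, forall f, ordge f d -> va (lrho a f) A = 0.
Proof.
move: A a; apply: (vm_ind hV).
- split=> [a|c A B hA hB a]; first by exists 0 => f _; rewrite (lin0 (vm_linA hV _)).
  have [d hd] := hA a; have [e he] := hB a; exists (Num.max d e) => f hf.
  rewrite (vm_linA hV) hd ?he ?scaler0 ?addr0 //.
    by move=> n ne; apply: hf; rewrite lt_max ne orbT.
  by move=> n nd; apply: hf; rewrite lt_max nd.
- by move=> a; exists 0 => f; exact: (vm_pos hV).
move=> x A hA a; move: x; apply: loop_ind.
  split=> [|c x y [d hd] [e he]]; first by exists 0 => f _; rewrite (lin0 (vm_linx hV _)) (lin0 (vm_linA hV _)).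
  exists (Num.max d e) => f hf; rewrite (vm_linx hV) (vm_linA hV) hd ?he ?scaler0 ?addr0 //.
    by move=> n ne; apply: hf; rewrite lt_max ne orbT.
  by move=> n nd; apply: hf; rewrite lt_max nd.
move=> b g; have [m hm] := vprod_trunc hL a b; have [e he] := ico_bounded g.
have [d0 hd0] := hA a.
have [D hD] : exists D : int, forall k, (k < m)%N -> forall f, ordge f D -> va (lrho (vprod a k b) f) A = 0.
  elim: m {hm} => [|m [D IH]]; first by exists 0.
  have [d hd] := hA (vprod a m b); exists (Num.max D d) => k.
  rewrite ltnS leq_eqVlt => /orP[/eqP -> f hf|km f hf].
    by apply: hd => n nd; apply: hf; rewrite lt_max nd orbT.
  by apply: (IH k km) => n nd; apply: hf; rewrite lt_max nd.
exists (Num.max d0 (D + m%:Z - e)) => f hf.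
rewrite va_comm hd0 ?(lin0 (vm_linA hV _)) ?add0r; last by move=> n nd; apply: hf; rewrite lt_max nd.
rewrite (lbrE hL) (lin_fsum (vm_linx hV A)); last exact: (brb_fins0 hL lrho_linl).
apply: fsum0 => k; rewrite (linZ (vm_linx hV A)).
case: (ltnP k m) => [km|/hm ->]; last by rewrite (lin0 (lrho_linl _)) (lin0 (vm_linx hV A)) scaler0.
rewrite (hD _ km) ?scaler0 //.
have hk : ordge (iter k lder f) (D + m%:Z - e - k%:Z).
  move=> n nk; rewrite iter_lder hf ?mulr0 // lt_max; apply/orP; right; lia.
move=> n nD; apply: (ordgeM hk he); lia.
Qed.

Lemma vm_level A : va (mode (vc L) (-1)) A = A.
Proof.
apply: (vm_eq_lin (F := va (mode (vc L) (-1))) (G := id)) => //; [exact: (vm_linA hV) | exact: (vm_c hV)|].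
move=> x B hB; rewrite va_comm hB; suff -> : lbr (mode (vc L) (-1)) x = 0.
  by rewrite (lin0 (vm_linx hV _)) addr0.
rewrite modeE; move: x; apply: loop_eq_lin; [exact: lbr_linr | exact: lin_cst0|].
move=> b g; rewrite (lbrE hL); apply: fsum0 => n.
by rewrite (vprod_cl hL) (lin0 (lrho_linl _)) scaler0.
Qed.

(** For n different from -1 the function t^n is a derivative, and Dc = 0. *)
Lemma mode_c n : n != -1 -> mode (vc L) n = 0.
Proof.
move=> n1; have n0 : (n + 1)%:~R != 0 :> K by rewrite intr_eq0; apply: contraNneq n1 => h; apply/eqP; lia.
apply: (scalerI n0); rewrite scaler0 modeE -(linZ (lrho_linr _)).
have -> : (n + 1)%:~R *: lmono n = lder (lmono (n + 1)) :> laurent K by rewrite lder_mono addrK.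
by apply/eqP; rewrite -oppr_eq0 -lrho_D (vD_c hL) (lin0 (lrho_linl _)).
Qed.

Lemma mode_D a n : mode (vD a) n = - n%:~R *: mode a (n - 1).
Proof. by rewrite !modeE lrho_D lder_mono (linZ (lrho_linr _)) scaleNr. Qed.

Lemma va_modes_trunc a A : exists d : int, forall n, d <= n -> va (mode a n) A = 0.
Proof.
have [d hd] := vm_smooth a A; exists d => n dn.
rewrite modeE hd // => k kd; rewrite ico_mono; case: eqP => // kn; move: kd; rewrite kn ltNge dn.
by [].
Qed.

Lemma va_termwise a f A : va (lrho a f) A = termwise f (fun n => va (mode a n) A).
Proof.
have [d hd] := vm_smooth a A.
have hm n : d <= n -> va (mode a n) A = 0.
  move=> dn; rewrite modeE hd // => k kd; rewrite ico_mono.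
  by case: eqP => // kn; move: kd; rewrite kn ltNge dn.
rewrite {1}(laurent_split f d) (linD (lrho_linr _)) (linD (vm_linx hV A)).
rewrite (hd _ (@ordge_ltrunc K f d)) addr0.
have fF : fins (fun n => if n < d then ico f n *: lmono n else 0 : laurent K).
  by apply: (@lhead_fins K _ f) => n ->; rewrite scale0r.
have fx := lin_comp (vm_linx hV A) (lrho_linr a).
rewrite (lin_fsum fx fF); apply: eq_fsum => n; case: ltP => nd.
  by rewrite (linZ fx) modeE.
by rewrite (lin0 fx) hm // scaler0.
Qed.

Lemma mode_lin n : linear (fun a => mode a n).
Proof. by move=> c a b; rewrite !modeE; exact: lrho_linl. Qed.

(** The universal property, applied to V with the action twisted by [LA z theta]; this automorphism
    preserves regular series and fixes c(-1). *)
Lemma vm_aut z theta : zaut z theta ->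
  exists Phi : V -> V, [/\ linear Phi, Phi v0 = v0 & forall x A, Phi (va x A) = va (LA z theta x) (Phi A)].
Proof.
move=> ht; have z0 := zaut_neq0 ht.
have [] := @vm_univ _ _ _ _ _ hV V (fun x A => va (LA z theta x) A) v0 (fun _ => True) => //.
- by move=> c x y A _; rewrite (LA_linear ht) (vm_linx hV).
- by move=> x c A B _ _; rewrite (vm_linA hV).
- by move=> x y A _; rewrite (LA_hom hL ht) (vm_br hV).
- move=> a f hf; rewrite (LA_rho ht) (linZ (vm_linx hV _)) (vm_pos hV) ?scaler0 // => n n0.
  by rewrite ico_sub hf ?mulr0.
- by rewrite (LA_mode ht) opprK subrr expr0z scale1r (zaut_c ht) (vm_c hV).
by move=> Phi [h1 h2 h3 _]; exists Phi.
Qed.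

(** As Da (x) f = - a (x) f' in the quotient, this is the derivation - d/dt of the loop algebra. *)
Definition ldelta (x : loop L) : loop L :=
  locked (lie_lift (fun a (f : laurent_dalg K) => @rho K L (laurent_dalg K) (vD a) f)) x.

Lemma ldelta_bil : liebil (fun a (f : laurent_dalg K) => @rho K L (laurent_dalg K) (vD a) f).
Proof.
split; first split.
- move=> f; exact: (lin_comp (rho_linl _) (vD_linear hL)).
- move=> a; exact: (@rho_linr _ _ (laurent_dalg K)).
by move=> a f; rewrite (rho_D (vD a)) addNr.
Qed.

Lemma ldelta_linear : linear ldelta.
Proof. rewrite /ldelta -lock; exact: lie_lift_linear ldelta_bil. Qed.

Lemma ldelta_rho a f : ldelta (lrho a f) = lrho (vD a) f.
Proof. rewrite /ldelta -lock !lrhoE; exact: (lie_liftE _ _ ldelta_bil). Qed.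

Lemma ldelta_mode a n : ldelta (mode a n) = - n%:~R *: mode a (n - 1).
Proof. by rewrite modeE ldelta_rho -mode_D modeE. Qed.

Lemma ldelta_br x y : ldelta (lbr x y) = lbr (ldelta x) y + lbr x (ldelta y).
Proof.
have Ll := ldelta_linear; have ll := lbr_linl hL; have lr := lbr_linr hL.
move: x; apply: loop_eq_lin; [exact: lin_comp Ll (ll _) | by apply: lin_add; [exact: lin_comp (ll _) Ll | exact: ll]|].
move=> a f; move: y; apply: loop_eq_lin; [exact: lin_comp Ll (lr _) | by apply: lin_add; [exact: lr | exact: lin_comp (lr _) Ll]|].
move=> b g; rewrite (ldelta_rho a f) (ldelta_rho b g) (lbrE hL a f b g) (lbrE hL (vD a)) (lbrE hL a f (vD b)).
have fi := brb_fins0 hL lrho_linl.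
rewrite (lin_fsum Ll (fi _ _ _)) /lbrb /brb -fsumD; try exact: fi.
apply: eq_fsum => n; rewrite (linZ Ll) ldelta_rho -scalerDr.
rewrite (vprod_D hL) (vprod_Dr hL) (linD (lrho_linl _) (vD _)) (linN (lrho_linl _)).
by rewrite addrCA addNr addr0.
Qed.

(** A derivation is the off-diagonal entry of a homomorphism: x acts on V x V by (A, B) -> (xA,
    delta(x) A + xB), and the universal property is applied to the vector (v0, 0). *)
Lemma vm_der : exists dV : V -> V,
  [/\ linear dV, dV v0 = 0 & forall x A, dV (va x A) = va (ldelta x) A + va x (dV A)].
Proof.
pose op x (p : (V * V)%type) : (V * V)%type := (va x p.1, va (ldelta x) p.1 + va x p.2).
have lx := vm_linx hV; have lA := vm_linA hV; have Ll := ldelta_linear.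
have [] := @vm_univ _ _ _ _ _ hV (V * V)%type op (v0, 0) (fun _ => True) => //.
- move=> c x y [A B] _; apply: injective_projections; rewrite /op /= ?Ll ?lx //.
  transitivity (c *: (va (ldelta x) A + va x B) + (va (ldelta y) A + va y B)) => //.
  by rewrite scalerDr addrACA.
- move=> x c [A B] [A' B'] _ _; apply: injective_projections; rewrite /op /= ?lA //.
  transitivity (c *: (va (ldelta x) A + va x B) + (va (ldelta x) A' + va x B')) => //.
  by rewrite scalerDr addrACA.
- move=> x y [A B] _; apply: injective_projections; rewrite /op /= ?(vm_br hV) //.
  rewrite ldelta_br (linD (lx _)) !(vm_br hV).
  transitivity (va (ldelta x) (va y A) + va x (va (ldelta y) A + va y B)
    - (va (ldelta y) (va x A) + va y (va (ldelta x) A + va x B))) => //.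
  by rewrite !(linD (lA _)) !opprD (AC (2*2*2) ((1*(3*5))*(4*(2*6)))).
- by move=> a f hf; rewrite /op /= ldelta_rho !(vm_pos hV) // (lin0 (lA _)) addr0.
- have e1 : ldelta (mode (vc L) (-1)) = 0 by rewrite ldelta_mode mode_c ?scaler0.
  by rewrite /op e1 -[(v0, 0).1]/v0 -[(v0, 0).2]/(0 : V) (vm_c hV) (lin0 (lx _)) (lin0 (lA _)) addr0.
move=> Phi [h1 h2 h3 _]; have h4 A : (Phi A).1 = A.
  move: A; apply: (vm_eq_lin (G := id)) => //; [|by rewrite h2 | by move=> x A e; rewrite h3 /op /= e].
  by move=> c A B; rewrite h1.
exists (fun A => (Phi A).2); split=> [c A B| | x A]; first by rewrite h1.
  by rewrite h2.
by rewrite h3 /op /= h4.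
Qed.

Inductive neg_word (S : set L) : nat -> V -> Prop :=
| neg_word0 : neg_word S 0 v0
| neg_wordS j n a A : S a -> neg_word S j A -> neg_word S j.+1 (va (mode a (- n.+1%:Z)) A).

(** The filtration by the number of letters, with all letters in S. Only spanning statements about
    it are made, never independence of the words. *)
Definition neg_filt (S : set L) (j : nat) : set V :=
  [set A | lspan [set B | exists i, (i <= j)%N /\ neg_word S i B] A].

Definition loop_pos : set (loop L) :=
  [set x | lspan ([set y | exists a f, ordge f 0 /\ y = lrho a f] `|` [set mode (vc L) (-1)]) x].

Definition generates (S : set L) := forall a,
  lspan ([set x | exists k s, S s /\ x = iter k (@vD _ L) s] `|` [set vc L]) a.

Section Spanning.
Context (S : set L) (hS : generates S).

Lemma neg_filt_sub j : subspace (neg_filt S j). Proof. exact: lspan_subspace. Qed.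

Lemma neg_filt_le i j A : (i <= j)%N -> neg_filt S i A -> neg_filt S j A.
Proof.
move=> ij; apply: lspan_sub => B [k [ki hB]]; apply: lspan_incl; exists k.
by split=> //; exact: leq_trans ij.
Qed.

Definition neg_modes : set (loop L) := [set y | exists n a, S a /\ y = mode a (- n.+1%:Z)].

Lemma neg_filt_neg j x A : lspan neg_modes x -> neg_filt S j A -> neg_filt S j.+1 (va x A).
Proof.
move=> hx hA; apply: (subspace_lspan (P := fun x => neg_filt S j.+1 (va x A)) _ _ hx).
  exact: (subspace_preim (vm_linx hV A) (neg_filt_sub _)).
move=> _ [n [a [Sa ->]]]; apply: (lspan_lin (vm_linA hV _) _ hA) => B [i [ij hB]].
by apply: lspan_incl; exists i.+1; split=> //; exact: neg_wordS.
Qed.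

Lemma mode_neg_split n a : exists x y,
  [/\ lspan neg_modes x, loop_pos y & mode a (- n.+1%:Z) = x + y].
Proof.
apply: (subspace_lspan (P := fun a => exists x y, [/\ lspan neg_modes x, loop_pos y & mode a (- n.+1%:Z) = x + y]) _ _ (hS a)).
  split=> [|c b b' [x [y [hx hy e]]] [x' [y' [hx' hy' e']]]].
    by exists 0, 0; split; [exact: lspan0 | exact: lspan0 | rewrite addr0 (lin0 (mode_lin _))].
  exists (c *: x + x'), (c *: y + y'); split.
  - by apply: lspanD => //; exact: lspanZ.
  - by apply: lspanD => //; exact: lspanZ.
  - by rewrite mode_lin e e' scalerDr addrACA.
move=> _ [[k [s [Ss ->]]]|->].
  exists (mode (iter k (@vD _ L) s) (- n.+1%:Z)), 0; split; [|exact: lspan0 | by rewrite addr0].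
  elim: k n => [|k IH] n; first by apply: lspan_incl; exists n, s.
  rewrite iterS mode_D; apply: lspanZ.
  have -> : - n.+1%:Z - 1 = - n.+2%:Z by lia.
  exact: IH.
exists 0, (mode (vc L) (- n.+1%:Z)); split; [exact: lspan0 | | by rewrite add0r].
case: n => [|n]; first by apply: lspan_incl; right.
by rewrite mode_c ?lspan0 //; exact: lspan0.
Qed.

Lemma loop_split x : exists u v, [/\ lspan neg_modes u, loop_pos v & x = u + v].
Proof.
pose P (x : loop L) := exists u v, [/\ lspan neg_modes u, loop_pos v & x = u + v].
have hsub : subspace P.
  split=> [|c x1 x2 [u [v [hu hv ->]]] [u' [v' [hu' hv' ->]]]].
    by exists 0, 0; split; [exact: lspan0 | exact: lspan0 | rewrite addr0].
  exists (c *: u + u'), (c *: v + v'); split.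
  - by apply: lspanD => //; exact: lspanZ.
  - by apply: lspanD => //; exact: lspanZ.
  - by rewrite scalerDr addrACA.
move: x; apply: loop_ind => // a f.
have fF : fins (fun n => if n < 0 then ico f n *: lmono n else 0 : laurent K).
  by apply: (@lhead_fins K _ f) => n ->; rewrite scale0r.
rewrite (laurent_split f 0) (linD (lrho_linr _)) (lin_fsum (lrho_linr a) fF).
have hD y z : P y -> loop_pos z -> P (y + z).
  move=> [u [v [hu hv ->]]] hz; exists u, (v + z); split=> //; first exact: lspanD.
  by rewrite addrA.
apply: hD; last by apply: lspan_incl; left; exists a, (ltrunc f 0); split=> //; exact: ordge_ltrunc.
apply: (subspace_sum (P := P)) => // n _; case: ifP => n0; last by rewrite (lin0 (lrho_linr a)); case: hsub.
rewrite (linZ (lrho_linr a)) -modeE.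
have [m ->] : exists m : nat, n = - m.+1%:Z by exists (`|n|.-1)%N; lia.
have [u [v [hu hv ->]]] := mode_neg_split m a.
exists (ico f (- m.+1%:Z) *: u), (ico f (- m.+1%:Z) *: v); split; [exact: lspanZ | exact: lspanZ | by rewrite scalerDr].
Qed.

(** Moving y past the first letter leaves y on a shorter word and a commutator acting on a word with
    one letter less. An arbitrary element adds at most one letter, so the length does not grow. *)
Lemma neg_word_pos j A : neg_word S j A -> forall y, loop_pos y -> neg_filt S j (va y A).
Proof.
elim: j A => [|j IH] A hA y hy.
  apply: (subspace_lspan (P := fun y => neg_filt S 0 (va y A)) _ _ hy).
    exact: (subspace_preim (vm_linx hV A) (neg_filt_sub _)).
  inversion hA as [|]; subst=> _ [[a [f [hf ->]]]|->].
    by rewrite (vm_pos hV) //; exact: lspan0.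
  by rewrite (vm_c hV); apply: lspan_incl; exists 0%N; split=> //; exact: neg_word0.
have any B x : neg_word S j B -> neg_filt S j.+1 (va x B).
  move=> hB; have [u [v [hu hv ->]]] := loop_split x.
  rewrite (linD (vm_linx hV B)); apply: lspanD.
    by apply: neg_filt_neg => //; apply: lspan_incl; exists j.
  by apply: (neg_filt_le (leqnSn j)); exact: IH.
inversion hA as [|j' n a B Sa hB ej eA]; subst.
rewrite va_comm; apply: lspanD; last exact: any.
apply: (@neg_filt_neg j); last exact: IH.
by apply: lspan_incl; exists n, a.
Qed.

Lemma neg_filt_pos j A y : loop_pos y -> neg_filt S j A -> neg_filt S j (va y A).
Proof.
move=> hy hA; apply: (subspace_lspan (P := fun A => neg_filt S j (va y A)) _ _ hA).
  exact: (subspace_preim (vm_linA hV y) (neg_filt_sub _)).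
by move=> B [i [ij hB]]; apply: (neg_filt_le ij); exact: neg_word_pos.
Qed.

Lemma neg_filt_any j A x : neg_filt S j A -> neg_filt S j.+1 (va x A).
Proof.
move=> hA; have [u [v [hu hv ->]]] := loop_split x.
rewrite (linD (vm_linx hV A)); apply: lspanD; first exact: neg_filt_neg.
by apply: (neg_filt_le (leqnSn j)); exact: neg_filt_pos.
Qed.

Lemma neg_filt_all A : exists j, neg_filt S j A.
Proof.
move: A; apply: (vm_ind hV).
- split=> [|c A B [i hi] [j hj]]; first by exists 0%N; exact: lspan0.
  exists (maxn i j); apply: lspanD; first apply: lspanZ.
    exact: (neg_filt_le (leq_maxl _ _) hi).
  exact: (neg_filt_le (leq_maxr _ _) hj).
- by exists 0%N; apply: lspan_incl; exists 0%N; split=> //; exact: neg_word0.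
- by move=> x A [j hj]; exists j.+1; exact: neg_filt_any.
Qed.

Lemma neg_filt_mode j A a (n : nat) : neg_filt S j A -> neg_filt S j (va (mode a n%:Z) A).
Proof.
apply: neg_filt_pos; apply: lspan_incl; left; exists a, (lmono n%:Z); split; last exact: modeE.
by move=> m m0; rewrite ico_mono; case: eqP => // e; move: m0; rewrite e.
Qed.

End Spanning.

End VacuumTheory.

(** * Twisted fields *)

Section IntBoxes.
Context {V : zmodType}.

Definition fins2 (F : int -> int -> V) := exists r : seq int,
  (forall i j, i \notin r -> F i j = 0) /\ (forall i j, j \notin r -> F i j = 0).

Lemma exchange_fins2 (F : int -> int -> V) : fins2 F ->
  \sum_(i \in [set: int]) \sum_(j \in [set: int]) F i j
  = \sum_(j \in [set: int]) \sum_(i \in [set: int]) F i j.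
Proof. by move=> [r [h1 h2]]; apply: exchange_fsum h1 h2. Qed.

Lemma fins2_row (F : int -> int -> V) i : fins2 F -> fins (F i).
Proof. by move=> [r [h1 h2]]; exists r => j; exact: h2. Qed.
Lemma fins2_sum (F : int -> int -> V) : fins2 F -> fins (fun i => \sum_(j \in [set: int]) F i j).
Proof. by move=> [r [h1 h2]]; exists r => i ir; apply: fsum0 => j; exact: h1. Qed.
Lemma fins2_swap (F : int -> int -> V) : fins2 F -> fins2 (fun j i => F i j).
Proof. by move=> [r [h1 h2]]; exists r; split=> j i; [exact: h2 | exact: h1]. Qed.

Lemma fins2D (F G : int -> int -> V) : fins2 F -> fins2 G -> fins2 (fun i j => F i j + G i j).
Proof.
move=> [r [h1 h2]] [s [g1 g2]]; exists (r ++ s); split=> i j; rewrite mem_cat negb_or => /andP[a b].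
  by rewrite h1 ?g1 ?addr0.
by rewrite h2 ?g2 ?addr0.
Qed.

Lemma fins2N (F : int -> int -> V) : fins2 F -> fins2 (fun i j => - F i j).
Proof. by move=> [r [h1 h2]]; exists r; split=> i j h; [rewrite h1|rewrite h2]; rewrite ?oppr0. Qed.

Lemma fins2_cone (F : int -> int -> V) (d e E : int) : (forall i j, i < d -> F i j = 0) ->
  (forall i j, j < e -> F i j = 0) -> (forall i j, E <= i + j -> F i j = 0) -> fins2 F.
Proof.
move=> hd he hE; exists (irange d (E - e) ++ irange e (E - d)); split=> i j; rewrite mem_cat negb_or => /andP[a b].
  case: (ltP i d) => [/hd ->//|di]; case: (ltP j e) => [/he ->//|ej].
  case: (ltP i (E - e)) => [iE|iE]; first by rewrite mem_irange in a.
  by apply: hE; lia.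
case: (ltP i d) => [/hd ->//|di]; case: (ltP j e) => [/he ->//|ej].
case: (ltP j (E - d)) => [iE|iE]; first by rewrite mem_irange in b.
by apply: hE; lia.
Qed.

Lemma int_bound (P : int -> int -> Prop) (d D : int) :
  (forall i, exists J, forall j, J <= j -> P i j) ->
  exists J, forall i j, d <= i -> i < D -> J <= j -> P i j.
Proof.
move=> h; have [J hJ] : exists J : int, forall (n : nat) i j, d <= i -> i < d + `|D - d|%N%:Z -> J <= j -> P i j.
  elim: `|D - d|%N => [|n [J hJ]]; first by exists 0 => _ i j; lia.
  have [J' hJ'] := h (d + n%:Z); exists (Num.max J J') => m i j di iD; rewrite ge_max => /andP[Jj J'j].
  have [e|ne] := eqVneq i (d + n%:Z); first by rewrite e; exact: hJ'.
  by apply: (hJ m) => //; move/eqP: ne; lia.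
exists J => i j di iD; apply: (hJ 0%N) => //; lia.
Qed.

(** For an operator acting on the result of another one: the upper bound on j depends on i, but i
    runs through a bounded interval. *)
Lemma fins2_strip (F : int -> int -> V) (d D e : int) : (forall i j, i < d -> F i j = 0) ->
  (forall i j, D <= i -> F i j = 0) -> (forall i j, j < e -> F i j = 0) ->
  (forall i, exists J, forall j, J <= j -> F i j = 0) -> fins2 F.
Proof.
move=> hd hD he hJ; have [J h] := int_bound d D hJ.
exists (irange d D ++ irange e J); split=> i j; rewrite mem_cat negb_or => /andP[a b].
  case: (ltP i d) => [/hd ->//|di]; case: (ltP i D) => [iD|/hD -> //].
  by rewrite mem_irange in a.
case: (ltP i d) => [/hd ->//|di]; case: (ltP i D) => [iD|/hD -> //].
case: (ltP j e) => [/he ->//|ej]; case: (ltP j J) => [jJ|Jj]; last exact: h.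
by rewrite mem_irange in b.
Qed.

End IntBoxes.

Section TwistedFields.
Context {K : numFieldType} {L : vla K} (hL : vertex_lie_algebra L).
Context {T : nat} {w : K} (w0 : w != 0) (hX : graded_vla L).
Context {M : lmodType K}.
Implicit Types (a b : L) (m n i j : int) (v : M) (f g h : ratfun K) (p q : laurent K).
Local Notation R k := (@vR _ L w k).

(** The relations satisfied by the modes a^Gamma(n) on M_0 and, for T = 1 and w = 1, by the modes
    a(n) on an ordinary module. Both kinds of modules are treated through this record. *)
Record twisted_fields (u : L -> int -> M -> M) : Prop := {
  tw_lina : forall n v, linear (fun a => u a n v);
  tw_linv : forall a n, linear (u a n);
  tw_trunc : forall a v, exists d : int, forall n, d <= n -> u a n v = 0;
  tw_D : forall a n v, u (vD a) n v = - n%:~R *: u a (n - 1) v;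
  tw_R : forall k a n v, (k < T)%N -> u (R k a) n v = (w ^+ k) ^ (n + 1) *: u a n v;
  tw_comm : forall a m b n v, u a m (u b n v) - u b n (u a m v) =
    \sum_(k < T) \sum_(l \in [set: nat])
      (binz m l * (w ^+ k) ^ (- m - 1)) *: u (vprod (R k a) l b) (m + n - l%:Z) v;
  tw_c : forall n v, u (vc L) n v = if n == -1 then v else 0 }.

Context {u : L -> int -> M -> M} (hu : twisted_fields u).

Definition is_field (phi : int -> M -> M) :=
  (forall n, linear (phi n)) /\ forall v, exists d : int, forall n, d <= n -> phi n v = 0.

Implicit Types phi psi : int -> M -> M.

Lemma is_field_sub : subspace is_field.
Proof.
split; first by split=> [n c x y|v]; [rewrite scaler0 addr0 | exists 0].
move=> c phi psi [pl pt] [ql qt]; split=> [n|v].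
  exact: (lin_add (lin_scale c (pl n)) (ql n)).
have [d hd] := pt v; have [e he] := qt v; exists (Num.max d e) => n; rewrite ge_max => /andP[dn en].
by change (c *: phi n v + psi n v = 0); rewrite hd // he // scaler0 addr0.
Qed.

Definition opL a p phi n v : M := \sum_(i \in [set: int]) ico p i *: u a (- i) (phi (n + i) v).
Definition opR a q phi n v : M := \sum_(i \in [set: int]) ico q i *: phi (n - i) (u a i v).
(** The modes of Res_y f(y/x) (a(y) phi(x) - phi(x) a(y)). The function f(s), s = y/x, is expanded
    at infinity in the first product ([opL]) and at 0 in the second ([opR]), as if y ran around a
    large and a small circle. *)
Definition op a f phi n v : M := opL a (expinf f) phi n v - opR a (expz 0 f) phi n v.
Lemma op_def a f phi n v : op a f phi n v = opL a (expinf f) phi n v - opR a (expz 0 f) phi n v.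
Proof. by []. Qed.

Lemma uu0 a n : u a n 0 = 0. Proof. exact: (lin0 (tw_linv hu a n)). Qed.
Lemma u0 n v : u 0 n v = 0. Proof. exact: (lin0 (tw_lina hu n v)). Qed.

Section OneField.
Context {phi : int -> M -> M} (hp : is_field phi).
Let pl := hp.1.

Lemma opL_fins a p n v : fins (fun i => ico p i *: u a (- i) (phi (n + i) v)).
Proof.
have [d hd] := ico_bounded p; have [e he] := hp.2 v.
apply: (fins_int (a := d) (b := e - n)) => i hi; first by rewrite hd ?scale0r.
by rewrite he ?uu0 ?scaler0 //; lia.
Qed.

Lemma opR_fins a q n v : fins (fun i => ico q i *: phi (n - i) (u a i v)).
Proof.
have [d hd] := ico_bounded q; have [e he] := tw_trunc hu a v.
apply: (fins_int (a := d) (b := e)) => i hi; first by rewrite hd ?scale0r.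
by rewrite he // (lin0 (pl _)) scaler0.
Qed.

Lemma opL_linp a n v : linear (fun p => opL a p phi n v).
Proof.
apply: lin_bigfsum => [i|p]; last exact: opL_fins.
by move=> c p q; rewrite icoD icoZ scalerDl scalerA.
Qed.

Lemma opR_linp a n v : linear (fun p => opR a p phi n v).
Proof.
apply: lin_bigfsum => [i|p]; last exact: opR_fins.
by move=> c p q; rewrite icoD icoZ scalerDl scalerA.
Qed.

Lemma op_linf a n v : linear (fun f => op a f phi n v).
Proof.
apply: lin_add; first exact: (lin_comp (opL_linp _ _ _) expinf_linear).
by apply: lin_opp; exact: (lin_comp (opR_linp _ _ _) (expz_linear 0)).
Qed.

Lemma op_lina f n v : linear (fun a => op a f phi n v).
Proof.
apply: lin_add; last apply: lin_opp; apply: lin_bigfsum => [i|x].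
- by apply: lin_scale; exact: (tw_lina hu).
- exact: opL_fins.
- by apply: lin_scale; exact: (lin_comp (pl _) (tw_lina hu _ _)).
- exact: opR_fins.
Qed.

Lemma op_field a f : is_field (op a f phi).
Proof.
split=> [n|v].
  apply: lin_add; last apply: lin_opp; apply: lin_bigfsum => [i|x].
  - by apply: lin_scale; exact: (lin_comp (tw_linv hu _ _) (pl _)).
  - exact: opL_fins.
  - by apply: lin_scale; exact: (lin_comp (pl _) (tw_linv hu _ _)).
  - exact: opR_fins.
have [d hd] := ico_bounded (expinf f); have [d' hd'] := ico_bounded (expz 0 f).
have [e he] := hp.2 v; have [D hD] := tw_trunc hu a v.
have [J hJ] := @int_bound (fun i j => phi j (u a i v) = 0) d' D (fun i => hp.2 (u a i v)).
exists (Num.max (e - d) (J + D)) => n; rewrite ge_max => /andP[n1 n2].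
rewrite /op /opL /opR fsum0 ?fsum0 ?subr0 // => i.
  case: (ltP i d') => [/hd' ->|i1]; first by rewrite scale0r.
  case: (ltP i D) => [i2|/hD ->]; last by rewrite (lin0 (pl _)) scaler0.
  by rewrite hJ ?scaler0 //; lia.
case: (ltP i d) => [/hd ->|i1]; first by rewrite scale0r.
by rewrite he ?uu0 ?scaler0 //; lia.
Qed.

Lemma op_D a f n v : op (vD a) f phi n v = - op a (rder f) phi (n - 1) v.
Proof.
rewrite /op opprB [RHS]addrC; congr (_ + _); last first.
  rewrite -[RHS]opprK; congr (- _); rewrite /opR expz_der [RHS]fsumN; last exact: opR_fins.
  rewrite (fsum_shift _ 1); apply: eq_fsum => i.
  rewrite (tw_D hu) (linZ (pl _)) addrK ico_der scalerA -scaleNr; congr (_ *: phi _ _); last by lia.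
  by rewrite mulrN mulrC.
rewrite /opL expinf_der [RHS]fsumN; last exact: opL_fins.
rewrite [RHS](fsum_shift _ 1); apply: eq_fsum => i.
rewrite (tw_D hu) scalerA ico_derinf addrK -scaleNr.
have -> : - (i + 1) = - i - 1 by lia.
have -> : n - 1 + (i + 1) = n + i by lia.
congr (_ *: _); have -> : 1 + (- i - 1) = - i by lia.
by rewrite mulrN mulrC.
Qed.

Lemma op_R k a f n v : (k < T)%N -> op (R k a) f phi n v = w ^+ k *: op a (rsub (w ^+ k) f) phi n v.
Proof.
move=> kT; have k0 : w ^+ k != 0 by rewrite expf_neq0.
rewrite /op scalerBr; congr (_ - _).
  rewrite /opL (expinf_sub _ k0) scaler_fsum; last exact: opL_fins.
  apply: eq_fsum => i; rewrite (tw_R hu) // ico_sub !scalerA; congr (_ *: _).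
  by rewrite expfzDr // expr1z exprz_inv mulrC -mulrA mulrCA.
rewrite /opR (expz_sub _ _ k0) mulr0 scaler_fsum; last exact: opR_fins.
apply: eq_fsum => i; rewrite (tw_R hu) // (linZ (pl _)) ico_sub !scalerA; congr (_ *: _).
by rewrite expfzDr // expr1z mulrC -mulrA mulrCA.
Qed.

End OneField.

Lemma op_linphi a f c phi psi n v : is_field phi -> is_field psi ->
  op a f (c *: phi + psi) n v = c *: op a f phi n v + op a f psi n v.
Proof.
move=> hp hq; have hpq := is_field_sub.2 c _ _ hp hq.
rewrite /op scalerBr addrACA -opprD; congr (_ - _).
  rewrite /opL scaler_fsum; last exact: opL_fins.
  rewrite -fsumD; [|by apply: fins_map; [rewrite scaler0 | exact: opL_fins] | exact: opL_fins].
  apply: eq_fsum => i; change ((c *: phi + psi) (n + i) v) with (c *: phi (n + i) v + psi (n + i) v).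
  by rewrite (tw_linv hu) scalerDr !scalerA mulrC.
rewrite /opR scaler_fsum; last exact: opR_fins.
rewrite -fsumD; [|by apply: fins_map; [rewrite scaler0 | exact: opR_fins] | exact: opR_fins].
apply: eq_fsum => i; change ((c *: phi + psi) (n - i) (u a i v)) with (c *: phi (n - i) (u a i v) + psi (n - i) (u a i v)).
by rewrite scalerDr !scalerA mulrC.
Qed.

Lemma op_shift a f phi k n v : op a f (fun n => phi (n + k)) n v = op a f phi (n + k) v.
Proof.
by rewrite /op /opL /opR; congr (_ - _); apply: eq_fsum => i; rewrite addrAC.
Qed.

(* The double sum produced by the commutator of two modes, for coefficients
   expanded at 0 (e = 1) or in 1/t (e = -1). *)
Lemma conv_binz (W : lmodType K) (e : int) (p q P : laurent K) (l : nat) (G : int -> W) B :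
  (forall n, B <= n -> G n = 0) ->
  (forall i, ico P (i - e * l%:Z) = l`!%:R * binz (e * i) l * ico p i) ->
  \sum_(i \in [set: int]) \sum_(j \in [set: int])
     (ico p i * ico q j * binz (e * i) l) *: G (i + j - e * l%:Z)
  = (l`!%:R)^-1 *: \sum_(n \in [set: int]) ico (P * q) n *: G n.
Proof.
move=> hB hP; have l0 : l`!%:R != 0 :> K by rewrite pnatr_eq0 -lt0n fact_gt0.
rewrite (fsum_conv P q hB) [in RHS](fsum_shift _ (- (e * l%:Z))).
have f2 : fins2 (fun i j => (ico P i * ico q j) *: G (i + j)).
  have [d hd] := ico_bounded P; have [d' hd'] := ico_bounded q.
  apply: (fins2_cone (d := d) (e := d') (E := B)) => i j hi.
  - by rewrite hd // mul0r scale0r.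
  - by rewrite hd' // mulr0 scale0r.
  - by rewrite hB // scaler0.
rewrite scaler_fsum; last first.
  have [r hr] := fins2_sum f2; exists [seq i + e * l%:Z | i <- r] => i ir.
  apply: hr; apply: contra ir => ir; apply/mapP; exists (i - e * l%:Z) => //; rewrite subrK //.
apply: eq_fsum => i; rewrite scaler_fsum; last exact: (fins2_row _ f2).
apply: eq_fsum => j; rewrite scalerA (addrAC i j) hP; congr (_ *: _).
by move: (binz _ _) (l`!%:R) l0 (ico p i) (ico q j) => x y y0 s t; field; exact: y0.
Qed.

Lemma ico_iter_lderinf l (p : laurent K) i :
  ico (iter l lderinf p) (i + l%:Z) = l`!%:R * binz (- i) l * ico p i.
Proof.
elim: l i => [|l IH] i; first by rewrite /= fact0 binz0 !mul1r addr0.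
rewrite iterS ico_derinf; have -> : i + l.+1%:Z - 1 = i + l%:Z by lia.
have -> : (1 - (i + l.+1%:Z))%:~R = (- i)%:~R - l%:R :> K.
  have -> : 1 - (i + l.+1%:Z) = - i - l%:Z by lia.
  by rewrite rmorphB.
have := binzS (K := K) (- i) l; rewrite IH factS natrM.
move: (binz (- i) l.+1) (binz (- i) l) (l`!%:R) (ico p i) ((- i)%:~R - l%:R) (l.+1%:R) => x y z t r s e.
have -> : s * z * x * t = (s * x) * (z * t) by ring.
by rewrite e; ring.
Qed.

Lemma ico_iter_lder l (p : laurent K) i :
  ico (iter l lder p) (i - l%:Z) = l`!%:R * binz i l * ico p i.
Proof. by rewrite iter_lder subrK. Qed.

Lemma iter_expinf l f : expinf (iter l rder f) = iter l lderinf (expinf f).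
Proof. by elim: l => //= l IH; rewrite expinf_der IH. Qed.
Lemma iter_expz z l f : expz z (iter l rder f) = iter l lder (expz z f).
Proof. by elim: l => //= l IH; rewrite expz_der IH. Qed.

Lemma expz0_sub c f : c != 0 -> expz 0 (rsub c f) = lsub c (expz 0 f).
Proof. by move=> c0; rewrite (expz_sub 0 f c0) mulr0. Qed.

Lemma opL_field a p phi : is_field phi -> is_field (opL a p phi).
Proof.
move=> hp; split=> [n|v].
  apply: lin_bigfsum => [i|x]; last exact: opL_fins.
  by apply: lin_scale; exact: (lin_comp (tw_linv hu _ _) (hp.1 _)).
have [d hd] := ico_bounded p; have [e he] := hp.2 v.
exists (e - d) => n n1; rewrite /opL fsum0 // => i.
case: (ltP i d) => [/hd ->|i1]; first by rewrite scale0r.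
by rewrite he ?uu0 ?scaler0 //; lia.
Qed.

Lemma opR_field a q phi : is_field phi -> is_field (opR a q phi).
Proof.
move=> hp; split=> [n|v].
  apply: lin_bigfsum => [i|x]; last exact: opR_fins.
  by apply: lin_scale; exact: (lin_comp (hp.1 _) (tw_linv hu _ _)).
have [d' hd'] := ico_bounded q; have [D hD] := tw_trunc hu a v.
have [J hJ] := @int_bound (fun i j => phi j (u a i v) = 0) d' D (fun i => hp.2 (u a i v)).
exists (J + D) => n n1; rewrite /opR fsum0 // => i.
case: (ltP i d') => [/hd' ->|i1]; first by rewrite scale0r.
case: (ltP i D) => [i2|/hD ->]; last by rewrite (lin0 (hp.1 _)) scaler0.
by rewrite hJ ?scaler0 //; lia.
Qed.

Section Commutator.
Context {phi : int -> M -> M} (hp : is_field phi).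
Variables (m : int) (v : M).

Lemma trunc_R a b : exists l0, forall (k : 'I_T) l, (l0 <= l)%N -> vprod (R k a) l b = 0.
Proof.
have h (k : 'I_T) : exists l0, forall l, (l0 <= l)%N -> vprod (R k a) l b = 0 by exact: vprod_trunc hL _ _.
have [f hf] := choice h; exists (\max_k f k) => k l hl; apply: hf.
by apply: leq_trans hl; exact: leq_bigmax.
Qed.

Lemma fsum2_sum (A : Type) (s : seq A) (F : A -> int -> int -> M) : (forall x, fins2 (F x)) ->
  \sum_(i \in [set: int]) \sum_(j \in [set: int]) \sum_(x <- s) F x i j
  = \sum_(x <- s) \sum_(i \in [set: int]) \sum_(j \in [set: int]) F x i j.
Proof.
move=> hF; rewrite -(fsum_sum s xpredT (fun x => fins2_sum (hF x))).
by apply: eq_fsum => i; rewrite fsum_sum // => x; exact: fins2_row.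
Qed.

Lemma fsum2B (F G : int -> int -> M) : fins2 F -> fins2 G ->
  \sum_(i \in [set: int]) \sum_(j \in [set: int]) F i j - \sum_(i \in [set: int]) \sum_(j \in [set: int]) G i j
  = \sum_(i \in [set: int]) \sum_(j \in [set: int]) (F i j - G i j).
Proof.
move=> hF hG; have hG' := fins2N hG.
rewrite fsumN; last exact: fins2_sum.
rewrite -fsumD; [|exact: fins2_sum|by apply: fins_map (fins2_sum hG); rewrite oppr0].
apply: eq_fsum => i; rewrite fsumN; last exact: fins2_row.
by rewrite -fsumD //; [exact: fins2_row | exact: (fins2_row i hG')].
Qed.

(** One computation for both expansions: e = -1 serves [opLL] and e = 1 serves [opRR]. The powers of
    w^k are absorbed by rotating p, the binomial coefficients by differentiating it l times. *)
Lemma comm_expand (e : int) (p q : laurent K) (P : 'I_T -> nat -> laurent K)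
    (G : 'I_T -> nat -> int -> M) l0 :
  (forall k l, (l0 <= l)%N -> forall n, G k l n = 0) ->
  (forall k l, exists B : int, forall n, B <= n -> G k l n = 0) ->
  (forall k l i, ico (P k l) (i - e * l%:Z) = l`!%:R * binz (e * i) l * ((w ^+ k) ^ (- (e * i)) * ico p i)) ->
  \sum_(i \in [set: int]) \sum_(j \in [set: int]) (ico p i * ico q j) *:
    \sum_(k < T) \sum_(l \in [set: nat]) (binz (e * i) l * (w ^+ k) ^ (- (e * i) - 1)) *: G k l (i + j - e * l%:Z)
  = \sum_(k < T) \sum_(l \in [set: nat]) ((l`!%:R)^-1 * (w ^+ k)^-1) *:
     \sum_(n \in [set: int]) ico (P k l * q) n *: G k l n.
Proof.
move=> h0 hB hP.
have [d hd] := ico_bounded p; have [d' hd'] := ico_bounded q.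
pose F (k : 'I_T) (l : nat) i j := (ico p i * ico q j * (binz (e * i) l * (w ^+ k) ^ (- (e * i) - 1))) *: G k l (i + j - e * l%:Z).
have hF k l : fins2 (F k l).
  have [B hB'] := hB k l.
  apply: (fins2_cone (d := d) (e := d') (E := B + e * l%:Z)) => i j h; rewrite /F.
  - by rewrite hd // !mul0r scale0r.
  - by rewrite hd' // mulr0 mul0r scale0r.
  - by rewrite hB' ?scaler0 //; lia.
transitivity (\sum_(i \in [set: int]) \sum_(j \in [set: int]) \sum_(k < T) \sum_(l < l0) F k l i j).
  apply: eq_fsum => i; apply: eq_fsum => j; rewrite scaler_sumr; apply: eq_bigr => k _.
  rewrite (fsum_ord (b := l0)) => [|l hl]; last by rewrite h0 // scaler0.
  by rewrite scaler_sumr; apply: eq_bigr => l _; rewrite scalerA.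
rewrite fsum2_sum; last first.
  move=> k; elim: (index_enum _) => [|x s IH].
    by exists [::]; split=> i j _; rewrite big_nil.
  have [r [h1 h2]] := fins2D (hF k x) IH.
  by exists r; split=> i j h; rewrite big_cons; [exact: h1|exact: h2].
apply: eq_bigr => k _; rewrite fsum2_sum //.
rewrite [RHS](fsum_ord (b := l0)) => [|l hl]; last first.
  by rewrite fsum0 ?scaler0 // => n; rewrite h0 // scaler0.
apply: eq_bigr => l _; have k0 : w ^+ k != 0 by rewrite expf_neq0.
have [B hB'] := hB k l.
pose p' := lsub ((w ^+ k) ^ (- e)) p : laurent K.
have hp' i : ico p' i = (w ^+ k) ^ (- (e * i)) * ico p i by rewrite ico_sub exprz_exp mulNr.
rewrite mulrC -scalerA -(conv_binz (p := p') (e := e) q hB') => [|i]; last by rewrite hP hp'.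
have F' : fins2 (fun i j => (ico p' i * ico q j * binz (e * i) l) *: G k l (i + j - e * l%:Z)).
  have [r [h1 h2]] := hF k l.
  apply: (fins2_cone (d := d) (e := d') (E := B + e * l%:Z)) => i j h.
  - by rewrite hp' hd // mulr0 !mul0r scale0r.
  - by rewrite hd' // mulr0 mul0r scale0r.
  - by rewrite hB' ?scaler0 //; lia.
rewrite scaler_fsum; last exact: fins2_sum.
apply: eq_fsum => i; rewrite scaler_fsum; last exact: (fins2_row i F').
apply: eq_fsum => j; rewrite /F scalerA hp'; congr (_ *: _).
rewrite expfzDr // exprN1.
move: (binz _ _) (_ ^ _) (ico p i) (ico q j) (_^-1) => x y r s t; ring.
Qed.

Lemma opLL a b p q : opL a p (opL b q phi) m v - opL b q (opL a p phi) m v =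
  \sum_(k < T) \sum_(l \in [set: nat]) ((l`!%:R)^-1 * (w ^+ k)^-1) *:
     opL (vprod (R k a) l b) (iter l lderinf (lsub (w ^+ k) p) * q) phi (m - l%:Z) v.
Proof.
have [d hd] := ico_bounded p; have [d' hd'] := ico_bounded q; have [e he] := hp.2 v.
have F1 : fins2 (fun i j => (ico p i * ico q j) *: u a (- i) (u b (- j) (phi (m + i + j) v))).
  apply: (fins2_cone (d := d) (e := d') (E := e - m)) => i j h.
  - by rewrite hd // mul0r scale0r.
  - by rewrite hd' // mulr0 scale0r.
  - by rewrite he ?uu0 ?scaler0 //; lia.
have F2 : fins2 (fun i j => (ico p i * ico q j) *: u b (- j) (u a (- i) (phi (m + i + j) v))).
  apply: (fins2_cone (d := d) (e := d') (E := e - m)) => i j h.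
  - by rewrite hd // mul0r scale0r.
  - by rewrite hd' // mulr0 scale0r.
  - by rewrite he ?uu0 ?scaler0 //; lia.
have -> : opL a p (opL b q phi) m v = \sum_(i \in [set: int]) \sum_(j \in [set: int])
    (ico p i * ico q j) *: u a (- i) (u b (- j) (phi (m + i + j) v)).
  apply: eq_fsum => i; rewrite /opL (lin_fsum (tw_linv hu _ _)); last exact: opL_fins.
  rewrite scaler_fsum; last first.
    by apply: fins_map; [exact: uu0 | exact: opL_fins].
  by apply: eq_fsum => j; rewrite (linZ (tw_linv hu _ _)) scalerA.
have -> : opL b q (opL a p phi) m v = \sum_(i \in [set: int]) \sum_(j \in [set: int])
    (ico p i * ico q j) *: u b (- j) (u a (- i) (phi (m + i + j) v)).
  rewrite exchange_fins2 //.
  apply: eq_fsum => i; rewrite /opL (lin_fsum (tw_linv hu _ _)); last exact: opL_fins.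
  rewrite scaler_fsum; last first.
    by apply: fins_map; [exact: uu0 | exact: opL_fins].
  by apply: eq_fsum => j; rewrite (linZ (tw_linv hu _ _)) scalerA mulrC addrAC.
rewrite fsum2B //.
have [l0 hl0] := trunc_R a b.
rewrite -(comm_expand (e := -1) (p := p) q (l0 := l0)
  (P := fun k l => iter l lderinf (lsub (w ^+ k) p))
  (G := fun k l n => u (vprod (R k a) l b) (- n) (phi (m - l%:Z + n) v))).
- apply: eq_fsum => i; apply: eq_fsum => j; rewrite -scalerBr (tw_comm hu).
  congr (_ *: _); apply: eq_bigr => k _; apply: eq_fsum => l.
  by rewrite !mulN1r !opprK; congr (_ *: u _ _ (phi _ _)); lia.
- by move=> k l hl n; rewrite hl0 // u0.
- by move=> k l; exists (e - m + l%:Z) => n hn; rewrite he ?uu0 //; lia.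
- by move=> k l i; rewrite !mulN1r !opprK ico_iter_lderinf ico_sub.
Qed.

Lemma opRR a b p q : opR a p (opR b q phi) m v - opR b q (opR a p phi) m v =
  - \sum_(k < T) \sum_(l \in [set: nat]) ((l`!%:R)^-1 * (w ^+ k)^-1) *:
     opR (vprod (R k a) l b) (iter l lder (lsub (w ^+ k)^-1 p) * q) phi (m - l%:Z) v.
Proof.
have [d hd] := ico_bounded p; have [d' hd'] := ico_bounded q.
have [A hA] := tw_trunc hu a v; have [B hB] := tw_trunc hu b v.
have phi0 n : phi n 0 = 0 by exact: (lin0 (hp.1 n)).
have F1 : fins2 (fun i j => (ico p i * ico q j) *: phi (m - i - j) (u b j (u a i v))).
  apply: (fins2_strip (d := d) (D := A) (e := d')) => [i j h|i j h|i j h|i].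
  - by rewrite hd // mul0r scale0r.
  - by rewrite hA // uu0 phi0 scaler0.
  - by rewrite hd' // mulr0 scale0r.
  - by have [J hJ] := tw_trunc hu b (u a i v); exists J => j jJ; rewrite hJ // phi0 scaler0.
have F2' : fins2 (fun j i => (ico p i * ico q j) *: phi (m - i - j) (u a i (u b j v))).
  apply: (fins2_strip (d := d') (D := B) (e := d)) => [i j h|i j h|i j h|i].
  - by rewrite hd' // mulr0 scale0r.
  - by rewrite hB // uu0 phi0 scaler0.
  - by rewrite hd // mul0r scale0r.
  - by have [J hJ] := tw_trunc hu a (u b i v); exists J => j jJ; rewrite hJ // phi0 scaler0.
have F2 := fins2_swap F2'.
have -> : opR a p (opR b q phi) m v = \sum_(i \in [set: int]) \sum_(j \in [set: int])
    (ico p i * ico q j) *: phi (m - i - j) (u b j (u a i v)).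
  apply: eq_fsum => i; rewrite scaler_fsum; last exact: opR_fins.
  by apply: eq_fsum => j; rewrite scalerA.
have -> : opR b q (opR a p phi) m v = \sum_(i \in [set: int]) \sum_(j \in [set: int])
    (ico p i * ico q j) *: phi (m - i - j) (u a i (u b j v)).
  rewrite exchange_fins2 //.
  apply: eq_fsum => i; rewrite scaler_fsum; last exact: opR_fins.
  by apply: eq_fsum => j; rewrite scalerA mulrC addrAC.
rewrite -opprB fsum2B //; congr (- _).
have [l0 hl0] := trunc_R a b.
rewrite -(comm_expand (e := 1) (p := p) q (l0 := l0)
  (P := fun k l => iter l lder (lsub (w ^+ k)^-1 p))
  (G := fun k l n => phi (m - l%:Z - n) (u (vprod (R k a) l b) n v))).
- apply: eq_fsum => i; apply: eq_fsum => j; rewrite -scalerBr -(linB (hp.1 _)) (tw_comm hu).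
  rewrite (lin_sum _ _ _ (hp.1 (m - i - j))); congr (_ *: _); apply: eq_bigr => k _.
  rewrite (fsum_ord (b := l0)) => [|l hl]; last by rewrite hl0 // u0 scaler0.
  rewrite (lin_sum _ _ _ (hp.1 (m - i - j))) (fsum_ord (b := l0)) => [|l hl]; last by rewrite hl0 // u0 phi0 scaler0.
  apply: eq_bigr => l _.
  by rewrite (linZ (hp.1 _)) !mul1r; congr (_ *: phi _ _); lia.
- by move=> k l hl n; rewrite hl0 // u0 phi0.
- by move=> k l; have [C hC] := tw_trunc hu (vprod (R k a) l b) v; exists C => n hn; rewrite hC // phi0.
- by move=> k l i; rewrite !mul1r ico_iter_lder ico_sub exprz_inv.
Qed.

Lemma opLR a b p q : opL a p (opR b q phi) m v = opR b q (opL a p phi) m v.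
Proof.
have [d hd] := ico_bounded p; have [d' hd'] := ico_bounded q.
have [B hB] := tw_trunc hu b v.
have F2' : fins2 (fun j i => (ico p i * ico q j) *: u a (- i) (phi (m + i - j) (u b j v))).
  apply: (fins2_strip (d := d') (D := B) (e := d)) => [i j h|i j h|i j h|i].
  - by rewrite hd' // mulr0 scale0r.
  - by rewrite hB // (lin0 (hp.1 _)) uu0 scaler0.
  - by rewrite hd // mul0r scale0r.
  - have [J hJ] := hp.2 (u b i v); exists (J - m + i) => j jJ; rewrite hJ ?uu0 ?scaler0 //; lia.
transitivity (\sum_(i \in [set: int]) \sum_(j \in [set: int]) (ico p i * ico q j) *: u a (- i) (phi (m + i - j) (u b j v))).
  apply: eq_fsum => i; rewrite /opR (lin_fsum (tw_linv hu _ _)); last exact: opR_fins.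
  rewrite scaler_fsum; last by apply: fins_map; [exact: uu0 | exact: opR_fins].
  by apply: eq_fsum => j; rewrite (linZ (tw_linv hu _ _)) scalerA.
rewrite exchange_fins2; last exact: fins2_swap.
apply: eq_fsum => j; rewrite scaler_fsum; last exact: opL_fins.
by apply: eq_fsum => i; rewrite scalerA mulrC addrAC.
Qed.

End Commutator.

Lemma opL_subphi a p phi psi n v : is_field phi -> is_field psi ->
  opL a p (phi - psi) n v = opL a p phi n v - opL a p psi n v.
Proof.
move=> hp hq; rewrite /opL fsumN; last exact: opL_fins.
rewrite -fsumD; [|exact: opL_fins |by apply: fins_map; [exact: oppr0 | exact: opL_fins]].
apply: eq_fsum => i; change ((phi - psi) (n + i) v) with (phi (n + i) v - psi (n + i) v).
by rewrite (linB (tw_linv hu _ _)) scalerBr.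
Qed.
Lemma opR_subphi a p phi psi n v : is_field phi -> is_field psi ->
  opR a p (phi - psi) n v = opR a p phi n v - opR a p psi n v.
Proof.
move=> hp hq; rewrite /opR fsumN; last exact: opR_fins.
rewrite -fsumD; [|exact: opR_fins |by apply: fins_map; [exact: oppr0 | exact: opR_fins]].
apply: eq_fsum => i; change ((phi - psi) (n - i) (u a i v)) with (phi (n - i) (u a i v) - psi (n - i) (u a i v)).
by rewrite scalerBr.
Qed.

Lemma comm_cancel (V : zmodType) (A B C D A' D' : V) :
  A - B - (C - D) - (A' - C - (B - D')) = A - A' + (D - D').
Proof.
rewrite !opprB (AC ((2*2)*(2*2)) ((1*8)*(3*6)*(2*5)*(4*7))) /= !addNr !addr0 //.
Qed.

(** Writing each operator as a left part minus a right part, the mixed terms cancel by [opLR]. The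
    two remaining commutators are expansions, at infinity and at 0, of one and the same rational
    function. *)
Lemma op_comm phi (hp : is_field phi) a b f h m v :
  op a f (op b h phi) m v - op b h (op a f phi) m v =
  \sum_(k < T) \sum_(l \in [set: nat]) ((l`!%:R)^-1 * (w ^+ k)^-1) *:
     op (vprod (R k a) l b) (iter l rder (rsub (w ^+ k)^-1 f) * h) phi (m - l%:Z) v.
Proof.
have E x (g : ratfun K) : op x g phi = opL x (expinf g) phi - opR x (expz 0 g) phi by [].
rewrite [op a f _ m v]/op [X in _ - X]/op !E.
have hL1 x p := opL_field x p hp; have hR1 x p := opR_field x p hp.
rewrite !opL_subphi // !opR_subphi // !(opLR hp).
set A := opL _ _ _ _ _; set B := opR _ _ _ _ _; set C := opR _ _ _ _ _; set D := opR _ _ _ _ _.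
set A' := opL _ _ _ _ _; set D' := opR b _ _ _ _.
have -> : A - B - (C - D) - (A' - C - (B - D')) = (A - A') + (D - D').
  exact: comm_cancel.
rewrite opLL // opRR // -sumrB; apply: eq_bigr => k _.
have k0 : w ^+ k != 0 by rewrite expf_neq0.
have [l0 hl0] := trunc_R a b.
rewrite !(fsum_ord (b := l0)); first 1 last.
- by move=> l hl; rewrite hl0 // (lin0 (op_lina hp _ _ _)) scaler0.
- move=> l hl; rewrite hl0 // /opR fsum0 ?scaler0 // => i.
  by rewrite u0 (lin0 (hp.1 _)) scaler0.
- move=> l hl; rewrite hl0 // /opL fsum0 ?scaler0 // => i.
  by rewrite u0 scaler0.
rewrite -sumrB; apply: eq_bigr => l _; rewrite -scalerBr /op; congr (_ *: (_ - _)).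
  by rewrite rmorphM /= iter_expinf expinf_sub ?invr_neq0 // invrK.
by rewrite rmorphM /= iter_expz expz0_sub ?invr_neq0.
Qed.

End TwistedFields.

Local Notation "p %:F" := (@FracField.tofrac {poly _} p).

(** * Orders of Laurent series *)

Section Orders.
Context {K : numFieldType}.
Implicit Types (f g : laurent K) (m n d e : int).

Lemma ordge_le f d e : e <= d -> ordge f d -> ordge f e.
Proof. by move=> ed h n ne; apply: h; apply: lt_le_trans ne ed. Qed.
Lemma ordge_subsp d : subspace (fun f : laurent K => ordge f d).
Proof.
split=> [n _|c f g hf hg n nd]; first by rewrite ico0.
by rewrite icoD icoZ hf // hg // mulr0 addr0.
Qed.
Lemma ordge_sum (A : Type) (s : seq A) (Q : pred A) (F : A -> laurent K) d :
  (forall a, Q a -> ordge (F a) d) -> ordge (\sum_(a <- s | Q a) F a) d.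
Proof. by move=> h; apply: (@subspace_sum _ _ (fun f => ordge f d)) h; exact: ordge_subsp. Qed.
Lemma ordgeB f g d : ordge f d -> ordge g d -> ordge (f - g) d.
Proof. by move=> hf hg n nd; rewrite icoB hf // hg // subr0. Qed.
Lemma ordgeD f g d : ordge f d -> ordge g d -> ordge (f + g) d.
Proof. by move=> hf hg n nd; rewrite icoD hf // hg // addr0. Qed.
Lemma ordgeZ c f d : ordge f d -> ordge (c *: f) d.
Proof. by move=> hf n nd; rewrite icoZ hf // mulr0. Qed.
Lemma ordge_mono n : ordge (lmono n : laurent K) n.
Proof. by move=> m mn; rewrite ico_mono lt_eqF. Qed.
Lemma ordge1 : ordge (1 : laurent K) 0.
Proof. by rewrite -lmono0; exact: ordge_mono. Qed.
Lemma ordge_lder f d : ordge f d -> ordge (lder f) (d - 1).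
Proof. by move=> hf n nd; rewrite ico_der hf ?mulr0 //; lia. Qed.
Lemma ordge_iter_lder f d (l : nat) : ordge f d -> ordge (iter l lder f) (d - l%:Z).
Proof.
move=> hf; elim: l => [|l IH]; first by rewrite subr0.
by apply: ordge_le (ordge_lder IH); lia.
Qed.
Lemma ordge_lsub c f d : ordge f d -> ordge (lsub c f) d.
Proof. by move=> hf n nd; rewrite ico_sub hf ?mulr0. Qed.
Lemma ordgeX f d (k : nat) : ordge f d -> ordge (f ^+ k) (d *+ k).
Proof.
move=> hf; elim: k => [|k IH]; first by rewrite expr0; exact: ordge1.
by rewrite exprS mulrS; exact: ordgeM.
Qed.
Lemma ordge_expz_poly z (p : {poly K}) : ordge (expz z p%:F) 0.
Proof. by rewrite expz_poly /psiz /= => n n0; rewrite ico_evl1 leNgt n0. Qed.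
Lemma ico0_expz_poly z (p : {poly K}) : ico (expz z p%:F) 0 = p.[z].
Proof. by rewrite expz_poly /psiz /= ico_evl1 lexx -horner_coef0 horner_comp /shiftX !hornerE. Qed.
Lemma ordge_root z (p : {poly K}) : ordge (expz z p%:F) 1 <-> root p z.
Proof.
rewrite rootE -ico0_expz_poly; split=> [-> //|/eqP h n n1].
by have [->|n0] := eqVneq n 0; [|apply: ordge_expz_poly; lia].
Qed.

End Orders.

(** * Germs of functions at the roots of unity *)

Section TwistPoles.
Context {K : numFieldType} {T : nat} {w : K} (hw : T.-primitive_root w).
Implicit Types (f g : ratfun K) (p q : {poly K}) (m n d e : int) (j k l : nat).

Let T0 : (0 < T)%N. Proof. exact: prim_order_gt0 hw. Qed.
Lemma prim_unit k : w ^+ k != 0.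
Proof.
rewrite expf_neq0 //; apply/eqP => w0; have := prim_expr_order hw.
by rewrite w0 expr0n gtn_eqF // => /eqP; rewrite eq_sym oner_eq0.
Qed.

Definition yT : {poly K} := 'X^T - 1.
Lemma yT_neq0 : yT != 0.
Proof. by rewrite /yT -size_poly_eq0 size_XnsubC. Qed.
Lemma yT_root k : root yT (w ^+ k).
Proof. by rewrite rootE /yT !hornerE -exprM mulnC exprM (prim_expr_order hw) expr1n subrr. Qed.
Lemma yT_comp k : yT \Po (w ^+ k *: 'X) = yT.
Proof.
rewrite /yT comp_polyB comp_Xn_poly -polyC1 comp_polyC exprZn -exprM mulnC exprM.
by rewrite (prim_expr_order hw) expr1n scale1r.
Qed.

(** Functions of s = y/x whose finite poles all lie in Gamma. [inJ d] consists of those vanishing to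
    order d at every point of Gamma; modulo it only the jets at these points remain. *)
Definition regG f := exists k p, f = p%:F / (yT ^+ k)%:F.
Definition vanG d f := forall k, ordge (expz (w ^+ k) f) d.
Definition inJ d f := regG f /\ vanG d f.

Let yF k : (yT ^+ k)%:F != 0 :> ratfun K. Proof. by rewrite tofrac_eq0 expf_neq0 // yT_neq0. Qed.

Lemma regG_poly p : regG p%:F.
Proof. by exists 0%N, p; rewrite expr0 tofrac1 divr1. Qed.
Lemma regGM f g : regG f -> regG g -> regG (f * g).
Proof.
move=> [k [p ->]] [l [q ->]]; exists (k + l)%N, (p * q).
by rewrite exprD !tofracM mulf_div.
Qed.
Lemma regGD f g : regG f -> regG g -> regG (f + g).
Proof.
move=> [k [p ->]] [l [q ->]]; exists (k + l)%N, (p * yT ^+ l + q * yT ^+ k).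
by rewrite exprD tofracD !tofracM addf_div.
Qed.
Lemma regGZ c f : regG f -> regG (c *: f).
Proof. by move=> hf; rewrite ratZ; apply: regGM => //; exact: regG_poly. Qed.
Lemma regGB f g : regG f -> regG g -> regG (f - g).
Proof. by move=> hf hg; rewrite -scaleN1r; apply: regGD => //; apply: regGZ. Qed.
Lemma regG_sub k f : regG f -> regG (rsub (w ^+ k) f).
Proof.
move=> [l [p ->]]; have k0 := prim_unit k; exists l, (p \Po (w ^+ k *: 'X)).
have E : (yT ^+ l) \Po (w ^+ k *: 'X) = yT ^+ l by rewrite rmorphXn /= yT_comp.
by rewrite rsubE // ?expf_neq0 ?yT_neq0 // E.
Qed.
Lemma prim_inv k : exists j, (w ^+ k)^-1 = w ^+ j.
Proof.
exists (T * k - k)%N; apply: (mulfI (prim_unit k)); rewrite divff ?prim_unit // -exprD subnKC.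
  by rewrite exprM (prim_expr_order hw) expr1n.
by rewrite leq_pmull.
Qed.
Lemma regG_subV k f : regG f -> regG (rsub (w ^+ k)^-1 f).
Proof. by have [j ->] := prim_inv k; exact: regG_sub. Qed.
Lemma regG_der f : regG f -> regG (rder f).
Proof.
move=> [k [p ->]]; rewrite rderE ?expf_neq0 ?yT_neq0 //.
by exists (k * 2)%N, (p^`() * yT ^+ k - p * (yT ^+ k)^`()); rewrite exprM.
Qed.
Lemma regG_iter l f : regG f -> regG (iter l (@rder K) f).
Proof. by move=> hf; elim: l => //= l IH; exact: regG_der. Qed.

Definition X1 : ratfun K := ('X - 1%:P)%:F.
Lemma X1_neq0 : X1 != 0. Proof. by rewrite tofrac_eq0 polyXsubC_eq0. Qed.
Lemma regG_X1 n : regG (X1 ^ n).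
Proof.
have hX : regG X1 by exact: regG_poly.
have hV : regG X1^-1.
  exists 1%N, (\sum_(i < T) 'X^i); rewrite expr1 /yT subrX1 tofracM invfM mulrCA divff ?mulr1 // tofrac_eq0.
  by apply: contraTneq yT_neq0 => e; rewrite /yT subrX1 e mulr0 eqxx.
have hk (k : nat) f : regG f -> regG (f ^+ k).
  by move=> hf; elim: k => [|k IH]; [rewrite expr0 -tofrac1; exact: regG_poly | rewrite exprS; exact: regGM].
by case: n => n; [exact: hk | rewrite NegzE -exprz_inv; exact: hk].
Qed.

Lemma vanG_le d e f : e <= d -> vanG d f -> vanG e f.
Proof. by move=> ed h k; exact: ordge_le ed (h k). Qed.
Lemma vanG_subsp d : subspace (vanG d).
Proof.
split=> [k|c f g hf hg k]; first by rewrite rmorph0; case: (ordge_subsp (K := K) d).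
by rewrite expz_linear; case: (ordge_subsp (K := K) d) => _; apply.
Qed.
Lemma inJ_subsp d : subspace (inJ d).
Proof.
have [h0 h] := vanG_subsp d; split; first by split=> //; rewrite -tofrac0; exact: regG_poly.
by move=> c f g [rf vf] [rg vg]; split; [apply: regGD => //; exact: regGZ | exact: h].
Qed.
Lemma inJ_le d e f : e <= d -> inJ d f -> inJ e f.
Proof. by move=> ed [h1 h2]; split=> //; exact: vanG_le h2. Qed.
Lemma vanGM d e f g : vanG d f -> vanG e g -> vanG (d + e) (f * g).
Proof. by move=> hf hg k; rewrite rmorphM /=; exact: ordgeM. Qed.
Lemma vanG_iter l d f : vanG d f -> vanG (d - l%:Z) (iter l (@rder K) f).
Proof. by move=> hf k; rewrite iter_expz; exact: ordge_iter_lder. Qed.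
Lemma vanG_sub j d f : vanG d f -> vanG d (rsub (w ^+ j) f).
Proof. by move=> hf k; rewrite expz_sub ?prim_unit // -exprD; exact: ordge_lsub. Qed.
Lemma vanG_subV j d f : vanG d f -> vanG d (rsub (w ^+ j)^-1 f).
Proof. by have [i ->] := prim_inv j; exact: vanG_sub. Qed.
Lemma vanG_poly p : vanG 0 p%:F. Proof. by move=> k; exact: ordge_expz_poly. Qed.
Lemma vanG_ex f : exists d : nat, vanG (- d%:Z) f.
Proof.
have h (k : 'I_T) : exists d : nat, ordge (expz (w ^+ k) f) (- d%:Z).
  by have [d hd] := ico_bounded (expz (w ^+ k) f); exists `|d|%N => n nd; apply: hd; lia.
have [d hd] := choice h; exists (\max_k d k) => k.
rewrite -(prim_expr_mod hw k); pose k' := Ordinal (ltn_pmod k T0).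
by apply: ordge_le (hd k'); rewrite lerN2 lez_nat; exact: leq_bigmax.
Qed.

(** Order 0 at every root of unity forces the numerator to vanish at all of them as long as the
    denominator contains X^T - 1, so one factor cancels at a time. *)
Lemma inJ0_poly f : inJ 0 f -> exists p, f = p%:F.
Proof.
case=> -[k [p ->]]; elim: k p => [|k IH] p; first by exists p; rewrite expr0 tofrac1 divr1.
move=> h; have [q Eq] : exists q, p = q * yT.
  have : all (root p) [seq w ^+ i | i <- index_iota 0 T].
    apply/allP => _ /mapP[i _ ->]; apply/ordge_root => n n1.
    have -> : p%:F = p%:F / (yT ^+ k.+1)%:F * (yT ^+ k.+1)%:F :> ratfun K by rewrite divfK.
    rewrite rmorphM /=; apply: (ordgeM (d := 0) (e := 1)) n1; first exact: h.
    by apply/ordge_root; rewrite rootE horner_exp; have /eqP -> := yT_root i; rewrite expr0n.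
  move/uniq_roots_prod_XsubC; case=> [|q ->].
    rewrite uniq_rootsE map_inj_in_uniq ?iota_uniq // => i j.
    rewrite !mem_index_iota !leq0n /= => iT jT /eqP.
    by rewrite (eq_prim_root_expr hw) !modn_small // => /eqP.
  by exists q; rewrite big_map factor_Xn_sub_1.
have E : p%:F / (yT ^+ k.+1)%:F = q%:F / (yT ^+ k)%:F :> ratfun K.
  by rewrite Eq exprSr !tofracM -mulf_div divff ?mulr1 // tofrac_eq0 yT_neq0.
by rewrite E in h *; exact: IH h.
Qed.

(** [e1] takes the value 1 at s = 1 and 0 at the other roots of unity. Passing to 1 - (1 - e1^N)^N
    is the usual lifting of an idempotent: the result agrees with 1 to order N at s = 1 and with 0
    to order N at the other points. *)
Definition e1 : {poly K} := T%:R^-1 *: \sum_(i < T) 'X^i.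
Definition eN (N : nat) : {poly K} := 1 - (1 - e1 ^+ N) ^+ N.

Lemma e1_1 : e1.[1] = 1.
Proof.
rewrite /e1 hornerZ horner_sum (eq_bigr (fun=> 1)) => [|i _]; last by rewrite hornerXn expr1n.
by rewrite sumr_const card_ord mulVf // pnatr_eq0 -lt0n.
Qed.
Lemma e1_root k : w ^+ k != 1 -> e1.[w ^+ k] = 0.
Proof.
move=> k1; rewrite /e1 hornerZ horner_sum; under eq_bigr do rewrite hornerXn.
have /eqP := subrX1 (w ^+ k) T; rewrite -exprM mulnC exprM (prim_expr_order hw) expr1n subrr eq_sym mulf_eq0.
by rewrite subr_eq0 (negbTE k1) => /eqP ->; rewrite mulr0.
Qed.

Lemma ordge_root_exp z p k : root p z -> ordge (expz z (p ^+ k)%:F) k%:Z.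
Proof. by move/ordge_root => h; rewrite !rmorphXn /=; apply: ordge_le (ordgeX (k := k) h); rewrite natz. Qed.

Lemma eN_at1 N : ordge (expz 1 (1 - (eN N)%:F)) N%:Z.
Proof.
have -> : 1 - (eN N)%:F = ((1 - e1 ^+ N) ^+ N)%:F :> ratfun K.
  by rewrite /eN tofracB tofrac1 opprB addrC subrK.
by apply: ordge_root_exp; rewrite rootE hornerD hornerN horner_exp e1_1 expr1n -polyC1 hornerC subrr.
Qed.
Arguments eN_at1 : clear implicits.
Lemma eN_at k N : w ^+ k != 1 -> ordge (expz (w ^+ k) (eN N)%:F) N%:Z.
Proof.
move=> k1; have -> : eN N = e1 ^+ N * \sum_(i < N) (1 - e1 ^+ N) ^+ i.
  by rewrite /eN -opprB subrX1 -mulNr opprB subKr.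
rewrite tofracM rmorphM /= -[N%:Z]addr0; apply: ordgeM (ordge_expz_poly _ _).
by apply: ordge_root_exp; rewrite rootE e1_root.
Qed.
Arguments eN_at : clear implicits.

(** A global function with the germ (s - 1)^n at s = 1 and the germ 0 at the other roots of unity,
    up to errors that vanish to high order when N is large. *)
Definition gN n N : ratfun K := X1 ^ n * (eN N)%:F.

Lemma regG_gN n N : regG (gN n N).
Proof. by apply: regGM; [exact: regG_X1 | exact: regG_poly]. Qed.

Lemma expz1_X1 n : expz 1 (X1 ^ n) = lmono n.
Proof.
have h : expz 1 X1 = lmono 1 by rewrite /X1 expz_Xs subrr scale0r addr0.
case: n => n; first by rewrite rmorphXn /= h lmonoX natz.
by rewrite NegzE -exprz_inv rmorphXn /= fmorphV /= h lmonoV lmonoX mulNrn natz.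
Qed.
Lemma expz_X1_at z n : z != 1 -> ordge (expz z (X1 ^ n)) 0.
Proof.
have hX y : ordge (expz y X1) 0 by exact: ordge_expz_poly.
move=> z1; case: n => n.
  by rewrite rmorphXn /=; apply: ordge_le (ordgeX (k := n) (hX _)); rewrite mul0rn.
have hV : ordge (expz z X1^-1) 0.
  have -> : X1^-1 = rpw 1 1 by rewrite /rpw expr1.
  by rewrite expz_rpw // => m m0; rewrite ico_geo leNgt m0.
rewrite NegzE -exprz_inv rmorphXn /=.
by apply: ordge_le (ordgeX (k := n.+1) hV); rewrite mul0rn.
Qed.

Lemma gN_at1 n N : ordge (expz 1 (gN n N) - lmono n) (n + N%:Z).
Proof.
have -> : expz 1 (gN n N) - lmono n = - (lmono n * expz 1 (1 - (eN N)%:F)).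
  by rewrite /gN rmorphM /= expz1_X1 [expz 1 (1 - _)]rmorphB /= rmorph1 mulrBr mulr1 opprB.
by rewrite -scaleN1r; apply/ordgeZ/ordgeM; [exact: ordge_mono | exact: eN_at1].
Qed.
Arguments gN_at1 : clear implicits.
Lemma gN_at k n N : w ^+ k != 1 -> ordge (expz (w ^+ k) (gN n N)) N%:Z.
Proof.
move=> k1; rewrite /gN rmorphM /= -[N%:Z]add0r; apply: ordgeM; [exact: expz_X1_at | exact: eN_at].
Qed.
Arguments gN_at : clear implicits.
Lemma gN_van n N : vanG (Num.min n N%:Z) (gN n N).
Proof.
move=> k; have [k1|k1] := eqVneq (w ^+ k) 1; last by apply: ordge_le (gN_at k n N k1); rewrite ge_min lexx orbT.
rewrite k1 -[expz 1 _](subrK (lmono n)); apply: ordgeD; last by apply: ordge_le (@ordge_mono K n); rewrite ge_min lexx.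
by apply: ordge_le (gN_at1 n N); lia.
Qed.
Arguments gN_van : clear implicits.
Opaque gN.

Lemma ordge_iter_mul (f g : laurent K) d e l : ordge f d -> ordge g e -> ordge (iter l lder f * g) (d - l%:Z + e).
Proof. by move=> hf hg; apply: ordgeM hg; exact: ordge_iter_lder. Qed.

(** The identity (u^m)^(l) u^n = l! C(m, l) u^(m+n-l) persists, up to order d, for series X, Y, Z
    that approximate these monomials. The lower bound on N pays for the derivatives and for negative
    m and n. *)
Lemma ordge_comm_mono (X Y Z : laurent K) l m n N d :
  ordge (X - lmono m) (m + N%:Z) -> ordge (Y - lmono n) (n + N%:Z) ->
  ordge (Z - lmono (m + n - l%:Z)) (m + n - l%:Z + N%:Z) -> ordge Y (Num.min n N%:Z) ->
  d + `|m|%N%:Z + `|n|%N%:Z + l%:Z <= N%:Z ->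
  ordge (iter l lder X * Y - (l`!%:R * binz m l) *: Z) d.
Proof.
move=> A1 B1 C1 B0 hd.
have -> : iter l lder X * Y - (l`!%:R * binz m l) *: Z =
   (iter l lder (X - lmono m) * Y + iter l lder (lmono m) * (Y - lmono n))
   - (l`!%:R * binz m l) *: (Z - lmono (m + n - l%:Z)).
  rewrite (linB (iter_lder_linear l)) scalerBr mulrBl mulrBr addrA subrK.
  have -> : iter l lder (lmono m) * lmono n = (l`!%:R * binz m l) *: lmono (m + n - l%:Z) :> laurent K.
    by rewrite iter_lder_mono lscalerAl lmonoD addrAC.
  by rewrite opprB addrA subrK.
apply: ordgeB; first apply: ordgeD.
- by refine (ordge_le _ (ordge_iter_mul A1 B0)); lia.
- by refine (ordge_le _ (ordge_iter_mul (@ordge_mono K m) B1)); lia.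
- by apply/ordgeZ/ordge_le/C1; lia.
Qed.

(* Congruence of functions with poles in Gamma is tested at 1 and at the other
   roots of unity separately. *)
Lemma vanG_split d f : ordge (expz 1 f) d -> (forall k, w ^+ k != 1 -> ordge (expz (w ^+ k) f) d) -> vanG d f.
Proof. by move=> h1 h k; have [->|] := eqVneq (w ^+ k) 1; [|exact: h]. Qed.

Lemma gN_indep n N N' d : d <= N%:Z -> d <= N'%:Z -> d <= n + N%:Z -> d <= n + N'%:Z ->
  inJ d (gN n N - gN n N').
Proof.
move=> h1 h2 h3 h4; split; first by apply: regGB; exact: regG_gN.
apply: vanG_split => [|k k1]; rewrite rmorphB /=.
  have -> : expz 1 (gN n N) - expz 1 (gN n N') = (expz 1 (gN n N) - lmono n) - (expz 1 (gN n N') - lmono n).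
    by rewrite opprB addrA subrK.
  by apply: ordgeB; [apply: ordge_le (gN_at1 n N) | apply: ordge_le (gN_at1 n N')].
by apply: ordgeB; [apply: ordge_le (gN_at k n N k1) | apply: ordge_le (gN_at k n N' k1)].
Qed.

Lemma gN_der n N d : d + 1 <= N%:Z -> d + 1 <= n + N%:Z ->
  inJ d (rder (gN n N) - n%:~R *: gN (n - 1) N).
Proof.
move=> h1 h2; split; first by apply: regGB; [apply: regG_der; exact: regG_gN|apply: regGZ; exact: regG_gN].
apply: vanG_split => [|k k1]; rewrite rmorphB /= expz_der.
  rewrite (linZ (expz_linear 1)).
  have -> : lder (expz 1 (gN n N)) - n%:~R *: expz 1 (gN (n - 1) N) =
      lder (expz 1 (gN n N) - lmono n) - n%:~R *: (expz 1 (gN (n - 1) N) - lmono (n - 1)).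
    by rewrite (linB lder_linear) lder_mono scalerBr opprB addrA subrK.
  by apply: ordgeB; [apply: ordge_le (ordge_lder (gN_at1 n N)); lia |
                     apply/ordgeZ/ordge_le/(gN_at1 (n - 1) N); lia].
rewrite (linZ (expz_linear _)).
by apply: ordgeB; [apply: ordge_le (ordge_lder (gN_at k n N k1)); lia |
                   apply/ordgeZ/ordge_le/(gN_at k (n - 1) N k1); lia].
Qed.

Lemma gN_small n N d : d <= n -> d <= N%:Z -> inJ d (gN n N).
Proof. by move=> h1 h2; split; [exact: regG_gN | apply: vanG_le (gN_van n N); lia]. Qed.

(** The rotated first factor is concentrated at w^k and the second at 1. As these points differ, at
    every root of unity one of the factors vanishes to high order. *)
Lemma gN_comm0 k l m n N d : w ^+ k != 1 -> d + `|m|%N%:Z + `|n|%N%:Z + l%:Z <= N%:Z ->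
  inJ d (iter l (@rder K) (rsub (w ^+ k)^-1 (gN m N)) * gN n N).
Proof.
move=> k1 hd; split; first by apply: regGM; [apply/regG_iter/regG_subV|]; exact: regG_gN.
apply: vanG_split => [|j j1]; rewrite rmorphM /= iter_expz expz_sub ?invr_neq0 ?prim_unit //.
  have [i ei] := prim_inv k; rewrite mulr1 ei.
  have i1 : w ^+ i != 1 by apply: contra k1 => /eqP i1; rewrite -[w ^+ k]invrK ei i1 invr1.
  have h := ordge_lsub (w ^+ i) (gN_at i m N i1).
  have g := gN_van n N 0; rewrite expr0 in g.
  by refine (ordge_le _ (ordge_iter_mul h g)); lia.
have [i ei] := prim_inv k; rewrite ei -exprD.
have h := ordge_lsub (w ^+ i) (gN_van m N (i + j)).
by refine (ordge_le _ (ordge_iter_mul h (gN_at j n N j1))); lia.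
Qed.

Lemma gN_comm1 l m n N d : d + `|m|%N%:Z + `|n|%N%:Z + l%:Z <= N%:Z ->
  inJ d (iter l (@rder K) (gN m N) * gN n N - (l`!%:R * binz m l) *: gN (m + n - l%:Z) N).
Proof.
move=> hd; split.
  by apply: regGB; [apply: regGM; [apply: regG_iter|] | apply: regGZ]; exact: regG_gN.
apply: vanG_split => [|j j1]; rewrite rmorphB rmorphM /= iter_expz (linZ (expz_linear _)).
  have B0 := gN_van n N 0; rewrite expr0 in B0.
  by apply: (ordge_comm_mono (gN_at1 m N) (gN_at1 n N) (gN_at1 _ N) B0).
apply: ordgeB.
  by refine (ordge_le _ (ordge_iter_mul (gN_at j m N j1) (gN_at j n N j1))); lia.
by apply/ordgeZ/ordge_le/(gN_at j _ N j1); lia.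
Qed.

(** At s = 1/c + u the function 1/(s - 1) is minus the sum of (c/(c - 1))^(m+1) u^m, and the added
    terms are the first D of these with the opposite sign. *)
Lemma geo_cancel (c : K) (D : nat) : c != 0 -> c != 1 ->
  ordge (geo (c^-1 - 1) 0 + \sum_(n < D) (c * ((c - 1) ^+ n.+1)^-1) *: lsub c (lmono n%:Z)) D%:Z.
Proof.
move=> c0 c1 m mD; rewrite icoD ico_sum ico_geo; case: (leP 0 m) => m0; last first.
  rewrite add0r big1 // => n _; rewrite lsub_mono !icoZ ico_mono.
  by case: eqP m0 => [->|_ _] //; rewrite !mulr0.
have Em : m = `|m|%N%:Z by lia.
have mD' : (`|m| < D)%N by lia.
rewrite (bigD1 (Ordinal mD')) // [X in _ + (_ + X)]big1 ?addr0; last first.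
  move=> n nm; rewrite lsub_mono !icoZ ico_mono; case: eqP => [e|_]; last by rewrite !mulr0.
  by case/negP: nm; apply/eqP/val_inj => /=; lia.
have -> : nat_of_ord (Ordinal mD') = `|m|%N by [].
rewrite lsub_mono !icoZ ico_mono -Em eqxx mulr1 add0n binn mulr1 {4}Em -exprnP.
have c1' : c - 1 != 0 by rewrite subr_eq0.
have -> : (c^-1 - 1)^-1 = - (c / (c - 1)).
  have -> : c^-1 - 1 = - ((c - 1) / c) by rewrite mulrBl divff // mul1r opprB.
  by rewrite invrN invf_div.
rewrite [(- (c / _)) ^+ _]exprNn [(-1) ^+ _.+1]exprS mulN1r mulNr mulrN signrMK exprMn exprVn [c ^+ _]exprS.
by rewrite [X in _ + X]mulrAC addNr.
Qed.

Lemma cancel_aux (V : zmodType) (a b c d : V) : a - b + c = a + d - b + (c - d).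
Proof. by rewrite [RHS]addrA [RHS](ACl ((1*3*4)*(2*5))) /= subrr addr0. Qed.

Lemma prim_lt_neq1 k : (0 < k < T)%N -> w ^+ k != 1.
Proof.
move=> /andP[k0 kT]; rewrite -[1](expr0 w) (eq_prim_root_expr hw) mod0n modn_small //.
by rewrite -lt0n.
Qed.

(* The partial fraction expansion of the polar part at 1 of 1/(s-1), transported
   to the other roots of unity, is the source of the extra terms of Y_W. *)
Lemma gN_extra d (D N : nat) : d <= D%:Z -> d + 1 <= N%:Z ->
  inJ d (X1 ^ (-1) - gN (-1) N + \sum_(k < T | (0 < k)%N) \sum_(n < D)
     (w ^+ k * ((w ^+ k - 1) ^+ n.+1)^-1) *: rsub (w ^+ k) (gN n%:Z N)).
Proof.
move=> dD dN; split.
  apply: regGD; first by apply: regGB; [exact: regG_X1 | exact: regG_gN].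
  have [h0 _] := inJ_subsp 0.
  apply: (big_ind regG) => [|f g|k _]; [by case: h0 | exact: regGD|].
  apply: (big_ind regG) => [|f g|n _]; [by case: h0 | exact: regGD|].
  by apply/regGZ/regG_sub; exact: regG_gN.
set F := fun k : 'I_T => \sum_(n < D) (w ^+ k * ((w ^+ k - 1) ^+ n.+1)^-1) *: rsub (w ^+ k) (gN n%:Z N).
have hF (k : 'I_T) j : w ^+ (k + j) != 1 -> ordge (expz (w ^+ j) (F k)) d.
  move=> kj; rewrite (lin_sum _ _ _ (expz_linear _)); apply: ordge_sum => n _.
  rewrite (linZ (expz_linear _)) expz_sub ?prim_unit // -exprD; apply/ordgeZ/ordge_lsub.
  by apply: ordge_le (gN_at _ n N kj); lia.
have hS (P : pred 'I_T) j : (forall k : 'I_T, P k -> w ^+ (k + j) != 1) -> ordge (expz (w ^+ j) (\sum_(k < T | P k) F k)) d.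
  move=> h; rewrite (lin_sum _ _ _ (expz_linear _)); apply: ordge_sum => k Pk.
  exact/hF/h.
apply: vanG_split => [|j' j1'].
  rewrite rmorphD rmorphB /= expz1_X1; apply: ordgeD.
    by rewrite -opprB -scaleN1r; apply/ordgeZ/ordge_le/(gN_at1 (-1) N); lia.
  rewrite -(expr0 w); apply: hS => k k0; rewrite addn0; apply: prim_lt_neq1.
  by rewrite k0 ltn_ord.
have [j jT jE] : exists2 j, (0 < j < T)%N & w ^+ j' = w ^+ j.
  exists (j' %% T)%N; last by rewrite (prim_expr_mod hw).
  rewrite ltn_pmod // andbT lt0n; apply: contra j1' => /eqP h.
  by rewrite -(prim_expr_mod hw) h.
rewrite jE in j1' *; have /andP[j0 jT'] := jT.
have k0T : (T - j < T)%N by rewrite ltn_subrL j0.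
(* The only index for which w^k carries w^j to 1. The other summands vanish at w^j to order d. *)
pose k0 := Ordinal k0T.
have k0j : w ^+ k0 * w ^+ j = 1 by rewrite -exprD subnK ?(prim_expr_order hw) // ltnW.
rewrite (bigD1 k0) /=; last by rewrite subn_gt0.
have k01 : w ^+ k0 != 1 by apply: prim_lt_neq1; rewrite k0T subn_gt0 jT'.
rewrite addrA rmorphD /=; apply: ordgeD; last first.
  apply: hS => k /andP[k_gt0 kk]; rewrite -[1](expr0 w) (eq_prim_root_expr hw) mod0n.
  have kT := ltn_ord k; case: (ltnP (k + j) T) => h.
    by rewrite modn_small //; lia.
  rewrite -(subnK h) modnDr modn_small; last by lia.
  apply: contra kk => /eqP e; apply/eqP/val_inj => /=; lia.
have wj : w ^+ j = (w ^+ k0)^-1 by apply: (mulfI (prim_unit k0)); rewrite k0j divff ?prim_unit.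
have [c Ec] : exists c, c = w ^+ k0 by exists (w ^+ k0).
have c0 : c != 0 by rewrite Ec prim_unit.
rewrite -Ec in k01 k0j wj.
have hX : expz (w ^+ j) (X1 ^ (-1)) = geo (c^-1 - 1) 0.
  by rewrite -wj -expz_rpw // /rpw expr1.
have hFk : expz (w ^+ j) (F k0) = \sum_(n < D) (c * ((c - 1) ^+ n.+1)^-1) *: lsub c (expz 1 (gN n%:Z N)).
  rewrite (lin_sum _ _ _ (expz_linear _)); apply: eq_bigr => n _; rewrite -Ec.
  by rewrite (linZ (expz_linear _)) (expz_sub _ _ c0) k0j.
have -> : expz (w ^+ j) (X1 ^ (-1) - gN (-1) N + F k0) =
   (geo (c^-1 - 1) 0 + \sum_(n < D) (c * ((c - 1) ^+ n.+1)^-1) *: lsub c (lmono n%:Z))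
   - expz (w ^+ j) (gN (-1) N) + \sum_(n < D) (c * ((c - 1) ^+ n.+1)^-1) *: lsub c (expz 1 (gN n%:Z N) - lmono n%:Z).
  rewrite rmorphD rmorphB /= hX hFk.
  under [X in _ = _ + X]eq_bigr do rewrite (linB (lsub_linear _)) scalerBr.
  by rewrite sumrB; exact: cancel_aux.
apply: ordgeD; first apply: ordgeB.
- exact: ordge_le dD (geo_cancel c0 k01).
- by apply: ordge_le (gN_at j (-1) N j1'); lia.
apply: ordge_sum => n _; apply/ordgeZ/ordge_lsub.
by apply: ordge_le (gN_at1 n%:Z N); lia.
Qed.

End TwistPoles.

(** * Normal ordered products as sums over the natural numbers *)

Section NormalProduct.
Context {K : fieldType} {M : lmodType K}.

Lemma fsum_set_neg (F : int -> M) :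
  \sum_(n \in [set n : int | n < 0]) F n = \sum_(n \in [set: nat]) F (- n%:Z - 1).
Proof.
apply: (@reindex_fsbig _ _ _ nat int (fun n => - n%:Z - 1)); split=> [n _ /=|m n _ _|n /= n0].
- lia.
- lia.
- by exists `|(n + 1)%R|%N => //; lia.
Qed.

Lemma fsum_set_pos (F : int -> M) :
  \sum_(n \in [set n : int | 0 <= n]) F n = \sum_(n \in [set: nat]) F n%:Z.
Proof.
apply: (@reindex_fsbig _ _ _ nat int Posz); split=> [n _ //|m n _ _ []//|n /= n0].
by exists `|n|%N => //; lia.
Qed.

Lemma normal_prodE (F G : int -> M -> M) m v : normal_prod F G m v =
  \sum_(n \in [set: nat]) F (- n%:Z - 1) (G (m + n%:Z) v) +
  \sum_(n \in [set: nat]) G (m - n%:Z - 1) (F n%:Z v).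
Proof.
rewrite /normal_prod fsum_set_neg fsum_set_pos; congr (_ + _); apply: eq_fsum => n.
by congr (F _ (G _ _)); lia.
Qed.

End NormalProduct.

(** * The action of the loop algebra on local fields *)

Section Localisation.
Context {K : numFieldType} {L : vla K} (hL : vertex_lie_algebra L) (hG : graded_vla L).
Context {T : nat} {w : K} (hw : T.-primitive_root w) {M : lmodType K}.
Context {u : L -> int -> M -> M} (hu : twisted_fields (T := T) (w := w) u).
Implicit Types (a b : L) (m n i j : int) (v : M) (f g h : ratfun K) (phi psi : int -> M -> M).
Local Notation R k := (@vR _ L w k).
Local Notation op := (@op K L M u).
Local Notation regG := (@regG K T).
Local Notation inJ := (@inJ K T w).
Local Notation gN := (@gN K T).

Lemma prim_neq0 : w != 0.
Proof. by have := prim_unit hw 1; rewrite expr1. Qed.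
Let w0 := prim_neq0.
Let T0 : (0 < T)%N := prim_order_gt0 hw.

(** Locality up to Gamma: the commutator with each a is killed by functions of y/x that vanish to
    order d(a) on Gamma, such as (s^T - 1)^d. Hence [op a f phi] depends only on the jets of f at
    Gamma. *)
Definition smooth_field phi := is_field phi /\
  exists d : L -> nat, forall a f, inJ (d a)%:Z f -> op a f phi = (0 : int -> M -> M).

Lemma op0 a f : op a f (0 : int -> M -> M) = (0 : int -> M -> M).
Proof.
apply/funext => n; apply/funext => v; have h0 := (@is_field_sub K M).1.
have := op_linphi w0 hu a f (-1) n v h0 h0; rewrite scaler0 addr0 => {1}->.
by rewrite scaleN1r addNr.
Qed.

Lemma smooth_field_sub : subspace smooth_field.
Proof.
split.
  by split; [exact: (@is_field_sub K M).1 | exists (fun=> 0%N) => a f _; exact: op0].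
move=> c phi psi [hp [d hd]] [hq [e he]]; split; first exact: is_field_sub.2.
exists (fun a => maxn (d a) (e a)) => a f hf; apply/funext => n; apply/funext => v.
rewrite (op_linphi w0 hu) // hd ?he ?scaler0 ?addr0 //; apply: inJ_le hf; lia.
Qed.

Lemma smooth_sum (A : Type) (s : seq A) (Q : pred A) (F : A -> int -> M -> M) :
  (forall x, Q x -> smooth_field (F x)) -> smooth_field (\sum_(x <- s | Q x) F x).
Proof. by move=> h; apply: (@subspace_sum K _ smooth_field) h; exact: smooth_field_sub. Qed.

Definition locR a n phi (N : nat) : int -> M -> M := fun m v => op a (gN n N) phi (m + n) v.

(* The value at a of the fields attached to the germ (s - 1)^n at s = 1; N is
   irrelevant once it is large. *)
Definition loc a n phi : int -> M -> M :=
  xget 0 [set psi | exists N0, forall N, (N0 <= N)%N -> locR a n phi N = psi].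

Lemma locR_field a n phi N : is_field phi -> is_field (locR a n phi N).
Proof.
move=> hp; have [h1 h2] := op_field w0 hu hp a (gN n N); split=> [m|v]; first exact: (h1 (m + n)).
by have [d hd] := h2 v; exists (d - n) => m hm; apply: hd; lia.
Qed.

Lemma op_congr a d phi f g : (forall f, inJ d f -> op a f phi = (0 : int -> M -> M)) ->
  is_field phi -> inJ d (f - g) -> op a f phi = op a g phi.
Proof.
move=> hd hp hfg; apply/funext => n; apply/funext => v; apply/eqP; rewrite -subr_eq0.
by rewrite -(linB (op_linf w0 hu hp a n v)) hd.
Qed.

Lemma locE a n phi : smooth_field phi -> exists N0 : nat, forall N, (N0 <= N)%N -> loc a n phi = locR a n phi N.
Proof.
move=> [hp [d hd]]; pose N0 := (d a + `|n|)%N.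
have E N : (N0 <= N)%N -> locR a n phi N = locR a n phi N0.
  move=> hN; apply/funext => m; rewrite /locR (op_congr (hd a) hp (g := gN n N0)) //.
  by apply: (gN_indep hw); lia.
exists N0 => N hN; rewrite /loc; case: xgetP => [psi _ [N1 h1]|/(_ (locR a n phi N0)) h].
  exact: etrans (esym (h1 _ (leq_maxr N0 N1))) (etrans (E _ (leq_maxl _ _)) (esym (E N hN))).
by case: h; exists N0.
Qed.

Lemma loc_field a n phi : smooth_field phi -> is_field (loc a n phi).
Proof.
move=> sp; have [N0 h] := locE a n sp; rewrite (h N0) //; apply: locR_field; exact: sp.1.
Qed.

Lemma loc_lina n phi : smooth_field phi -> linear (fun a => loc a n phi).
Proof.
move=> sp c a b; have [N1 h1] := locE (c *: a + b) n sp.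
have [N2 h2] := locE a n sp; have [N3 h3] := locE b n sp.
pose N := maxn N1 (maxn N2 N3).
rewrite (h1 N) ?(h2 N) ?(h3 N) ?leq_max ?leqnn ?orbT //.
apply/funext => m; apply/funext => v.
exact: (op_lina w0 hu sp.1).
Qed.

Lemma loc_linphi a n c phi psi : smooth_field phi -> smooth_field psi ->
  loc a n (c *: phi + psi) = c *: loc a n phi + loc a n psi.
Proof.
move=> sp sq; have [N1 h1] := locE a n (smooth_field_sub.2 c _ _ sp sq).
have [N2 h2] := locE a n sp; have [N3 h3] := locE a n sq.
pose N := maxn N1 (maxn N2 N3).
rewrite (h1 N) ?(h2 N) ?(h3 N) ?leq_max ?leqnn ?orbT //.
apply/funext => m; apply/funext => v.
exact: (op_linphi w0 hu _ _ _ _ _ sp.1 sq.1).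
Qed.

Lemma loc_D a n phi : smooth_field phi -> loc (vD a) n phi = - n%:~R *: loc a (n - 1) phi.
Proof.
move=> sp; have [hp [d hd]] := sp; have [N1 h1] := locE (vD a) n sp.
have [N2 h2] := locE a (n - 1) sp; pose N := (N1 + N2 + d a + `|n|).+2.
rewrite (h1 N) ?(h2 N); [|lia|lia].
apply/funext => m; apply/funext => v; rewrite /locR (op_D w0 hu hp).
rewrite (op_congr (hd a) hp (g := n%:~R *: gN (n - 1) N)); last by apply: (gN_der hw); lia.
change ((- n%:~R *: (fun m v => op a (gN (n - 1) N) phi (m + (n - 1)) v)) m v)
  with (- n%:~R *: op a (gN (n - 1) N) phi (m + (n - 1)) v).
by rewrite (linZ (op_linf w0 hu hp a _ v)) scaleNr addrA.
Qed.

Lemma loc_trunc a phi : smooth_field phi -> exists D : int, forall n, D <= n -> loc a n phi = 0.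
Proof.
move=> sp; have [hp [d hd]] := sp; exists (d a)%:Z => n hn; have [N1 h1] := locE a n sp.
rewrite (h1 (N1 + d a)%N) ?leq_addr //; apply/funext => m; rewrite /locR hd //.
by apply: (gN_small hw); lia.
Qed.

(** The analogue of Dong's lemma. By [op_comm] the operators of b and a can be interchanged at the
    cost of finitely many products (R_(w^k) b)_(l) a, and with h vanishing to a high enough order
    every term is killed by the locality of phi. *)
Lemma loc_smooth a n phi : smooth_field phi -> smooth_field (loc a n phi).
Proof.
move=> sp; split; first exact: loc_field.
have [hp [d hd]] := sp; have [N0 h0] := locE a n sp; rewrite (h0 N0) // {h0}.
set g := gN n N0; have [e he] := vanG_ex hw g.
suff h b : exists d : nat, forall h, inJ d%:Z h -> op b h (op a g phi) = (0 : int -> M -> M).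
  have [D hD] := choice h; exists D => b f hf; apply/funext => m; apply/funext => v.
  by rewrite /locR (op_shift b f (op a g phi)) hD.
have [l0 hl0] := trunc_R hL (T := T) (w := w) b a.
(* Room for at most l0 derivatives of h and for the poles of g, of order at most e. *)
pose D := (d b + \max_(k < T) \max_(l < l0) d (vprod (R k b) l a) + l0 + e)%N.
exists D => h hh; apply/funext => m; apply/funext => v.
have := op_comm hL w0 hu hp b a h g m v; rewrite (hd b); last by apply: inJ_le hh; lia.
rewrite op0 subr0 => ->; rewrite big1 // => k _; apply: fsum0 => l.
case: (ltnP l l0) => [ll|/hl0 ->]; last by rewrite (lin0 (op_lina w0 hu hp _ _ _)) scaler0.
rewrite hd ?scaler0 //; split.
  by apply: regGM; [apply/(regG_iter hw)/(regG_subV hw)/hh.1 | exact: (regG_gN hw)].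
apply: vanG_le (vanGM (vanG_iter (l := l) (vanG_subV hw k hh.2)) he).
have : (d (vprod (R k b) l a) <= \max_(k < T) \max_(l < l0) d (vprod (R k b) l a))%N.
  apply: leq_trans (leq_bigmax k).
  exact: (leq_bigmax (Ordinal ll) (F := fun l : 'I_l0 => d (vprod (R k b) l a))).
rewrite /D; lia.
Qed.

Lemma uniform_bound (P : nat -> nat -> Prop) (n0 : nat) :
  (forall k, exists N0 : nat, forall N : nat, (N0 <= N)%N -> P k N) ->
  exists N0 : nat, forall k N : nat, (k < n0)%N -> (N0 <= N)%N -> P k N.
Proof.
move=> h; have [f hf] := choice h; exists (\max_(k < n0) f k) => k N kn hN; apply: hf.
exact: leq_trans (leq_bigmax (Ordinal kn) (F := fun k : 'I_n0 => f k)) hN.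
Qed.

(** The term k = 0 of [op_comm] is the commutator formula of the loop algebra. The terms with k > 0
    vanish by [gN_comm0]: near s = 1 the other points of Gamma are invisible, and the twist
    disappears. *)
Lemma loc_comm a m b n phi : smooth_field phi ->
  loc a m (loc b n phi) - loc b n (loc a m phi)
  = \sum_(k \in [set: nat]) binz m k *: loc (vprod a k b) (m + n - k%:Z) phi.
Proof.
move=> sp; have [hp [d hd]] := sp; have [l0 hl0] := trunc_R hL (T := T) (w := w) a b.
have R0 : R 0 a = a by exact: (vR0 hG).
have la l : (l0 <= l)%N -> vprod a l b = 0 by move/(hl0 (Ordinal T0)); rewrite R0.
have [N1 h1] := locE b n sp; have [N2 h2] := locE a m sp.
have [N3 h3] := locE a m (loc_smooth b n sp); have [N4 h4] := locE b n (loc_smooth a m sp).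
have [N5 h5] := @uniform_bound (fun k N => loc (vprod a k b) (m + n - k%:Z) phi = locR (vprod a k b) (m + n - k%:Z) phi N) l0
  (fun k => locE (vprod a k b) (m + n - k%:Z) sp).
pose D := (\max_(k < T) \max_(l < l0) d (vprod (R k a) l b))%N.
have hDk (k : 'I_T) l : (l < l0)%N -> (d (vprod (R k a) l b) <= D)%N.
  move=> ll; apply: leq_trans (leq_bigmax k).
  exact: (leq_bigmax (Ordinal ll) (F := fun l : 'I_l0 => d (vprod (R k a) l b))).
pose N := (N1 + N2 + N3 + N4 + N5 + D + `|m| + `|n| + l0)%N.
rewrite (fsum_ord (b := l0)) => [|l hl]; last by rewrite la // (lin0 (loc_lina _ sp)) scaler0.
apply/funext => i; apply/funext => v.
change (loc a m (loc b n phi) i v - loc b n (loc a m phi) i v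
  = (\sum_(k < l0) binz m k *: loc (vprod a k b) (m + n - k%:Z) phi) i v).
rewrite (h3 N) ?(h4 N) ?(h1 N) ?(h2 N); try by rewrite /N; lia.
rewrite /locR (op_shift a _ (op b _ phi)) (op_shift b _ (op a _ phi)).
rewrite [i + n + m]addrAC (op_comm hL w0 hu hp).
rewrite (bigD1 (Ordinal T0)) //= [X in _ + X]big1 ?addr0; last first.
  move=> k k0; apply: fsum0 => l.
  case: (ltnP l l0) => [ll|/hl0 ->]; last by rewrite (lin0 (op_lina w0 hu hp _ _ _)) scaler0.
  rewrite hd ?scaler0 //; apply: (gN_comm0 hw).
    by apply: (prim_lt_neq1 hw); rewrite ltn_ord lt0n andbT; apply: contra k0 => /eqP e; apply/eqP/val_inj.
  by have := hDk k l ll; rewrite /N; lia.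
rewrite R0 expr0 invr1 (fsum_ord (b := l0)) => [|l hl]; last first.
  by rewrite la // (lin0 (op_lina w0 hu hp _ _ _)) scaler0.
have sumE (F : 'I_l0 -> int -> M -> M) : (\sum_(k < l0) F k) i v = \sum_(k < l0) F k i v.
  by elim/big_rec2: _ => // k x y _ <-.
rewrite sumE; apply: eq_bigr => l _.
rewrite (op_congr (hd _) hp (g := (l`!%:R * binz m l) *: gN (m + n - l%:Z) N)); last first.
  rewrite (rsub_id (gN m N)); apply: (gN_comm1 hw).
  have := hDk (Ordinal T0) l (ltn_ord l); rewrite [R (Ordinal T0) a]R0 => hd0.
  by have := ltn_ord l; rewrite /N; move: (d _) hd0 => x; lia.
rewrite (linZ (op_linf w0 hu hp _ _ v)) scalerA mulr1 mulKf ?pnatr_eq0 -?lt0n ?fact_gt0 //.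
change ((binz m l *: loc (vprod a l b) (m + n - l%:Z) phi) i v)
  with (binz m l *: loc (vprod a l b) (m + n - l%:Z) phi i v).
rewrite (h5 l N) ?ltn_ord //; last by rewrite /N; lia.
by rewrite /locR; have -> : i + (m + n - l%:Z) = i + m + n - l%:Z by lia.
Qed.

Definition idf : int -> M -> M := fun n v => if n == -1 then v else 0.

Lemma idf_field : is_field idf.
Proof.
split=> [n|v]; last by exists 0 => n n0; rewrite /idf ifF //; lia.
by rewrite /idf; case: eqP => _; [exact: lin_id | exact: lin_cst0].
Qed.

Lemma op_idf a f m v : op a f idf m v
  = (ico (expinf f) (- (m + 1)) - ico (expz 0 f) (m + 1)) *: u a (m + 1) v.
Proof.
rewrite op_def scalerBl; congr (_ - _).
  rewrite /opL (fsum_only (j := - (m + 1))) => [|i im].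
    rewrite opprK; congr (_ *: u _ _ _); rewrite /idf ifT //; lia.
  rewrite /idf ifF ?(lin0 (tw_linv hu _ _)) ?scaler0 //; move/eqP: im; lia.
rewrite /opR (fsum_only (j := m + 1)) => [|i im]; first by rewrite /idf ifT //; lia.
by rewrite /idf ifF ?scaler0 //; move/eqP: im; lia.
Qed.

(** A polynomial has the same expansion at 0 and at infinity, and the identity field commutes with
    every a. Thus non-negative modes kill the identity field, as they kill the vacuum. *)
Lemma op_poly_idf a (p : {poly K}) : op a (FracField.tofrac p) idf = (0 : int -> M -> M).
Proof.
apply/funext => m; apply/funext => v; rewrite op_idf expinf_poly expz_poly /psiz /=.
rewrite ico_evlN1 ico_evl1 oppr_le0 abszN; have -> : shiftX 0 = 'X :> {poly K} by rewrite /shiftX polyC0 addr0.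
by rewrite comp_polyXr subrr scale0r.
Qed.

Lemma idf_smooth : smooth_field idf.
Proof.
split; first exact: idf_field.
by exists (fun=> 0%N) => a f /(inJ0_poly hw)[p ->]; exact: op_poly_idf.
Qed.

Lemma loc_idf_pos a n : 0 <= n -> loc a n idf = 0.
Proof.
move=> n0; have [N0 h] := locE a n idf_smooth; rewrite (h N0) //; apply/funext => m.
have [p E] : exists p : {poly K}, gN n N0 = FracField.tofrac p.
  by apply: (inJ0_poly hw); apply: (gN_small hw).
by rewrite /locR E op_poly_idf.
Qed.

Lemma op_X1V_idf a m v : op a (X1 ^ (-1)) idf m v = u a (m + 1) v.
Proof.
rewrite op_idf; have -> : X1 ^ (-1) = rpw 1 1 :> ratfun K by rewrite /rpw expr1.
rewrite ico_expinf_rpw1 expz_rpw ?ico_geo 1?eq_sym ?oner_eq0 // expr1n sub0r add0n.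
case: (leP 0 (m + 1)) => hm; last by rewrite ifT ?subr0 ?scale1r //; lia.
rewrite ifF; last lia.
by rewrite binn mulr1 sub0r invrN1 exprS mulN1r mulrN opprK -exprD addnn -mul2n exprM sqrrN !expr1n scale1r.
Qed.

Lemma loc_idf_m1 a : loc a (-1) idf = u a.
Proof.
have [N1 h] := locE a (-1) idf_smooth; rewrite (h N1.+1) //; apply/funext => m; apply/funext => v.
rewrite /locR; transitivity (op a (X1 ^ (-1)) idf (m - 1) v); last by rewrite op_X1V_idf subrK.
have hi f : inJ 0%:Z f -> op a f idf = (0 : int -> M -> M) by move/(inJ0_poly hw) => [p ->]; exact: op_poly_idf.
rewrite (op_congr hi idf_field (f := X1 ^ (-1)) (g := gN (-1) N1.+1)) //.
have := gN_extra hw (d := 0) (D := 0) (N := N1.+1) isT; rewrite big1 ?addr0; last by move=> k _; rewrite big_ord0.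
by apply; lia.
Qed.

(** The function 1/(s - 1) is the sum of s^(-i), i >= 1, at infinity and minus the sum of s^i, i >=
    0, at 0. The two expansions pick out the creation part on the left and the annihilation part on
    the right. *)
Lemma op_X1V a phi m v : is_field phi -> op a (X1 ^ (-1)) phi (m - 1) v = normal_prod (u a) phi m v.
Proof.
move=> hp; have -> : X1 ^ (-1) = rpw 1 1 :> ratfun K by rewrite /rpw expr1.
have E1 i : ico (expinf (rpw 1 1 : ratfun K)) i = if 1 <= i then 1 else 0 by rewrite ico_expinf_rpw1 expr1n.
have E0 i : ico (expz 0 (rpw 1 1 : ratfun K)) i = if 0 <= i then -1 else 0.
  rewrite expz_rpw ?ico_geo 1?eq_sym ?oner_eq0 // sub0r add0n; case: leP => // _.
  by rewrite binn mulr1 invrN1 exprS mulN1r mulrN -exprD addnn -mul2n exprM sqrrN !expr1n.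
rewrite normal_prodE op_def; congr (_ + _).
  rewrite /opL (fsum_shift _ 1) fsum_int_pos => [|i i0]; last by rewrite E1 ifF ?scale0r //; lia.
  apply: eq_fsum => i; rewrite E1 ifT ?scale1r; last lia.
  by congr (u _ _ (phi _ _)); lia.
rewrite /opR fsumN; last exact: (opR_fins hu hp).
rewrite fsum_int_pos => [|i i0]; last by rewrite E0 ifF ?scale0r ?oppr0 //; lia.
by apply: eq_fsum => i; rewrite E0 /= scaleN1r opprK addrAC.
Qed.

(** The germ of 1/(s - 1) at s = 1 alone is 1/(s - 1) plus corrections at the other roots of unity.
    By [gN_extra] the corrections are rotated germs of (s - 1)^n at s = 1, that is, non-negative
    modes of R_(w^k) a: these are the extra terms of Y_W. *)
Lemma loc_m1 a phi m v : smooth_field phi -> loc a (-1) phi m v = normal_prod (u a) phi m v +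
  \sum_(k < T | (0 < k)%N) \sum_(n \in [set: nat]) ((w ^+ k - 1) ^+ n.+1)^-1 *: loc (R k a) n%:Z phi (m - n%:Z - 1) v.
Proof.
move=> sp; have [hp [d hd]] := sp.
have hT (k : 'I_T) : exists D : nat, forall n : nat, (D <= n)%N -> loc (R k a) n%:Z phi = 0.
  by have [D hD] := loc_trunc (R k a) sp; exists `|D|%N => n hn; apply: hD; lia.
have [f hf] := choice hT.
pose D := (\max_(k < T) f k + d a)%N.
have hD (k : 'I_T) (n : nat) : (D <= n)%N -> loc (R k a) n%:Z phi = 0.
  by move=> hn; apply: hf; apply: leq_trans (leq_bigmax k) _; apply: leq_trans hn; exact: leq_addr.
have [N1 h1] := locE a (-1) sp.
have [N2 h2] : exists N2 : nat, forall k N : nat, (k < T)%N -> (N2 <= N)%N -> forall n : nat, (n < D)%N -> loc (R k a) n%:Z phi = locR (R k a) n%:Z phi N.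
  apply: (@uniform_bound (fun k N : nat => forall n : nat, (n < D)%N -> loc (R k a) n%:Z phi = locR (R k a) n%:Z phi N)) => k.
  have [N2 h2] := @uniform_bound (fun (n N : nat) => loc (R k a) n%:Z phi = locR (R k a) n%:Z phi N) D (fun n : nat => locE (R k a) n%:Z sp).
  by exists N2 => N hN n nD; exact: h2.
pose N := (N1 + N2 + d a).+1.
have hJ := gN_extra hw (d := (d a)%:Z) (D := D) (N := N).
rewrite (h1 N) /locR; last by rewrite /N; lia.
set S := \sum_(k < T | _) _ in hJ.
have E : op a (gN (-1) N) phi = op a (X1 ^ (-1) + S) phi.
  apply/esym/(op_congr (hd a) hp); rewrite addrAC; apply: hJ; rewrite /D /N; lia.
have ol := op_linf w0 hu hp a (m - 1) v.
have EX := op_X1V a m v hp; rewrite -EX {EX} E; transitivity (op a (X1 ^ (-1)) phi (m - 1) v + op a S phi (m - 1) v); first exact: (linD ol).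
congr (_ + _).
transitivity (\sum_(k < T | (0 < k)%N) op a (\sum_(n < D) (w ^+ k / (w ^+ k - 1) ^+ n.+1) *: rsub (w ^+ k) (gN n%:Z N)) phi (m - 1) v).
  exact: (lin_sum _ _ _ ol).
apply: eq_bigr => k k0.
rewrite (fsum_ord (b := D)) => [|n nD]; last by rewrite hD // scaler0.
transitivity (\sum_(n < D) op a ((w ^+ k / (w ^+ k - 1) ^+ n.+1) *: rsub (w ^+ k) (gN n%:Z N)) phi (m - 1) v).
  exact: (lin_sum _ _ _ ol).
apply: eq_bigr => n _; rewrite (h2 k N) ?ltn_ord //; last by rewrite /N; lia.
rewrite /locR (op_R w0 hu hp _ _ _ _ (ltn_ord k)) scalerA [in RHS]mulrC; have -> : m - n%:Z - 1 + n%:Z = m - 1 by lia.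
exact: (linZ ol).
Qed.

Definition lact (x : loop L) phi : int -> M -> M :=
  lie_lift (fun a (f : laurent_dalg K) => \sum_(n \in [set: int]) ico f n *: loc a n phi) x.

Section OneSmooth.
Context {phi : int -> M -> M} (sp : smooth_field phi).

Lemma lact_fins a (f : laurent K) : fins (fun n => ico f n *: loc a n phi).
Proof.
have [d hd] := ico_bounded f; have [D hD] := loc_trunc a sp.
by apply: (fins_int (a := d) (b := D)) => i hi; [rewrite hd ?scale0r | rewrite hD ?scaler0].
Qed.

Lemma lact_bil : liebil (fun a (f : laurent_dalg K) => \sum_(n \in [set: int]) ico f n *: loc a n phi).
Proof.
split; first split.
- move=> f; apply: lin_bigfsum => [n|a]; last exact: lact_fins.
  by apply: lin_scale; exact: loc_lina.
- move=> a; apply: lin_bigfsum => [n|f]; last exact: lact_fins.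
  by move=> c f g; rewrite icoD icoZ scalerDl scalerA.
move=> a f; rewrite [X in _ + X](_ : _ = - \sum_(n \in [set: int]) ico f n *: loc (vD a) n phi) ?subrr //.
rewrite fsumN; last exact: lact_fins.
rewrite (fsum_shift _ (-1)); apply: eq_fsum => n.
rewrite (loc_D _ _ sp) ico_der subrK scalerA -scaleNr; congr (_ *: _).
by rewrite mulrN opprK mulrC.
Qed.

Lemma lact_lin : linear (fun x => lact x phi).
Proof. exact: (lie_lift_linear lact_bil). Qed.

Lemma lactE a (f : laurent K) : lact (lrho a f) phi = \sum_(n \in [set: int]) ico f n *: loc a n phi.
Proof. rewrite lrhoE; exact: (lie_liftE _ _ lact_bil). Qed.

Lemma lact_mode a n : lact (mode a n) phi = loc a n phi.
Proof.
rewrite modeE lactE (fsum_only (j := n)) ?ico_mono ?eqxx ?scale1r // => i ni.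
by rewrite ico_mono (negbTE ni) scale0r.
Qed.

Lemma lact_smooth x : smooth_field (lact x phi).
Proof.
move: x; apply: loop_ind => [|a f].
  split; first by rewrite (lin0 lact_lin); exact: smooth_field_sub.1.
  by move=> c x y sx sy; rewrite lact_lin; exact: smooth_field_sub.2.
rewrite lactE; have [r [ur hr]] := finsP (lact_fins a f); rewrite (fsumE ur hr).
apply: smooth_sum => n _.
rewrite -[_ *: _]addr0; apply: smooth_field_sub.2; [exact: loc_smooth | exact: smooth_field_sub.1].
Qed.

End OneSmooth.

Lemma lact_linphi x c phi psi : smooth_field phi -> smooth_field psi ->
  lact x (c *: phi + psi) = c *: lact x phi + lact x psi.
Proof.
move=> sp sq; have spq := smooth_field_sub.2 c _ _ sp sq.
move: x; apply: loop_eq_lin; first exact: lact_lin.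
  by apply: lin_add; [apply: lin_scale|]; exact: lact_lin.
move=> a f; rewrite !lactE // scaler_fsum; last exact: lact_fins.
rewrite -fsumD; [|by apply: fins_map (lact_fins sp a f); rewrite scaler0|exact: lact_fins].
by apply: eq_fsum => n; rewrite loc_linphi // scalerDr !scalerA mulrC.
Qed.

Lemma loc_fsum a m (F : int -> int -> M -> M) : (forall n, smooth_field (F n)) -> fins F ->
  loc a m (\sum_(n \in [set: int]) F n) = \sum_(n \in [set: int]) loc a m (F n).
Proof.
move=> hF fF; have [r [ur hr]] := finsP fF.
have l0 : loc a m 0 = 0.
  have := loc_linphi a m (-1) smooth_field_sub.1 smooth_field_sub.1.
  by rewrite scaler0 addr0 => {1}->; rewrite scaleN1r addNr.
rewrite !(fsumE ur) // => [|n nr]; last by rewrite hr.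
elim: (r) => [|n s IH]; first by rewrite !big_nil.
rewrite !big_cons -[F n]scale1r loc_linphi //; last by apply: smooth_sum => k _.
by rewrite !scale1r IH.
Qed.

Lemma lact_br x y phi : smooth_field phi ->
  lact (lbr x y) phi = lact x (lact y phi) - lact y (lact x phi).
Proof.
move=> sp; have sx z := lact_smooth sp z.
have sl z c x' y' : lact z (lact (c *: x' + y') phi) = c *: lact z (lact x' phi) + lact z (lact y' phi).
  by rewrite (lact_lin sp) lact_linphi.
move: x; apply: loop_eq_lin.
- exact: (lin_comp (lact_lin sp) (lbr_linl hL y)).
- by apply: lin_add; [exact: lact_lin | apply: lin_opp => c x x'; exact: sl].
move=> a f; move: y; apply: loop_eq_lin.
- exact: (lin_comp (lact_lin sp) (lbr_linr hL _)).
- by apply: lin_add; [move=> c x x'; exact: sl | apply: lin_opp; exact: lact_lin].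
move=> b g; have [d hd] := ico_bounded f; have [d' hd'] := ico_bounded g.
have [A hA] := loc_trunc a sp; have [B hB] := loc_trunc b sp.
have l0 c n : loc c n 0 = 0.
  have := loc_linphi c n (-1) smooth_field_sub.1 smooth_field_sub.1.
  by rewrite scaler0 addr0 => {1}->; rewrite scaleN1r addNr.
have lZ c n k psi : smooth_field psi -> loc c n (k *: psi) = k *: loc c n psi.
  move=> sq; rewrite -[k *: psi]addr0 loc_linphi // ?l0 ?addr0 //; exact: smooth_field_sub.1.
have sZ k psi : smooth_field psi -> smooth_field (k *: psi).
  move=> sq; rewrite -[_ *: _]addr0; apply: smooth_field_sub.2 => //; exact: smooth_field_sub.1.
have F1' : fins2 (fun j i => (ico f i * ico g j) *: loc a i (loc b j phi)).
  apply: (fins2_strip (d := d') (D := B) (e := d)) => [j i h|j i h|j i h|j].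
  - by rewrite hd' // mulr0 scale0r.
  - by rewrite hB // l0 scaler0.
  - by rewrite hd // mul0r scale0r.
  - by have [C hC] := loc_trunc a (loc_smooth b j sp); exists C => i iC; rewrite hC // scaler0.
have F1 := fins2_swap F1'.
have F2 : fins2 (fun i j => (ico f i * ico g j) *: loc b j (loc a i phi)).
  apply: (fins2_strip (d := d) (D := A) (e := d')) => [i j h|i j h|i j h|i].
  - by rewrite hd // mul0r scale0r.
  - by rewrite hA // l0 scaler0.
  - by rewrite hd' // mulr0 scale0r.
  - by have [C hC] := loc_trunc b (loc_smooth a i sp); exists C => j jC; rewrite hC // scaler0.
have -> : lact (lrho a f) (lact (lrho b g) phi) =
   \sum_(i \in [set: int]) \sum_(j \in [set: int]) (ico f i * ico g j) *: loc a i (loc b j phi).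
  rewrite (lactE (sx _)); apply: eq_fsum => i; rewrite lactE // loc_fsum => [|j|]; last exact: lact_fins.
    rewrite scaler_fsum; last by apply: fins_map (lact_fins sp b g); exact: l0.
    by apply: eq_fsum => j; rewrite lZ ?scalerA //; exact: loc_smooth.
  by apply: sZ; exact: loc_smooth.
have -> : lact (lrho b g) (lact (lrho a f) phi) =
   \sum_(i \in [set: int]) \sum_(j \in [set: int]) (ico f i * ico g j) *: loc b j (loc a i phi).
  rewrite exchange_fins2 // (lactE (sx _)); apply: eq_fsum => j; rewrite lactE // loc_fsum => [|i|]; last exact: lact_fins.
    rewrite scaler_fsum; last by apply: fins_map (lact_fins sp a f); exact: l0.
    by apply: eq_fsum => i; rewrite lZ ?scalerA 1?mulrC //; exact: loc_smooth.
  by apply: sZ; exact: loc_smooth.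
rewrite fsum2B //; have [k0 hk0] := vprod_trunc hL a b.
have lz n : loc 0 n phi = 0 by exact: (lin0 (loc_lina n sp)).
transitivity (\sum_(k < k0) ((k`!%:R)^-1 *: lact (lrho (vprod a k b) (iter k lder f * g)) phi)).
  have -> : lbr (lrho a f) (lrho b g) = \sum_(k \in [set: nat]) (k`!%:R)^-1 *: lrho (vprod a k b) (iter k lder f * g).
    exact: lbrE.
  rewrite (fsum_ord (b := k0)) => [|k hk]; last by rewrite hk0 // (lin0 (lrho_linl _)) scaler0.
  by rewrite (lin_sum _ _ _ (lact_lin sp)); apply: eq_bigr => k _; rewrite (linZ (lact_lin sp)).
have [C hC] : exists C : int, forall (k : 'I_k0) n, C <= n -> loc (vprod a k b) n phi = 0.
  have h (k : 'I_k0) : exists C : nat, forall n, C%:Z <= n -> loc (vprod a k b) n phi = 0.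
    by have [D hD] := loc_trunc (vprod a k b) sp; exists `|D|%N => n hn; apply: hD; lia.
  have [c hc] := choice h; exists (\max_k c k)%N%:Z => k n hn; apply: hc; apply: le_trans hn.
  by rewrite lez_nat; exact: leq_bigmax.
transitivity (\sum_(i \in [set: int]) \sum_(j \in [set: int]) \sum_(k < k0)
    (ico f i * ico g j * binz (1 * i) k) *: loc (vprod a k b) (i + j - 1 * k%:Z) phi); last first.
  apply: eq_fsum => i; apply: eq_fsum => j; rewrite -scalerBr loc_comm //.
  rewrite (fsum_ord (b := k0)) => [|k hk]; last by rewrite hk0 // lz scaler0.
  by rewrite scaler_sumr; apply: eq_bigr => k _; rewrite scalerA !mul1r.
rewrite (fsum2_sum (M := (int -> M -> M) : lmodType K)); last first.
  move=> k; apply: (fins2_cone (d := d) (e := d') (E := C + k%:Z)) => i j h.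
  - by rewrite hd // !mul0r scale0r.
  - by rewrite hd' // mulr0 mul0r scale0r.
  - by rewrite hC ?scaler0 //; lia.
apply: eq_bigr => k _; rewrite (conv_binz (P := iter k lder f) g (hC k)) => [|i]; last first.
  by rewrite !mul1r ico_iter_lder.
by rewrite lactE.
Qed.

Section FieldsOfStates.
Context {V : lmodType K} {va : loop L -> V -> V} {v0 : V} (hV : vacuum_module va v0).

(** The identity field is killed by regular series and fixed by c(-1), so the universal property of
    the vacuum module sends the vacuum to it. *)
Lemma states_ex : exists Y : V -> int -> M -> M,
  [/\ linear Y, Y v0 = idf, forall x A, Y (va x A) = lact x (Y A) & forall A, smooth_field (Y A)].
Proof.
apply: (vm_univ hV (op := lact) (w0 := idf) smooth_field_sub idf_smooth).
- by move=> x phi sp; exact: lact_smooth.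
- by move=> c x y phi sp; exact: lact_lin.
- by move=> x c phi psi sp sq; exact: lact_linphi.
- by move=> x y phi sp; exact: lact_br.
- move=> a f hf; rewrite lactE; last exact: idf_smooth.
  apply: fsum0 => n; case: (ltP n 0) => [/hf ->|n0]; first by rewrite scale0r.
  by rewrite loc_idf_pos // scaler0.
rewrite lact_mode ?loc_idf_m1; last exact: idf_smooth.
by apply/funext => n; apply/funext => v; rewrite (tw_c hu).
Qed.

End FieldsOfStates.

End Localisation.

(** * Smooth modules as twisted fields *)

Section ModuleFields.
Context {K : numFieldType} {L : vla K} (hL : vertex_lie_algebra L).

Lemma smooth_twisted (hX : graded_vla L) (M : lmodType K) (act : loop L -> M -> M) :
  smooth_module act -> twisted_fields (T := 1) (w := 1) (fun a n v => act (mode a n) v).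
Proof.
move=> [[hl hv hb] hc hs ht]; have ax v : linear (fun x => act x v) by move=> c x y; exact: hl.
split.
- by move=> n v; exact: (lin_comp (ax v) (mode_lin n)).
- by move=> a n; exact: hv.
- exact: hs.
- by move=> a n v; rewrite (mode_D) (linZ (ax v)).
- move=> k a n v; rewrite ltnS leqn0 => /eqP ->; have e1 := vR0 hX 1 a; have e2 : ((1 : K) ^+ 0) ^ (n + 1) = 1 by rewrite expr0 exp1rz.
  rewrite e1 e2; exact: esym (scale1r _).
- move=> a m b n v; rewrite big_ord1 (vR0 hX) -(hb _ _ v I I) -lbr_lie_br (lbr_modes hL).
  rewrite (lin_fsum (ax v)); last first.
    by have [k0 hk] := vprod_trunc hL a b; apply: (fins_nat (b := k0)) => k kk; rewrite hk // (lin0 (mode_lin _)) scaler0.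
  by apply: eq_fsum => k; rewrite (linZ (ax v)) expr0 exp1rz mulr1.
move=> n v; case: eqP => [->|/eqP n1]; first exact: hc.
by rewrite mode_c // (lin0 (ax v)).
Qed.

Section Twisted.
Context {T : nat} {w : K} (hw : T.-primitive_root w) (hS : vla_automorphism L T).
Local Notation R k := (@vR _ L w k).
Let w0 : w != 0 := prim_neq0 hw.
Let T0 : (0 < T)%N := prim_order_gt0 hw.
Let hX := vla_graded_vla hL hS.
Local Notation g k := (LA (w ^+ k) (@vR _ L w k)).
Let hz k := zaut_vR hL k hS w0.

Lemma vR_mod j a : R (j %% T)%N a = R j a.
Proof.
rewrite [in RHS](divn_eq j T) -(vR_comp hX) (vR_order hX) //; first exact: prim_expr_order hw.
exact: vsigma_order hS.
Qed.

Lemma lsub_comp (c d : K) (f : laurent K) : lsub c (lsub d f) = lsub (c * d) f.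
Proof. by apply: laurentP => n; rewrite !ico_sub expfzMl mulrA. Qed.

Lemma LA_vR_comp j k x : g j (g k x) = g (j + k) x.
Proof.
move: x; apply: loop_eq_lin.
- exact: (lin_comp (LA_linear (hz j)) (LA_linear (hz k))).
- exact: LA_linear.
move=> a f; rewrite !(LA_rho (hz _)) (linZ (LA_linear (hz j))) (LA_rho (hz j)) (vR_comp hX) scalerA -invfM -exprD addnC.
by rewrite lsub_comp -invfM -exprD.
Qed.

Lemma LA_vR_mod j x : g (j %% T)%N x = g j x.
Proof.
have E : @vR _ L w (j %% T) = @vR _ L w j by apply/funext => a; exact: vR_mod.
by rewrite E (prim_expr_mod hw).
Qed.

Lemma sum_mod_shift (V : zmodType) (F : nat -> V) j : (forall k, F (k %% T)%N = F k) ->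
  \sum_(k < T) F (j + k)%N = \sum_(k < T) F k.
Proof.
move=> hF; elim: j => [|j IH]; first by apply: eq_bigr.
rewrite -IH; have [t Et] : exists t, T = t.+1 by exists T.-1; rewrite prednK.
rewrite -!(big_mkord xpredT (fun k => F (_ + k)%N)) Et big_nat_recr //= [RHS]big_nat_recl //= addrC.
congr (_ + _); last by apply: eq_bigr => k _; rewrite addSnnS.
by rewrite addSnnS -Et addn0 -hF modnDr hF.
Qed.

Lemma modeG_orb a n : modeG T w a n = \sum_(k < T) g k (mode a n).
Proof. by apply: eq_bigr => k _; rewrite (LA_mode (hz k)). Qed.

Definition orbit_sum x : loop L := \sum_(k < T) g k x.

Lemma orbit_sum_lin : linear orbit_sum.
Proof. by move=> c x y; rewrite /orbit_sum scaler_sumr -big_split; apply: eq_bigr => k _; rewrite (LA_linear (hz k)). Qed.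

Lemma orbit_sumG x : loopG w (orbit_sum x).
Proof.
move=> j; rewrite gactE /orbit_sum (lin_sum _ _ _ (LA_linear (hz j))).
under eq_bigr do rewrite LA_vR_comp.
by apply: (sum_mod_shift (F := fun k => g k x)) => k; exact: LA_vR_mod.
Qed.

Lemma orbit_sum_br x y : lbr (orbit_sum x) (orbit_sum y) = orbit_sum (lbr (orbit_sum x) y).
Proof.
rewrite {2}/orbit_sum (lin_sum _ _ _ (lbr_linr hL _)); apply: eq_bigr => k _.
by rewrite (LA_hom hL (hz k)); congr lbr; have := orbit_sumG x k; rewrite gactE.
Qed.

Lemma loopG_sub : subspace (loopG (L := L) w).
Proof.
split=> [k|c x y hx hy k]; rewrite gactE; have gl := LA_linear (hz k); first by rewrite (lin0 gl).
by have := hx k; have := hy k; rewrite !gactE gl => -> ->.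
Qed.

(** The element a^Gamma(n) is the orbit sum of a(n). The module axioms are available on invariant
    elements only, so each relation is first written between orbit sums; [Ox, Oy] = O[Ox, y] leaves
    a single sum over Gamma in the commutator. *)
Lemma smoothG_twisted (M : lmodType K) (act : loop L -> M -> M) :
  smooth_moduleG T w act -> twisted_fields (T := T) (w := w) (fun a n v => act (modeG T w a n) v).
Proof.
move=> [[hl hv hb] hc hs _].
have [P EP] : exists P : loop L -> Prop, P = loopG w by exists (loopG w).
have PO x : P (orbit_sum x) by rewrite EP; exact: orbit_sumG.
have Psub : subspace P by rewrite EP; exact: loopG_sub.
have Pfix k x : P x -> g k x = x by rewrite EP => /(_ k); rewrite gactE.
have Pc : P (mode (vc L) (-1)).
  by rewrite EP => k; rewrite gactE (LA_mode (hz k)) opprK subrr expr0z scale1r (zaut_c (hz k)).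
rewrite -EP in hl hv hb; rewrite -lbr_lie_br in hb; move: hl hv hb hc hs {EP} => hl hv hb hc hs.
have O := orbit_sum_lin; have Obr := orbit_sum_br; have mG : forall a n, modeG T w a n = orbit_sum (mode a n) by exact: modeG_orb.
have OE x k : orbit_sum (g k x) = orbit_sum x.
  rewrite -[RHS](Pfix k) // /orbit_sum (lin_sum _ _ _ (LA_linear (hz k))).
  by apply: eq_bigr => j _; rewrite !LA_vR_comp addnC.
move: orbit_sum PO O Obr mG OE => Os PO O Obr mG OE.
have G0 := Psub.1.
have a0 v : act 0 v = 0 by have := hl (-1) 0 0 v G0 G0; rewrite scaler0 addr0 => {1}->; rewrite scaleN1r addNr.
have aO v : linear (fun x => act (Os x) v) by move=> c x y; rewrite O hl.
have ml n : linear (fun a => Os (mode a n)) by exact: (lin_comp O (mode_lin n)).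
split.
- move=> n v c a b; rewrite !mG; exact: (lin_comp (aO v) (mode_lin n) c a b).
- by move=> a n; rewrite mG; apply: hv.
- exact: hs.
- by move=> a n v; rewrite !mG mode_D; exact: (linZ (aO v)).
- move=> k a n v kT; rewrite !mG; have e := OE (mode a n) k; rewrite (LA_mode (hz k)) in e.
  rewrite -e; have e' := linZ (aO v) ((w ^+ k) ^ (- n - 1)) (mode (R k a) n); rewrite e' scalerA -expfzDr ?expf_neq0 //.
  rewrite (_ : n + 1 + (- n - 1) = 0); last lia.
  by rewrite expr0z; exact: esym (scale1r _).
- move=> a m b n v; rewrite !mG -hb // Obr -(mG a m).
  have [k0 hk] : exists k0, forall (k : 'I_T) l, (k0 <= l)%N -> vprod (R k a) l b = 0 by exact: (trunc_R hL).
  have e1 : act (Os (lbr (modeG T w a m) (mode b n))) v =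
     \sum_(k < T) (w ^+ k) ^ (- m - 1) *: act (Os (lbr (mode (R k a) m) (mode b n))) v.
    rewrite /modeG (lin_sum _ _ _ (lbr_linl hL _)) (lin_sum _ _ _ (aO v)); apply: eq_bigr => k _.
    by rewrite (linZ (lbr_linl hL _)) (linZ (aO v)).
  rewrite e1; apply: eq_bigr => k _; rewrite (lbr_modes hL).
  rewrite (fsum_ord (b := k0)) => [|l hl']; last by rewrite hk // (lin0 (mode_lin _)) scaler0.
  rewrite (fsum_ord (b := k0)) => [|l hl']; last first.
    by rewrite hk // mG (lin0 (mode_lin _)) (lin0 O) a0 scaler0.
  rewrite (lin_sum _ _ _ (aO v)) scaler_sumr; apply: eq_bigr => l _.
  by rewrite mG (linZ (aO v)) scalerA mulrC.
(* All T terms in the orbit of c(-1) are equal, and level 1/T turns their sum into the identity. *)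
move=> n v; have Oc m : Os (mode (vc L) m) = (if m == -1 then T%:R else 0) *: mode (vc L) (-1).
  case: eqP => [->|/eqP m1]; last by rewrite mode_c // (lin0 O) scale0r.
  rewrite -mG /modeG (eq_bigr (fun=> mode (vc L) (-1))) => [|k _].
    by rewrite sumr_const card_ord scaler_nat.
  by rewrite opprK subrr expr0z scale1r (zaut_c (hz k)).
rewrite mG Oc; case: eqP => _; last by rewrite scale0r a0.
have := hl T%:R (mode (vc L) (-1)) 0 v Pc G0; rewrite addr0 a0 addr0 => ->.
by rewrite hc scalerA divff ?scale1r // pnatr_eq0 -lt0n.
Qed.

End Twisted.
End ModuleFields.

(** * The maps Y_M and Y_W *)

Section StateFields.
Context {K : numFieldType} {L : vla K} (hL : vertex_lie_algebra L) (hX : graded_vla L).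
Context {T : nat} {w : K} (hw : T.-primitive_root w).
Context {V : lmodType K} {va : loop L -> V -> V} {v0 : V} (hV : vacuum_module va v0).
Context {M : lmodType K} {u : L -> int -> M -> M} (hu : twisted_fields (T := T) (w := w) u).
Implicit Types (a b : L) (m n : int) (v : M) (A B : V) (f g : ratfun K).
Local Notation R k := (@vR _ L w k).
Local Notation lact := (@lact K L T M u).
Local Notation loc := (@loc K L T M u).
Local Notation smooth_field := (@smooth_field K L T w M u).

(** A homomorphism of modules over the loop algebra from the vacuum module to the local fields,
    taking the vacuum to the identity field. *)
Record state_map (Y : V -> int -> M -> M) : Prop := {
  stm_lin : linear Y;
  stm_v0 : Y v0 = @idf K M;
  stm_act : forall x A, Y (va x A) = lact x (Y A);
  stm_smooth : forall A, smooth_field (Y A) }.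

Lemma state_map_ex : exists Y, state_map Y.
Proof. by have [Y [h1 h2 h3 h4]] := states_ex hL hX hw hu hV; exists Y. Qed.

Definition field_axioms (extra : (V -> int -> M -> M) -> L -> V -> int -> M -> M) (Y : V -> int -> M -> M) : Prop :=
  (forall n v, linear (fun A => Y A n v)) /\
  (forall A n, linear (Y A n)) /\
  (forall A v, exists d : int, forall n, d <= n -> Y A n v = 0) /\
  (forall n v, Y v0 n v = if n == -1 then v else 0) /\
  (forall a n v, Y (va (mode a (-1)) v0) n v = u a n v) /\
  (forall a B m v, Y (va (mode a (-1)) B) m v =
     normal_prod (Y (va (mode a (-1)) v0)) (Y B) m v + extra Y a B m v).

Definition extraW (Y : V -> int -> M -> M) a B m v : M :=
  \sum_(k < T | (0 < k)%N) \sum_(n \in [set: nat])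
       ((w ^+ k - 1) ^+ n.+1)^-1 *: Y (va (mode (R k a) n%:Z) B) (m - n%:Z - 1) v.

Section OneMap.
Context {Y : V -> int -> M -> M} (hY : state_map Y).

Lemma stm_mode a n A : Y (va (mode a n) A) = loc a n (Y A).
Proof. by rewrite (stm_act hY) (lact_mode hw hu) //; exact: stm_smooth. Qed.

Lemma stm_m1 a : Y (va (mode a (-1)) v0) = u a.
Proof. by rewrite stm_mode (stm_v0 hY); exact: (loc_idf_m1 hw hu). Qed.

Lemma stm_axioms : field_axioms extraW Y.
Proof.
split; first by move=> n v c A B; rewrite (stm_lin hY).
split; first by move=> A n; exact: (stm_smooth hY A).1.1.
split; first by move=> A; exact: (stm_smooth hY A).1.2.
split; first by move=> n v; rewrite (stm_v0 hY).
split; first by move=> a n v; rewrite stm_m1.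
move=> a B m v; rewrite stm_m1 stm_mode (loc_m1 hw hu) //; last exact: stm_smooth.
congr (_ + _); rewrite /extraW; apply: eq_bigr => k _; apply: eq_fsum => n.
by rewrite stm_mode.
Qed.

End OneMap.

(** For j = 0 it reads (D^n a)(-1) = n! a(-n-1). A recursion that mentions only modes a(-1)
    therefore reaches all creation modes. *)
Lemma mode_iter_D a (n j : nat) :
  j`!%:R *: mode (iter n (@vD _ L) a) (- j.+1%:Z) = (j + n)`!%:R *: mode a (- (j + n).+1%:Z).
Proof.
elim: n j => [|n IH] j; first by rewrite addn0.
rewrite iterS mode_D scalerA -addSnnS -IH; congr (_ *: mode _ _); last lia.
by rewrite mulrNz opprK factS natrM mulrC.
Qed.

Lemma generates_T : generates (L := L) setT.
Proof. by move=> a; apply: lspan_incl; left; exists 0%N, a. Qed.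

(* Every state is a combination of the vacuum and of the a(-1)B; the non-negative
   modes met in the extra terms do not lengthen words. *)
Lemma field_axioms_uniq Y Y' : field_axioms extraW Y -> field_axioms extraW Y' ->
  forall A n v, Y A n v = Y' A n v.
Proof.
move=> [l1 [_ [_ [z1 [m1 p1]]]]] [l2 [_ [_ [z2 [m2 p2]]]]].
suff H j A : neg_filt (va := va) (v0 := v0) setT j A -> forall n v, Y A n v = Y' A n v.
  by move=> A; have [j hj] := neg_filt_all hL hV generates_T A; exact: H hj.
elim: j A => [|j IH] A.
  move=> hA n v; apply: (lin_eq_span (l1 n v) (l2 n v) _ hA) => B [i [i0 hB]].
  move: i0; rewrite leqn0 => /eqP e; rewrite e in hB; have -> : B = v0 by inversion hB.
  by rewrite z1 z2.
have step B : neg_word (va := va) (v0 := v0) setT j.+1 B -> forall n v, Y B n v = Y' B n v.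
  move=> h; inversion h as [|j' q a C Sa hC]; subst.
  have hC' : neg_filt (va := va) (v0 := v0) setT j C by apply: lspan_incl; exists j.
  have e := mode_iter_D a q 0; rewrite fact0 scale1r add0n in e.
  have -> : va (mode a (- q.+1%:Z)) C = (q`!%:R)^-1 *: va (mode (iter q (@vD _ L) a) (-1)) C.
    by rewrite e (linZ (vm_linx hV C)) scalerA mulVf ?scale1r // pnatr_eq0 -lt0n fact_gt0.
  move=> n v; rewrite (linZ (l1 n v)) (linZ (l2 n v)); congr (_ *: _).
  move: (iter q _ a) => b; rewrite p1 p2; congr (_ + _).
    rewrite !normal_prodE; congr (_ + _); apply: eq_fsum => i; rewrite m1 m2; first by rewrite IH.
    by rewrite IH.
  apply: eq_bigr => k _; apply: eq_fsum => i; congr (_ *: _); apply: IH.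
  exact: (neg_filt_mode hL hV generates_T).
move=> hA n v; apply: (lin_eq_span (l1 n v) (l2 n v) _ hA) => B [i [ij hB]].
have [e|ne] := eqVneq i j.+1; first by rewrite e in hB; exact: step.
by apply: IH; apply: lspan_incl; exists i; split=> //; lia.
Qed.

Section Derivation.
Context {dV : V -> V} (dlin : linear dV) (d0 : dV v0 = 0)
  (dact : forall x A, dV (va x A) = va (ldelta x) A + va x (dV A)).

(** The modes of the derivative d/dx phi(x). *)
Definition dfield (phi : int -> M -> M) : int -> M -> M := fun n v => - n%:~R *: phi (n - 1) v.

Let w0 := prim_neq0 hw.

Lemma rat_scaleAr c f g : c *: (f * g) = f * (c *: g) :> ratfun K.
Proof. by rewrite !ratZ mulrCA. Qed.

Lemma gN_X n N : FracField.tofrac 'X * gN (K := K) (T := T) (n - 1) N = gN (T := T) n N + gN (T := T) (n - 1) N.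
Proof.
have E : FracField.tofrac 'X = X1 + 1 :> ratfun K by rewrite /X1 tofracB tofrac1 subrK.
have h (F : fieldType) (x y : F) : x != 0 -> (x + 1) * (x ^ (n - 1) * y) = x ^ n * y + x ^ (n - 1) * y.
  by move=> x0; rewrite mulrDl mul1r mulrA -{1}[x]expr1z -expfzDr //; have -> : 1 + (n - 1) = n by lia.
rewrite E; exact: (h _ _ _ (X1_neq0 (K := K))).
Qed.

Lemma dfield_aux (W : lmodType K) (c x y : K) (z : W) : c *: (- (x + y) *: z) = - x *: (c *: z) + (- y * c) *: z.
Proof. by rewrite !scalerA -scalerDl -mulrDl -opprD mulrC. Qed.

Lemma opL_dfield a (p p' : laurent K) phi m v : is_field phi -> (forall i, ico p' i = - i%:~R * ico p i) ->
  opL (u := u) a p (dfield phi) m v = - m%:~R *: opL (u := u) a p phi (m - 1) v + opL (u := u) a p' phi (m - 1) v.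
Proof.
move=> hp Ei; rewrite /opL scaler_fsum; last exact: (opL_fins w0 hu hp).
rewrite -fsumD; [|by apply: fins_map (opL_fins w0 hu hp _ _ _ _); rewrite scaler0|exact: (opL_fins w0 hu hp)].
apply: eq_fsum => i; rewrite (Ei i); have -> : dfield phi (m + i) v = - (m%:~R + i%:~R) *: phi (m - 1 + i) v.
  by rewrite -rmorphD /dfield addrAC.
by rewrite (linZ (tw_linv hu _ _)); exact: dfield_aux.
Qed.

Lemma opR_dfield a (p p' : laurent K) phi m v : is_field phi -> (forall i, ico p' i = i%:~R * ico p i) ->
  opR (u := u) a p (dfield phi) m v = - m%:~R *: opR (u := u) a p phi (m - 1) v + opR (u := u) a p' phi (m - 1) v.
Proof.
move=> hp Ez; rewrite /opR scaler_fsum; last exact: (opR_fins hu hp).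
rewrite -fsumD; [|by apply: fins_map (opR_fins hu hp _ _ _ _); rewrite scaler0|exact: (opR_fins hu hp)].
apply: eq_fsum => i; rewrite (Ez i); have -> : dfield phi (m - i) (u a i v) = - (m%:~R - i%:~R) *: phi (m - 1 - i) (u a i v).
  by rewrite -rmorphB /dfield addrAC.
by rewrite -[X in (X * ico _ _) *: _]opprK; exact: dfield_aux.
Qed.

(** Differentiating Res_y f(y/x) [a(y), phi(x)] in x also differentiates f, and x d/dx f(y/x) = - s
    f'(s). *)
Lemma op_dfield a f phi m v : is_field phi ->
  op (u := u) a f (dfield phi) m v =
  - m%:~R *: op (u := u) a f phi (m - 1) v + op (u := u) a (FracField.tofrac 'X * rder f) phi (m - 1) v.
Proof.
move=> hp; have EX : FracField.tofrac 'X * rder f = FracField.tofrac ('X - 0%:P) * rder f :> ratfun K by rewrite polyC0 subr0.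
have Ei i : ico (expinf (FracField.tofrac 'X * rder f)) i = - i%:~R * ico (expinf f) i.
  rewrite EX rmorphM /= expinf_Xs scale0r subr0 ico_mulmono expinf_der ico_derinf.
  by congr (_ * ico _ _); rewrite ?opprK; last lia; rewrite -mulrNz; congr _%:~R; lia.
have Ez i : ico (expz 0 (FracField.tofrac 'X * rder f)) i = i%:~R * ico (expz 0 f) i.
  by rewrite EX rmorphM /= expz_Xs subrr scale0r addr0 ico_mulmono expz_der ico_der subrK.
rewrite op_def scalerBr addrACA -opprD; congr (_ - _); first exact: opL_dfield Ei.
exact: opR_dfield Ez.
Qed.

Lemma dfield_field phi : is_field phi -> is_field (dfield phi).
Proof.
move=> [pl pt]; split=> [n|v]; first exact: lin_scale.
by have [d hd] := pt v; exists (d + 1) => n hn; rewrite /dfield hd ?scaler0 //; lia.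
Qed.

Lemma inJ_X_der d f : inJ (T := T) (w := w) (d + 1) f -> inJ (T := T) (w := w) d (FracField.tofrac 'X * rder f).
Proof.
move=> [rf vf]; split; first by apply: regGM; [exact: regG_poly | exact: (regG_der hw)].
have := vanGM (vanG_poly (w := w) 'X) (vanG_iter (l := 1) vf).
by rewrite add0r addrK.
Qed.

Lemma dfield_smooth phi : smooth_field phi -> smooth_field (dfield phi).
Proof.
move=> [hp [d hd]]; split; first exact: dfield_field.
exists (fun a => (d a).+1) => a f hf; apply/funext => m; apply/funext => v.
rewrite op_dfield // hd; last by apply: inJ_le hf; lia.
rewrite hd ?scaler0 ?addr0 //; apply: inJ_X_der; apply: inJ_le hf; lia.
Qed.

Lemma loc_dfield a n phi : smooth_field phi ->
  loc a n (dfield phi) = dfield (loc a n phi) + n%:~R *: loc a (n - 1) phi.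
Proof.
move=> sp; have [hp [d hd]] := sp.
have [N1 h1] := locE hw hu a n (dfield_smooth sp).
have [N2 h2] := locE hw hu a n sp; have [N3 h3] := locE hw hu a (n - 1) sp.
pose N := (N1 + N2 + N3 + d a + `|n|).+2.
have ol m v := op_linf w0 hu hp a m v.
apply/funext => m; apply/funext => v.
change (loc a n (dfield phi) m v = - m%:~R *: loc a n phi (m - 1) v + n%:~R *: loc a (n - 1) phi m v).
rewrite (h1 N) ?(h2 N) ?(h3 N); try (rewrite /N; lia).
rewrite /locR op_dfield // .
have -> : op (u := u) a (FracField.tofrac 'X * rder (gN (T := T) n N)) phi
   = op (u := u) a (n%:~R *: gN (T := T) n N + n%:~R *: gN (T := T) (n - 1) N) phi.
  apply: (op_congr hw hu (hd a) hp); rewrite -scalerDr -gN_X rat_scaleAr -mulrBr; split.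
    apply: regGM; first exact: regG_poly.
    by apply: (regGB hw); [apply: (regG_der hw); exact: (regG_gN hw) | apply: regGZ; exact: (regG_gN hw)].
  have [_ hv] := gN_der hw (n := n) (N := N) (d := (d a)%:Z) ltac:(rewrite /N; lia) ltac:(rewrite /N; lia).
  by have := vanGM (vanG_poly (w := w) 'X) hv; rewrite add0r.
rewrite (linD (ol _ _)) !(linZ (ol _ _)).
have -> : m + n - 1 = m - 1 + n by lia.
have -> : m + (n - 1) = m - 1 + n by lia.
rewrite addrA; congr (_ + _); rewrite -scalerDl; congr (_ *: _).
by rewrite rmorphD opprD /= subrK.
Qed.

(** Y(DA, x) = d/dx Y(A, x), since D on states and d/dx on fields have the same commutation rule
    with the loop algebra and kill the vacuum and the identity field. *)
Lemma stm_der Y : state_map Y -> forall A n v, Y (dV A) n v = - n%:~R *: Y A (n - 1) v.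
Proof.
move=> hY; have Yl := stm_lin hY.
have dl : linear dfield.
  move=> c phi psi; apply/funext => n; apply/funext => v.
  change (- n%:~R *: (c *: phi (n - 1) v + psi (n - 1) v) = c *: (- n%:~R *: phi (n - 1) v) + - n%:~R *: psi (n - 1) v).
  by rewrite scalerDr !scalerA mulrC.
suff H A : Y (dV A) = dfield (Y A) by move=> A n v; rewrite H.
move: A; apply: (vm_ind hV (P := fun A => Y (dV A) = dfield (Y A))).
- split; first by rewrite (lin0 dlin) (lin0 Yl) (lin0 dl).
  by move=> c A B hA hB; rewrite dlin !Yl dl hA hB.
- rewrite d0 (lin0 Yl) (stm_v0 hY); apply/funext => n; apply/funext => v; rewrite /dfield /idf.
  transitivity (0 : M) => //; case: eqP => e; last by rewrite scaler0.
  have -> : n = 0 by move: e; lia.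
  by rewrite oppr0 scale0r.
move=> x A hA; rewrite dact (linD Yl) !(stm_act hY) hA; have sA := stm_smooth hY A.
move: x; apply: loop_eq_lin.
- apply: lin_add; first exact: (lin_comp (lact_lin hw hu sA) (ldelta_linear hL)).
  exact: (lact_lin hw hu (dfield_smooth sA)).
- exact: (lin_comp dl (lact_lin hw hu sA)).
move=> a f; rewrite (ldelta_rho hL) !(lactE hw hu) //; try exact: dfield_smooth.
rewrite (lin_fsum dl); last exact: (lact_fins hw hu sA).
rewrite -fsumD; [|exact: (lact_fins hw hu sA) | exact: (lact_fins hw hu (dfield_smooth sA))].
apply: eq_fsum => n; rewrite (loc_D hw hu) // loc_dfield // -scalerDr (linZ dl) addrCA.
by rewrite -scalerDl addNr scale0r addr0.
Qed.

End Derivation.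

End StateFields.

(** * The untwisted case: commutators and the creation property *)

Section Untwisted.
Context {K : numFieldType} {L : vla K} (hL : vertex_lie_algebra L) (hX : graded_vla L).
Context {M : lmodType K} {u : L -> int -> M -> M} (hu : twisted_fields (T := 1) (w := 1) u).
Implicit Types (a : L) (m n : int) (v : M) (phi : int -> M -> M).
Local Notation loc := (@loc K L 1 M u).
Local Notation smooth_field := (@smooth_field K L 1 1 M u).

Lemma prim1 : 1.-primitive_root (1 : K).
Proof. by apply/andP; split=> //; apply/forallP => i; rewrite ord1 /= unity_rootE expr1 !eqxx. Qed.
Let w0 : (1 : K) != 0 := oner_neq0 K.

(** For T = 1 there is no other root of unity to suppress, and (s - 1)^n itself represents the
    germ. *)
Lemma loc1E a n phi m v : smooth_field phi -> loc a n phi m v = op (u := u) a (X1 ^ n) phi (m + n) v.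
Proof.
move=> sp; have [hp [d hd]] := sp; have [N1 h1] := locE prim1 hu a n sp.
rewrite (h1 (N1 + d a + `|n|)%N); last lia.
rewrite /locR (op_congr prim1 hu (hd a) hp (g := X1 ^ n)) //; split.
  by apply: (regGB prim1); [exact: (regG_gN prim1) | exact: (regG_X1 prim1)].
move=> k; rewrite expr1n rmorphB /= expz1_X1; have h := @gN_at1 K 1 1 prim1 n (N1 + d a + `|n|)%N.
by refine (ordge_le _ h); lia.
Qed.

(** The commutator with a(n), n >= 0, belongs to the function s^n, which has the same expansion at 0
    and at infinity; it is then expanded in powers of s - 1. *)
Lemma loc1_comm a (n : nat) phi m v : smooth_field phi ->
  u a n%:Z (phi m v) - phi m (u a n%:Z v) =
  \sum_(k < n.+1) 'C(n, k)%:R *: loc a k%:Z phi (m + n%:Z - k%:Z) v.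
Proof.
move=> sp; have hp := sp.1.
have -> : u a n%:Z (phi m v) - phi m (u a n%:Z v) = op (u := u) a (FracField.tofrac 'X^n) phi (m + n%:Z) v.
  have Ez i : ico (expz 0 (FracField.tofrac 'X^n : ratfun K)) i = (i == n%:Z)%:R.
    rewrite expz_poly /psiz /= /shiftX polyC0 addr0 comp_polyXr rmorphXn /= evlX lmonoX natz ico_mono.
    by rewrite eq_sym.
  have Ei i : ico (expinf (FracField.tofrac 'X^n : ratfun K)) i = (i == - n%:Z)%:R.
    by rewrite expinf_poly rmorphXn /= evlX lmonoX mulNrn natz ico_mono eq_sym.
  rewrite /op /opL /opR (fsum_only (j := - n%:Z)) => [|i ni]; last by rewrite Ei (negbTE ni) scale0r.
  rewrite (fsum_only (j := n%:Z)) => [|i ni]; last by rewrite Ez (negbTE ni) scale0r.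
  by rewrite Ei Ez !eqxx !scale1r opprK addrK.
have -> : FracField.tofrac 'X^n = \sum_(k < n.+1) 'C(n, k)%:R *: X1 ^ k%:Z :> ratfun K.
  have -> : 'X^n = \sum_(k < n.+1) 'C(n, k)%:R *: ('X - 1%:P) ^+ k :> {poly K}.
    rewrite -{1}['X](subrK 1%:P) addrC exprDn; apply: eq_bigr => k _.
    by rewrite polyC1 expr1n mul1r scaler_nat.
  rewrite rmorph_sum; apply: eq_bigr => k _.
  by rewrite -mul_polyC rmorphM rmorphXn.
have ol := op_linf w0 hu hp a (m + n%:Z) v.
transitivity (\sum_(k < n.+1) op (u := u) a ('C(n, k)%:R *: X1 ^ k%:Z) phi (m + n%:Z) v).
  exact: (lin_sum _ _ _ ol).
apply: eq_bigr => k _; rewrite loc1E // subrK; exact: (linZ ol).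
Qed.

Lemma expinf_X1 n : ordge (expinf (X1 ^ n : ratfun K)) (- n) /\ ico (expinf (X1 ^ n : ratfun K)) (- n) = 1.
Proof.
have h (f : ratfun K) d : ordge (expinf f) d -> ico (expinf f) d = 1 ->
   forall k : nat, ordge (expinf (f ^+ k)) (d *+ k) /\ ico (expinf (f ^+ k)) (d *+ k) = 1.
  move=> h1 h2; elim=> [|k [IH1 IH2]].
    by rewrite expr0 mulr0n rmorph1 -lmono0 ico_mono eqxx; split=> //; exact: ordge_mono.
  rewrite exprS mulrS rmorphM; split; first exact: ordgeM.
  by rewrite ico_mul_lead // h2 IH2 mulr1.
case: n => n.
  have [||h1 h2] := h X1 (-1) _ _ n; last by rewrite mulNrn natz in h1 h2; split.
  - rewrite /X1 expinf_Xs; apply: ordgeB; first exact: ordge_mono.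
    by apply/ordgeZ/ordge_le/ordge1.
  - by rewrite /X1 expinf_Xs icoB icoZ -lmono0 !ico_mono /= mulr0 subr0.
have [||h1 h2] := h X1^-1 1 _ _ n.+1; last by rewrite natz in h1 h2; rewrite NegzE -exprz_inv opprK; split.
- by have := @ordge_expinf_rpw _ (1 : K) 1; rewrite /rpw expr1.
- by have := ico_expinf_rpw1 (1 : K) 1; rewrite /rpw expr1.
Qed.

End Untwisted.

Section Creation.
Context {K : numFieldType} {L : vla K} (hL : vertex_lie_algebra L) (hX : graded_vla L).
Context {V : lmodType K} {va : loop L -> V -> V} {v0 : V} (hV : vacuum_module va v0).
Let u a n (A : V) := va (mode a n) A.
Context (hu : twisted_fields (T := 1) (w := 1) u).
Context {Y : V -> int -> V -> V} (hY : state_map (T := 1) (w := 1) (va := va) (v0 := v0) (u := u) Y).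

(** On the vacuum the right part of the operator vanishes, because non-negative modes kill v0. In
    the left part only the leading term s^n of (s - 1)^n at infinity, with coefficient 1, reaches
    the mode -1 of phi. *)
Lemma loc_creation a n phi : smooth_field (T := 1) (w := 1) (u := u) phi ->
  (forall m, 0 <= m -> phi m v0 = 0) ->
  (forall m, 0 <= m -> loc (T := 1) (u := u) a n phi m v0 = 0) /\
  loc (T := 1) (u := u) a n phi (-1) v0 = va (mode a n) (phi (-1) v0).
Proof.
move=> sp p0; have hp := sp.1; have [o1 o2] := expinf_X1 (K := K) n.
have R0 m : opR (u := u) a (expz 0 (X1 ^ n)) phi m v0 = 0.
  apply: fsum0 => i; case: (ltP i 0) => i0.
    by rewrite (expz_X1_at n _ i0) ?scale0r // eq_sym oner_neq0.
  by rewrite /u modeE (vm_pos hV) ?(lin0 (hp.1 _)) ?scaler0 //; apply: ordge_le (@ordge_mono K i).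
have E m : loc (T := 1) (u := u) a n phi m v0 = opL (u := u) a (expinf (X1 ^ n)) phi (m + n) v0.
  by rewrite loc1E // /op R0 subr0.
split=> [m m0|]; rewrite E /opL.
  apply: fsum0 => i; case: (ltP i (- n)) => [/o1 ->|i1]; first by rewrite scale0r.
  by rewrite /u p0 ?(lin0 (vm_linA hV _)) ?scaler0 //; lia.
rewrite (fsum_only (j := - n)) => [|i ni]; first by rewrite o2 scale1r opprK addrK.
case: (ltP i (- n)) => [/o1 ->|i1]; first by rewrite scale0r.
by rewrite /u p0 ?(lin0 (vm_linA hV _)) ?scaler0 //; move/eqP: ni; lia.
Qed.

Lemma stm_creation A : (forall m, 0 <= m -> Y A m v0 = 0) /\ Y A (-1) v0 = A.
Proof.
have Yl := stm_lin hY.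
move: A; apply: (vm_ind hV (P := fun A => (forall m, 0 <= m -> Y A m v0 = 0) /\ Y A (-1) v0 = A)).
- split; first by rewrite (lin0 Yl).
  move=> c A B [h1 h2] [h3 h4]; split=> [m m0|]; rewrite Yl.
    by change (c *: Y A m v0 + Y B m v0 = 0); rewrite h1 // h3 // scaler0 addr0.
  by change (c *: Y A (-1) v0 + Y B (-1) v0 = c *: A + B); rewrite h2 h4.
- by rewrite (stm_v0 hY) /idf; split=> // m m0; rewrite ifF //; lia.
move=> x A [h1 h2]; have sA := stm_smooth hY A.
have ev m : linear (fun x => Y (va x A) m v0).
  by move=> c y z; rewrite (vm_linx hV) Yl.
have el m : linear (fun phi : int -> V -> V => phi m v0) by [].
split=> [m m0|].
  move: x; apply: (loop_eq_lin (g := fun=> 0) (ev m)); first by move=> c y z; rewrite scaler0 addr0.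
  move=> a f.
  rewrite (stm_act hY) (lactE prim1 hu) // (lin_fsum (el m)); last exact: (lact_fins prim1 hu sA).
  apply: fsum0 => n; have [h _] := loc_creation a n sA h1.
  by change (ico f n *: loc (T := 1) (u := u) a n (Y A) m v0 = 0); rewrite h // scaler0.
move: x; apply: (loop_eq_lin (ev _) (vm_linx hV A)) => a f.
rewrite (stm_act hY) (lactE prim1 hu) // (lin_fsum (el _)); last exact: (lact_fins prim1 hu sA).
rewrite (va_termwise hL hV) /termwise; apply: eq_fsum => n; have [_ h] := loc_creation a n sA h1.
by change (ico f n *: loc (T := 1) (u := u) a n (Y A) (-1) v0 = ico f n *: va (mode a n) A); rewrite h h2.
Qed.

End Creation.

(** * The vertex Lie algebra structure of the vacuum module *)

Section EigenGrading.
Context {K : numFieldType} {V : lmodType K} (P : nat -> set V) (Phi : V -> V).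
Context (Psub : forall n, subspace (P n)) (Phil : linear Phi)
  (PhiP : forall n A, P n A -> Phi A = 2%:R ^+ n *: A).

(** Vectors in the eigenspaces for the distinct eigenvalues 2^n are independent. This makes the
    grading of V(L) direct, although its pieces are defined only as spans of monomials. *)
Lemma eigen_indep N (x : nat -> V) : (forall n, P n (x n)) -> \sum_(n < N) x n = 0 ->
  forall n, (n < N)%N -> x n = 0.
Proof.
elim: N x => [//|N IH] x Px s0.
have h : forall n, (n < N)%N -> (2%:R ^+ n - 2%:R ^+ N) *: x n = 0.
  apply: (IH (fun n => (2%:R ^+ n - 2%:R ^+ N) *: x n)) => [n|].
    by rewrite -[_ *: _]addr0; case: (Psub n) => h0; apply.
  have e : Phi (\sum_(n < N.+1) x n) - 2%:R ^+ N *: \sum_(n < N.+1) x n = 0.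
    by rewrite s0 (lin0 Phil) scaler0 subr0.
  rewrite (lin_sum _ _ _ Phil) scaler_sumr -sumrB big_ord_recr /= in e.
  rewrite (PhiP (Px N)) subrr addr0 in e; rewrite -[RHS]e.
  by apply: eq_bigr => n _; rewrite (PhiP (Px n)) scalerBl.
have x0 n : (n < N)%N -> x n = 0.
  move=> nN; have /eqP := h n nN; rewrite scaler_eq0 subr_eq0 => /orP[|/eqP //].
  by rewrite -!natrX eqr_nat eqn_exp2l // => /eqP e; rewrite e ltnn in nN.
move=> n; rewrite ltnS leq_eqVlt => /orP[/eqP ->|]; last exact: x0.
by move: s0; rewrite big_ord_recr /= big1 ?add0r // => i _; exact: x0.
Qed.

End EigenGrading.

Section VacuumVLA.
Context {K : numFieldType} {L : vla K} (hL : vertex_lie_algebra L) {T : nat} (hS : vla_automorphism L T).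
Context {V : lmodType K} {va : loop L -> V -> V} {v0 : V} (hV : vacuum_module va v0).
Context {mn : nat -> V -> Prop} (mn0 : mn 0 v0)
  (mnS : forall p n d (a : L) A, vhomog p a -> mn d A -> mn (p + n + d) (va (mode a (- n.+1%:Z)) A))
  (mn_rec : forall P : nat -> V -> Prop, P 0%N v0 ->
     (forall p n d (a : L) A, vhomog p a -> mn d A -> P d A -> P (p + n + d)%N (va (mode a (- n.+1%:Z)) A)) ->
     forall d A, mn d A -> P d A).
Context {dV : V -> V} (dlin : linear dV) (d0 : dV v0 = 0)
  (dact : forall x A, dV (va x A) = va (ldelta x) A + va x (dV A)).
Context {sV : V -> V} (slin : linear sV) (s0 : sV v0 = v0)
  (sact : forall x A, sV (va x A) = va (LA 1 (@vsigma _ L) x) (sV A)).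
Context {DV : V -> V} (DVE : forall A, DV A = dV A) {pV : V -> nat -> V -> V}.
Let X := @VLA K V DV pV v0 (fun d => lspan (mn d)) sV.
Let hX := vla_graded_vla hL hS.
Local Notation Phi_spec z Phi := [/\ linear Phi, Phi v0 = v0 &
  forall x A, Phi (va x A) = va (LA z (@vG _ L z) x) (Phi A)].

(** The operator z^deg on states, lifted from z^deg on L. It separates the degrees for z = 2 and
    enters R_(w^k) on V(L) for z = w^k. *)
Lemma vm_deg z : z != 0 -> exists Phi : V -> V, Phi_spec z Phi /\ forall n A, lspan (mn n) A -> Phi A = z ^+ n *: A.
Proof.
move=> z0; have hz := zaut_vG hL hX z0; have [Phi [Pl P0 PA]] := vm_aut hL hV hz.
exists Phi; split=> // n A hA; apply: (lin_eq_span Pl (lin_scale (z ^+ n) (@lin_id _ _)) _ hA) => B.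
move: n B {A hA}; apply: mn_rec; first by rewrite expr0 scale1r.
move=> p n d a A pa dA IH; rewrite PA (LA_mode hz) (vG_homog hX _ pa) IH.
have ml := mode_lin (L := L) (- n.+1%:Z).
rewrite (linZ ml) !(linZ (vm_linx hV _)) (linZ (vm_linA hV _)) !scalerA; congr (_ *: _).
have -> : - (- n.+1%:Z) - 1 = n%:Z by lia.
by rewrite !exprD -exprnP [z ^+ n * _]mulrC.
Qed.

Lemma generates_homog : generates (L := L) [set a | exists p, vhomog p a].
Proof.
move=> a; rewrite (vcomp_sum hX a); apply: lspan_fsum => n; apply: lspan_incl; left.
by exists 0%N, (vcomp a n); split=> //; exists n; exact: (vcomp_homog hX).
Qed.

Lemma mn_of_word j A : neg_word (va := va) (v0 := v0) [set a | exists p, vhomog p a] j A -> exists d, mn d A.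
Proof.
elim=> [|{}j n a B [p pa] _ [d dB]]; first by exists 0%N.
by exists (p + n + d)%N; exact: mnS.
Qed.

Lemma vac_decomp (A : X) : exists h, @homog_decomp _ X A h.
Proof.
have [j hj] := neg_filt_all hL hV generates_homog A.
apply: (subspace_lspan (P := fun A : V => exists h, @homog_decomp _ X A h) _ _ hj).
  have sub n := lspan_subspace (mn n).
  split; first by exists (fun=> 0); split=> [n|]; [case: (sub n) | exists 0%N; rewrite big_ord0].
  move=> c B C [h [hh [d [hd ->]]]] [h' [hh' [e [he ->]]]].
  exists (fun n => c *: h n + h' n); split=> [n|]; first by case: (sub n) => _; apply; [exact: hh|exact: hh'].
  exists (maxn d e); split=> [n|]; first by rewrite geq_max => /andP[/hd -> /he ->]; rewrite scaler0 addr0.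
  rewrite -(fsum_ord hd) -(fsum_ord he) scaler_fsum; last exact: (fins_nat hd).
  rewrite -fsumD; [|by apply: fins_map; [rewrite scaler0|exact: (fins_nat hd)] | exact: (fins_nat he)].
  by apply: fsum_ord => n; rewrite geq_max => /andP[/hd -> /he ->]; rewrite scaler0 addr0.
move=> B [i [_ /mn_of_word[p pB]]]; exists (fun n => if n == p then B else 0); split=> [n|].
  by case: eqP => [->|_]; [exact: lspan_incl | case: (lspan_subspace (mn n))].
have h0 n : (p.+1 <= n)%N -> (if n == p then B else 0) = 0 by case: eqP => // ->; rewrite ltnn.
exists p.+1; split=> //; rewrite -(fsum_ord h0) (fsum_only (j := p)) ?eqxx //.
by move=> k /negbTE ->.
Qed.

Lemma vac_graded : graded_vla X.
Proof.
split.
- by move=> n; exact: lspan_subspace.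
- exact: vac_decomp.
- move=> A h h' [hh [d [hd E]]] [hh' [e [he E']]] n; apply/eqP; rewrite -subr_eq0; apply/eqP.
  have [Phi [[Pl _ _] PhiP]] := vm_deg (z := 2%:R) ltac:(by rewrite pnatr_eq0).
  pose N := (maxn (maxn d e) n.+1).
  apply: (@eigen_indep _ _ (fun n => lspan (mn n)) Phi (fun n => lspan_subspace (mn n)) Pl PhiP N (fun n => h n - h' n)).
  + by move=> k; rewrite -scaleN1r addrC; case: (lspan_subspace (mn k)) => _; apply; [exact: hh' | exact: hh].
  + rewrite sumrB -(fsum_ord (b := N) (F := h)) => [|k hk]; last by apply: hd; lia.
    rewrite -(fsum_ord (b := N) (F := h')) => [|k hk]; last by apply: he; lia.
    by rewrite (fsum_ord hd) (fsum_ord he) -E -E' subrr.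
  + lia.
- exact: lspan_incl.
- by move=> c A B; rewrite /= !DVE dlin.
- move=> n A; rewrite /= DVE; apply: (lspan_lin dlin) => B hB; move: n B hB {A}; apply: (mn_rec (P := fun n B => lspan (mn n.+1) (dV B))).
    by rewrite d0; case: (lspan_subspace (mn 1)).
  move=> p n d a A pa dA IH; rewrite dact (ldelta_mode hL); apply: lspanD.
    rewrite (linZ (vm_linx hV _)); apply: lspanZ; apply: lspan_incl.
    have -> : - n.+1%:Z - 1 = - n.+2%:Z by lia.
    have -> : (p + n + d).+1 = (p + n.+1 + d)%N by rewrite addnS addSn.
    exact: mnS.
  apply: (lspan_lin (vm_linA hV _) _ IH) => B dB; apply: lspan_incl.
  by rewrite -addnS; exact: mnS.
- by rewrite /= DVE.
- exact: slin.
- move=> n A; apply: (lspan_lin slin) => B hB; apply: lspan_incl; move: n B hB; apply: mn_rec.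
    by rewrite /= s0.
  move=> p n d a B pa dB IH; rewrite /= sact (LA_mode (zaut_sigma hS)) exp1rz scale1r.
  by apply: mnS => //; exact: (vsigma_homog hS).
- move=> A; rewrite /= !DVE.
  apply: (vm_ind hV (P := fun A => sV (dV A) = dV (sV A))); last 2 first.
  + by rewrite d0 s0 d0 (lin0 slin).
  + move=> x B IH; rewrite dact (linD slin) !sact dact IH; congr (va _ _ + _).
    have ll := LA_linear (zaut_sigma hS).
    move: x; apply: loop_eq_lin.
    * exact: (lin_comp ll (ldelta_linear hL)).
    * exact: (lin_comp (ldelta_linear hL) ll).
    by move=> a f; rewrite (ldelta_rho hL) !(LA_rho (zaut_sigma hS)) (linZ (ldelta_linear hL)) (ldelta_rho hL) (vsigma_D hS).
  split; first by rewrite (lin0 dlin) (lin0 slin) (lin0 dlin).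
  by move=> c B C hB hC; rewrite dlin !slin dlin hB hC.
- exact: s0.
Qed.

Lemma vac_vR w k x (A : V) : w != 0 ->
  @vR _ X w k (va x A) = va (LA (w ^+ k) (@vR _ L w k) x) (@vR _ X w k A) :> V.
Proof.
move=> w0; have hG := vac_graded; have z0 : w ^+ k != 0 by rewrite expf_neq0.
have [Phi [[Pl _ PA] PhiP]] := vm_deg z0.
have EG (B : V) : @vG _ X (w ^+ k) B = Phi B.
  apply: (homog_eq_lin hG (f := @vG _ X (w ^+ k)) (g := Phi) (vG_linear hG _) Pl) => n C hC.
  by rewrite (vG_homog hG _ hC) (PhiP n).
rewrite !(vRE hG) !EG PA.
have hs := LA_linear (zaut_sigma hS); have hzg := zaut_vG hL hX z0.
have Es j y B : iter j (@vsigma _ X) (va y B) = va (iter j (LA 1 (@vsigma _ L)) y) (iter j (@vsigma _ X) B).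
  by elim: j => //= j ->; rewrite sact.
rewrite Es; congr va; have il j : linear (iter j (LA 1 (@vsigma _ L))).
  by elim: j => //= j IH; exact: (lin_comp hs IH).
move: x; apply: loop_eq_lin.
- exact: (lin_comp (il k) (LA_linear hzg)).
- exact: (LA_linear (zaut_vR hL k hS w0)).
move=> a f; rewrite (LA_rho hzg) (LA_rho (zaut_vR hL k hS w0)) (linZ (il k)) (vRE hX); congr (_ *: _).
move: (@vG _ L _ a) (lsub _ f) => b g.
elim: (k) => // j IH; rewrite iterS IH (LA_rho (zaut_sigma hS)) invr1 scale1r iterS; congr lrho.
by apply: laurentP => n; rewrite ico_sub exp1rz mul1r.
Qed.

Lemma vac_sigma_order (A : X) : iter T (@vsigma _ X) A = A.
Proof.
have il j : linear (iter j sV) by elim: j => //= j IH; exact: (lin_comp slin IH).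
have hs := LA_linear (zaut_sigma hS).
apply: (vm_eq_lin hV (il T) (@lin_id _ _)).
  by elim: (T) => //= j ->.
move=> x B IH; have Es j y C : iter j sV (va y C) = va (iter j (LA 1 (@vsigma _ L)) y) (iter j sV C).
  by elim: j => //= j ->; rewrite sact.
rewrite Es IH; congr va; have il' j : linear (iter j (LA 1 (@vsigma _ L))).
  by elim: j => //= j IH'; exact: (lin_comp hs IH').
move: x; apply: (loop_eq_lin (il' T) (@lin_id _ _)) => a f.
transitivity (lrho (iter T (@vsigma _ L) a) f); last by rewrite (vsigma_order hS).
elim: (T) => //= j ->; rewrite (LA_rho (zaut_sigma hS)) invr1 scale1r; congr lrho.
by apply: laurentP => n; rewrite ico_sub exp1rz mul1r.
Qed.

End VacuumVLA.

(** * The chosen maps [YM] and [YW], the translation and the automorphism of V(L) *)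

Section StateMaps.
Context {K : numFieldType} {L : vla K} (hL : vertex_lie_algebra L) {T : nat} {w : K}
  (hw : T.-primitive_root w) (hS : vla_automorphism L T).
Let hX := vla_graded_vla hL hS.
Let hV := vacm_vacuum (L := L).

(** The recursion has a solution by [state_map_ex], so the map chosen by [xget] solves it too; by
    [field_axioms_uniq] it is that solution. *)
Lemma YW_state_map (M : lmodType K) (act : loop L -> M -> M) : smooth_moduleG T w act ->
  state_map (T := T) (w := w) (va := vact (L := L)) (v0 := vacuum L) (u := fun a n v => act (modeG T w a n) v) (YW T w act).
Proof.
move=> ha; have hu := smoothG_twisted hL hw hS ha.
have [Y hY] := state_map_ex hL hX hw hV hu; have aY := stm_axioms hw hu hY.
have aW : field_axioms (va := vact (L := L)) (v0 := vacuum L) (u := fun a n v => act (modeG T w a n) v) (extraW (T := T) (w := w) (va := vact (L := L))) (YW T w act).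
  by apply: (@xgetPex _ (fun _ _ => 0)); exists Y; exact: aY.
have -> : YW T w act = Y; last exact: hY.
by apply/funext => A; apply/funext => n; apply/funext => v; exact: (field_axioms_uniq hL hw hV aW aY).
Qed.

Lemma YM_state_map (M : lmodType K) (act : loop L -> M -> M) : smooth_module act ->
  state_map (T := 1) (w := 1) (va := vact (L := L)) (v0 := vacuum L) (u := fun a n v => act (mode a n) v) (YM act).
Proof.
move=> ha; have hu := smooth_twisted hL hX ha; have hw1 := prim1 (K := K).
have [Y hY] := state_map_ex hL hX hw1 hV hu; have aY := stm_axioms hw1 hu hY.
have E : (fun _ _ _ _ => 0) = extraW (M := M) (T := 1) (w := 1) (va := vact (L := L)).
  apply/funext => Z; apply/funext => a; apply/funext => B; apply/funext => m; apply/funext => v.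
  by rewrite /extraW big_pred0 // => k; rewrite ord1.
have aW : field_axioms (va := vact (L := L)) (v0 := vacuum L) (u := fun a n v => act (mode a n) v) (extraW (T := 1) (w := 1) (va := vact (L := L))) (YM act).
  rewrite -E; apply: (@xgetPex _ (fun _ _ => 0)); exists Y; rewrite -E in aY; exact: aY.
have -> : YM act = Y; last exact: hY.
by apply/funext => A; apply/funext => n; apply/funext => v; exact: (field_axioms_uniq hL hw1 hV aW aY).
Qed.

Lemma vact_smooth : smooth_module (vact (L := L)).
Proof.
split; last 3 first.
- by move=> v; exact: (vm_level hL hV).
- by move=> a A; exact: (va_modes_trunc hL hV).
- by move=> a f A; rewrite -lrhoE; exact: (va_termwise hL hV).
split.
- by move=> c x y v _ _; exact: (vm_linx hV).
- by move=> x _; exact: (vm_linA hV).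
- by move=> x y v _ _; rewrite -lbr_lie_br; exact: (vm_br hV).
Qed.

(** A_(-2)|0> is the value at x = 0 of d/dx Y(A, x)|0>, which is Y(dV A, x)|0>; by the creation
    property its value at 0 is dV A. *)
Lemma vac_vlaD (dV : vacm L -> vacm L) : linear dV -> dV (vacuum L) = 0 ->
  (forall x A, dV (vact x A) = vact (ldelta x) A + vact x (dV A)) ->
  forall A, YM (vact (L := L)) A (- 2) (vacuum L) = dV A.
Proof.
move=> dl d0 da A; have hY := YM_state_map vact_smooth; have hu := smooth_twisted hL hX vact_smooth.
have e1 := stm_der hL (prim1 (K := K)) hV hu dl d0 da hY A (-1) (vacuum L).
have [_ e2] := stm_creation hL hV hu hY (dV A).
by rewrite -e2 e1 opprK scale1r.
Qed.

Lemma vac_sigmaE : [/\ linear (@vac_sigma K L), vac_sigma (vacuum L) = vacuum L &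
  forall x A, vac_sigma (vact x A) = vact (LA 1 (@vsigma _ L) x) (vac_sigma A)].
Proof.
have hz := zaut_sigma hS; have [Phi [Pl P0 PA]] := vm_aut hL hV hz.
have E x : lie_lift (fun a (f : laurent_dalg K) => @rho K L (laurent_dalg K) (vsigma a) f) x = LA 1 (@vsigma _ L) x.
  rewrite /LA -lock; congr (lie_lift _ x); apply/funext => a; apply/funext => f.
  rewrite invr1 scale1r; congr rho; apply: laurentP => n.
  by rewrite /= ico_sub exp1rz mul1r.
have Pw u : Phi (vword u) = vword [seq lie_lift (fun a (f : laurent_dalg K) => @rho K L (laurent_dalg K) (vsigma a) f) x | x <- u].
  elim: u => [|x u IH]; first exact: P0.
  by rewrite -vact_word PA IH /= -vact_word E.
suff H A : vac_sigma A = Phi A.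
  by split=> [c A B||x A]; rewrite !H; [exact: Pl | exact: P0 | exact: PA].
rewrite /vac_sigma.
have fl := @free_lift_linear K _ _ (fun u => Phi (vword (L := L) u)).
have Ph : (fun u => vword [seq lie_lift (fun a (f : laurent_dalg K) => @rho K L (laurent_dalg K) (vsigma a) f) x | x <- u]) = (fun u => Phi (vword (L := L) u)).
  by apply/funext => u; rewrite Pw.
rewrite Ph.
have hg g : free_lift (fun u => Phi (vword (L := L) u)) g = Phi (qpi (@vac_rels K L) g).
  apply: (lin_eq_span fl (lin_comp Pl (@qpi_linear _ _ _)) _ (malg_span g)) => _ [u _ <-].
  by rewrite free_liftU.
have hr r : @vac_rels K L r -> free_lift (fun u => Phi (vword (L := L) u)) r = 0.
  by move=> h; rewrite hg qpi_rel // (lin0 Pl).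
have [g ->] := quot_ex A; by rewrite quot_liftE.
Qed.

End StateMaps.

(** * The residue argument *)

Section ScalarIdentity.
Context {K : numFieldType}.

(** The coefficient of X^j in (1 + y(1 + X))^M, expanded in powers of 1 + X and in powers of X. *)
Lemma sum_bin_bin (y : K) M j : (j <= M)%N ->
  \sum_(q < M.+1) 'C(M, q)%:R * 'C(q, j)%:R * y ^+ q = 'C(M, j)%:R * y ^+ j * (1 + y) ^+ (M - j).
Proof.
move=> jM; have E : \sum_(q < M.+1) ('C(M, q)%:R * y ^+ q) *: (1 + 'X) ^+ q = ((1 + y)%:P + y *: 'X) ^+ M :> {poly K}.
  have -> : (1 + y)%:P + y *: 'X = 1 + y *: (1 + 'X) :> {poly K}.
    by rewrite scalerDr alg_polyC polyCD polyC1 addrA.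
  rewrite exprDn; apply: eq_bigr => q _.
  by rewrite expr1n mul1r exprZn -scaler_nat scalerA.
have := congr1 (fun p : {poly K} => p`_j) E; rewrite exprDn !coef_sum => E'.
transitivity (\sum_(q < M.+1) (('C(M, q)%:R * y ^+ q) *: (1 + 'X : {poly K}) ^+ q)`_j).
  apply: eq_bigr => q _; rewrite coefZ addrC mulrAC; congr (_ * _).
  rewrite addrC exprDn coef_sum; have [jq|qj] := ltnP j q.+1.
    rewrite (bigD1 (Ordinal jq)) //= big1 ?addr0 => [|i ij].
      by rewrite expr1n mul1r coefMn coefXn eqxx.
    have /negbTE ji : j != i :> nat by rewrite eq_sym; exact: ij.
    by rewrite expr1n mul1r coefMn coefXn ji mul0rn.
  rewrite bin_small // big1 // => i _; rewrite expr1n mul1r coefMn coefXn gtn_eqF ?mul0rn //.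
  by apply: leq_trans qj; exact: ltn_ord.
rewrite E' (bigD1 (Ordinal (jM : (j < M.+1)%N))) //= big1 ?addr0 => [|i ij].
  rewrite coefMn exprZn -!polyC_exp mul_polyC !coefZ coefXn eqxx mulr1 -mulr_natl; ring.
rewrite coefMn exprZn -!polyC_exp mul_polyC !coefZ coefXn eq_sym.
have /negbTE -> : i != j :> nat by exact: ij.
by rewrite !mulr0 mul0rn.
Qed.

(* Re-expansion of ((x - 1) u)^(-j-1) at c in terms of the coefficients of
   (u - c)^(-p-1) at c / x. *)
Lemma reexpand (x c : K) M j : x != 0 -> x != 1 -> c != 0 -> (j <= M)%N ->
  \sum_(q < M.+1) - (ico (geo (c / x - c) (M - q)) q%:Z * ('C(q, j)%:R * (x ^+ q.+1)^-1))
  = ((x - 1) ^+ j.+1)^-1 * ico (geo c j) (M - j)%N%:Z.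
Proof.
move=> x0 x1 c0 jM; have x1' : x - 1 != 0 by rewrite subr_eq0.
have x1'' : 1 - x != 0 by rewrite -opprB oppr_eq0.
have dE : c / x - c = c * (1 - x) / x by rewrite mulrBr mulr1 mulrBl mulfK.
have d0 : c / x - c != 0 by rewrite dE !mulf_neq0 ?invr_eq0.
transitivity (- ((c / x - c)^-1 ^+ M.+1 * x^-1) * \sum_(q < M.+1) 'C(M, q)%:R * 'C(q, j)%:R * (- x^-1) ^+ q).
  rewrite mulr_sumr; apply: eq_bigr => q _; have qM : (q <= M)%N by rewrite -ltnS.
  rewrite ico_geo /= subnK // [(- x^-1) ^+ q]exprNn exprVn [x^-1 ^+ q]exprVn [x ^+ q.+1]exprS invfM.
  move: ((-1) ^+ q) ('C(M, q)%:R) ('C(q, j)%:R) ((_ ^+ M.+1)^-1) ((x ^+ q)^-1) => u1 u2 u3 u4 u5; ring.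
rewrite sum_bin_bin // ico_geo /=.
have [i Ei] : exists i, M = (j + i)%N by exists (M - j)%N; rewrite subnKC.
have -> : 1 + - x^-1 = (x - 1) / x by rewrite mulrBl divff // mul1r.
have -> : c / x - c = - (c * (x - 1) / x) by rewrite dE -opprB mulrN mulNr.
have eb : 'C(j + i, i) = 'C(j + i, j) by rewrite -{2}(addKn j i) bin_sub ?leq_addr.
rewrite Ei addKn eb.
have sj : (-1) ^+ j * (-1) ^+ j = 1 :> K by rewrite -exprD addnn -mul2n exprM sqrrN expr1n expr1n.
rewrite -[RHS]mul1r -[X in _ = X * _]sj.
rewrite invrN [(- (_)^-1) ^+ _]exprNn [(- x^-1) ^+ _]exprNn invf_div !expr_div_n !exprMn !exprVn !exprS !exprD.
have [u1 [u2 [u3 [u4 [u5 u6]]]]] : [/\ x ^+ i != 0, x ^+ j != 0, c ^+ i != 0, c ^+ j != 0 & (x - 1) ^+ i != 0 /\ (x - 1) ^+ j != 0] by rewrite !expf_neq0.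
move: ('C(j + i, j)%:R) ((-1) ^+ i) ((-1) ^+ j) => b si sj'.
move: x1' (x ^+ i) (x ^+ j) (c ^+ i) (c ^+ j) ((x - 1) ^+ i) ((x - 1) ^+ j) u1 u2 u3 u4 u5 u6.
move: (x - 1) => e e0 v1 v2 v3 v4 v5 v6 u1 u2 u3 u4 u5 u6; field.
by rewrite e0 x0 c0 u1 u2 u3 u4 u5 u6.
Qed.

End ScalarIdentity.

Section MainStep.
Context {K : numFieldType} {T : nat} {w : K} (w0 : w != 0)
  (w1 : forall k, (0 < k < T)%N -> w ^+ k != 1).
Context {W : lmodType K} {P : finType} (r0 : P) (c : P -> K) (cinj : injective c) (c0 : c r0 = 0)
  (sh : nat -> P -> P).
Context (sh_ne : forall r k, r != r0 -> (0 < k < T)%N -> sh k r != r)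
  (sh_c : forall r k, r != r0 -> (0 < k < T)%N -> c (sh k r) = c r / w ^+ k).
(* At the point r with coordinate c r, the fields y r, phi r, chi r and psi r k j are those
   of a, B, a(-1)B and (R_(w^k) a)(j)B. H1 says that Omega_a(1/(t - c r)^(p+1)) maps into
   S, F1 is the recursion for the field of a(-1)B, and F2 is the commutator formula. *)
Context (y phi chi : P -> int -> W -> W) (psi : P -> nat -> nat -> int -> W -> W).
Context (yf : forall s, is_field (y s)) (phif : forall s, is_field (phi s))
  (psif : forall s k j, is_field (psi s k j))
  (psi0 : exists J, forall s k j, (k < T)%N -> (J <= j)%N -> forall m t, psi s k j m t = 0).
Context (S : set W) (Ssub : subspace S).
Context (H1 : forall r (p : nat) t, S (\sum_s \sum_(q \in [set: int]) ico (expz (c s) (rpw (c r) p.+1)) q *: y s q t)).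
Context (F1 : forall r m t, chi r m t =
   \sum_(p \in [set: nat]) y r (- p.+1%:Z) (phi r (m + p%:Z) t) +
   \sum_(p \in [set: nat]) phi r (m - p.+1%:Z) (y r p%:Z t) +
   (if r == r0 then \sum_(k < T | (0 < k)%N) \sum_(j \in [set: nat])
       ((w ^+ k - 1) ^+ j.+1)^-1 *: psi r k j (m - j.+1%:Z) t else 0)).
Context (F2 : forall r s (q : nat) m t, s != r -> y s q%:Z (phi r m t) - phi r m (y s q%:Z t) =
   (if r == r0 then 0 else \sum_(k < T | (0 < k)%N) if s == sh k r then
      \sum_(j < q.+1) ('C(q, j)%:R * ((w ^+ k) ^+ q.+1)^-1) *: psi r k j (m + q%:Z - j%:Z) t else 0)).
Implicit Types (F G : laurent K) (t : W) (p q j k : nat) (m n : int) (f : int -> W -> W).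

(** The residue of F(u) u^e f(u), where f(u) is the sum of f_n u^(-n-1). *)
Definition pair F f (e : int) t : W := \sum_(n \in [set: int]) ico F n *: f (n + e) t.

Lemma pair_fins F f e t : is_field f -> fins (fun n => ico F n *: f (n + e) t).
Proof.
move=> hf; have [d hd] := ico_bounded F; have [b hb] := hf.2 t.
by apply: (fins_int (a := d) (b := b - e)) => n h; [rewrite hd ?scale0r | rewrite hb ?scaler0 //; lia].
Qed.

Lemma pair_lin F f e : is_field f -> linear (pair F f e).
Proof.
move=> hf; apply: lin_bigfsum => [n|t]; last exact: pair_fins.
exact: (lin_scale (ico F n) (hf.1 _)).
Qed.

Lemma pair_vanish F f e t d b : ordge F d -> (forall m, b <= m -> f m t = 0) -> b <= d + e -> pair F f e t = 0.
Proof.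
move=> hF hf be; apply: fsum0 => n; case: (ltP n d) => [/hF ->|dn]; first by rewrite scale0r.
by rewrite hf ?scaler0 //; lia.
Qed.

Lemma pair_mul F G f t d (N : nat) : is_field f -> ordge F d -> ordge G 0 ->
  (forall m, d + N%:Z <= m -> f m t = 0) ->
  pair (F * G) f 0 t = \sum_(p < N) ico G p%:Z *: pair F f p%:Z t.
Proof.
move=> hf hF hG hN; rewrite /pair mulrC.
under eq_fsum do rewrite addr0.
rewrite -lmulE (fsum_conv G F hN) fsum_int_pos => [|i i0]; last first.
  by apply: fsum0 => n; rewrite hG // mul0r scale0r.
rewrite (fsum_ord (b := N)) => [|p hp]; last first.
  apply: fsum0 => n; case: (ltP n d) => [/hF ->|dn]; first by rewrite mulr0 scale0r.
  by rewrite hN ?scaler0 //; lia.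
apply: eq_bigr => p _; rewrite scaler_fsum; last exact: pair_fins.
by apply: eq_fsum => n; rewrite scalerA addrC.
Qed.

Lemma pair_mono F f t q : pair (F * lmono (- q.+1%:Z)) f 0 t = pair F f (- q.+1%:Z) t.
Proof.
rewrite /pair (fsum_shift _ (- q.+1%:Z)); apply: eq_fsum => n.
by rewrite mulrC ico_mulmono addr0; congr (ico F _ *: _); lia.
Qed.

Lemma sum_only (A : finType) (Q : pred A) (a : A) (E : A -> W) : Q a ->
  \sum_(s | Q s) (if s == a then E s else 0) = E a.
Proof. by move=> Qa; rewrite (bigD1 a) //= eqxx big1 ?addr0 // => s /andP[_ /negbTE ->]. Qed.

Lemma diag_ord (G : nat -> nat -> W) (N : nat) : (forall p q, (N <= p + q)%N -> G p q = 0) ->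
  \sum_(p < N) \sum_(q < N) G p q = \sum_(m < N) \sum_(q < m.+1) G (m - q)%N q.
Proof.
move=> hG; rewrite exchange_big /=.
have -> : \sum_(q < N) \sum_(p < N) G p q = \sum_(q \in [set: nat]) \sum_(p \in [set: nat]) G p q.
  rewrite (fsum_ord (b := N)) => [|q hq]; last by apply: fsum0 => p; rewrite hG //; lia.
  by apply: eq_bigr => q _; rewrite (fsum_ord (b := N)) // => p hp; rewrite hG //; lia.
rewrite (fsum_diag (G := fun q p => G p q) (B := N)) => [|q p h]; last by rewrite hG //; lia.
by rewrite (fsum_ord (b := N)) // => m hm; rewrite big1 // => q _; rewrite hG //; have := ltn_ord q; lia.
Qed.

Section Bounds.
Context (r : P) (F : laurent K) (t : W).

Lemma int_fam_bound (A : finType) (f : A -> int -> W) : (forall a, exists d : int, forall m, d <= m -> f a m = 0) ->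
  exists d : nat, forall a m, d%:Z <= m -> f a m = 0.
Proof.
move=> h; have h' a : exists d : nat, forall m, d%:Z <= m -> f a m = 0.
  by have [d hd] := h a; exists `|d|%N => m hm; apply: hd; lia.
have [d hd] := choice h'; exists (\max_a d a) => a m hm; apply: hd; apply: le_trans hm.
by rewrite lez_nat; exact: leq_bigmax.
Qed.

(* All the sums below become finite sums over p, q, j < N. *)
Lemma bounds : exists (d : int) (N J : nat) (E : int), [/\ ordge F d,
  [/\ forall m, d + N%:Z <= m -> phi r m t = 0,
      forall s m, N%:Z <= m -> y s m t = 0 &
      forall s q m, d + N%:Z <= m -> phi r m (y s q%:Z t) = 0],
  (forall s q p, (N <= q)%N -> y s q%:Z (pair F (phi r) p%:Z t) = 0),
  [/\ forall k j, (k < T)%N -> (J <= j)%N -> forall m, psi r k j m t = 0,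
      forall k j m, (k < T)%N -> E <= m -> psi r k j m t = 0, (J <= N)%N & E + J%:Z <= d + N%:Z] &
  E <= d + N%:Z].
Proof.
have [d hd] := ico_bounded F; have [E0 hE0] := (phif r).2 t.
have [Q1 hQ1] := int_fam_bound (fun s => (yf s).2 t).
have [Q2 hQ2] := @int_fam_bound (P * 'I_`|E0 - d|)%type (fun a m => y a.1 m (phi r (d + a.2%:Z) t))
  (fun a => (yf a.1).2 _).
have [E1 hE1] := @int_fam_bound (P * 'I_(maxn Q1 Q2))%type (fun a m => phi r m (y a.1 a.2%:Z t)) (fun a => (phif r).2 _).
have [J hJ] := psi0.
have [E2 hE2] := @int_fam_bound ('I_T * 'I_J)%type (fun a m => psi r a.1 a.2 m t) (fun a => (psif r a.1 a.2).2 t).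
pose N := (Q1 + Q2 + `|E0| + E1 + E2 + J + `|d|)%N.
have hq s q : (maxn Q1 Q2 <= q)%N -> y s q%:Z t = 0 by move=> h; apply: hQ1; lia.
exists d, N, J, E2%:Z; split; first exact: hd.
- split=> [m hm|s m hm|s q m hm].
  + by apply: hE0; rewrite /N in hm; lia.
  + by apply: hQ1; rewrite /N in hm; lia.
  + case: (ltnP q (maxn Q1 Q2)) => [qQ|/hq ->]; last by rewrite (lin0 ((phif r).1 _)).
    by apply: (hE1 (s, Ordinal qQ)); rewrite /N in hm; lia.
- move=> s q p hq'; rewrite /pair (lin_fsum ((yf s).1 _)); last exact: pair_fins.
  apply: fsum0 => n; rewrite (linZ ((yf s).1 _)).
  case: (ltP n d) => [/hd ->|dn]; first by rewrite scale0r.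
  case: (ltP (n + p%:Z) E0) => [nE|/hE0 ->]; last by rewrite (lin0 ((yf s).1 _)) scaler0.
  have hi : (`|(n + p%:Z - d)%R| < `|(E0 - d)%R|)%N by lia.
  have := hQ2 (s, Ordinal hi) q%:Z; rewrite /= (_ : d + `|(n + p%:Z - d)%R|%N%:Z = n + p%:Z); last lia.
  by move=> ->; rewrite ?scaler0 //; rewrite /N in hq'; lia.
- split=> [k j kT hj m|k j m kT hm||]; [exact: hJ | | rewrite /N; lia | rewrite /N; lia].
  case: (ltnP j J) => [jJ|hj]; last exact: hJ.
  exact: (hE2 (Ordinal kT, Ordinal jJ)).
- by rewrite /N; lia.
Qed.

End Bounds.

(** At a point r other than the origin the commutators with the point [sh k r] acquire the form of
    the extra terms of Y_W at the origin. For fixed M = p + q the sum over q is [reexpand], and the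
    sum over M is then the expansion at c r of 1/t^(j+1). *)
Lemma inner_sum (r : P) F t d (N J : nat) (E : int) k j : r != r0 -> (0 < k < T)%N -> (j < N)%N ->
  c r != 0 -> ordge F d ->
  (forall k j, (k < T)%N -> (J <= j)%N -> forall m, psi r k j m t = 0) ->
  (forall k j m, (k < T)%N -> E <= m -> psi r k j m t = 0) -> E + J%:Z <= d + N%:Z -> E <= d + N%:Z ->
  \sum_(p < N) \sum_(q < N) - (ico (expz (c (sh k r)) (rpw (c r) p.+1)) q%:Z *
      ('C(q, j)%:R * ((w ^+ k) ^+ q.+1)^-1)) *: pair F (psi r k j) (p%:Z + q%:Z - j%:Z) t
  = ((w ^+ k - 1) ^+ j.+1)^-1 *: pair (F * expz (c r) (rpw 0 j.+1)) (psi r k j) 0 t.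
Proof.
move=> rr0 kT jN cr0 hF hJ hE EN EN'; have kT' : (k < T)%N by case/andP: kT.
have x0 : w ^+ k != 0 by rewrite expf_neq0.
have f0 := psif r k j.
have pz e : E - d <= e -> pair F (psi r k j) e t = 0.
  by move=> he; apply: (pair_vanish hF (fun m hm => hE k j m kT' hm)); lia.
case: (leqP J j) => [Jj|jJ].
  have z e g : pair g (psi r k j) e t = 0 by apply: fsum0 => n; rewrite hJ // scaler0.
  rewrite z scaler0 big1 // => p _; rewrite big1 // => q _; by rewrite z scaler0.
rewrite (pair_mul (N := N) f0 hF) => [||m hm]; last first.
- by apply: hE => //; lia.
- by rewrite expz_rpw // => m m0; rewrite ico_geo leNgt m0.
rewrite (diag_ord (G := fun p q => - (ico (expz (c (sh k r)) (rpw (c r) p.+1)) q%:Z *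
      ('C(q, j)%:R * ((w ^+ k) ^+ q.+1)^-1)) *: pair F (psi r k j) (p%:Z + q%:Z - j%:Z) t)) => [|p q hpq]; last first.
  by rewrite pz ?scaler0 //; lia.
have hs : c (sh k r) != c r by rewrite (inj_eq cinj) sh_ne.
(* Here M = p + q. For M < j every C(q, j) with q <= M is 0, which is the source of the condition j
   <= M. *)
transitivity (\sum_(M < N) (if (j <= M)%N then ((w ^+ k - 1) ^+ j.+1)^-1 * ico (expz (c r) (rpw 0 j.+1)) (M - j)%N%:Z else 0) *: pair F (psi r k j) (M%:Z - j%:Z) t).
  apply: eq_bigr => M _; transitivity ((\sum_(q < M.+1) - (ico (expz (c (sh k r)) (rpw (c r) (M - q).+1)) q%:Z *
      ('C(q, j)%:R * ((w ^+ k) ^+ q.+1)^-1))) *: pair F (psi r k j) (M%:Z - j%:Z) t).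
    rewrite scaler_suml; apply: eq_bigr => q _; congr (_ *: _).
    by congr (pair F (psi r k j) _ t); have := ltn_ord q; lia.
  congr (_ *: _); case: (leqP j M) => jM; last first.
    by apply: big1 => q _; rewrite bin_small ?mul0r ?mulr0 ?oppr0 //; have := ltn_ord q; lia.
  rewrite expz_rpw // subr0 -(reexpand x0 (w1 kT) cr0 jM); apply: eq_bigr => q _.
  by rewrite expz_rpw // sh_c.
rewrite scaler_sumr; have [i Ei] : exists i, N = (j + i)%N by exists (N - j)%N; rewrite subnKC // ltnW.
pose A M := (if (j <= M)%N then ((w ^+ k - 1) ^+ j.+1)^-1 * ico (expz (c r) (rpw 0 j.+1)) (M - j)%N%:Z else 0) *: pair F (psi r k j) (M%:Z - j%:Z) t.
pose B p := ((w ^+ k - 1) ^+ j.+1)^-1 *: (ico (expz (c r) (rpw 0 j.+1)) p%:Z *: pair F (psi r k j) p%:Z t).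
transitivity (\sum_(p < i) B p).
  have -> : \sum_(M < N) A M = \sum_(0 <= M < j + i) A M by rewrite big_mkord Ei.
  rewrite (big_cat_nat (n := j)) //=; last exact: leq_addr.
  rewrite big_nat_cond big1 ?add0r => [|M /andP[/andP[_ Mj] _]]; last by rewrite /A leqNgt Mj scale0r.
  rewrite -{1}[j]add0n big_addn addKn big_mkord; apply: eq_bigr => p _.
  rewrite /A /B leq_addl addnK scalerA; congr (_ *: _).
  by congr (pair F (psi r k j) _ t); lia.
have -> : \sum_(p < N) ((w ^+ k - 1) ^+ j.+1)^-1 *: (ico (expz (c r) (rpw 0 j.+1)) p%:Z *: pair F (psi r k j) p%:Z t)
  = \sum_(0 <= p < N) B p by rewrite big_mkord.
rewrite (big_cat_nat (n := i)) //=; last by rewrite Ei leq_addl.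
rewrite big_mkord [X in _ = _ + X]big_nat_cond [X in _ = _ + X]big1 ?addr0 // => p /andP[/andP[ip _] _].
by rewrite /B pz ?scaler0 //; lia.
Qed.

Lemma main_step r F t : S (\sum_(n \in [set: int]) ico F n *: chi r n t
   - \sum_s \sum_(q \in [set: nat]) pair (F * expz (c r) (rpw (c s) q.+1)) (phi r) 0 (y s q%:Z t)
   - \sum_(k < T | (0 < k)%N) \sum_(j \in [set: nat])
       ((w ^+ k - 1) ^+ j.+1)^-1 *: pair (F * expz (c r) (rpw 0 j.+1)) (psi r k j) 0 t).
Proof.
have [d [N [J [E [hF [b1 b2 b3] b4 [b5 b6 JN EN] EN']]]]] := bounds r F t.
have pf := phif r.
have y0 s m : y s m 0 = 0 by exact: (lin0 ((yf s).1 _)).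
have p0 m : phi r m 0 = 0 by exact: (lin0 (pf.1 _)).
have y2 s q : (N <= q)%N -> y s q%:Z t = 0 by move=> h; apply: b2; lia.
have q0 G j k e : (k < T)%N -> (N <= j)%N -> pair G (psi r k j) e t = 0.
  by move=> kT h; apply: fsum0 => n; rewrite b5 ?scaler0 //; lia.
pose ex k j := ((w ^+ k - 1) ^+ j.+1)^-1.
pose X3 := if r == r0 then \sum_(k < T | (0 < k)%N) \sum_(j < N)
       ex k j *: pair F (psi r k j) (- j.+1%:Z) t else 0.
(* The recursion F1 paired with F: creation part, annihilation part, and at the origin the extra
   terms. *)
have EA : \sum_(n \in [set: int]) ico F n *: chi r n t =
   \sum_(p < N) y r (- p.+1%:Z) (pair F (phi r) p%:Z t)
   + \sum_(p < N) pair F (phi r) (- p.+1%:Z) (y r p%:Z t) + X3.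
  transitivity (\sum_(n \in [set: int]) (\sum_(p < N) y r (- p.+1%:Z) (ico F n *: phi r (n + p%:Z) t) +
      \sum_(p < N) ico F n *: phi r (n - p.+1%:Z) (y r p%:Z t) +
      (if r == r0 then \sum_(k < T | (0 < k)%N) \sum_(j < N) ex k j *: (ico F n *: psi r k j (n - j.+1%:Z) t) else 0))).
    apply: eq_fsum => n; case: (ltP n d) => [/hF ->|dn].
      rewrite scale0r big1 => [|p _]; last by rewrite scale0r y0.
      rewrite big1 => [|p _]; last by rewrite scale0r.
      rewrite !add0r; case: eqP => // _; rewrite big1 // => k _; by rewrite big1 // => j _; rewrite scale0r scaler0.
    rewrite F1 !scalerDr; congr (_ + _ + _).
    - rewrite (fsum_ord (b := N)) => [|p hp]; last by rewrite b1 ?y0 //; lia.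
      by rewrite scaler_sumr; apply: eq_bigr => p _; rewrite (linZ ((yf r).1 _)).
    - rewrite (fsum_ord (b := N)) => [|p hp]; last by rewrite y2.
      by rewrite scaler_sumr.
    - case: eqP => // _; last by rewrite scaler0.
      rewrite scaler_sumr; apply: eq_bigr => k _; rewrite (fsum_ord (b := N)) => [|j hj]; last first.
        by rewrite b5 ?scaler0 ?ltn_ord //; lia.
      by rewrite scaler_sumr; apply: eq_bigr => j _; rewrite !scalerA mulrC.
  have g1 p : fins (fun n => y r (- p.+1%:Z) (ico F n *: phi r (n + p%:Z) t)).
    by apply: (fins_map (y0 r _)); exact: pair_fins.
  have g2 p : fins (fun n => ico F n *: phi r (n - p.+1%:Z) (y r p%:Z t)) by exact: pair_fins.
  have g3 k j : fins (fun n => ex k j *: (ico F n *: psi r k j (n - j.+1%:Z) t)).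
    by apply: (fins_map (scaler0 _ _)); exact: pair_fins.
  have f1 : fins (fun n => \sum_(p < N) y r (- p.+1%:Z) (ico F n *: phi r (n + p%:Z) t)).
    by apply: fins_sum => p; exact: g1.
  have f2 : fins (fun n => \sum_(p < N) ico F n *: phi r (n - p.+1%:Z) (y r p%:Z t)).
    by apply: fins_sum => p; exact: g2.
  have f3 : fins (fun n => if r == r0 then \sum_(k < T | (0 < k)%N) \sum_(j < N) ex k j *: (ico F n *: psi r k j (n - j.+1%:Z) t) else 0).
    case: eqP => _; last by exists [::].
    by apply: fins_sum => k; apply: fins_sum => j; exact: g3.
  rewrite (fsumD (finsD f1 f2) f3) (fsumD f1 f2); congr (_ + _ + _).
  - rewrite (fsum_sum _ _ (fun p : 'I_N => g1 p)); apply: eq_bigr => p _.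
    by rewrite -(lin_fsum ((yf r).1 _)) //; exact: pair_fins.
  - by rewrite (fsum_sum _ _ (fun p : 'I_N => g2 p)).
  - rewrite /X3; case: eqP => // _; last by rewrite fsum0.
    have g4 (k : 'I_T) : fins (fun n => \sum_(j < N) ex k j *: (ico F n *: psi r k j (n - j.+1%:Z) t)).
      by apply: fins_sum => j; exact: g3.
    rewrite (fsum_sum _ _ g4); apply: eq_bigr => k _.
    rewrite (fsum_sum _ _ (fun j : 'I_N => g3 k j)); apply: eq_bigr => j _.
    by rewrite -scaler_fsum //; exact: pair_fins.
pose kap s p q := ico (expz (c s) (rpw (c r) p.+1)) q%:Z.
pose C s q p := if r == r0 then 0 else \sum_(k < T | (0 < k)%N) if s == sh k r then
      \sum_(j < N) ('C(q, j)%:R * ((w ^+ k) ^+ q.+1)^-1) *: pair F (psi r k j) (p%:Z + q%:Z - j%:Z) t else 0.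
have cne s : s != r -> c s != c r by move=> sr; rewrite (inj_eq cinj).
(* H1 applied to the vector [pair F (phi r) p t]. At r the function 1/(t - c r)^(p+1) is the single
   monomial u^(-p-1); at the other points it is regular and brings in annihilation modes only. *)
have hH (p : 'I_N) : S (y r (- p.+1%:Z) (pair F (phi r) p%:Z t) +
    \sum_(s | s != r) \sum_(q < N) kap s p q *: y s q%:Z (pair F (phi r) p%:Z t)).
  have := H1 r p (pair F (phi r) p%:Z t); rewrite (bigD1 r) //=.
  rewrite expz_rpw_diag (fsum_only (j := - p.+1%:Z)) => [|m mp]; last by rewrite ico_mono (negbTE mp) scale0r.
  rewrite ico_mono eqxx scale1r; congr (S (_ + _)); apply: eq_bigr => s sr.
  rewrite fsum_int_pos => [|m m0]; last by rewrite expz_rpw ?cne // ico_geo leNgt m0 scale0r.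
  by rewrite (fsum_ord (b := N)) // => q hq; rewrite b4 ?scaler0.
have hC s q p : (q < N)%N -> s != r -> y s q%:Z (pair F (phi r) p%:Z t) = pair F (phi r) p%:Z (y s q%:Z t) + C s q p.
  move=> qN sr; rewrite {1}/pair (lin_fsum ((yf s).1 _)); last exact: pair_fins.
  pose D m := if r == r0 then 0 else \sum_(k < T | (0 < k)%N) if s == sh k r then
      \sum_(j < N) ('C(q, j)%:R * ((w ^+ k) ^+ q.+1)^-1) *: psi r k j (m + q%:Z - j%:Z) t else 0.
  transitivity (\sum_(n \in [set: int]) (ico F n *: phi r (n + p%:Z) (y s q%:Z t) + ico F n *: D (n + p%:Z))).
    apply: eq_fsum => n; rewrite (linZ ((yf s).1 _)) -scalerDr; congr (_ *: _).
    have /eqP := F2 q (n + p%:Z) t sr; rewrite subr_eq => /eqP ->; rewrite [LHS]addrC; congr (_ + _).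
    rewrite /D; case: (r == r0) => //; apply: eq_bigr => k _; case: (s == sh k r) => //.
    rewrite -(big_mkord xpredT (fun j => ('C(q, j)%:R * ((w ^+ k) ^+ q.+1)^-1) *: psi r k j (n + p%:Z + q%:Z - j%:Z) t)).
    rewrite -(big_mkord xpredT (fun j => ('C(q, j)%:R * ((w ^+ k) ^+ q.+1)^-1) *: psi r k j (n + p%:Z + q%:Z - j%:Z) t)).
    rewrite [RHS](big_cat_nat (n := q.+1)) //= [X in _ = _ + X]big_nat_cond [X in _ = _ + X]big1 ?addr0 // => j /andP[/andP[qj _] _].
    by rewrite bin_small // mul0r scale0r.
  have g k j : fins (fun n => ('C(q, j)%:R * ((w ^+ k) ^+ q.+1)^-1) *: (ico F n *: psi r k j (n + (p%:Z + q%:Z - j%:Z)) t)).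
    by apply: (fins_map (scaler0 _ _)); exact: pair_fins.
  have E1 n : ico F n *: D (n + p%:Z) = if r == r0 then 0 else \sum_(k < T | (0 < k)%N) if s == sh k r then
      \sum_(j < N) ('C(q, j)%:R * ((w ^+ k) ^+ q.+1)^-1) *: (ico F n *: psi r k j (n + (p%:Z + q%:Z - j%:Z)) t) else 0.
    rewrite /D; case: eqP => _; first by rewrite scaler0.
    rewrite scaler_sumr; apply: eq_bigr => k _; case: eqP => _; last by rewrite scaler0.
    rewrite scaler_sumr; apply: eq_bigr => j _; rewrite !scalerA mulrC; congr (_ *: psi _ _ _ _ _); lia.
  have g1 k : fins (fun n => if s == sh k r then
      \sum_(j < N) ('C(q, j)%:R * ((w ^+ k) ^+ q.+1)^-1) *: (ico F n *: psi r k j (n + (p%:Z + q%:Z - j%:Z)) t) else 0).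
    by case: eqP => _; [apply: fins_sum => j; exact: g | exists [::]].
  under eq_fsum do rewrite E1.
  have g2 : fins (fun n => if r == r0 then 0 else \sum_(k < T | (0 < k)%N) if s == sh k r then
      \sum_(j < N) ('C(q, j)%:R * ((w ^+ k) ^+ q.+1)^-1) *: (ico F n *: psi r k j (n + (p%:Z + q%:Z - j%:Z)) t) else 0).
    by case: eqP => _; [exists [::] | apply: fins_sum => k; exact: g1].
  rewrite fsumD //; last exact: pair_fins.
  congr (_ + _); rewrite /C; case: eqP => _; first by rewrite fsum0.
  rewrite (fsum_sum _ _ (fun k : 'I_T => g1 k)); apply: eq_bigr => k _; case: eqP => _; last by rewrite fsum0.
  rewrite (fsum_sum _ _ (fun j : 'I_N => g k j)); apply: eq_bigr => j _.
  by rewrite -scaler_fsum //; exact: pair_fins.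
(* The summand s = r is the annihilation part of F1. For s different from r, [expz_rpw_sym] turns a
   pole of order q + 1 at s into one of order p + 1 at r, with the sign that makes it cancel against
   the moved terms. *)
have hY1 : \sum_s \sum_(q \in [set: nat]) pair (F * expz (c r) (rpw (c s) q.+1)) (phi r) 0 (y s q%:Z t)
   = \sum_(p < N) pair F (phi r) (- p.+1%:Z) (y r p%:Z t)
     - \sum_(s | s != r) \sum_(p < N) \sum_(q < N) kap s p q *: pair F (phi r) p%:Z (y s q%:Z t).
  rewrite (bigD1 r) //=; congr (_ + _).
    rewrite (fsum_ord (b := N)) => [|q hq]; last by rewrite y2 // (lin0 (pair_lin _ _ pf)).
    by apply: eq_bigr => q _; rewrite expz_rpw_diag pair_mono.
  rewrite -sumrN; apply: eq_bigr => s sr.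
  rewrite (fsum_ord (b := N)) => [|q hq]; last by rewrite y2 // (lin0 (pair_lin _ _ pf)).
  rewrite exchange_big /= -sumrN; apply: eq_bigr => q _.
  rewrite (pair_mul (N := N) pf hF) => [||m hm]; last first.
  - by rewrite b3.
  - by rewrite expz_rpw 1?eq_sym ?cne // => m m0; rewrite ico_geo leNgt m0.
  rewrite -sumrN; apply: eq_bigr => p _; rewrite -scaleNr; congr (_ *: _).
  by rewrite expz_rpw_sym // eq_sym cne.
(* For r = r0 there are no commutators and X3 is already the right side; for the other points X3 = 0
   and [inner_sum] evaluates the commutators. *)
have hR : - (\sum_(s | s != r) \sum_(p < N) \sum_(q < N) kap s p q *: C s q p) + X3
   = \sum_(k < T | (0 < k)%N) \sum_(j \in [set: nat])
       ((w ^+ k - 1) ^+ j.+1)^-1 *: pair (F * expz (c r) (rpw 0 j.+1)) (psi r k j) 0 t.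
  rewrite /X3; case: (eqVneq r r0) => [rr0|rr0].
    rewrite big1 ?oppr0 ?add0r => [|s _]; last first.
      by rewrite big1 // => p _; rewrite big1 // => q _; rewrite /C rr0 eqxx scaler0.
    apply: eq_bigr => k _; rewrite (fsum_ord (b := N)) => [|j hj]; last by rewrite q0 ?scaler0.
    apply: eq_bigr => j _; congr (_ *: _).
    have -> : expz (c r) (rpw 0 j.+1) = lmono (- j.+1%:Z) by rewrite rr0 c0 expz_rpw_diag.
    by rewrite pair_mono.
  rewrite addr0; have cr0 : c r != 0 by rewrite -c0 (inj_eq cinj).
  transitivity (\sum_(k < T | (0 < k)%N) \sum_(j < N) \sum_(p < N) \sum_(q < N) - (kap (sh k r) p q *
      ('C(q, j)%:R * ((w ^+ k) ^+ q.+1)^-1)) *: pair F (psi r k j) (p%:Z + q%:Z - j%:Z) t); last first.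
    apply: eq_bigr => k k0; rewrite (fsum_ord (b := N)) => [|j hj]; last by rewrite q0 ?scaler0.
    apply: eq_bigr => j _; apply: (inner_sum (J := J) (E := E) rr0 _ (ltn_ord j) cr0 hF) => //.
    by rewrite k0 ltn_ord.
  transitivity (- \sum_(k < T | (0 < k)%N) \sum_(s | s != r) if s == sh k r then \sum_(p < N) \sum_(q < N)
     kap s p q *: (\sum_(j < N) ('C(q, j)%:R * ((w ^+ k) ^+ q.+1)^-1) *: pair F (psi r k j) (p%:Z + q%:Z - j%:Z) t) else 0).
    rewrite [in RHS]exchange_big /=; congr (- _); apply: eq_bigr => s sr.
    transitivity (\sum_(p < N) \sum_(q < N) \sum_(k < T | (0 < k)%N) if s == sh k r then
     kap s p q *: (\sum_(j < N) ('C(q, j)%:R * ((w ^+ k) ^+ q.+1)^-1) *: pair F (psi r k j) (p%:Z + q%:Z - j%:Z) t) else 0).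
      apply: eq_bigr => p _; apply: eq_bigr => q _; rewrite /C (negbTE rr0) scaler_sumr.
      by apply: eq_bigr => k _; case: eqP => // _; rewrite scaler0.
    pose G p q (k : 'I_T) := if s == sh k r then
     kap s p q *: (\sum_(j < N) ('C(q, j)%:R * ((w ^+ k) ^+ q.+1)^-1) *: pair F (psi r k j) (p%:Z + q%:Z - j%:Z) t) else 0.
    transitivity (\sum_(p < N) \sum_(k < T | (0 < k)%N) \sum_(q < N) G p q k).
      by apply: eq_bigr => p _; exact: exchange_big.
    rewrite exchange_big /=; apply: eq_bigr => k _; rewrite /G; case: eqP => // _.
    by rewrite big1 // => p _; rewrite big1.
  rewrite -sumrN; apply: eq_bigr => k k0.
  have kT : (0 < k < T)%N by rewrite k0 ltn_ord.
  have hs : sh k r != r by exact: sh_ne.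
  rewrite (sum_only (fun s => \sum_(p < N) \sum_(q < N)
     kap s p q *: (\sum_(j < N) ('C(q, j)%:R * ((w ^+ k) ^+ q.+1)^-1) *: pair F (psi r k j) (p%:Z + q%:Z - j%:Z) t)) hs).
  transitivity (\sum_(p < N) \sum_(q < N) \sum_(j < N) - (kap (sh k r) p q *
      ('C(q, j)%:R * ((w ^+ k) ^+ q.+1)^-1)) *: pair F (psi r k j) (p%:Z + q%:Z - j%:Z) t).
    rewrite -sumrN; apply: eq_bigr => p _; rewrite -sumrN; apply: eq_bigr => q _.
    by rewrite scaler_sumr -sumrN; apply: eq_bigr => j _; rewrite scalerA scaleNr.
  rewrite [RHS]exchange_big /=; apply: eq_bigr => p _; exact: exchange_big.
have [S0 SD] := Ssub.
rewrite -hR EA hY1.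
have : S (\sum_(p < N) (y r (- p.+1%:Z) (pair F (phi r) p%:Z t) +
    \sum_(s | s != r) \sum_(q < N) kap s p q *: y s q%:Z (pair F (phi r) p%:Z t))).
  by apply: (@subspace_sum K _ S) => // p _; exact: hH.
have -> : \sum_(p < N) (y r (- p.+1%:Z) (pair F (phi r) p%:Z t) +
    \sum_(s | s != r) \sum_(q < N) kap s p q *: y s q%:Z (pair F (phi r) p%:Z t)) =
  \sum_(p < N) y r (- p.+1%:Z) (pair F (phi r) p%:Z t) + (
   \sum_(s | s != r) \sum_(p < N) \sum_(q < N) kap s p q *: pair F (phi r) p%:Z (y s q%:Z t) +
   \sum_(s | s != r) \sum_(p < N) \sum_(q < N) kap s p q *: C s q p).
  rewrite big_split /=; congr (_ + _); rewrite exchange_big /= -big_split; apply: eq_bigr => s sr.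
  rewrite -big_split; apply: eq_bigr => p _; rewrite -big_split; apply: eq_bigr => q _.
  by rewrite hC ?ltn_ord // scalerDr.
move: (\sum_(p < N) y r _ _) (\sum_(s | s != r) \sum_(p < N) \sum_(q < N) kap s p q *: pair _ _ _ _)
  (\sum_(s | s != r) \sum_(p < N) \sum_(q < N) kap s p q *: C _ _ _) (\sum_(p < N) pair _ _ _ _) => u1 u2 u3 u4.
congr S; rewrite !opprD !opprK [RHS](AC (3*2*2) (1*(5*6)*(2*4)*(3*7))) /= !subrr !addr0 //.
Qed.
End MainStep.

Section StateRotation.
Context {K : numFieldType} {L : vla K} (hL : vertex_lie_algebra L).
Context {T : nat} {w : K} (hw : T.-primitive_root w) (hS : vla_automorphism L T).
Context {V : lmodType K} {va : loop L -> V -> V} {v0 : V} (hV : vacuum_module va v0).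
Context {M : lmodType K} {u : L -> int -> M -> M} (hu : twisted_fields (T := T) (w := w) u).
Context {Y : V -> int -> M -> M} (hY : state_map (T := T) (w := w) (va := va) (v0 := v0) (u := u) Y).
Context {RV : V -> V} {k : nat} (kT : (k < T)%N) (Rlin : linear RV) (R0 : RV v0 = v0)
  (Ract : forall x A, RV (va x A) = va (LA (w ^+ k) (@vR _ L w k) x) (RV A)).
Local Notation R k := (@vR _ L w k).

(* The fields rescaled by powers of w^k satisfy the defining recursion of Y, which determines it. *)
Lemma stm_rotate A n v : Y (RV A) n v = (w ^+ k) ^ (n + 1) *: Y A n v.
Proof.
have w0 := prim_neq0 hw; have c0 : w ^+ k != 0 by rewrite expf_neq0.
have hX := vla_graded_vla hL hS; have hz := zaut_vR hL k hS w0.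
move: Ract hz c0 (fun a n v => tw_R hu a n v kT) => Ract' hz c0 uR; move: (w ^+ k) Ract' hz c0 uR => c Ract' hz c0 uR.
have aY := stm_axioms hw hu hY; have [l1 [l2 [l3 [l4 [l5 l6]]]]] := aY.
have Rm a m B : RV (va (mode a m) B) = c ^ (- m - 1) *: va (mode (R k a) m) (RV B).
  by rewrite Ract' (LA_mode hz) (linZ (vm_linx hV _)).
have Rm1 a B : RV (va (mode a (-1)) B) = va (mode (R k a) (-1)) (RV B) by rewrite Rm scale1r.
pose Y' A n v := c ^ (- n - 1) *: Y (RV A) n v.
suff aY' : field_axioms (va := va) (v0 := v0) (u := u) (extraW (T := T) (w := w) (va := va)) Y'.
  rewrite -(field_axioms_uniq hL hw hV aY' aY A) /Y' scalerA -expfzDr //.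
  by rewrite (_ : n + 1 + (- n - 1) = 0) ?scale1r //; lia.
have Ym1 a m t : Y' (va (mode a (-1)) v0) m t = u a m t.
  rewrite /Y' Rm1 R0 l5 uR scalerA -expfzDr //.
  by rewrite (_ : - m - 1 + (m + 1) = 0) ?scale1r //; lia.
split; first by move=> m t; apply: lin_scale; exact: (lin_comp (l1 m t) Rlin).
split; first by move=> B m; apply: lin_scale; exact: l2.
split; first by move=> B t; have [d hd] := l3 (RV B) t; exists d => m /hd; rewrite /Y' => ->; rewrite scaler0.
split.
  move=> m t; rewrite /Y' R0 l4; case: eqP => [->|_]; last by rewrite scaler0.
  by rewrite scale1r.
split; first exact: Ym1.
move=> a B m t; rewrite {1}/Y' Rm1 l6 scalerDr; congr (_ + _).
  have e n1 (n2 : int) : n1 + n2 = m - 1 -> c ^ (- m - 1) * (c ^ (n1 + 1) * c ^ (n2 + 1)) = 1.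
    by move=> e; rewrite -!expfzDr // (_ : - m - 1 + _ = 0) //; lia.
  have e' n1 n2 (x : M) : n1 + n2 = m - 1 -> c ^ (- m - 1) *: (c ^ (n1 + 1) *: (c ^ (n2 + 1) *: x)) = x.
    by move=> /e en; rewrite !scalerA -mulrA en scale1r.
  have YE n1 t1 : Y (RV B) n1 t1 = c ^ (n1 + 1) *: Y' B n1 t1.
    by rewrite /Y' scalerA -expfzDr // (_ : n1 + 1 + _ = 0) ?scale1r //; lia.
  have uE n1 t1 : Y (va (mode (R k a) (-1)) v0) n1 t1 = c ^ (n1 + 1) *: Y' (va (mode a (-1)) v0) n1 t1.
    by rewrite l5 Ym1 uR.
  have Yl n1 : linear (Y' (va (mode a (-1)) v0) n1) by apply: lin_scale; exact: l2.
  have Yl' n1 : linear (Y' B n1) by apply: lin_scale; exact: l2.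
  have g1 t1 : fins (fun p : nat => Y (va (mode (R k a) (-1)) v0) (- p%:Z - 1) (Y (RV B) (m + p%:Z) t1)).
    have [d hd] := l3 (RV B) t1; apply: (fins_nat (b := `|d - m|%N)) => p hp.
    by rewrite hd ?(lin0 (l2 _ _)) //; lia.
  have g2 t1 : fins (fun p : nat => Y (RV B) (m - p%:Z - 1) (Y (va (mode (R k a) (-1)) v0) p%:Z t1)).
    have [d hd] := l3 (va (mode (R k a) (-1)) v0) t1; apply: (fins_nat (b := `|d|%N)) => p hp.
    by rewrite hd ?(lin0 (l2 _ _)) //; lia.
  rewrite !normal_prodE scalerDr !scaler_fsum //; congr (_ + _); apply: eq_fsum => p.
    by rewrite uE YE (linZ (Yl _)) e' //; lia.
  by rewrite YE uE (linZ (Yl' _)) e' //; lia.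
rewrite /extraW scaler_sumr; apply: eq_bigr => l l0.
have g3 : fins (fun n : nat => ((w ^+ l - 1) ^+ n.+1)^-1 *: Y (va (mode (R l (R k a)) n%:Z) (RV B)) (m - n%:Z - 1) t).
  have [d hd] := va_modes_trunc hL hV (R l (R k a)) (RV B); apply: (fins_nat (b := `|d|%N)) => p hp.
  by rewrite hd ?(lin0 (l1 _ _)) ?scaler0 //; lia.
rewrite scaler_fsum //; apply: eq_fsum => n1.
rewrite /Y' Rm (linZ (l1 _ _)) !scalerA vR_comp // addnC -vR_comp //; congr (_ *: _).
rewrite [LHS]mulrC -?mulrA; congr (_ * _).
by rewrite -expfzDr //; congr (c ^ _); lia.
Qed.

End StateRotation.

(** * Operators on one factor of a multiple tensor product *)

Section MultiTensor.
Context {K : fieldType} {I : finType} {M : I -> lmodType K}.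
Local Notation W := (mtensor M).
Implicit Types (v : forall i, M i) (t : W).

Lemma dfwith_same v i (x y : M i) : dfwith (dfwith v x) y = dfwith v y.
Proof.
apply: functional_extensionality_dep => j; case: (eqVneq j i) => [->|ji]; first by rewrite !dfwith_in.
by rewrite !dfwith_out // eq_sym.
Qed.

Lemma dfwith_swap v i j (x : M i) (y : M j) : j != i -> dfwith (dfwith v x) y = dfwith (dfwith v y) x.
Proof.
move=> ji; apply: functional_extensionality_dep => k; case: (eqVneq k j) => [->|kj].
  by rewrite dfwith_in dfwith_out 1?eq_sym // dfwith_in.
rewrite [LHS]dfwith_out 1?eq_sym //; case: (eqVneq k i) => [->|ki]; first by rewrite !dfwith_in.
by rewrite !dfwith_out // eq_sym.
Qed.

Lemma dfwith_id v i : dfwith v (v i) = v.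
Proof.
apply: functional_extensionality_dep => j; case: (eqVneq j i) => [->|ji]; first by rewrite dfwith_in.
by rewrite dfwith_out // eq_sym.
Qed.

(** A pure tensor as a function of its entry in slot i, the other entries being those of v.
    Identities between operators on slot i are verified on these. *)
Definition mslot v i (x : M i) : W := mtens (dfwith v x).
Arguments mslot : clear implicits.

Lemma mslot_lin v i : linear (mslot v i).
Proof.
move=> c x y; rewrite /mslot /mtens -(linZ (qpi_linear _)) -qpiD; apply/qpiP/lspan_incl.
by exists v, i, c, x, y; rewrite opprD addrA.
Qed.

Lemma mtensor_ind i (P : set W) : subspace P -> (forall v x, P (mslot v i x)) -> forall t, P t.
Proof.
move=> hP h t; apply: (subspace_lspan hP) (quot_malg_span t) => _ [v _ <-].
by rewrite -(dfwith_id v i); exact: h.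
Qed.

Section Op.
Context {i : I} {phi : M i -> M i} (phil : linear phi).

Lemma mop_rels r : mtensor_rels r -> free_lift (fun v => mtens (dfwith v (phi (v i)))) r = 0.
Proof.
move=> [v [j [c [x [y ->]]]]]; rewrite free_lift_rel; case: (eqVneq j i) => [e|ji].
  subst j; rewrite !dfwith_same !dfwith_in phil.
  by rewrite [mtens _](mslot_lin v) -addrA -opprD subrr.
rewrite !(@dfwith_out _ _ _ _ _ i) //.
rewrite !(dfwith_swap _ _ (phi (v i))) 1?eq_sym //.
by rewrite [mtens (dfwith _ (c *: x + y))](mslot_lin (dfwith v (phi (v i)))) -addrA -opprD subrr.
Qed.

Lemma mop_linear : linear (mtensor_op phi).
Proof. exact: (quot_lift_linear mop_rels). Qed.

Lemma mop_mslot v x : mtensor_op phi (mslot v i x) = mslot v i (phi x).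
Proof. by rewrite /mtensor_op /mslot /mtens (quot_liftU _ mop_rels) dfwith_in dfwith_same. Qed.

Lemma mop_mslot_ne v j x : j != i -> mtensor_op phi (mslot v j x) = mslot (dfwith v (phi (v i))) j x.
Proof.
move=> ji; rewrite /mtensor_op /mslot /mtens (quot_liftU _ mop_rels) dfwith_out //.
by rewrite dfwith_swap 1?eq_sym.
Qed.

End Op.

Lemma mop_eq i (f g : W -> W) : linear f -> linear g ->
  (forall v x, f (mslot v i x) = g (mslot v i x)) -> f =1 g.
Proof.
move=> fl gl h; apply: (mtensor_ind (i := i)) => //.
by split=> [|c x y /= hx hy]; rewrite ?(lin0 fl) ?(lin0 gl) // fl gl hx hy.
Qed.

Lemma mop_comm i j (phi : M i -> M i) (psi : M j -> M j) t : linear phi -> linear psi -> j != i ->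
  mtensor_op phi (mtensor_op psi t) = mtensor_op psi (mtensor_op phi t).
Proof.
move=> hp hq ji; have lp := mop_linear hp; have lq := mop_linear hq; move: t; apply: (mop_eq (i := i)).
- exact: (lin_comp lp lq).
- exact: (lin_comp lq lp).
have ij : i != j by rewrite eq_sym.
by move=> v x; rewrite (mop_mslot_ne hq v x ij) !(mop_mslot hp) (mop_mslot_ne hq v _ ij).
Qed.

Lemma mop_lincomb i c (phi psi chi : M i -> M i) t : linear phi -> linear psi ->
  (forall x, chi x = c *: phi x + psi x) -> mtensor_op chi t = c *: mtensor_op phi t + mtensor_op psi t.
Proof.
move=> hp hq hc; have hl : linear chi.
  by move=> d x y; rewrite !hc; have := lin_add (lin_scale c hp) hq; apply.
have lp := mop_linear hp; have lq := mop_linear hq; move: t; apply: (mop_eq (i := i)).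
- exact: mop_linear.
- exact: (lin_add (lin_scale c lp) lq).
by move=> v x; rewrite !mop_mslot // hc (mslot_lin v).
Qed.

Lemma mop_id i t : mtensor_op (fun x : M i => x) t = t.
Proof.
move: t; apply: (mop_eq (i := i)) => [||v x]; [exact: (mop_linear (@lin_id _ _)) | exact: lin_id |].
by rewrite mop_mslot //; exact: lin_id.
Qed.

Lemma mop_zero i t : mtensor_op (fun x : M i => 0 : M i) t = 0.
Proof.
move: t; apply: (mop_eq (i := i)) => [||v x]; [exact: (mop_linear (@lin_cst0 _ _ _)) | exact: lin_cst0 |].
by rewrite mop_mslot; [exact: (lin0 (mslot_lin v (i := i))) | exact: lin_cst0].
Qed.

Lemma mop_comp i (phi psi : M i -> M i) t : linear phi -> linear psi ->
  mtensor_op (fun x => phi (psi x)) t = mtensor_op phi (mtensor_op psi t).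
Proof.
move=> hp hq; have lp := mop_linear hp; have lq := mop_linear hq; move: t; apply: (mop_eq (i := i)).
- exact: (mop_linear (lin_comp hp hq)).
- exact: (lin_comp lp lq).
by move=> v x; rewrite !mop_mslot //; exact: (lin_comp hp hq).
Qed.

End MultiTensor.

Section TensorFields.
Context {K : numFieldType} {I : finType} {M : I -> lmodType K}.
Local Notation W := (mtensor M).

Definition mfield i (f : int -> M i -> M i) : int -> W -> W := fun n => mtensor_op (f n).

(** An element of the tensor product is a finite combination of pure tensors, so the truncation
    bound survives although it depends on the vector. *)
Lemma mfield_field i (f : int -> M i -> M i) : is_field f -> is_field (mfield f).
Proof.
move=> [fl fb]; split=> [n|]; first exact: mop_linear (fl n).
apply: (mtensor_ind (i := i)) => [|v x].
  split=> [|c x y [d hd] [e he]]; first by exists 0 => n _; exact: (lin0 (mop_linear (fl n))).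
  exists (Num.max d e) => n; rewrite ge_max => /andP[nd ne].
  by rewrite /mfield (mop_linear (fl n)) [mtensor_op _ x]hd // [mtensor_op _ y]he // scaler0 addr0.
have [d hd] := fb x; exists d => n /hd e; rewrite /mfield mop_mslot; last exact: fl.
by rewrite e; exact: (lin0 (mslot_lin v (i := i))).
Qed.

Lemma mfield_fsum (J : choiceType) i (F : J -> M i -> M i) (f : M i -> M i) t :
  (forall j, linear (F j)) -> (forall x, fins (fun j => F j x)) -> (forall t, fins (fun j => mtensor_op (F j) t)) ->
  (forall x, f x = \sum_(j \in [set: J]) F j x) ->
  mtensor_op f t = \sum_(j \in [set: J]) mtensor_op (F j) t.
Proof.
move=> Fl Ff Fm hf; have fl : linear f.
  by move=> c x y; rewrite !hf; have := lin_bigfsum Fl Ff; apply.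
move: t; apply: (mop_eq (i := i)); first exact: mop_linear.
  by apply: lin_bigfsum => // j; exact: mop_linear (Fl j).
move=> v x; rewrite mop_mslot // hf (lin_fsum (mslot_lin v (i := i))) //.
by apply: eq_fsum => j; rewrite mop_mslot.
Qed.

End TensorFields.

(** * A functional separating the vacuum from V(L)^o *)

Section WordFunctionals.
Context {K : numFieldType} {g : lmodType K}.
Implicit Types (F G : seq g -> K) (d e : g -> g) (u v r : seq g) (x y z : g).

(* The transpose of the derivation of words which applies d to the letters. *)
Fixpoint dtr d F r : K :=
  if r is z :: r' then F (d z :: r') + dtr d (fun s => F (z :: s)) r' else 0.

Lemma dtr_lin d c F F1 F2 r :
  (forall s, size s = size r -> F s = c * F1 s + F2 s) -> dtr d F r = c * dtr d F1 r + dtr d F2 r.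
Proof.
elim: r F F1 F2 => [|z r IH] F F1 F2 h /=; first by rewrite mulr0 addr0.
rewrite h // (IH _ (fun s => F1 (z :: s)) (fun s => F2 (z :: s))) => [|s hs]; last by rewrite h //= hs.
by rewrite mulrDr addrACA.
Qed.

Arguments dtr_lin : clear implicits.

Lemma dtr_ext d F G r : (forall s, size s = size r -> F s = G s) -> dtr d F r = dtr d G r.
Proof.
move=> h; rewrite (dtr_lin d 1 F G (fun=> 0)) => [|s hs]; last by rewrite mul1r addr0 h.
rewrite mul1r; have -> : dtr d (fun=> 0) r = 0; last by rewrite addr0.
by elim: r {h} => //= z r ->; rewrite addr0.
Qed.

Lemma dtr_add d F F1 F2 r :
  (forall s, size s = size r -> F s = F1 s + F2 s) -> dtr d F r = dtr d F1 r + dtr d F2 r.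
Proof. by move=> h; rewrite (dtr_lin d 1 F F1 F2) ?mul1r // => s hs; rewrite mul1r h. Qed.

Lemma dtr_sub d F F1 F2 r :
  (forall s, size s = size r -> F s = F1 s - F2 s) -> dtr d F r = dtr d F1 r - dtr d F2 r.
Proof.
move=> h; rewrite (dtr_lin d (-1) F F2 F1) => [|s hs]; last by rewrite h // mulN1r addrC.
by rewrite mulN1r addrC.
Qed.

Arguments dtr_ext : clear implicits.
Arguments dtr_add : clear implicits.
Arguments dtr_sub : clear implicits.

Lemma dtr_cat d F u v : dtr d F (u ++ v) = dtr d (fun s => F (s ++ v)) u + dtr d (fun s => F (u ++ s)) v.
Proof. by elim: u F => [|z u IH] F /=; [rewrite add0r | rewrite IH addrA]. Qed.

(** Multilinearity restricted to words of length n. The functional is built by recursion on the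
    length, and its multilinearity is proved along the same recursion. *)
Definition mlin n F := forall u c x y v, (size u + size v).+1 = n ->
  F (u ++ (c *: x + y) :: v) = c * F (u ++ x :: v) + F (u ++ y :: v).
Definition multilinear F := forall u c x y v, F (u ++ (c *: x + y) :: v) = c * F (u ++ x :: v) + F (u ++ y :: v).

Lemma mlin_cons n F z : mlin n.+1 F -> mlin n (fun s => F (z :: s)).
Proof. by move=> h u c x y v e; rewrite -!cat_cons h //= -e. Qed.

Lemma multilinear_mlin F n : multilinear F -> mlin n F.
Proof. by move=> h u c x y v _; exact: h. Qed.

Lemma multilinear_cons F z : multilinear F -> multilinear (fun s => F (z :: s)).
Proof. by move=> h u c x y v; rewrite -!cat_cons h. Qed.

Lemma multilinear_D F x y u v : multilinear F -> F (u ++ (x + y) :: v) = F (u ++ x :: v) + F (u ++ y :: v).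
Proof. by move=> h; have := h u 1 x y v; rewrite scale1r mul1r. Qed.

Lemma multilinear_N F x u v : multilinear F -> F (u ++ (- x) :: v) = - F (u ++ x :: v).
Proof.
move=> h; have h0 : F (u ++ 0 :: v) = 0.
  by have := h u (-1) 0 0 v; rewrite addr0 scaler0 mulN1r addNr.
by have := h u (-1) x 0 v; rewrite addr0 h0 scaleN1r mulN1r addr0.
Qed.

Lemma multilinear_B F x y u v : multilinear F -> F (u ++ (x - y) :: v) = F (u ++ x :: v) - F (u ++ y :: v).
Proof. by move=> h; rewrite multilinear_D // multilinear_N. Qed.

Lemma dtr_mlin n d F : linear d -> mlin n F -> mlin n (dtr d F).
Proof.
move=> dl h u c x y v e; rewrite !dtr_cat /= dl.
rewrite (dtr_lin _ c _ (fun s => F (s ++ x :: v)) (fun s => F (s ++ y :: v)) u) => [|s es]; last by rewrite /= h ?es.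
rewrite h // (dtr_lin _ c _ (fun s => F (u ++ x :: s)) (fun s => F (u ++ y :: s)) v) => [|s es]; last by rewrite /= h ?es.
ring.
Qed.

Lemma dtr_dlin d d1 d2 c F r : mlin (size r) F -> (forall z, d z = c *: d1 z + d2 z) ->
  dtr d F r = c * dtr d1 F r + dtr d2 F r.
Proof.
move=> + hd; elim: r F => [|z r IH] F h /=; first by rewrite mulr0 addr0.
have e : F (d z :: r) = c * F (d1 z :: r) + F (d2 z :: r) by rewrite hd; exact: (h [::]).
rewrite e IH ?mulrDr 1?addrACA //; exact: mlin_cons.
Qed.

(** As a transpose, [dtr] reverses composition: the commutator of the transposes belongs to ed -
    de. *)
Lemma dtr_comm d e F r : multilinear F ->
  dtr d (dtr e F) r - dtr e (dtr d F) r = dtr (fun z => e (d z) - d (e z)) F r.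
Proof.
elim: r F => [|z r IH] F h /=; first by rewrite subr0.
rewrite (dtr_add d (fun s => F (e z :: s) + dtr e (fun s => F (z :: s)) s) (fun s => F (e z :: s)) (dtr e (fun s => F (z :: s)))) //.
rewrite (dtr_add e (fun s => F (d z :: s) + dtr d (fun s => F (z :: s)) s) (fun s => F (d z :: s)) (dtr d (fun s => F (z :: s)))) //.
have -> : F ((e (d z) - d (e z)) :: r) = F (e (d z) :: r) - F (d (e z) :: r) by exact: (multilinear_B _ _ [::]).
by rewrite -IH; [ring | exact: multilinear_cons].
Qed.

End WordFunctionals.
Arguments dtr_lin {K g} d c F F1 F2 r _.
Arguments dtr_ext {K g} d F G r _.
Arguments dtr_add {K g} d F F1 F2 r _.
Arguments dtr_sub {K g} d F F1 F2 r _.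

Section Augmentation.
Context {K : numFieldType} {g : lmodType K} (br : g -> g -> g).
Context (brl : forall y, linear (fun x => br x y)) (brr : forall x, linear (br x))
  (bra : forall x y, br x y = - br y x)
  (brj : forall x y z, br x (br y z) - br y (br x z) = br (br x y) z).
Context (p : g -> g) (pl : linear p) (pp : forall x, p (p x) = p x).
Context (kap : g -> K) (kl : linear (kap : g -> K^o)).
Context (A1 : forall x y, p (br (x - p x) (y - p y)) = 0) (A2 : forall x y, kap (br (x - p x) (y - p y)) = 0)
  (A3 : forall x y, p (br (p x) (p y)) = br (p x) (p y)) (A4 : forall x y, kap (br (p x) (p y)) = 0).
Implicit Types (F G : seq g -> K) (u v r : seq g) (x y z : g).

(* Words are read from the right: the head of the list acts first on the vacuum. *)
Fixpoint lamn (n : nat) (r : seq g) : K :=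
  match n, r with
  | _, [::] => 1
  | 0, _ => 0
  | n'.+1, x :: r' => kap x * lamn n' r' + dtr (fun z => br z (p x)) (lamn n') r'
  end.

(** With g_- = im p and g_+ = ker p, this is the functional on the induced module for which g_- acts
    through [kap] from the left and g_+ acts through [kap] on the vacuum. The letter x next to the
    vacuum is replaced by p x and the scalar of x - p x; then p x is moved to the far left, leaving
    one commutator for each letter it passes. *)
Definition lam r := lamn (size r) r.

Lemma lam_cons x r : lam (x :: r) = kap x * lam r + dtr (fun z => br z (p x)) lam r.
Proof. by rewrite /lam /=; congr (_ + _); apply: dtr_ext => s ->. Qed.

Lemma lam_multilinear : multilinear lam.
Proof.
suff H n : mlin n lam by move=> u c x y v; exact: (H _ u c x y v erefl).
elim: n => [//|n IH] u c x y v [e]; case: u e => [|z u] /= e; rewrite !lam_cons.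
  rewrite (kl c x y : kap _ = c * kap x + kap y).
  rewrite (dtr_dlin (d1 := fun z => br z (p x)) (d2 := fun z => br z (p y)) (c := c)) => [||z].
  - ring.
  - by rewrite -[size v]add0n e.
  - by rewrite pl brr.
rewrite IH // (dtr_mlin (brl (p z)) IH) //; ring.
Qed.

Lemma dtr_lam_lin d d1 d2 c r : (forall z, d z = c *: d1 z + d2 z) ->
  dtr d lam r = c * dtr d1 lam r + dtr d2 lam r.
Proof. by apply: dtr_dlin; apply: multilinear_mlin; exact: lam_multilinear. Qed.

Lemma jac_der x y z : br (br x y) z = br (br x z) y + br x (br y z).
Proof.
rewrite (bra (br x y)) (bra x z) (bra y z) (linN (brr _)) (linN (brl _)) -brj opprB.
by rewrite addrAC subrr sub0r.
Qed.

(** The Lie relation next to the vacuum. In [x, y] = q + [x_+, y_+] - [x_-, y_-] with q = [x, y_-] +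
    [x_-, y], the second term is invisible to [p] and [kap] by A1 and A2, and the third is fixed by
    [p] and invisible to [kap] by A3 and A4. The difference of the two double recursions is governed
    by the Jacobi identity. *)
Lemma lam_swap0 x y v : lam (y :: x :: v) - lam (x :: y :: v) = lam (br x y :: v).
Proof.
have hl := lam_multilinear.
pose q := br x (p y) + br (p x) y.
have Eq : br x y = q + br (x - p x) (y - p y) - br (p x) (p y).
  rewrite (linB (brr _)) !(linB (brl _)) /q.
  move: (br x y) (br x (p y)) (br (p x) y) (br (p x) (p y)) => a b c d.
  by rewrite opprB [RHS](AC ((2*(2*2))*1) (3*(1*6)*(2*4)*(5*7))) /= !subrr !addr0.
have kD := linD kl; have kB := linB kl.
have kq : kap (br x y) = kap q.
  by rewrite Eq [kap _]kB [kap (_ + _)]kD A2 A4 subr0 addr0.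
have pq : p (br x y) = p q - br (p x) (p y) by rewrite Eq (linB pl) (linD pl) A1 A3 addr0.
rewrite [lam (y :: _)]lam_cons [lam (x :: y :: _)]lam_cons [dtr _ _ (_ :: _)]/= [dtr _ lam (y :: v)]/=.
rewrite (dtr_lin (fun z => br z (p y)) (kap x) _ lam (dtr (fun z => br z (p x)) lam)) => [|s _]; last exact: lam_cons.
rewrite (dtr_lin (fun z => br z (p x)) (kap y) _ lam (dtr (fun z => br z (p y)) lam)) => [|s _]; last exact: lam_cons.
have e1 : dtr (fun z => br z (p y)) (dtr (fun z => br z (p x)) lam) v - dtr (fun z => br z (p x)) (dtr (fun z => br z (p y)) lam) v
   = - dtr (fun z => br z (br (p x) (p y))) lam v.
  rewrite dtr_comm // (dtr_lam_lin (c := -1) (d1 := fun z => br z (br (p x) (p y))) (d2 := fun=> 0)) => [|z].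
    rewrite mulN1r; have -> : dtr (fun=> 0) lam v = 0; last by rewrite addr0.
    by rewrite (dtr_lam_lin (c := -1) (d1 := fun=> 0) (d2 := fun=> 0)) ?mulN1r ?addNr // => z; rewrite scaler0 addr0.
  by rewrite scaleN1r addr0 (jac_der z (p y)) addrAC subrr add0r (bra (p y)) (linN (brr _)).
have e2 : lam (br x (p y) :: v) - lam (br y (p x) :: v) = lam (q :: v).
  rewrite /q (multilinear_D _ _ [::] v hl) /=; congr (_ + _).
  by rewrite (bra y) (multilinear_N _ [::] v hl) /= opprK.
have e3 : lam (br x y :: v) = lam (q :: v) - dtr (fun z => br z (br (p x) (p y))) lam v.
  rewrite !lam_cons kq -addrA; congr (_ + _).
  rewrite (dtr_lam_lin (c := -1) (d1 := fun z => br z (br (p x) (p y))) (d2 := fun z => br z (p q))) => [|z].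
    by rewrite mulN1r addrC.
  by rewrite pq (linB (brr _)) scaleN1r addrC.
rewrite e3 -e2 -e1 !lam_cons; ring.
Qed.

(** Away from the vacuum the relation is inherited from shorter words, because z' -> [z', p z] is a
    derivation of the bracket. *)
Lemma lam_swap u x y v : lam (u ++ y :: x :: v) - lam (u ++ x :: y :: v) = lam (u ++ br x y :: v).
Proof.
have hl := lam_multilinear.
have [n] := ubnP (size u + size v); elim: n u x y v => // n IH u x y v; rewrite ltnS => h.
case: u h => [|z u] h; first exact: lam_swap0.
rewrite !cat_cons ![lam (z :: _)]lam_cons; pose d z' := br z' (p z).
have hs : (size u + size v < n)%N by rewrite /= in h; lia.
suff E : dtr d lam (u ++ y :: x :: v) - dtr d lam (u ++ x :: y :: v) = dtr d lam (u ++ br x y :: v).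
  rewrite -E -(IH u x y v hs); rewrite /d; ring.
rewrite !dtr_cat /=.
have e1 : dtr d (fun s => lam (s ++ br x y :: v)) u = dtr d (fun s => lam (s ++ y :: x :: v)) u - dtr d (fun s => lam (s ++ x :: y :: v)) u.
  by apply: dtr_sub => s es; rewrite IH // es.
have e2 : dtr d (fun s => lam (u ++ br x y :: s)) v = dtr d (fun s => lam (u ++ y :: x :: s)) v - dtr d (fun s => lam (u ++ x :: y :: s)) v.
  by apply: dtr_sub => s es; rewrite IH // es.
have e3 : lam (u ++ d (br x y) :: v) = lam (u ++ br (d x) y :: v) + lam (u ++ br x (d y) :: v).
  rewrite -multilinear_D //; congr (lam (u ++ _ :: v)).
  by rewrite /d jac_der.
rewrite e1 e2 e3 -(IH u (d x) y v hs) -(IH u x (d y) v hs); ring.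
Qed.

(** Here z is the letter acting last. The recursion either leaves it alone or replaces it by
    [z, p x], which by A3 and A4 again lies in im p and is killed by [kap]; the induction ends with
    kap z = 0. *)
Lemma lam_minus z r : p z = z -> kap z = 0 -> lam (rcons r z) = 0.
Proof.
have hl := lam_multilinear.
have [n] := ubnP (size r); elim: n r z => // n IH [|x r] z; rewrite ltnS => h pz kz; first by rewrite lam_cons /= kz mul0r addr0.
rewrite rcons_cons lam_cons IH // mulr0 add0r -cats1 dtr_cat /= addr0.
rewrite (dtr_ext _ _ (fun=> 0) r) => [|s es]; last by rewrite cats1 IH // es.
rewrite cats1 IH //; last by rewrite -pz A4.
  rewrite addr0; by elim: (r) => //= y s ->; rewrite addr0.
by rewrite -pz A3.
Qed.

(** The terms with d on the letters and those with z -> [z, p x] commute up to z -> [z, p (d x)],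
    which is the term coming from d on the first letter. Applied to [ldelta], this kills im D. *)
Lemma lam_der (d : g -> g) r : linear d -> (forall x, p (d x) = d (p x)) -> (forall x, kap (d x) = 0) ->
  (forall x y, d (br x y) = br (d x) y + br x (d y)) -> dtr d lam r = 0.
Proof.
move=> dl dp dk db; have hl := lam_multilinear.
have [n] := ubnP (size r); elim: n r => // n IH [|x r]; rewrite ltnS => h //=.
rewrite lam_cons dk mul0r add0r.
rewrite (dtr_lin d (kap x) _ lam (dtr (fun z => br z (p x)) lam)) => [|s _]; last exact: lam_cons.
rewrite IH // mulr0 add0r.
have := dtr_comm d (fun z => br z (p x)) r hl.
rewrite (dtr_ext (fun z => br z (p x)) (dtr d lam) (fun=> 0) r) => [|s es]; last by rewrite IH // es.
have -> : dtr (fun z => br z (p x)) (fun=> 0) r = 0 by elim: (r) => //= {}z s ->; rewrite addr0.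
rewrite subr0 => ->.
rewrite (dtr_lam_lin (d := fun z => br (d z) (p x) - d (br z (p x))) (c := -1) (d1 := fun z => br z (p (d x))) (d2 := fun=> 0)) => [|z].
  rewrite mulN1r addrA subrr add0r.
  by rewrite (dtr_lam_lin (c := -1) (d1 := fun=> 0) (d2 := fun=> 0)) ?mulN1r ?addNr // => z; rewrite scaler0 addr0.
by rewrite addr0 scaleN1r db dp opprD addrA subrr add0r.
Qed.

End Augmentation.

Section LoopAugmentation.
Context {K : numFieldType} {L : vla K} (hL : vertex_lie_algebra L).
Implicit Types (f g : laurent K) (x y : loop L).

Lemma lbr_apply (W : lmodType K) (F : loop L -> W) a f b g : linear F -> F (lbr (lrho a f) (lrho b g)) =
  \sum_(n \in [set: nat]) (n`!%:R)^-1 *: F (lrho (vprod a n b) (iter n (@lder K) f * g)).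
Proof.
move=> Fl; have E := lin_fsum Fl (brb_fins0 hL lrho_linl a b (fun n => iter n (@lder K) f * g)).
rewrite (lbrE hL); transitivity (\sum_(i \in [set: nat]) F ((i`!%:R)^-1 *: lrho (vprod a i b) (iter i (@lder K) f * g))).
  exact: E.
by apply: eq_fsum => n; rewrite (linZ Fl).
Qed.

Definition lpolar f : laurent K := f - ltrunc f 0.

Lemma ico_lpolar f n : ico (lpolar f) n = if n < 0 then ico f n else 0.
Proof. by rewrite /lpolar icoB ico_ltrunc; case: ltP; rewrite ?subr0 ?subrr. Qed.

Lemma lpolar_linear : linear lpolar.
Proof.
move=> c f g; apply: laurentP => n; rewrite ico_lpolar icoD icoZ [RHS]icoD icoZ !ico_lpolar.
by case: ifP => _; rewrite ?mulr0 ?addr0.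
Qed.

Lemma lpolar_der f : lpolar (lder f) = lder (lpolar f).
Proof.
apply: laurentP => n; rewrite ico_der !ico_lpolar ico_der.
case: (ltP n 0) => n0; last by rewrite ifF ?mulr0 //; lia.
case: (ltP (n + 1) 0) => n1 //; have -> : n + 1 = 0 by lia.
by rewrite !mul0r.
Qed.

(** The projection onto polar parts respects the relation Da (x) f = - a (x) f' because taking the
    polar part commutes with d/dt. *)
Definition loop_polar x : loop L :=
  lie_lift (fun a (f : laurent_dalg K) => lrho a (lpolar f)) x.

Lemma loop_polar_bil : liebil (fun (a : L) (f : laurent_dalg K) => lrho a (lpolar f)).
Proof.
split; first split.
- by move=> f; exact: lrho_linl.
- by move=> a; exact: (lin_comp (lrho_linr a) lpolar_linear).
- by move=> a f; rewrite lrho_D lpolar_der addNr.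
Qed.

Lemma loop_polar_linear : linear loop_polar.
Proof. exact: (lie_lift_linear loop_polar_bil). Qed.

Lemma loop_polar_rho a f : loop_polar (lrho a f) = lrho a (lpolar f).
Proof. by rewrite [lrho a f]lrhoE /loop_polar (lie_liftE _ _ loop_polar_bil). Qed.

Context (pic : L -> K) (picl : linear (pic : L -> K^o)) (picc : pic (vc L) = 1) (picD : forall a, pic (vD a) = 0).

(** The character pic(a) Res f. It is well defined since [pic] vanishes on im D and a derivative has
    residue 0. *)
Definition loop_char x : K := lie_lift (fun a (f : laurent_dalg K) => pic a * ico f (-1) : K^o) x.

Lemma loop_char_bil : liebil (fun (a : L) (f : laurent_dalg K) => pic a * ico f (-1) : K^o).
Proof.
split; first split.
- by move=> f c a b; rewrite (picl c a b : pic _ = c * pic a + pic b) mulrDl -mulrA.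
- by move=> a c f g; rewrite icoD icoZ mulrDr mulrCA.
- by move=> a f; rewrite picD mul0r add0r /= ico_der mul0r mulr0.
Qed.

Lemma loop_char_linear : linear (loop_char : loop L -> K^o).
Proof. exact: (lie_lift_linear loop_char_bil). Qed.

Lemma loop_char_rho a f : loop_char (lrho a f) = pic a * ico f (-1).
Proof. by rewrite lrhoE /loop_char (lie_liftE _ _ loop_char_bil). Qed.

Lemma ordge0_iter_lder f k : ordge f 0 -> ordge (iter k lder f) 0.
Proof.
move=> hf n n0; rewrite iter_lder; case: (ltP (n + k%:Z) 0) => h; first by rewrite hf ?mulr0.
by rewrite -[n + _]gez0_abs // binz_nat bin_small ?mulr0 ?mul0r //; lia.
Qed.

(** A product of two polar series starts at t^(-2) from above. Hence brackets of polar elements stay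
    polar and have no residue, which gives the conditions A3 and A4. *)
Lemma polar_mul f g k : (forall n, 0 <= n -> ico f n = 0) -> (forall n, 0 <= n -> ico g n = 0) ->
  forall n, -1 <= n -> ico (iter k lder f * g) n = 0.
Proof.
move=> hf hg n n1; rewrite ico_mulE; apply: fsum0 => m.
case: (ltP m 0) => m0; first by rewrite hg ?mulr0 //; lia.
by rewrite iter_lder hf ?mulr0 ?mul0r //; lia.
Qed.

Lemma loop_br_pos x y : loop_polar (lbr (x - loop_polar x) (y - loop_polar y)) = 0 /\ loop_char (lbr (x - loop_polar x) (y - loop_polar y)) = 0.
Proof.
have pl := loop_polar_linear; have ll := lbr_linl hL; have lr := lbr_linr hL; have cl := loop_char_linear.
pose q x := x - loop_polar x; have ql : linear q by apply: lin_add => //; apply: lin_opp.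
suff [h1 h2] : (forall x y, loop_polar (lbr (q x) (q y)) = 0) /\ (forall x y, loop_char (lbr (q x) (q y)) = 0).
  by split; [exact: h1 | exact: h2].
have qE a f : q (lrho a f) = lrho a (ltrunc f 0).
  by rewrite /q loop_polar_rho -(linB (lrho_linr a)); congr lrho; rewrite opprB addrC subrK.
have Lx z : linear (fun x => lbr (q x) z) by exact: (lin_comp (ll z) ql).
have Ly z : linear (fun y => lbr z (q y)) by exact: (lin_comp (lr z) ql).
have hg b f g : forall n, (n < 0) -> ico (iter b lder (ltrunc f 0) * ltrunc g 0) n = 0.
  have o (h : laurent K) : ordge (ltrunc h 0) 0 by exact: ordge_ltrunc.
  by have := ordgeM (@ordge0_iter_lder _ b (o f)) (o g); rewrite addr0.
split=> {}x {}y.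
  move: x; apply: loop_eq_lin; [exact: (lin_comp pl (Lx _)) | exact: lin_cst0 | move=> a f].
  move: y; apply: loop_eq_lin; [exact: (lin_comp pl (Ly _)) | exact: lin_cst0 | move=> b g].
  rewrite !qE (lbr_apply _ _ _ _ pl).
  apply: fsum0 => n; rewrite loop_polar_rho; have -> : lpolar (iter n lder (ltrunc f 0) * ltrunc g 0) = 0.
    by apply: laurentP => m; rewrite ico_lpolar ico0; case: ltP => // m0; rewrite hg.
  by rewrite (lin0 (lrho_linr _)) scaler0.
have cl0 : linear (fun _ : loop L => 0 : K^o) by exact: lin_cst0.
move: x; apply: (@loop_eq_lin _ _ K^o (fun x => loop_char (lbr (q x) (q y)))); [exact: (lin_comp cl (Lx _)) | exact: cl0 | move=> a f].
move: y; apply: (@loop_eq_lin _ _ K^o (fun y => loop_char (lbr (q (lrho a f)) (q y)))); [exact: (lin_comp cl (Ly _)) | exact: cl0 | move=> b g].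
rewrite !qE (lbr_apply _ _ _ _ cl).
by apply: fsum0 => n; rewrite loop_char_rho hg // mulr0 scaler0.
Qed.

Lemma loop_br_neg x y : loop_polar (lbr (loop_polar x) (loop_polar y)) = lbr (loop_polar x) (loop_polar y) /\ loop_char (lbr (loop_polar x) (loop_polar y)) = 0.
Proof.
have pl := loop_polar_linear; have ll := lbr_linl hL; have lr := lbr_linr hL; have cl := loop_char_linear.
have Lx z : linear (fun x => lbr (loop_polar x) z) by exact: (lin_comp (ll z) pl).
have Ly z : linear (fun y => lbr z (loop_polar y)) by exact: (lin_comp (lr z) pl).
have hp f n : 0 <= n -> ico (lpolar f) n = 0 by move=> n0; rewrite ico_lpolar ltNge n0.
split.
  move: x; apply: loop_eq_lin; [exact: (lin_comp pl (Lx _)) | exact: Lx | move=> a f].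
  move: y; apply: loop_eq_lin; [exact: (lin_comp pl (Ly _)) | exact: Ly | move=> b g].
  rewrite !loop_polar_rho (lbr_apply _ _ _ _ pl) (lbrE hL).
  apply: eq_fsum => n; rewrite loop_polar_rho; congr (_ *: lrho _ _).
  apply: laurentP => m; rewrite ico_lpolar; case: ltP => // m0.
  by rewrite (polar_mul n (hp f) (hp g)) //; lia.
have cl0 : linear (fun _ : loop L => 0 : K^o) by exact: lin_cst0.
move: x; apply: (@loop_eq_lin _ _ K^o (fun x => loop_char (lbr (loop_polar x) (loop_polar y)))); [exact: (lin_comp cl (Lx _)) | exact: cl0 | move=> a f].
move: y; apply: (@loop_eq_lin _ _ K^o (fun y => loop_char (lbr (loop_polar (lrho a f)) (loop_polar y)))); [exact: (lin_comp cl (Ly _)) | exact: cl0 | move=> b g].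
rewrite !loop_polar_rho (lbr_apply _ _ _ _ cl).
by apply: fsum0 => n; rewrite loop_char_rho (polar_mul n (hp f) (hp g)) // mulr0 scaler0.
Qed.

End LoopAugmentation.

Section ComplementCoordinate.
Context {K : numFieldType} {L : vla K} (hL : vertex_lie_algebra L) {Lo : set L} (hC : vla_complement Lo).

Lemma complement_coordinate : exists pic : L -> K, [/\ linear (pic : L -> K^o), pic (vc L) = 1,
  forall a, pic (vD a) = 0 & forall a, Lo a -> pic a = 0].
Proof.
have ex a : exists l, exists s b, Lo s /\ a = s + l *: vc L + vD b.
  by have [s [l [b [hs e]]]] := compl_sum hC a; exists l, s, b.
have [pic hp] := choice ex; have Dl := vD_linear hL; have [S0 SD] := compl_subspace hC.
have uq a s l b : Lo s -> a = s + l *: vc L + vD b -> pic a = l.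
  move=> hs e; have [s' [b' [hs' e']]] := hp a; apply/eqP; rewrite -subr_eq0; apply/eqP.
  have hss : Lo (s' - s) by rewrite addrC -scaleN1r; exact: SD.
  have [|_ e1 _] := @compl_direct _ _ _ hC (s' - s) (pic a - l) (b' - b) hss.
    rewrite (linB Dl) scalerBl (AC ((2*2)*2) ((1*3*5)*(2*4*6))) /= -e' -!opprD -e subrr //.
  move: e1 => /eqP; rewrite scaler_eq0 => /orP[/eqP //|/eqP h]; case: (vc_neq0 hL h).
exists pic; split.
- move=> c a a'; have [s [b [hs e]]] := hp a; have [s' [b' [hs' e']]] := hp a'.
  apply: (uq _ (c *: s + s') _ (c *: b + b')); first exact: SD.
  rewrite {1}e {1}e' Dl !scalerDr scalerDl scalerA.
  by rewrite [LHS](AC (3*3) ((1*4)*(2*5)*(3*6))).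
- apply: (uq _ 0 _ 0); first exact: S0.
  by rewrite scale1r (lin0 Dl) add0r addr0.
- by move=> a; apply: (uq _ 0 _ a); [exact: S0 | rewrite scale0r !add0r].
- by move=> a ha; apply: (uq _ a _ 0) => //; rewrite scale0r (lin0 Dl) !addr0.
Qed.

End ComplementCoordinate.

Section VacuumFunctional.
Context {K : numFieldType} {L : vla K} (hL : vertex_lie_algebra L) {Lo : set L} (hC : vla_complement Lo).

Lemma lbr_c z : lbr z (mode (vc L) (-1)) = 0.
Proof.
rewrite (lbr_antisym hL) modeE; apply/eqP; rewrite oppr_eq0; apply/eqP.
move: z; apply: loop_eq_lin; [exact: (lbr_linr hL) | exact: lin_cst0 | move=> b g].
rewrite (lbr_apply hL _ _ _ _ (@lin_id _ _)); apply: fsum0 => n.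
by rewrite (vprod_cl hL) (lin0 (lrho_linl _)) scaler0.
Qed.

(** The functional [lam] of the loop algebra, with p the polar part and kap = pic Res. The element
    c(-1) is polar with kap = 1, in agreement with the level; a mode a(-n-1) with a in Lo is polar
    with kap = 0, so it may be the last letter only of words with value 0. *)
Lemma vacuum_functional : exists lam : vacm L -> K, [/\ linear (lam : vacm L -> K^o), lam (vacuum L) = 1,
  forall n a A, Lo a -> lam (vact (mode a (- n.+1%:Z)) A) = 0 &
  forall dV : vacm L -> vacm L, linear dV -> dV (vacuum L) = 0 ->
    (forall x A, dV (vact x A) = vact (ldelta x) A + vact x (dV A)) -> forall A, lam (dV A) = 0].
Proof.
have [pic [pl pc pD po]] := complement_coordinate hL hC.
pose kap := loop_char pic; pose p := @loop_polar K L.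
have kl : linear (kap : loop L -> K^o) := loop_char_linear pl pD.
have ppl : linear p := @loop_polar_linear K L.
have brl := lbr_linl hL; have brr := lbr_linr hL; have bra := lbr_antisym hL.
have brj := lbr_jacobi hL.
have A1 x y := (loop_br_pos hL pl pD x y).1.
have A2 x y := (loop_br_pos hL pl pD x y).2.
have A3 x y := (loop_br_neg hL pl pD x y).1.
have A4 x y := (loop_br_neg hL pl pD x y).2.
pose Lam : seq (loop L) -> K := lam lbr p kap.
have Lc x r : Lam (x :: r) = kap x * Lam r + dtr (fun z => lbr z (p x)) Lam r by exact: lam_cons.
have Lm : multilinear Lam by exact: lam_multilinear.
have Lsw u x y v : Lam (u ++ y :: x :: v) - Lam (u ++ x :: y :: v) = Lam (u ++ lbr x y :: v).
  exact: lam_swap.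
have Lmin r z : p z = z -> kap z = 0 -> Lam (rcons r z) = 0 by exact: lam_minus.
have Lder r d : linear d -> (forall x, p (d x) = d (p x)) -> (forall x, kap (d x) = 0) ->
  (forall x y, d (lbr x y) = lbr (d x) y + lbr x (d y)) -> dtr d Lam r = 0 by exact: lam_der.
have d0 r d : (forall z, d z = 0) -> dtr d Lam r = 0.
  move=> hd; have h : mlin (size r) Lam by apply: multilinear_mlin.
  rewrite (dtr_dlin (d := d) (d1 := d) (d2 := d) (c := -1) h) => [|z]; first by rewrite mulN1r addNr.
  by rewrite hd scaler0 addr0.
have L0 : Lam [::] = 1 by [].
clearbody Lam.
(* The head of a word in [vacm] acts last, whereas [lam] reads from the vacuum end, hence [rev]. *)
have hr r : vac_rels r -> free_lift (fun u => Lam (rev u) : K^o) r = 0.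
  case=> [[[u [v [c [x [y ->]]]]]|[u [v [x [y ->]]]]]|[u [x [c [h ->]]]]].
  - by rewrite free_lift_rel !rev_cat !rev_cons !cat_rcons Lm -addrA -opprD subrr.
  - rewrite free_lift_rel2 !rev_cat !rev_cons !cat_rcons -lbr_lie_br -Lsw.
    by rewrite subrr.
  - rewrite free_lift_rel1 rev_rcons Lc; case: h => [[a [f [hf [-> ->]]]]|/= [-> ->]].
      rewrite -lrhoE d0 => [|z]; last first.
        rewrite /p loop_polar_rho (_ : lpolar f = 0) ?(lin0 (lrho_linr _)) ?(lin0 (brr _)) //.
        by apply: laurentP => n; rewrite ico_lpolar ico0; case: ltP => // /hf.
      rewrite /kap (loop_char_rho pl pD) [ico f (-1)]hf // mulr0 mul0r addr0 scale0r subrr //.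
    have pE : p (mode (vc L) (-1)) = mode (vc L) (-1).
      rewrite modeE /p loop_polar_rho; congr lrho; apply: laurentP => n; rewrite ico_lpolar ico_mono.
      by case: ltP => //; case: eqP => // ->.
    rewrite d0 => [|z]; last by rewrite pE lbr_c.
    by rewrite /kap modeE (loop_char_rho pl pD) pc ico_mono eqxx !mul1r addr0 scale1r subrr.
have fl := quot_lift_linear hr.
have lamw u : quot_lift (S := @vac_rels K L) (fun u => Lam (rev u) : K^o) (vword u) = Lam (rev u) by exact: quot_liftU.
pose lamV (A : vacm L) : K := quot_lift (S := @vac_rels K L) (fun u => Lam (rev u) : K^o) A.
have lamE u : lamV (vword u) = Lam (rev u) by exact: lamw.
have lamVl : linear (lamV : vacm L -> K^o) by exact: fl.
clearbody lamV; exists lamV; split.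
- exact: lamVl.
- by rewrite /vacuum lamE L0.
- move=> n a A ha; have Vl := vm_linA (vacm_vacuum (L := L)) (mode a (- n.+1%:Z)).
  apply: (@lin_eq_span _ _ K^o (fun A => lamV (vact (mode a (- n.+1%:Z)) A)) (fun _ => 0) _ A _ _ _ (vacm_span A)).
  + exact: (lin_comp lamVl Vl).
  + exact: lin_cst0.
  move=> _ [u ->]; rewrite vact_word // lamE rev_cons Lmin //.
    rewrite modeE /p loop_polar_rho; congr lrho; apply: laurentP => m; rewrite ico_lpolar ico_mono.
    by case: ltP => //; case: eqP => // ->.
  by rewrite modeE /kap (loop_char_rho pl pD) po // mul0r.
- move=> dV dl dv0 da A.
  (* The letters of w have already been passed by dV. In this form, dV applied to a word becomes the
     transpose of [ldelta] under the functional. *)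
  have H u w : lamV (foldr (@vact K L) (dV (vword u)) w) = dtr (@ldelta K L) (fun r => Lam (r ++ rev w)) (rev u).
    have Vl := vm_linA (vacm_vacuum (L := L)).
    have fD w' (B C : vacm L) : foldr (@vact K L) (B + C) w' = foldr (@vact K L) B w' + foldr (@vact K L) C w'.
      by elim: w' => //= y w' ->; rewrite (linD (Vl y)).
    have fw w' u' : foldr (@vact K L) (vword u') w' = vword (w' ++ u').
      by elim: w' => //= y w' ->; rewrite vact_word.
    elim: u w => [|x u IH] w.
      have -> : vword [::] = vacuum L by [].
      rewrite dv0 /=; suff -> : foldr (@vact K L) 0 w = 0 by exact: (lin0 lamVl).
      by elim: w => //= y w ->; exact: (lin0 (Vl y)).
    have -> : vword (x :: u) = vact x (vword u) by rewrite vact_word.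
    rewrite da fD (linD lamVl) vact_word // fw lamE rev_cat rev_cons cat_rcons.
    have -> : foldr (@vact K L) (vact x (dV (vword u))) w = foldr (@vact K L) (dV (vword u)) (rcons w x).
      by rewrite -cats1 foldr_cat.
    have -> : rev (x :: u) = rev u ++ [:: x] by rewrite rev_cons -cats1.
    rewrite IH dtr_cat /= addr0 addrC -catA /=; congr (_ + _).
    by apply: dtr_ext => r' _; rewrite rev_rcons -catA.
  apply: (@lin_eq_span _ _ K^o (fun A => lamV (dV A)) (fun _ => 0) _ A _ _ _ (vacm_span A)).
  + exact: (lin_comp lamVl dl).
  + exact: lin_cst0.
  move=> _ [u ->]; rewrite -[dV _]/(foldr (@vact K L) (dV (vword u)) [::]) H.
  rewrite (dtr_ext _ _ Lam) => [|r' _]; last by rewrite cats0.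
  apply: Lder; first exact: (ldelta_linear hL).
  + move=> x; rewrite /p; have pp := @loop_polar_linear K L; have dl' := ldelta_linear hL; move: x.
    apply: loop_eq_lin; [exact: (lin_comp pp dl') | exact: (lin_comp dl' pp) | move=> a f].
    by rewrite (ldelta_rho hL) !loop_polar_rho (ldelta_rho hL).
  + move=> x; have dl' := ldelta_linear hL; move: x.
    apply: (@loop_eq_lin _ _ K^o (fun x => kap (ldelta x)) (fun _ => 0)); [exact: (lin_comp kl dl') | exact: lin_cst0 | move=> a f].
    by rewrite (ldelta_rho hL) /kap (loop_char_rho pl pD) pD mul0r.
  + exact: (ldelta_br hL).
Qed.

End VacuumFunctional.

Section VacuumVertexLie.
Context {K : numFieldType} {L : vla K} (hL : vertex_lie_algebra L) {T : nat} {w : K}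
  (hw : T.-primitive_root w) (hS : vla_automorphism L T).

Lemma vac_translation : exists dV : vacm L -> vacm L, [/\ linear dV, dV (vacuum L) = 0,
  forall x A, dV (vact x A) = vact (ldelta x) A + vact x (dV A) &
  forall A, YM (vact (L := L)) A (- 2) (vacuum L) = dV A].
Proof.
have [dV [dl d0 da]] := vm_der hL (vacm_vacuum (L := L)).
by exists dV; split=> //; exact: (vac_vlaD hL hS dl d0 da).
Qed.

Lemma vac_monomial_rec (P : nat -> vacm L -> Prop) : P 0%N (vacuum L) ->
  (forall p n d (a : L) A, vhomog p a -> vac_monomial d A -> P d A -> P (p + n + d)%N (vact (mode a (- n.+1%:Z)) A)) ->
  forall d A, vac_monomial d A -> P d A.
Proof. by move=> P0 PS d A; elim=> // p n {}d a {}A pa mA; exact: PS. Qed.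

Lemma vac_vla_graded : graded_vla (vac_vla L).
Proof.
have [dV [dl d0 da dE]] := vac_translation; have [sl s0 sa] := vac_sigmaE hL hS.
exact: (vac_graded hL hS (vacm_vacuum (L := L)) (@vac_mono0 K L) (@vac_monoS K L) vac_monomial_rec dl d0 da sl s0 sa dE).
Qed.

Lemma vac_vla_vR k x (A : vac_vla L) :
  @vR _ (vac_vla L) w k (vact x A) = vact (LA (w ^+ k) (@vR _ L w k) x) (@vR _ (vac_vla L) w k A).
Proof.
have [dV [dl d0 da dE]] := vac_translation; have [sl s0 sa] := vac_sigmaE hL hS.
exact: (vac_vR hL hS (vacm_vacuum (L := L)) (@vac_mono0 K L) (@vac_monoS K L) vac_monomial_rec dl d0 da sl s0 sa dE k x A (prim_neq0 hw)).
Qed.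

Lemma vac_vla_order (A : vac_vla L) : iter T (@vsigma _ (vac_vla L)) A = A.
Proof.
have [sl s0 sa] := vac_sigmaE hL hS.
exact: (vac_sigma_order hS (vacm_vacuum (L := L)) sl s0 sa).
Qed.

(* The functional of vacuum_functional vanishes on V(L)^o, on im D and on A, so A has no
   component along the vacuum. *)
Lemma vac_pos_rho (Lo : set L) (Vo : set (vac_vla L)) (D : dalg K) (A : vac_vla L) (f : D) :
  vla_complement Lo -> vla_complement Vo -> vla_graded Vo -> Vo `<=` lspan (vac_pos Lo) ->
  lspan (vac_pos Lo) A -> lspan [set x | exists (s : vac_vla L) (g : D), Vo s /\ x = rho s g] (rho A f).
Proof.
move=> hC cV gV sV hA; have [lam [ll l1 lo lD]] := vacuum_functional hL hC.
have [dV [dl d0 da dE]] := vac_translation.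
have lP B : lspan (vac_pos Lo) B -> lam B = 0.
  apply: (@lin_eq_span _ _ K^o lam (fun _ => 0)) => //; first exact: lin_cst0.
  by move=> _ [n a Sa|n a C Sa _]; exact: lo.
have := complement_span vac_vla_graded cV gV A.
set U := [set x | _]; move=> hAU.
have [A' [l [hA' eA]]] : exists A' l, lspan U A' /\ A = A' + l *: vacuum L.
  move: hAU; apply: (subspace_lspan (P := fun A => exists A' l, lspan U A' /\ A = A' + l *: vacuum L)).
    split; first by exists 0, 0; rewrite scale0r addr0; split=> //; exact: lspan0.
    move=> c x y [x' [l [hx ->]]] [y' [m [hy ->]]]; exists (c *: x' + y'), (c * l + m); split.
      by apply: lspanD => //; apply: lspanZ.
    by rewrite scalerDr scalerDl scalerA addrACA.
  move=> x [Ux|->]; first by exists x, 0; rewrite scale0r addr0; split=> //; apply: lspan_incl.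
  by exists 0, 1; rewrite add0r scale1r; split=> //; exact: lspan0.
have lU : lam A' = 0.
  apply: (@lin_eq_span _ _ K^o lam (fun _ => 0) _ A' _ _ _ hA') => //; first exact: lin_cst0.
  move=> _ [[|k] [s [Ss ->]]]; first by apply: lP; exact: sV.
  by rewrite iterS /= dE; exact: lD.
have : lam A = lam A' + l * lam (vacuum L) by rewrite eA (linD ll) (linZ ll).
rewrite lP // lU l1 mulr1 add0r => l0; rewrite eA -l0 scale0r addr0.
have rl := @rho_liebil K (vac_vla L) D.
apply: (lspan_lin (f := fun B : vac_vla L => rho B f) (rl.1.1 f) _ hA') => _ [k [s [Ss ->]]].
elim: k f => [|k IH] f; first by apply: lspan_incl; exists s, f.
by rewrite iterS rho_D; apply: lspanN; exact: IH.
Qed.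

End VacuumVertexLie.

(** * The global Lie algebra and its action *)

Section GammaAction.
Context {K : numFieldType} {X : vla K} (hX : graded_vla X) {T : nat} {w : K} (hw : T.-primitive_root w)
  (sT : forall a : X, iter T (@vsigma _ X) a = a).
Context {A : dalg K}.
Local Notation R k := (@vR _ X w k).
Local Notation S k := (@dsub K A (w ^+ k)^-1).
Context (Slin : forall k, linear (S k)) (Sder : forall k f, dder (S k f) = (w ^+ k)^-1 *: S k (dder f))
  (Scomp : forall j k f, S j (S k f) = S (j + k) f) (ST : forall k f, S (k + T) f = S k f) (S0 : forall f, S 0 f = f).
Let w0 : w != 0 := prim_neq0 hw.

Lemma gact_bil k : liebil (fun (a : X) (f : A) => (w ^+ k)^-1 *: rho (R k a) (S k f)).
Proof.
have rl := @rho_liebil K X A; split; first split.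
- by move=> f; apply: lin_scale; exact: (lin_comp (rl.1.1 _) (vR_linear hX w k)).
- by move=> a; apply: lin_scale; exact: (lin_comp (rl.1.2 _) (Slin k)).
- move=> a f; rewrite (vR_D hX) (linZ (rl.1.1 _)) rho_D Sder (linZ (rl.1.2 _)).
  by rewrite !scalerN [w ^+ k *: _]scalerA mulfV ?expf_neq0 // scale1r addNr.
Qed.

Lemma gact_linear k : linear (@gact K X A w k).
Proof. exact: (lie_lift_linear (gact_bil k)). Qed.

Lemma gact_rho k a f : gact w k (rho a f) = (w ^+ k)^-1 *: rho (R k a) (S k f).
Proof. exact: (lie_liftE _ _ (gact_bil k)). Qed.

Lemma gact_comp j k (x : lie X A) : gact w j (gact w k x) = gact w (j + k) x.
Proof.
have gl := gact_linear; have rl := @rho_liebil K X A; move: x; apply: lie_eq_lin; [exact: (lin_comp (gl j) (gl k)) | exact: gl |].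
move=> a f; rewrite (gact_rho k a f) (linZ (gl j)) (gact_rho j (R k a) (S k f)) (gact_rho (j + k) a f) scalerA (vR_comp hX w j k a) (Scomp j k f).
by congr (_ *: _); rewrite exprD invfM mulrC.
Qed.

Lemma gact0 (x : lie X A) : gact w 0 x = x.
Proof.
move: x; apply: lie_eq_lin; [exact: gact_linear | exact: lin_id | move=> a f].
by rewrite (gact_rho 0 a f) (vR0 hX w a) (S0 f) expr0 invr1 scale1r.
Qed.

Lemma gactDT k (x : lie X A) : gact w (k + T) x = gact w k x.
Proof.
have gl := gact_linear; move: x; apply: lie_eq_lin; [exact: gl | exact: gl | move=> a f].
have wT : w ^+ T = 1 by exact: prim_expr_order.
have RT : R T a = a by have := vR_order hX 1 a wT sT; rewrite mul1n.
by rewrite (gact_rho (k + T) a f) (gact_rho k a f) (ST k f) -(vR_comp hX w k T a) RT exprD wT mulr1.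
Qed.

Definition gorb (x : lie X A) : lie X A := \sum_(k < T) gact w k x.

Lemma gorb_linear : linear gorb.
Proof. by apply: lin_bigsum => k; exact: gact_linear. Qed.

Lemma gact_gorb j x : gact w j (gorb x) = gorb x.
Proof.
rewrite /gorb (lin_sum _ _ _ (gact_linear j)).
transitivity (\sum_(k < T) gact w (j + k) x); first by apply: eq_bigr => k _; exact (gact_comp j k x).
have hm k : gact w (k %% T) x = gact w k x.
  rewrite {2}(divn_eq k T) addnC; elim: (k %/ T)%N => [|q IH]; first by rewrite mul0n addn0.
  by rewrite mulSnr addnA gactDT.
exact: (sum_mod_shift hw (F := fun k => gact w k x)).
Qed.

End GammaAction.

Section LaurentRotation.
Context {K : numFieldType} {T : nat} {w : K} (hw : T.-primitive_root w).
Let w0 : w != 0 := prim_neq0 hw.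

Lemma laurent_dalg_rot : let S k := @dsub K (laurent_dalg K) (w ^+ k)^-1 in
  [/\ forall k, linear (S k), forall k f, dder (S k f) = (w ^+ k)^-1 *: S k (dder f),
      forall j k f, S j (S k f) = S (j + k)%N f, forall k f, S (k + T)%N f = S k f & forall f, S 0%N f = f].
Proof.
split=> /=.
- by move=> k; exact: lsub_linear.
- move=> k f; apply: laurentP => n; rewrite ico_der ico_sub icoZ ico_sub ico_der.
  by rewrite expfzDr ?invr_eq0 ?expf_neq0 // expr1z; ring.
- by move=> j k f; rewrite lsub_comp exprD invfM.
- by move=> k f; rewrite exprD (prim_expr_order hw) mulr1.
- by move=> f; apply: laurentP => n; rewrite ico_sub expr0 invr1 exp1rz mul1r.
Qed.

Context {N : nat} (z : 'I_N -> K).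
Local Notation P := (poles T w z).

Lemma poles_ind (Q : K -> Prop) : Q 0 -> (forall k i, Q (w ^+ k * z i)) -> forall s, s \in P -> Q s.
Proof.
move=> Q0 Qz s; rewrite inE => /orP[/eqP -> //|/allpairsP[[k i] [_ _ ->]]]; exact: Qz.
Qed.

Lemma poles_z k i : w ^+ k * z i \in P.
Proof.
rewrite -(prim_expr_mod hw) inE; apply/orP; right; apply/allpairsP.
by exists (Ordinal (ltn_pmod k (prim_order_gt0 hw)), i); rewrite !mem_enum.
Qed.

Lemma poles0 : 0 \in P. Proof. by rewrite inE eqxx. Qed.

Lemma poles_rot k s : s \in P -> s / (w ^+ k)^-1 \in P.
Proof.
rewrite invrK; move: s; apply: poles_ind => [|j i]; first by rewrite mul0r poles0.
by rewrite mulrAC -exprD poles_z.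
Qed.

Lemma rinf_dsubE k (f : rinf P) : rval (@dsub K (rinf_dalg P) (w ^+ k)^-1 f) = rsub (w ^+ k)^-1 (rval f).
Proof.
rewrite /= mkrinfE //; apply: rinf_sub; rewrite ?invr_eq0 ?expf_neq0 //; last exact: rval_in.
by move=> s; exact: poles_rot.
Qed.

Lemma rinf_dderE (f : rinf P) : rval (@dder K (rinf_dalg P) f) = rder (rval f).
Proof. by rewrite /= mkrinfE //; apply: rinf_der; exact: rval_in. Qed.

Lemma rpoleE s : s \in P -> rval (rpole P s) = rpw s 1.
Proof. by move=> sP; rewrite /rpole mkrinfE ?expr1 //; exact: (rpw_in 0 sP). Qed.

Lemma rinf_dalg_rot : let S k := @dsub K (rinf_dalg P) (w ^+ k)^-1 in
  [/\ forall k, linear (S k), forall k f, dder (S k f) = (w ^+ k)^-1 *: S k (dder f),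
      forall j k f, S j (S k f) = S (j + k)%N f, forall k f, S (k + T)%N f = S k f & forall f, S 0%N f = f].
Proof.
have c0 k : (w ^+ k)^-1 != 0 by rewrite invr_eq0 expf_neq0.
have vl := @rval_linear K P.
split.
- move=> k c f g; apply: val_inj; rewrite [LHS]rinf_dsubE [RHS]vl !rinf_dsubE vl.
  exact: (rsub_linear (c0 k)).
- move=> k f; apply: val_inj; rewrite [LHS]rinf_dderE [RHS](linZ vl) !rinf_dsubE rinf_dderE.
  exact: rsub_der.
- move=> j k f; apply: val_inj; rewrite [LHS]rinf_dsubE [RHS]rinf_dsubE rinf_dsubE rsub_comp //.
  by rewrite exprD invfM.
- by move=> k f; rewrite exprD (prim_expr_order hw) mulr1.
- by move=> f; apply: val_inj; rewrite [LHS]rinf_dsubE expr0 invr1 rsub_id.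
Qed.

End LaurentRotation.

(** * Averaging over a cyclic group modulo an ideal *)

Section InvariantActions.
Context {K : numFieldType} {T : nat} (T0 : (0 < T)%N) {G W : lmodType K}.
Context (g : nat -> G -> G) (gl : forall k, linear (g k)) (gcomp : forall j k x, g j (g k x) = g (j + k)%N x)
  (g0 : forall x, g 0%N x = x) (gT : forall k x, g (k + T)%N x = g k x).
Context (I : set G) (gI : forall k e, I e -> g k e = e).
Context (LG : set G) (LGsub : subspace LG) (LGI : forall e, I e -> LG e).
Let orb x := \sum_(k < T) g k x.
Context (LGorb : forall x, LG (orb x)).
Context (act : G -> W -> W) (actl : forall c x y t, LG x -> LG y -> act (c *: x + y) t = c *: act x t + act y t)
  (actI : forall e t, I e -> act e t = 0).
Implicit Types (x y e : G) (t : W).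

Lemma ideal_fixed k e : lspan I e -> g k e = e.
Proof. by apply: lin_eq_span => [||y]; [exact: gl | exact: lin_id | exact: gI]. Qed.

Lemma ideal_LG e : lspan I e -> LG e.
Proof. by apply: subspace_lspan. Qed.

Lemma act0x t : act 0 t = 0.
Proof.
have [h _] := LGsub; have := actl (-1) t h h.
by rewrite scaler0 addr0 scaleN1r addNr.
Qed.

Lemma actD x y t : LG x -> LG y -> act (x + y) t = act x t + act y t.
Proof. by move=> hx hy; have := actl 1 t hx hy; rewrite !scale1r. Qed.

Lemma actZ c x t : LG x -> act (c *: x) t = c *: act x t.
Proof. by move=> hx; have [h _] := LGsub; have := actl c t hx h; rewrite !addr0 act0x addr0. Qed.

Lemma ideal_act e t : lspan I e -> act e t = 0.
Proof.
move=> he; suff [] : LG e /\ act e t = 0 by [].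
move: he; apply: (subspace_lspan (P := fun e => LG e /\ act e t = 0)) => [|y Iy]; last by split; [exact: LGI | exact: actI].
split=> [|c x y [hx ex] [hy ey]]; first by split; [exact: LGsub.1 | exact: act0x].
by split; [exact: LGsub.2 | rewrite actl // ex ey scaler0 addr0].
Qed.

Lemma orb_linear : linear orb.
Proof. by apply: lin_bigsum. Qed.

Lemma g_orb j x : g j (orb x) = orb x.
Proof.
rewrite /orb (lin_sum _ _ _ (gl j)).
have hm k : g (k %% T)%N x = g k x.
  rewrite {2}(divn_eq k T) addnC; elim: (k %/ T)%N => [|q IH]; first by rewrite mul0n addn0.
  by rewrite mulSnr addnA gT.
transitivity (\sum_(k < T) g (j + k)%N x); first by apply: eq_bigr => k _; exact: gcomp.
case: T T0 hm => // n _ hm; rewrite [RHS](reindex_inj (h := fun k : 'I_n.+1 => inZp (j + k))) /=.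
  by apply: eq_bigr => k _; rewrite hm.
move=> k l /(congr1 (@nat_of_ord _)) /= /eqP; rewrite eqn_modDl => /eqP e.
by apply: val_inj; rewrite /= -(modn_small (ltn_ord k)) e modn_small.
Qed.

(* An element invariant modulo the ideal is invariant: its defect d is fixed by the
   group, and T d = 0. *)
Lemma invariant_exact y : (forall k, qpi I (g k y) = qpi I y) -> forall k, g k y = y.
Proof.
move=> hy; have [d hd] : exists d, g 1%N y = y + d /\ lspan I d.
  by exists (g 1%N y - y); rewrite addrC subrK; split=> //; apply/qpiP.
have hk k : g k y = y + k%:R *: d.
  elim: k => [|k IH]; first by rewrite g0 scale0r addr0.
  rewrite -add1n -gcomp IH (linD (gl 1)) (linZ (gl 1)) (ideal_fixed 1 hd.2) hd.1 natrD scalerDl scale1r addrA //.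
have d0 : d = 0.
  have := hk T; rewrite -[T]add0n gT g0 add0n => /eqP; rewrite -subr_eq0 opprD addrA subrr sub0r oppr_eq0 scaler_eq0.
  by rewrite pnatr_eq0 eqn0Ngt T0 => /eqP.
by move=> k; rewrite hk d0 scaler0 addr0.
Qed.

Context (Rs : set G).

(** T y is the orbit sum of a combination of elements of Rs, up to an element of the ideal, which
    acts by 0. The action is linear on LG only, so both summands are checked to lie there before it
    is applied. *)
Lemma invariant_act y t : (forall k, qpi I (g k y) = qpi I y) ->
  lspan [set q | exists r, Rs r /\ q = qpi I r] (qpi I y) ->
  lspan [set s | exists r, Rs r /\ s = act (orb r) t] (act y t).
Proof.
move=> hy hR; have ye := invariant_exact hy.
have [x [hx hxy]] : exists x, lspan Rs x /\ qpi I y = qpi I x.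
  move: hR; apply: (subspace_lspan (P := fun q => exists x, lspan Rs x /\ q = qpi I x)).
    split; first by exists 0; split; [exact: lspan0 | rewrite (lin0 (qpi_linear _))].
    move=> c p q [x [hx ->]] [x' [hx' ->]]; exists (c *: x + x'); split; last by rewrite (qpi_linear _).
    by apply: lspanD => //; exact: lspanZ.
  by move=> _ [r [hr ->]]; exists r; split=> //; exact: lspan_incl.
move/qpiP: hxy => he; set e := y - x in he.
have yE : T%:R *: y = orb x + T%:R *: e.
  have <- : orb y = T%:R *: y by rewrite /orb (eq_bigr (fun=> y)) // sumr_const card_ord scaler_nat.
  have <- : orb e = T%:R *: e.
    by rewrite /orb (eq_bigr (fun=> e)) => [|k _]; [rewrite sumr_const card_ord scaler_nat | exact: ideal_fixed].
  by rewrite -(linD orb_linear) /e addrC subrK.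
have Tn : T%:R != 0 :> K by rewrite pnatr_eq0 -lt0n.
have hTe : lspan I (T%:R *: e) by exact: lspanZ.
have -> : act y t = T%:R^-1 *: act (orb x) t.
  have yE' : y = T%:R^-1 *: (orb x + T%:R *: e) by rewrite -yE scalerA mulVf // scale1r.
  rewrite {1}yE' actZ; last by have := LGsub.2 1 _ _ (LGorb x) (ideal_LG hTe); rewrite scale1r.
  by rewrite actD //; [rewrite (ideal_act t hTe) addr0 | exact: ideal_LG].
apply: lspanZ; move: hx; apply: (subspace_lspan (P := fun x => lspan _ (act (orb x) t))).
  split; first by rewrite (lin0 orb_linear) act0x; exact: lspan0.
  by move=> c u v hu hv; rewrite orb_linear actl //; apply: lspanD => //; exact: lspanZ.
by move=> r hr; apply: lspan_incl; exists r.
Qed.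

Lemma orb_invariant r : (forall k, lspan Rs (g k r)) ->
  let q := qpi I (orb r) in
  [/\ lspan [set q | exists r, Rs r /\ q = qpi I r] q, forall k, qpi I (g k (repr q)) = q &
      forall t, act (repr q) t = act (orb r) t].
Proof.
move=> hr q; have [e he] : exists e, repr q = orb r + e /\ lspan I e.
  by exists (repr q - orb r); rewrite addrC subrK; split=> //; apply/qpiP; rewrite qpiK.
split.
- rewrite /q (lin_sum _ _ _ (qpi_linear _)); apply: lspan_sum => k _.
  by apply: (lspan_lin (qpi_linear _) _ (hr k)) => x hx; apply: lspan_incl; exists x.
- move=> k; rewrite he.1 (linD (gl k)) g_orb (ideal_fixed k he.2) /q; apply/qpiP.
  by rewrite addrC addKr; exact: he.2.
- by move=> t; rewrite he.1 actD //; [rewrite (ideal_act t he.2) addr0 | exact: ideal_LG he.2].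
Qed.

End InvariantActions.

(** * Invariant global elements as residue operators *)

Section GlobalAction.
Context {K : numFieldType} {X : vla K} (hX : graded_vla X) {T : nat} {w : K} (hw : T.-primitive_root w)
  (sT : forall a : X, iter T (@vsigma _ X) a = a).
Context {N : nat} {z : 'I_N -> K} (z0 : forall i, z i != 0)
  (zd : forall i j k l, i != j -> w ^+ k * z i != w ^+ l * z j).
Local Notation P := (poles T w z).
Local Notation A := (rinf_dalg P).
Local Notation R k := (@vR _ X w k).
Let w0 : w != 0 := prim_neq0 hw.
Let T0 : (0 < T)%N := prim_order_gt0 hw.

(* The points of Gamma z and the origin (None). *)
Definition gpoint := option ('I_N * 'I_T)%type.
(** The coordinate is w^(-k) z_i because w^k in Gamma acts by f(t) -> f(w^(-k) t), and the expansion
    of the latter at z_i comes from that of f at w^(-k) z_i. *)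
Definition pcoord (r : gpoint) : K := if r is Some (i, k) then (w ^+ k)^-1 * z i else 0.

Lemma pcoord_inj : injective pcoord.
Proof.
have wx k : w ^+ k != 0 by rewrite expf_neq0.
have nz i k : (w ^+ k)^-1 * z i != 0 by rewrite mulf_neq0 ?invr_eq0.
move=> [[i k]|] [[j l]|] //= e; last 2 first.
- by move: (nz i k); rewrite e eqxx.
- by move: (nz j l); rewrite -e eqxx.
case: (eqVneq i j) => [ij|/zd h]; last first.
  have := h l k => /eqP[]; rewrite -[z i](mulVKf (wx k)) e.
  by rewrite mulrA [w ^+ l * _]mulrC -mulrA mulVKf.
subst j; congr (Some (_, _)); move: e => /(mulIf (z0 i)) /invr_inj e; apply: val_inj.
by have /eqP := e; rewrite (eq_prim_root_expr hw) !modn_small // => /eqP.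
Qed.

(** A regular series is a derivative, and Dc = 0. *)
Lemma rho_vc_pos (f : laurent_dalg K) : ordge f 0 -> rho (vc X) f = 0 :> loop X.
Proof.
move=> hf; pose g : laurent K := mklaurent (fun n => if 0 < n then n%:~R^-1 * ico f (n - 1) else 0).
have E : f = lder g.
  apply: laurentP => n; rewrite ico_der /g (icoE (d := 0)) => [|m m0]; last by rewrite ltNge ltW.
  case: ltP => n1; last by rewrite mulr0 hf //; lia.
  by rewrite mulrA mulfV ?mul1r ?addrK // intr_eq0; lia.
have := rho_D (vc X) (g : laurent_dalg K); rewrite (ga_Dc hX) E.
have rl := @rho_liebil K X (laurent_dalg K); rewrite (lin0 (rl.1.1 _)) => /esym/eqP.
by rewrite oppr_eq0 => /eqP.
Qed.

Lemma glob_expand_bil (s : K) : liebil (fun a (f : A) => rho a (expand s (rval f) : laurent_dalg K) : loop X).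
Proof.
have rl := @rho_liebil K X (laurent_dalg K).
have el : linear (fun f : A => expand s (rval f) : laurent_dalg K).
  move=> c f g; have -> : rval (c *: f + g) = c *: rval f + rval g by exact: rval_linear.
  by rewrite !expandE expz_linear.
split; first split.
- by move=> f; exact: rl.1.1.
- by move=> a; exact: (lin_comp (rl.1.2 a) el).
- move=> a f; rewrite rho_D rinf_dderE !expandE expz_der addNr //.
Qed.

Lemma glob_expand_linear s : linear (@glob_expand K X T w N z s).
Proof. exact: (lie_lift_linear (glob_expand_bil s)). Qed.

Lemma glob_expand_rho s (a : X) (f : A) : glob_expand s (rho a f) = lrho a (expz s (rval f)).
Proof. by rewrite lrhoE /glob_expand (lie_liftE _ _ (glob_expand_bil s)) expandE. Qed.

Lemma glob_expand_gact k (x : lie X A) : glob_expand 0 (gact w k x) = gact w k (glob_expand 0 x) :> loop X.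
Proof.
have [s1 s2 s3 s4 s5] := laurent_dalg_rot hw; have [t1 t2 t3 t4 t5] := rinf_dalg_rot hw z.
have c0 : (w ^+ k)^-1 != 0 by rewrite invr_eq0 expf_neq0.
have el := glob_expand_linear 0; have gl := gact_linear hX hw t1 t2 k; have gl' := gact_linear hX hw s1 s2 k.
move: x; apply: lie_eq_lin; [exact: (lin_comp el gl) | exact: (lin_comp gl' el) | move=> a f].
have e1 : expz 0 (rval (@dsub K A (w ^+ k)^-1 f)) = lsub (w ^+ k)^-1 (expz 0 (rval f)).
  by rewrite (rinf_dsubE hw k f) (expz_sub _ _ c0) mulr0.
have e2 := gact_rho hX hw s1 s2 k a (expz 0 (rval f) : laurent_dalg K).
rewrite (gact_rho hX hw t1 t2 k a f); apply: (etrans (linZ el (w ^+ k)^-1 (rho (R k a) (@dsub K A (w ^+ k)^-1 f)))).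
have e3 := glob_expand_rho 0 (R k a) (@dsub K A (w ^+ k)^-1 f); rewrite e1 lrhoE in e3.
have e4 := glob_expand_rho 0 a f; rewrite lrhoE in e4.
apply: (etrans (congr1 (fun x : loop X => (w ^+ k)^-1 *: x) e3)); apply: esym.
apply: (etrans (congr1 (@gact K X (laurent_dalg K) w k) e4)); exact: e2.
Qed.

Section Actions.
Context {M : 'I_N -> lmodType K} {M0 : lmodType K}.
Context (ai : forall i, loop X -> M i -> M i) (a0 : loop X -> M0 -> M0).
Context (yi : forall i, X -> int -> M i -> M i) (y0 : X -> int -> M0 -> M0).
Context (aix : forall i v, linear (fun x => ai x v : M i)) (aiv : forall i x, linear (ai (i := i) x)).
Context (aiE : forall i a f v, ai (lrho a f) v = \sum_(n \in [set: int]) ico f n *: yi a n v :> M i).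
Context (yif : forall i a, is_field (yi (i := i) a)).
Context (yic : forall i n v, yi (vc X) n v = if n == -1 then v else 0 :> M i).
Context (a0x : forall c x y v, loopG w x -> loopG w y -> a0 (c *: x + y) v = c *: a0 x v + a0 y v)
  (a0v : forall x, loopG w x -> linear (a0 x)).
Context (a0E : forall a (f : laurent K) v, a0 (\sum_(k < T) gact w k (lrho a f)) v = \sum_(n \in [set: int]) ico f n *: y0 a n v).
Context (y0f : forall a, is_field (y0 a)) (a0c : forall v, a0 (mode (vc X) (-1)) v = T%:R^-1 *: v).
Local Notation F := (factor M M0).
Local Notation W := (mtensor F).
Local Notation mop i := (@mtensor_op K (option 'I_N) F i).

(** At w^(-k) z_i the field of a is that of R_(w^k) a on the factor M_(z_i). The scalar w^(k(-n-1))
    is the prefactor w^(-k) of the action times w^(-kn) from rotating t^n. *)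
Definition pfield (r : gpoint) (a : X) (n : int) : W -> W :=
  match r with
  | Some (i, k) => mop (Some i) (fun v => (w ^+ k) ^ (- n - 1) *: yi (R k a) n v)
  | None => mop None (y0 a n)
  end.

(* omega a f is the sum over r of the residues at r of f(t) times the field of a at r. *)
Definition omega (a : X) (f : rinf P) (t : W) : W :=
  \sum_(r : gpoint) \sum_(n \in [set: int]) ico (expz (pcoord r) (rval f)) n *: pfield r a n t.

Definition act_tot (x : lie X A) (t : W) : W :=
  \sum_(i < N) mop (Some i) (ai (i := i) (glob_expand (z i) x)) t + mop None (a0 (glob_expand 0 x)) t.

Lemma field_fins (U : lmodType K) (G : laurent K) (h : int -> U -> U) v : is_field h -> fins (fun n => ico G n *: h n v).
Proof.
move=> hh; have [d hd] := ico_bounded G; have [b hb] := hh.2 v.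
by apply: (fins_int (a := d) (b := b)) => n nd; [rewrite hd ?scale0r | rewrite hb ?scaler0].
Qed.

Lemma mop_scale i c (h : F i -> F i) t : linear h -> mop i (fun v => c *: h v) t = c *: mop i h t.
Proof.
move=> hl; rewrite (mop_lincomb (c := c) (phi := h) (psi := fun _ => 0)) ?mop_zero ?addr0 //; first exact: lin_cst0.
by move=> x; rewrite addr0.
Qed.

Lemma mop_field_sum i (G : laurent K) (h : int -> F i -> F i) (q : F i -> F i) t : is_field h ->
  (forall v, q v = \sum_(n \in [set: int]) ico G n *: h n v) ->
  mop i q t = \sum_(n \in [set: int]) ico G n *: mop i (h n) t.
Proof.
move=> hh hq; have hm := mfield_field (I := option 'I_N) (M := F) hh.
have E n t' : mop i (fun v => ico G n *: h n v) t' = ico G n *: mfield h n t'.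
  by apply: mop_scale; exact: hh.1.
transitivity (\sum_(n \in [set: int]) mop i (fun v => ico G n *: h n v) t); last by apply: eq_fsum => n; exact: E.
apply: mfield_fsum => //.
- by move=> n; apply: lin_scale; exact: hh.1.
- by move=> v; exact: field_fins.
- by move=> t'; have [r hr] := field_fins G t' hm; exists r => n /hr e; apply: (etrans (E n t')).
Qed.

Lemma mop_sum i (J : Type) (s : seq J) (G : J -> F i -> F i) (h : F i -> F i) t :
  (forall j, linear (G j)) -> (forall v, h v = \sum_(j <- s) G j v) -> mop i h t = \sum_(j <- s) mop i (G j) t.
Proof.
move=> Gl hh; have hl : linear h by move=> c u v; rewrite !hh; have := lin_bigsum s xpredT Gl; apply.
move: t; apply: (mop_eq (i := i)); first exact: mop_linear.
  by apply: lin_bigsum => j; exact: mop_linear (Gl j).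
move=> v x; rewrite mop_mslot // hh (lin_sum _ _ _ (mslot_lin v (i := i))).
by apply: eq_bigr => j _; rewrite mop_mslot.
Qed.

Lemma big_point (V : zmodType) (G : gpoint -> V) :
  \sum_(r : gpoint) G r = \sum_(i < N) \sum_(k < T) G (Some (i, k)) + G None.
Proof.
rewrite (bigD1 None) //= addrC; congr (_ + _); rewrite pair_big /=.
rewrite (reindex_omap Some id) /=; last by case.
by apply: eq_big => [[i k]|[i k] _]; rewrite //= eqxx.
Qed.

Lemma pfield_field r a : is_field (pfield r a).
Proof.
case: r => [[i k]|]; last exact: (mfield_field (I := option 'I_N) (M := F) (i := None) (y0f a)).
apply: (mfield_field (I := option 'I_N) (M := F) (i := Some i) (f := fun n v => (w ^+ k) ^ (- n - 1) *: yi (R k a) n v)).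
have [l b] := yif i (R k a); split=> [n|v]; first exact: lin_scale (l n).
by have [d hd] := b v; exists d => n /hd ->; rewrite scaler0.
Qed.

Lemma loopG_glob_orb (x : lie X A) : loopG w (glob_expand 0 (\sum_(k < T) gact w k x) : loop X).
Proof.
have [s1 s2 s3 s4 s5] := laurent_dalg_rot hw.
rewrite (lin_sum _ _ _ (glob_expand_linear 0)) => j.
have -> : \sum_(k < T) glob_expand 0 (gact w k x) = gorb (T := T) (w := w) (glob_expand 0 x).
  by apply: eq_bigr => k _; exact: glob_expand_gact.
exact: (gact_gorb hX hw sT s1 s2 s3 s4).
Qed.

(** Expanding the orbit sum of a (x) f at z_i collects the contributions of f at all w^(-k) z_i. At
    0 it gives the orbit sum of one expansion, which acts through the modes [y0]. *)
Lemma act_tot_orb a f t : act_tot (\sum_(k < T) gact w k (rho a (f : A))) t = omega a f t.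
Proof.
have [t1 t2 t3 t4 t5] := rinf_dalg_rot hw z.
rewrite /omega big_point /act_tot; congr (_ + _).
  apply: eq_bigr => i _.
  pose G (k : 'I_T) (v : M i) := \sum_(n \in [set: int]) ico (expz ((w ^+ k)^-1 * z i) (rval f)) n *: ((w ^+ k) ^ (- n - 1) *: yi (R k a) n v).
  have fld k : is_field (fun n v => (w ^+ k) ^ (- n - 1) *: yi (i := i) (R k a) n v).
    have [l b] := yif i (R k a); split=> [n|v]; first exact: lin_scale (l n).
    by have [d hd] := b v; exists d => n /hd ->; rewrite scaler0.
  have Gl k : linear (G k).
    by apply: lin_bigfsum => [n|v]; [exact: lin_scale ((fld k).1 n) | exact: field_fins (fld k)].
  rewrite (mop_sum (i := Some i) (s := index_enum 'I_T) (G := G)) //.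
    by apply: eq_bigr => k _; exact: (mop_field_sum (i := Some i) t (fld k)).
  move=> v; have el := glob_expand_linear (z i).
  rewrite (lin_sum _ _ _ el) (lin_sum _ _ _ (aix v)); apply: eq_bigr => k _.
  have c0 : (w ^+ k)^-1 != 0 by rewrite invr_eq0 expf_neq0.
  have e1 : expz (z i) (rval (@dsub K A (w ^+ k)^-1 f)) = lsub (w ^+ k)^-1 (expz ((w ^+ k)^-1 * z i) (rval f)).
    by rewrite (rinf_dsubE hw k f) (expz_sub _ _ c0).
  rewrite (gact_rho hX hw t1 t2 k a f) (linZ el (w ^+ k)^-1 (rho (R k a) (@dsub K A (w ^+ k)^-1 f))).
  rewrite (glob_expand_rho (z i) (R k a)) e1 (linZ (aix v)) aiE /G scaler_fsum; last exact: field_fins.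
  apply: eq_fsum => n; rewrite ico_sub !scalerA; congr (_ *: _).
  rewrite exprz_inv expfzDr ?expf_neq0 // exprN1.
  by rewrite mulrA [LHS]mulrC [X in _ * X = _]mulrC.
apply: (mop_field_sum (i := None) t (y0f a)) => v.
rewrite -a0E; congr (a0 _ v); rewrite (lin_sum _ _ _ (glob_expand_linear 0)); apply: eq_bigr => k _.
by apply: (etrans (glob_expand_gact k (rho a (f : A)))); rewrite glob_expand_rho.
Qed.

Local Notation I := (@glob_ideal K X T w N z).
Local Notation LG := [set x : lie X A | loopG w (glob_expand 0 x)].

Lemma loopG_subspace : subspace (loopG (L := X) w).
Proof.
have [s1 s2 s3 s4 s5] := laurent_dalg_rot hw; have gl := gact_linear hX hw s1 s2.
split=> [k|c x y hx hy k]; first exact: (lin0 (gl k)).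
by rewrite (gl k c x y) hx hy.
Qed.

Lemma LG_subspace : subspace LG.
Proof. exact: (subspace_preim (glob_expand_linear 0) loopG_subspace). Qed.

Lemma loopG_c : loopG w (mode (vc X) (-1)).
Proof.
have [s1 s2 s3 s4 s5] := laurent_dalg_rot hw; have rl := @rho_liebil K X (laurent_dalg K) => k.
apply: (etrans (gact_rho hX hw s1 s2 k (vc X) (lmono (-1) : laurent_dalg K))).
have -> : @dsub K (laurent_dalg K) (w ^+ k)^-1 (lmono (-1)) = (w ^+ k) *: (lmono (-1) : laurent_dalg K).
  apply: laurentP => n; rewrite [LHS]ico_sub icoZ ico_mono; case: eqP => [->|_]; last by rewrite !mulr0.
  by rewrite exprz_inv opprK expr1z.
by rewrite (vR_c hX) (linZ (rl.1.2 _)) scalerA mulVf ?scale1r // expf_neq0.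
Qed.

(** M_0 is a module over the invariants only, so additivity is confined to LG, the global elements
    whose expansion at 0 is invariant. *)
Lemma act_tot_lin c x y t : LG x -> LG y -> act_tot (c *: x + y) t = c *: act_tot x t + act_tot y t.
Proof.
move=> hx hy; rewrite /act_tot scalerDr addrACA scaler_sumr -big_split; congr (_ + _).
  apply: eq_bigr => i _; apply: (mop_lincomb (i := Some i) (M := F)); [exact: aiv | exact: aiv | move=> v].
  by rewrite (glob_expand_linear (z i) c x y); exact: (aix v).
have h (x1 x2 x3 : loop X) : loopG w x1 -> loopG w x2 -> x3 = c *: x1 + x2 ->
    mop None (a0 x3) t = c *: mop None (a0 x1) t + mop None (a0 x2) t.
  move=> h1 h2 ->; apply: (@mop_lincomb K _ F None c (a0 x1) (a0 x2) (a0 (c *: x1 + x2)) t (a0v h1) (a0v h2)) => v.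
  exact: a0x.
exact: (h _ _ _ hx hy (glob_expand_linear 0 c x y)).
Qed.

Definition ideal_gen (i : 'I_N) : lie X A :=
  \sum_(k < T) rho (vc X) (rpole P (w ^+ k * z i) : A) - T%:R *: rho (vc X) (rpole P 0 : A).

Lemma ideal_gen_fixed k i : gact w k (ideal_gen i) = ideal_gen i.
Proof.
have [t1 t2 t3 t4 t5] := rinf_dalg_rot hw z; have gl := gact_linear hX hw t1 t2 k.
have rl := @rho_liebil K X A.
have E s : s \in P -> s * w ^+ k \in P -> gact w k (rho (vc X) (rpole P s : A)) = rho (vc X) (rpole P (s * w ^+ k) : A).
  move=> sP sP'; apply: (etrans (gact_rho hX hw t1 t2 k (vc X) (rpole P s : A))).
  have -> : @dsub K A (w ^+ k)^-1 (rpole P s) = w ^+ k *: (rpole P (s * w ^+ k) : A).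
    apply: val_inj; rewrite [LHS](rinf_dsubE hw) [RHS](linZ (@rval_linear K P)) !rpoleE //.
    by rewrite rsub_rpw ?invr_eq0 ?expf_neq0 // expr1 !invrK.
  by rewrite (vR_c hX) (linZ (rl.1.2 _)) scalerA mulVf ?scale1r // expf_neq0.
rewrite /ideal_gen (linB gl) (linZ gl) (lin_sum _ _ _ gl); congr (_ - _ *: _); last first.
  by rewrite E ?mul0r // poles0.
pose G j : lie X A := rho (vc X) (rpole P (w ^+ j * z i) : A).
transitivity (\sum_(j < T) G (k + j)%N).
  apply: eq_bigr => j _; have ej : w ^+ j * z i * w ^+ k = w ^+ (k + j) * z i by rewrite mulrAC -exprD addnC.
  have := E (w ^+ j * z i); rewrite ej => h; exact (h (poles_z hw z j i) (poles_z hw z (k + j) i)).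
by apply: (sum_mod_shift hw (F := G)) => j; rewrite /G (prim_expr_mod hw).
Qed.

Lemma ideal_gen_expand0 i : glob_expand 0 (ideal_gen i) = - T%:R *: mode (vc X) (-1).
Proof.
have el := glob_expand_linear 0.
rewrite /ideal_gen (linB el) (linZ el) (lin_sum _ _ _ el) big1 => [|k _].
  rewrite sub0r scaleNr modeE; congr (- (_ *: _)).
  by rewrite (glob_expand_rho 0 (vc X)) rpoleE ?poles0 // expz_rpw_diag.
rewrite (glob_expand_rho 0 (vc X)) rpoleE ?(poles_z hw) // lrhoE; apply: rho_vc_pos.
by rewrite expz_rpw => [n n0|]; rewrite ?ico_geo ?leNgt ?n0 // eq_sym mulf_neq0 ?expf_neq0.
Qed.

Lemma ideal_gen_LG i : LG (ideal_gen i).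
Proof.
rewrite /= ideal_gen_expand0; have [h0 hD] := loopG_subspace.
by have := hD (- T%:R) _ _ loopG_c h0; rewrite addr0.
Qed.

(** Among the functions in the generator only 1/(t - z_i) has a pole at z_i, where c acts by 1, and
    none has one at z_j for j different from i. At 0 the term - T/t acts by - T times the level 1/T,
    so the two contributions cancel. *)
Lemma ideal_gen_act i t : act_tot (ideal_gen i) t = 0.
Proof.
have yE j (f : rinf P) v : ai (lrho (vc X) (expz (z j) (rval f))) v = ico (expz (z j) (rval f)) (-1) *: v :> M j.
  rewrite aiE (fsum_only (j := -1)) => [|n /negbTE n1]; first by rewrite yic eqxx.
  by rewrite yic n1 scaler0.
have aE j v : ai (glob_expand (z j) (ideal_gen i)) v = (i == j)%:R *: v :> M j.
  have el := glob_expand_linear (z j).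
  have e0 : ico (expz (z j) (rpw 0 1)) (-1) = 0 by rewrite expz_rpw ?ico_geo // z0.
  rewrite /ideal_gen (linB el) (linZ el) (lin_sum _ _ _ el) (linB (aix v)) (linZ (aix v)) (lin_sum _ _ _ (aix v)).
  rewrite [X in _ - _ *: X](_ : _ = 0); last first.
    by rewrite (glob_expand_rho (z j) (vc X)) yE rpoleE ?poles0 // e0 scale0r.
  rewrite scaler0 subr0; pose k0 : 'I_T := Ordinal T0; rewrite (bigD1 k0) //= big1 => [|k k0'].
    rewrite (glob_expand_rho (z j) (vc X)) yE rpoleE ?(poles_z hw) // addr0 expr0 mul1r.
    case: (eqVneq i j) => [->|ij]; first by rewrite expz_rpw_diag ico_mono eqxx.
    rewrite expz_rpw ?ico_geo ?scale0r //; have := zd 0 0 ij; rewrite !expr0 !mul1r eq_sym //.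
  rewrite (glob_expand_rho (z j) (vc X)) yE rpoleE ?(poles_z hw) // expz_rpw ?ico_geo ?scale0r // eq_sym.
  case: (eqVneq i j) => [ij|ij]; last by have := zd k 0 ij; rewrite expr0 mul1r.
  rewrite ij -[X in _ != X]mul1r (inj_eq (mulIf (z0 j))) -(prim_order_dvd hw) gtnNdvd //.
  by rewrite lt0n; apply: contra k0' => /eqP e; apply/eqP/val_inj.
rewrite /act_tot (bigD1 i) //= big1 => [|j ji]; last first.
  rewrite -(mop_zero (M := F) (Some j) t); congr (mtensor_op _ t); apply/funext => v.
  by rewrite aE eq_sym (negbTE ji) scale0r.
have -> : mop (Some i) (ai (glob_expand (z i) (ideal_gen i))) t = t.
  rewrite -[RHS](mop_id (M := F) (Some i)); congr (mtensor_op _ t); apply/funext => v.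
  by rewrite aE eqxx scale1r.
have -> : mop None (a0 (glob_expand 0 (ideal_gen i))) t = - t; last by rewrite addr0 subrr.
rewrite -scaleN1r -[in RHS](mop_id (M := F) None t) -mop_scale; last exact: lin_id.
congr (mtensor_op _ t); apply/funext => v; rewrite ideal_gen_expand0.
have [h0 hD] := loopG_subspace; have := a0x (- T%:R) v loopG_c h0; rewrite addr0 => ->.
have -> : a0 0 v = 0 by have := a0x (-1) v h0 h0; rewrite scaler0 addr0 scaleN1r addNr.
by rewrite a0c addr0 scalerA mulNr mulfV ?pnatr_eq0 -?lt0n.
Qed.

Lemma globG_omega (Lo : set X) (q : @globI K X T w N z) t : globG Lo q ->
  lspan [set s | exists a f, Lo a /\ s = omega a f t] (glob_act ai a0 q t).
Proof.
move=> [h1 h2]; have [t1 t2 t3 t4 t5] := rinf_dalg_rot hw z; have gl := gact_linear hX hw t1 t2.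
have gI k e : I e -> gact w k e = e by move=> [i ->]; exact: ideal_gen_fixed.
have IG e : I e -> LG e by move=> [i ->]; exact: ideal_gen_LG.
have aI e t' : I e -> act_tot e t' = 0 by move=> [i ->]; exact: ideal_gen_act.
have := @invariant_act K T T0 _ _ (@gact K X A w) gl (gact_comp hX hw t1 t2 t3) (gact0 hX hw t1 t2 t5)
  (gactDT hX hw sT t1 t2 t4) I gI LG LG_subspace IG loopG_glob_orb act_tot act_tot_lin aI
  [set x | exists a f, Lo a /\ x = rho a f] (repr q) t.
rewrite !qpiK => /(_ h2) h; apply: (lspan_sub _ (h _)).
  move=> _ [_ [[a [f [ha ->]]] ->]]; apply: lspan_incl; exists a, f; split=> //; exact: act_tot_orb.
apply: lspan_sub h1 => _ [a [f [ha ->]]]; apply: lspan_incl; exists (rho a f); split=> //.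
by exists a, f.
Qed.

(** The converse of [globG_omega]. The orbit sum of a (x) f contains all R_(w^k) a, so each of
    these, tensored with functions, has to lie in the span coming from Lo; a itself need not belong
    to Lo. *)
Lemma omega_globG (Lo : set X) a f :
  (forall k (g : A), lspan [set x | exists (s : X) (h : A), Lo s /\ x = rho s h] (rho (R k a) g : lie X A)) ->
  exists q : @globI K X T w N z, globG Lo q /\ forall t, glob_act ai a0 q t = omega a f t.
Proof.
move=> hR; have [t1 t2 t3 t4 t5] := rinf_dalg_rot hw z; have gl := gact_linear hX hw t1 t2.
have gI k e : I e -> gact w k e = e by move=> [i ->]; exact: ideal_gen_fixed.
have IG e : I e -> LG e by move=> [i ->]; exact: ideal_gen_LG.
have aI e t' : I e -> act_tot e t' = 0 by move=> [i ->]; exact: ideal_gen_act.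
have := @orb_invariant K T T0 _ _ (@gact K X A w) gl (gact_comp hX hw t1 t2 t3)
  (gactDT hX hw sT t1 t2 t4) I gI LG LG_subspace IG loopG_glob_orb act_tot act_tot_lin aI
  [set x | exists a f, Lo a /\ x = rho a f] (rho a (f : A)).
case=> [k|h1 h2 h3].
  apply: (@eq_ind_r _ _ (lspan _) _ _ (gact_rho hX hw t1 t2 k a f)); exact: (lspanZ _ (hR k _)).
exists (qpi I (\sum_(k < T) gact w k (rho a (f : A)))); split; last first.
  by move=> t; apply: (etrans (h3 t)); exact: act_tot_orb.
split; last exact: h2.
apply: lspan_sub h1 => _ [_ [[b [g [hb ->]]] ->]]; apply: lspan_incl; exists b, g; split=> //.
Qed.

End Actions.

End GlobalAction.

(** The interface between the local actions and the global operators: each a (x) f acts as the sum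
    of its modes weighted by the coefficients of f, at 0 after taking the orbit sum. It holds for L
    with its own modes and for V(L) with those of [YM] and [YW]. *)
Record action_system (K : numFieldType) (X : vla K) (T : nat) (w : K) (N : nat) (M : 'I_N -> lmodType K) (M0 : lmodType K)
    (ai : forall i, loop X -> M i -> M i) (a0 : loop X -> M0 -> M0)
    (yi : forall i, X -> int -> M i -> M i) (y0 : X -> int -> M0 -> M0) : Prop := {
  as_x : forall i v, linear (fun x => ai i x v : M i);
  as_v : forall i x, linear (ai i x);
  as_E : forall i a f v, ai i (lrho a f) v = \sum_(n \in [set: int]) ico f n *: yi i a n v;
  as_field : forall i a, is_field (yi i a);
  as_c : forall i n v, yi i (vc X) n v = if n == -1 then v else 0;
  as_x0 : forall c x y v, loopG w x -> loopG w y -> a0 (c *: x + y) v = c *: a0 x v + a0 y v;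
  as_v0 : forall x, loopG w x -> linear (a0 x);
  as_E0 : forall a (f : laurent K) v, a0 (\sum_(k < T) gact w k (lrho a f)) v = \sum_(n \in [set: int]) ico f n *: y0 a n v;
  as_field0 : forall a, is_field (y0 a);
  as_c0 : forall v, a0 (mode (vc X) (-1)) v = T%:R^-1 *: v }.

(** * Induction on the word length *)

Section Systems.
Context {K : numFieldType} {L : vla K} (hL : vertex_lie_algebra L) {T : nat} {w : K}
  (hw : T.-primitive_root w) (hS : vla_automorphism L T).
Context {N : nat} {M : 'I_N -> lmodType K} {M0 : lmodType K}.
Context {act : forall i, loop L -> M i -> M i} {act0 : loop L -> M0 -> M0}.
Context (hm : forall i, smooth_module (@act i)) (hm0 : smooth_moduleG T w act0).
Let hX := vla_graded_vla hL hS.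
Let hV := vacm_vacuum (L := L).

Lemma small_system : action_system T w (@act) act0 (fun i a n v => @act i (mode a n) v)
  (fun a n v => act0 (modeG T w a n) v).
Proof.
have tw0 := smoothG_twisted hL hw hS hm0.
have ml i : forall x, linear (@act i x) by have [[_ h _] _ _ _] := hm i => x; exact: h.
have mx i v : linear (fun x => @act i x v) by have [[h _ _] _ _ _] := hm i => c x y; exact: h.
split.
- exact: mx.
- exact: ml.
- by move=> i a f v; rewrite lrhoE; exact: (sm_termwise (hm i)).
- by move=> i a; split=> [n|v]; [exact: ml | exact: (sm_smooth (hm i))].
- move=> i n v; case: eqP => [->|/eqP n1]; first exact: (sm_level (hm i)).
  by rewrite (mode_c hL n1) (lin0 (mx i v)).
- by move=> c x y v hx hy; have [[h _ _] _ _ _] := hm0; exact: h.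
- by move=> x hx; have [[_ h _] _ _ _] := hm0; exact: h.
- by move=> a f v; rewrite lrhoE (smG_termwise hm0).
- by move=> a; split=> [n|v]; [exact: (tw_linv tw0) | exact: (tw_trunc tw0)].
- exact: (smG_level hm0).
Qed.

Section StateLift.
Context {T' : nat} {w' : K} (hw' : T'.-primitive_root w') {U : lmodType K} {u : L -> int -> U -> U}
  (hu : twisted_fields (T := T') (w := w') u) {Y : vacm L -> int -> U -> U}
  (hY : state_map (T := T') (w := w') (va := vact (L := L)) (v0 := vacuum L) (u := u) Y).

Lemma stm_field A : is_field (Y A). Proof. exact: (stm_smooth hY A).1. Qed.

Lemma stm_linA n v : linear (fun A => Y A n v).
Proof. by move=> c A B; rewrite (stm_lin hY). Qed.

(** That DA (x) f + A (x) f' acts by 0 is the formula Y(DA, x) = d/dx Y(A, x) of [stm_der],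
    integrated against f. *)
Lemma state_lift_bil v : liebil (fun (A : vac_vla L) (f : laurent_dalg K) => termwise f (fun n => Y A n v)).
Proof.
have [dV [dl d0 da dE]] := vac_translation hL hS.
have tE (f : laurent K) A : termwise f (fun n => Y A n v) = \sum_(n \in [set: int]) ico f n *: Y A n v by [].
split; first split.
- by move=> f; apply: lin_bigfsum => [n|A]; [exact: lin_scale (stm_linA n v) | exact: field_fins (stm_field A)].
- move=> A c f g; rewrite !tE scaler_fsum; last exact: field_fins (stm_field A).
  rewrite -fsumD; [|by apply: (fins_map (scaler0 _ c)); exact: field_fins (stm_field A)|exact: field_fins (stm_field A)].
  by apply: eq_fsum => n; rewrite icoD icoZ scalerDl scalerA.
- move=> A f; rewrite !tE /= dE.
  have sd n : Y (dV A) n v = - n%:~R *: Y A (n - 1) v by exact: (stm_der hL hw' hV hu dl d0 da hY).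
  rewrite (fsum_shift _ 1) -fsumD.
  + by apply: fsum0 => n; rewrite sd ico_der addrK scalerA mulrN scaleNr mulrC addNr.
  + have := field_fins f v (stm_field (dV A)) => -[s hs]; exists [seq i - 1 | i <- s] => n hn.
    by apply: hs; apply: contra hn => h; apply/mapP; exists (n + 1) => //; rewrite addrK.
  + exact: field_fins (stm_field A).
Qed.

Lemma state_lift_linv (x : loop (vac_vla L)) :
  linear (fun v => lie_lift (fun (A : vac_vla L) (f : laurent_dalg K) => termwise f (fun n => Y A n v)) x).
Proof.
have bl v := lie_lift_linear (state_lift_bil v); move: x; apply: lie_ind.
  split=> [c u1 u2|c x y hx hy d u1 u2]; first by rewrite !(lin0 (bl _)) scaler0 addr0.
  by rewrite !(bl _ c x y) hx hy !scalerDr !scalerA [c * d]mulrC addrACA.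
move=> A f c u1 u2; rewrite !(lie_liftE _ _ (state_lift_bil _)) /termwise.
have fl := lin_bigfsum (F := fun n v => ico f n *: Y A n v) (fun n => lin_scale _ ((stm_field A).1 n)) (fun v => field_fins f v (stm_field A)).
exact: fl.
Qed.

End StateLift.

Lemma YM_map i : state_map (T := 1) (w := 1) (va := vact (L := L)) (v0 := vacuum L) (u := fun a n v => @act i (mode a n) v) (YM (@act i)).
Proof. exact: (YM_state_map hL hS (hm i)). Qed.

Lemma YW_map : state_map (T := T) (w := w) (va := vact (L := L)) (v0 := vacuum L) (u := fun a n v => act0 (modeG T w a n) v) (YW T w act0).
Proof. exact: (YW_state_map hL hw hS hm0). Qed.

Lemma YW_rotate k (A : vac_vla L) n v : (k < T)%N -> YW T w act0 (@vR _ (vac_vla L) w k A) n v = (w ^+ k) ^ (n + 1) *: YW T w act0 A n v.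
Proof.
move=> kT; have tw0 := smoothG_twisted hL hw hS hm0; have gX := vac_vla_graded hL hS.
apply: (stm_rotate hL hw hS hV tw0 YW_map kT (RV := @vR _ (vac_vla L) w k)).
- exact: (vR_linear gX w k).
- exact: (vR_c gX w k).
- exact: (vac_vla_vR hL hw hS k).
Qed.

(** The only delicate clause is the one at 0. By [YW_rotate] the T terms of an orbit sum act
    equally, and the factor 1/T in [big_actG] leaves one copy of A^W_(n). *)
Lemma big_system : action_system (X := vac_vla L) T w (fun i => big_act (@act i)) (big_actG T w act0)
  (fun i A n v => YM (@act i) A n v) (fun A n v => YW T w act0 A n v).
Proof.
have tw0 := smoothG_twisted hL hw hS hm0; have twi i := smooth_twisted hL hX (hm i).
have b0 v := state_lift_bil hw tw0 YW_map v; have bi i v := state_lift_bil (prim1 (K := K)) (twi i) (YM_map i) v.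
have l0 v := lie_lift_linear (b0 v); have gX := vac_vla_graded hL hS.
have T0 : T%:R != 0 :> K by rewrite pnatr_eq0 -lt0n (prim_order_gt0 hw).
have E0 A (f : laurent K) v : big_actG T w act0 (lrho (A : vac_vla L) f) v = T%:R^-1 *: \sum_(n \in [set: int]) ico f n *: YW T w act0 A n v.
  by rewrite /big_actG lrhoE (lie_liftE _ _ (b0 v)).
have G0 v : linear (fun x => big_actG T w act0 x v) by exact: lin_scale (l0 v).
split.
- by move=> i v; exact: (lie_lift_linear (bi i v)).
- by move=> i x; exact: (state_lift_linv (prim1 (K := K)) (twi i) (YM_map i)).
- by move=> i A f v; rewrite /big_act lrhoE (lie_liftE _ _ (bi i v)).
- by move=> i A; exact: (stm_field (YM_map i)).
- by move=> i n v; rewrite /= (stm_v0 (YM_map i)).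
- by move=> c x y v _ _; exact: G0.
- by move=> x _; apply: lin_scale; exact: (state_lift_linv hw tw0 YW_map).
- move=> A f v; rewrite (lin_sum _ _ _ (G0 v)).
  have [s1 s2 s3 s4 s5] := laurent_dalg_rot hw.
  rewrite (eq_bigr (fun=> T%:R^-1 *: \sum_(n \in [set: int]) ico f n *: YW T w act0 A n v)) => [|k _].
    by rewrite sumr_const card_ord -scaler_nat scalerA mulfV // scale1r.
  have e : gact w k (lrho A f) = (w ^+ k)^-1 *: lrho (@vR _ (vac_vla L) w k A) (lsub (w ^+ k)^-1 f).
    by rewrite !lrhoE; exact: (gact_rho gX hw s1 s2 k A (f : laurent_dalg K)).
  apply: (etrans (congr1 (fun x => big_actG T w act0 x v) e)); rewrite (linZ (G0 v)) E0 scalerA mulrC -scalerA; congr (_ *: _).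
  rewrite scaler_fsum; last exact: field_fins (stm_field YW_map _).
  apply: eq_fsum => n; rewrite YW_rotate // !scalerA ico_sub; congr (_ *: _).
  have c0 : w ^+ k != 0 by rewrite expf_neq0 // (prim_neq0 hw).
  have key : (w ^+ k)^-1 * (w ^+ k)^-1 ^ n * (w ^+ k) ^ (n + 1) = 1.
    by rewrite exprz_inv -exprN1 -!expfzDr // (_ : -1 + - n + (n + 1) = 0) //; lia.
  rewrite -[RHS]mulr1 -key; move: ((w ^+ k)^-1) ((w ^+ k) ^ (n + 1)) (ico f n) => x1 x2 x3; ring.
- by move=> A; exact: (stm_field YW_map).
- move=> v; rewrite modeE E0 (fsum_only (j := -1)) => [|n /negbTE n1]; last by rewrite ico_mono n1 scale0r.
  by rewrite ico_mono eqxx scale1r /= (stm_v0 YW_map).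
Qed.

End Systems.

(** * Recursions and commutators on the tensor product *)

Section Lifting.
Context {K : numFieldType} {I : finType} {F : I -> lmodType K}.
Local Notation mop i := (@mtensor_op K I F i).
Implicit Types (t : mtensor F).

Lemma mop_add i (f g h : F i -> F i) t : linear f -> linear g -> (forall v, h v = f v + g v) ->
  mop i h t = mop i f t + mop i g t.
Proof. by move=> fl gl hh; rewrite (mop_lincomb (c := 1) (phi := f) (psi := g)) ?scale1r // => v; rewrite scale1r. Qed.

Lemma mop_normal_prod i (f g : int -> F i -> F i) (h e : F i -> F i) m t : is_field f -> is_field g -> linear e ->
  (forall v, h v = \sum_(p \in [set: nat]) f (- p.+1%:Z) (g (m + p%:Z) v) + \sum_(p \in [set: nat]) g (m - p.+1%:Z) (f p%:Z v) + e v) ->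
  mop i h t = \sum_(p \in [set: nat]) mop i (f (- p.+1%:Z)) (mop i (g (m + p%:Z)) t) +
    \sum_(p \in [set: nat]) mop i (g (m - p.+1%:Z)) (mop i (f p%:Z) t) + mop i e t.
Proof.
move=> hf hg el hh.
have f1 (V : lmodType K) (f' g' : int -> V -> V) v : is_field f' -> is_field g' -> fins (fun p : nat => f' (- p.+1%:Z) (g' (m + p%:Z) v)).
  move=> hf' hg'; have [d hd] := hg'.2 v; apply: (fins_nat (b := `|d - m|%N)) => p hp.
  by rewrite hd ?(lin0 (hf'.1 _)) //; lia.
have f2 (V : lmodType K) (f' g' : int -> V -> V) v : is_field f' -> is_field g' -> fins (fun p : nat => g' (m - p.+1%:Z) (f' p%:Z v)).
  move=> hf' hg'; have [d hd] := hf'.2 v; apply: (fins_nat (b := `|d|%N)) => p hp.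
  by rewrite hd ?(lin0 (hg'.1 _)) //; lia.
have mf := mfield_field (I := I) (M := F) hf; have mg := mfield_field (I := I) (M := F) hg.
have l1 (p : nat) : linear (fun v => f (- p.+1%:Z) (g (m + p%:Z) v)) by exact: (lin_comp (hf.1 _) (hg.1 _)).
have l2 (p : nat) : linear (fun v => g (m - p.+1%:Z) (f p%:Z v)) by exact: (lin_comp (hg.1 _) (hf.1 _)).
pose h1 v := \sum_(p \in [set: nat]) f (- p.+1%:Z) (g (m + p%:Z) v).
pose h2 v := \sum_(p \in [set: nat]) g (m - p.+1%:Z) (f p%:Z v).
have h1l : linear h1 by apply: lin_bigfsum => // v; exact: (f1 _ f g v hf hg).
have h2l : linear h2 by apply: lin_bigfsum => // v; exact: (f2 _ f g v hf hg).
rewrite (mop_add (f := fun v => h1 v + h2 v) (g := e)) //; last exact: lin_add.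
rewrite (mop_add (f := h1) (g := h2)) //; congr (_ + _ + _).
- rewrite (mfield_fsum (F := fun (p : nat) v => f (- p.+1%:Z) (g (m + p%:Z) v))) //.
  + by apply: eq_fsum => p; exact: (mop_comp t (hf.1 _) (hg.1 _)).
  + by move=> v; exact: (f1 _ f g v hf hg).
  + move=> t'; have [s hs] := f1 _ _ _ t' mf mg; exists s => p /hs <-.
    exact: (mop_comp t' (hf.1 _) (hg.1 _)).
- rewrite (mfield_fsum (F := fun (p : nat) v => g (m - p.+1%:Z) (f p%:Z v))) //.
  + by apply: eq_fsum => p; exact: (mop_comp t (hg.1 _) (hf.1 _)).
  + by move=> v; exact: (f2 _ f g v hf hg).
  + move=> t'; have [s hs] := f2 _ _ _ t' mf mg; exists s => p /hs <-.
    exact: (mop_comp t' (hg.1 _) (hf.1 _)).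
Qed.

Lemma mop_commutator i (f g e : F i -> F i) t : linear f -> linear g -> linear e ->
  (forall v, f (g v) - g (f v) = e v) -> mop i f (mop i g t) - mop i g (mop i f t) = mop i e t.
Proof.
move=> fl gl el h; rewrite -!mop_comp //; apply/eqP; rewrite subr_eq; apply/eqP.
apply: mop_add => //; first exact: lin_comp.
by move=> v; rewrite -h subrK.
Qed.

End Lifting.

Section StateNormal.
Context {K : numFieldType} {L : vla K} {T : nat} {w : K} (hw : T.-primitive_root w).
Context {V : lmodType K} {va : loop L -> V -> V} {v0 : V}.
Context {U : lmodType K} {u : L -> int -> U -> U} (hu : twisted_fields (T := T) (w := w) u).
Context {Y : V -> int -> U -> U} (hY : state_map (T := T) (w := w) (va := va) (v0 := v0) (u := u) Y).

Lemma stm_normal a B m v : Y (va (mode a (-1)) B) m v =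
  \sum_(p \in [set: nat]) u a (- p.+1%:Z) (Y B (m + p%:Z) v) +
  \sum_(p \in [set: nat]) Y B (m - p.+1%:Z) (u a p%:Z v) +
  \sum_(k < T | (0 < k)%N) \sum_(j \in [set: nat])
       ((w ^+ k - 1) ^+ j.+1)^-1 *: Y (va (mode (@vR _ L w k a) j%:Z) B) (m - j.+1%:Z) v.
Proof.
have [_ [_ [_ [_ [ax1 ax2]]]]] := stm_axioms hw hu hY.
apply: (etrans (ax2 a B m v)).
apply: (etrans (congr1 (fun x => x + _) (normal_prodE _ _ m v))).
apply: (f_equal2 +%R); first apply: (f_equal2 +%R).
- by apply: eq_fsum => p; rewrite ax1; congr (u a _ _); lia.
- by apply: eq_fsum => p; rewrite ax1; congr (Y B _ _); lia.
- by apply: eq_bigr => k _; apply: eq_fsum => j; congr (_ *: Y _ _ _); lia.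
Qed.

End StateNormal.

Section OmegaTheory.
Context {K : numFieldType} {X : vla K} (hX : graded_vla X) {T : nat} {w : K} (hw : T.-primitive_root w)
  (sT : forall a : X, iter T (@vsigma _ X) a = a).
Context {N : nat} {z : 'I_N -> K} {M : 'I_N -> lmodType K} {M0 : lmodType K}.
Context {ai : forall i, loop X -> M i -> M i} {a0 : loop X -> M0 -> M0}.
Context {yi : forall i, X -> int -> M i -> M i} {y0 : X -> int -> M0 -> M0}.
Context (hA : action_system T w (@ai) a0 (@yi) y0).
Local Notation P := (poles T w z).
Local Notation omega := (@omega K X T w N z M M0 (@yi) y0).

Lemma omega_rho a (f : rinf P) t : omega a f t = act_tot (@ai) a0 (\sum_(k < T) gact w k (rho a (f : rinf_dalg P))) t.
Proof.
symmetry; apply: (act_tot_orb hX hw (yi := @yi) (y0 := y0)).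
- exact: (as_x hA).
- exact: (as_E hA).
- exact: (as_field hA).
- exact: (as_E0 hA).
- exact: (as_field0 hA).
Qed.

Lemma orb_rho_lin c x y t : act_tot (@ai) a0 (\sum_(k < T) gact w k (c *: x + y : lie X (rinf_dalg P))) t =
  c *: act_tot (@ai) a0 (\sum_(k < T) gact w k x) t + act_tot (@ai) a0 (\sum_(k < T) gact w k y) t.
Proof.
have [t1 t2 t3 t4 t5] := rinf_dalg_rot hw z; have gl := gorb_linear hX hw t1 t2.
apply: (etrans (congr1 (fun x => act_tot (@ai) a0 x t) (gl c x y))).
apply: (act_tot_lin (w := w)).
- exact: (as_x hA).
- exact: (as_v hA).
- exact: (as_x0 hA).
- exact: (as_v0 hA).
- exact: (loopG_glob_orb hX hw sT).
- exact: (loopG_glob_orb hX hw sT).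
Qed.

Lemma omega_lina f t : linear (fun a => omega a f t).
Proof.
move=> c a b; rewrite !omega_rho; have rl := @rho_liebil K X (rinf_dalg P).
by rewrite -orb_rho_lin -(rl.1.1 _).
Qed.

Lemma omega_D a f t : omega (vD a) f t = - omega a (@dder K (rinf_dalg P) f) t.
Proof.
pose G (x : lie X (rinf_dalg P)) := act_tot (@ai) a0 (\sum_(k < T) gact w k x) t.
have Gl : linear G := fun c x y => orb_rho_lin c x y t.
rewrite !omega_rho; exact: (etrans (congr1 G (rho_D a (f : rinf_dalg P))) (linN Gl _)).
Qed.

End OmegaTheory.

Section Induction.
Context {K : numFieldType} {L : vla K} (hL : vertex_lie_algebra L) {T : nat} {w : K}
  (hw : T.-primitive_root w) (hS : vla_automorphism L T).
Context {N : nat} {z : 'I_N -> K} (z0 : forall i, z i != 0)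
  (zd : forall i j k l, i != j -> w ^+ k * z i != w ^+ l * z j).
Context {M : 'I_N -> lmodType K} {M0 : lmodType K}.
Context {act : forall i, loop L -> M i -> M i} {act0 : loop L -> M0 -> M0}.
Context (hm : forall i, smooth_module (@act i)) (hm0 : smooth_moduleG T w act0).
Let hX := vla_graded_vla hL hS.
Let hV := vacm_vacuum (L := L).
Let gV := vac_vla_graded hL hS.
Let T0 : (0 < T)%N := prim_order_gt0 hw.
Let w0 : w != 0 := prim_neq0 hw.
Local Notation P := (poles T w z).
Local Notation W := (mtensor (factor M M0)).
Local Notation R k := (@vR _ L w k).
Local Notation RV k := (@vR _ (vac_vla L) w k).
Local Notation small_field := (@pfield K L T w N M M0 (fun i a n v => @act i (mode a n) v) (fun a n v => act0 (modeG T w a n) v)).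
Local Notation big_field := (@pfield K (vac_vla L) T w N M M0 (fun i A n v => YM (@act i) A n v) (fun A n v => YW T w act0 A n v)).
Local Notation small_omega := (@omega K L T w N z M M0 (fun i a n v => @act i (mode a n) v) (fun a n v => act0 (modeG T w a n) v)).
Local Notation big_omega := (@omega K (vac_vla L) T w N z M M0 (fun i A n v => YM (@act i) A n v) (fun A n v => YW T w act0 A n v)).
Let sm := small_system hL hw hS hm hm0.
Let bg := big_system hL hw hS hm hm0.
Local Notation pc := (@pcoord K T w N z).
Local Notation pt := (@gpoint T N).

Lemma smallf r a : is_field (small_field r a).
Proof. apply: pfield_field; [exact: (as_field sm) | exact: (as_field0 sm)]. Qed.
Lemma bigf r A : is_field (big_field r A).
Proof. apply: (pfield_field (X := vac_vla L)); [exact: (as_field bg) | exact: (as_field0 bg)]. Qed.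

Lemma vR_mode k a n (A : vac_vla L) : RV k (vact (mode a n) A) = (w ^+ k) ^ (- n - 1) *: vact (mode (R k a) n) (RV k A).
Proof.
rewrite (vac_vla_vR hL hw hS) (LA_mode (zaut_vR hL k hS w0)); exact: (linZ (vm_linx hV _)).
Qed.

Lemma big_field_lin r n t : linear (fun A => big_field r A n t).
Proof.
case: r => [[i k]|] c A B /=.
  apply: (mop_lincomb (i := Some i) (M := factor M M0)).
  - by apply: lin_scale; exact: (as_field bg i _).1.
  - by apply: lin_scale; exact: (as_field bg i _).1.
  - move=> v; rewrite (vR_linear gV w k c A B) (stm_linA (YM_map hL hS hm i) n v c).
    by rewrite scalerDr !scalerA mulrC.
apply: (mop_lincomb (i := None) (M := factor M M0)).
- exact: (as_field0 bg _).1.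
- exact: (as_field0 bg _).1.
- by move=> v; exact: (stm_linA (YW_map hL hw hS hm0) n v c).
Qed.

Lemma small_big_field r a n t : big_field r (vact (mode a (-1)) (vacuum L)) n t = small_field r a n t.
Proof.
case: r => [[i k]|] /=.
  congr (mtensor_op _ t); apply/funext => v; congr (_ *: _).
  rewrite vR_mode scale1r (vR_c gV) (stm_m1 (prim1 (K := K)) (smooth_twisted hL hX (hm i)) (YM_map hL hS hm i)) //.
congr (mtensor_op _ t); apply/funext => v.
by rewrite (stm_m1 hw (smoothG_twisted hL hw hS hm0) (YW_map hL hw hS hm0)).
Qed.

Lemma vac_field r n t : big_field r (vacuum L) n t = if n == -1 then t else 0.
Proof.
case: r => [[i k]|] /=.
  case: eqP => [->|/eqP n1].
    rewrite -[RHS](mop_id (M := factor M M0) (Some i)); congr (mtensor_op _ t); apply/funext => v.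
    by rewrite scale1r (vR_c gV) (as_c bg).
  rewrite -[RHS](mop_zero (M := factor M M0) (Some i) t); congr (mtensor_op _ t); apply/funext => v.
  by rewrite (vR_c gV) (as_c bg) (negbTE n1) scaler0.
case: eqP => [->|/eqP n1].
  rewrite -[RHS](mop_id (M := factor M M0) None); congr (mtensor_op _ t); apply/funext => v.
  by rewrite (stm_v0 (YW_map hL hw hS hm0)).
rewrite -[RHS](mop_zero (M := factor M M0) None t); congr (mtensor_op _ t); apply/funext => v.
by rewrite (stm_v0 (YW_map hL hw hS hm0)) /idf (negbTE n1).
Qed.

Lemma pcoord_pole r : pc r \in P.
Proof.
case: r => [[i k]|]; last exact: poles0.
by rewrite /=; have [j ->] := prim_inv hw k; exact: poles_z.
Qed.

(** The vacuum has the identity field at every point, so Omega is the sum of all residues of f, and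
    the residue theorem moves it to infinity. *)
Lemma omega_vac f t : big_omega (vacuum L) f t = ico (expinf (rval f)) 1 *: t.
Proof.
have E r : \sum_(n \in [set: int]) ico (expz (pc r) (rval f)) n *: big_field r (vacuum L) n t
  = ico (expz (pc r) (rval f)) (-1) *: t.
  rewrite (fsum_only (j := -1)) => [|n /negbTE n1]; first by rewrite vac_field eqxx.
  by rewrite vac_field n1 scaler0.
rewrite /omega (eq_bigr _ (fun r _ => E r)) -scaler_suml; congr (_ *: _).
rewrite -(residues (S := P) (r := [seq pc r | r <- index_enum pt])) ?rval_in //.
- by rewrite big_map.
- by rewrite map_inj_uniq ?index_enum_uniq //; exact: (pcoord_inj hw z0 zd).
- apply: poles_ind => [|k i]; apply/mapP; first by exists None; rewrite ?mem_index_enum.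
  have [j hj] := prim_inv hw k; exists (Some (i, Ordinal (ltn_pmod j T0))); first by rewrite mem_index_enum.
  by rewrite /= (prim_expr_mod hw) -hj invrK.
Qed.

Definition shift_point (k : nat) (r : pt) : pt :=
  if r is Some (i, l) then Some (i, Ordinal (ltn_pmod (l + k) T0)) else None.

Lemma shift_ne r k : r != None -> (0 < k < T)%N -> shift_point k r != r.
Proof.
case: r => [[i l]|] // _ /andP[k0 kT]; apply/eqP => -[] /(congr1 (@nat_of_ord _)) /= e.
have /eqP : (l + k = l + 0 %[mod T])%N by rewrite e addn0 (modn_small (ltn_ord l)).
by rewrite eqn_modDl mod0n modn_small // => /eqP k0'; rewrite k0' in k0.
Qed.

Lemma shift_coord r k : r != None -> (0 < k < T)%N -> pc (shift_point k r) = pc r / w ^+ k.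
Proof.
case: r => [[i l]|] // _ _; rewrite /= (prim_expr_mod hw) exprD invfM mulrAC //.
Qed.

Lemma subspace_fsum (V : lmodType K) (S : set V) (J : choiceType) (G : J -> V) : subspace S ->
  (forall j, S (G j)) -> S (\sum_(j \in [set: J]) G j).
Proof.
move=> hS' h; apply: (subspace_lspan hS' (S := S)) => //.
by apply: lspan_fsum => j; exact: lspan_incl.
Qed.

Definition rpole_mul (f : rinf P) s q : rinf P := mkrinf P (rval f * rpw s q.+1).

Lemma rpole_mulE f r q : rval (rpole_mul f (pc r) q) = rval f * rpw (pc r) q.+1.
Proof. by rewrite /rpole_mul mkrinfE // rinfM ?rval_in //; apply: rpw_in; exact: pcoord_pole. Qed.

Lemma YM_normal i a B m v : YM (@act i) (vact (mode a (-1)) B) m v =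
  \sum_(p \in [set: nat]) @act i (mode a (- p.+1%:Z)) (YM (@act i) B (m + p%:Z) v) +
  \sum_(p \in [set: nat]) YM (@act i) B (m - p.+1%:Z) (@act i (mode a p%:Z) v).
Proof.
have e := stm_normal (prim1 (K := K)) (smooth_twisted hL hX (hm i)) (YM_map hL hS hm i) a B m v.
apply: (etrans e); rewrite [X in _ + _ + X]big_pred0 ?addr0 // => k; by rewrite (ord1 k).
Qed.

Lemma YW_normal a B m v : YW T w act0 (vact (mode a (-1)) B) m v =
  \sum_(p \in [set: nat]) act0 (modeG T w a (- p.+1%:Z)) (YW T w act0 B (m + p%:Z) v) +
  \sum_(p \in [set: nat]) YW T w act0 B (m - p.+1%:Z) (act0 (modeG T w a p%:Z) v) +
  \sum_(k < T | (0 < k)%N) \sum_(j \in [set: nat])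
       ((w ^+ k - 1) ^+ j.+1)^-1 *: YW T w act0 (vact (mode (R k a) j%:Z) B) (m - j.+1%:Z) v.
Proof.
exact: (stm_normal hw (smoothG_twisted hL hw hS hm0) (YW_map hL hw hS hm0) a B m v).
Qed.

(** At w^(-l) z_i this is the recursion of Y_M for R_(w^l) a and R_(w^l) B. The rescaling by
    w^(l(-n-1)) is compatible with it because the two mode indices always add up to m - 1. At the
    origin it is the recursion of Y_W. *)
Lemma F1_small r a B m t : big_field r (vact (mode a (-1)) B) m t =
   \sum_(p \in [set: nat]) small_field r a (- p.+1%:Z) (big_field r B (m + p%:Z) t) +
   \sum_(p \in [set: nat]) big_field r B (m - p.+1%:Z) (small_field r a p%:Z t) +
   (if r == None then \sum_(k < T | (0 < k)%N) \sum_(j \in [set: nat])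
       ((w ^+ k - 1) ^+ j.+1)^-1 *: big_field r (vact (mode (R k a) j%:Z) B) (m - j.+1%:Z) t else 0).
Proof.
case: r => [[i l]|] /=.
  rewrite addr0; have c0 : w ^+ l != 0 by rewrite expf_neq0.
  pose f (n : int) (v : M i) := (w ^+ l) ^ (- n - 1) *: @act i (mode (R l a) n) v.
  pose g (n : int) (v : M i) := (w ^+ l) ^ (- n - 1) *: YM (@act i) (RV l B) n v.
  have af := as_field sm i (R l a); have bf := as_field bg i (RV l B).
  have hf : is_field f.
    have [h1 h2] := af; split=> [n|v]; first exact: lin_scale (h1 n).
    by have [d hd] := h2 v; exists d => n /hd e; rewrite /f e scaler0.
  have hg : is_field g.
    have [h1 h2] := bf; split=> [n|v]; first exact: lin_scale (h1 n).
    by have [d hd] := h2 v; exists d => n /hd e; rewrite /g e scaler0.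
  have := mop_normal_prod (I := option 'I_N) (F := factor M M0) (i := Some i) (f := f) (g := g) (e := fun _ => 0)
    (h := fun v => (w ^+ l) ^ (- m - 1) *: YM (@act i) (RV l (vact (mode a (-1)) B)) m v) (m := m) t hf hg (@lin_cst0 _ _ _).
  rewrite mop_zero addr0; apply => v; rewrite addr0.
  have cE n1 n2 : n1 + n2 = m - 1 -> (w ^+ l) ^ (- m - 1) = (w ^+ l) ^ (- n1 - 1) * (w ^+ l) ^ (- n2 - 1).
    by move=> e; rewrite -expfzDr //; congr (_ ^ _); lia.
  rewrite vR_mode scale1r YM_normal scalerDr !scaler_fsum; last first.
  - have [d hd] := bf.2 v; apply: (fins_nat (b := `|d - m|%N)) => p hp.
    by rewrite hd ?(lin0 (af.1 _)) //; lia.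
  - have [d hd] := af.2 v; apply: (fins_nat (b := `|d|%N)) => p hp.
    by rewrite hd ?(lin0 (bf.1 _)) //; lia.
  congr (_ + _); apply: eq_fsum => p; rewrite /f /g.
    by rewrite (linZ (af.1 _)) scalerA -cE //; lia.
  by rewrite (linZ (bf.1 _)) scalerA -cE //; lia.
have af := as_field0 sm a; have bf := as_field0 bg B.
pose G (k j : nat) (v : M0) := ((w ^+ k - 1) ^+ j.+1)^-1 *: YW T w act0 (vact (mode (R k a) j%:Z) B) (m - j.+1%:Z) v.
have Gl k j : linear (G k j) by apply: lin_scale; exact: (as_field0 bg _).1.
have G0 k : exists d, forall j, (d <= j)%N -> forall v, G k j v = 0.
  have [d hd] := va_modes_trunc hL hV (R k a) B; exists `|d|%N => j dj v.
  by rewrite /G hd ?(lin0 (stm_linA (YW_map hL hw hS hm0) _ v)) ?scaler0 //; lia.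
pose E k v := \sum_(j \in [set: nat]) G k j v.
have El k : linear (E k).
  by apply: lin_bigfsum => // v; have [d hd] := G0 k; apply: (fins_nat (b := d)) => j dj; exact: hd.
pose e v := \sum_(k < T) (if (0 < k)%N then E k v else 0).
have el : linear e.
  by apply: lin_bigsum => k; case: (0 < k)%N; [exact: El | exact: lin_cst0].
have := mop_normal_prod (I := option 'I_N) (F := factor M M0) (i := None) (f := fun n v => act0 (modeG T w a n) v)
  (g := fun n v => YW T w act0 B n v) (e := e) (h := fun v => YW T w act0 (vact (mode a (-1)) B) m v) (m := m) t af bf el.
move=> -> => [|v]; last by rewrite YW_normal /e -big_mkcond.
congr (_ + _); rewrite (mop_sum (i := None) (s := index_enum 'I_T) (G := fun (k : 'I_T) v => if (0 < k)%N then E k v else 0)) //; last first.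
  by move=> k; case: (0 < k)%N; [exact: El | exact: lin_cst0].
rewrite [RHS]big_mkcond; apply: eq_bigr => k _; case: ifP => _; last exact: mop_zero.
have [d hd] := G0 k.
rewrite (mfield_fsum (I := option 'I_N) (M := factor M M0) (i := None) (F := G k)) //.
- apply: eq_fsum => j; rewrite /G; apply: (mop_scale (i := None)); exact: (as_field0 bg _).1.
- by move=> v; apply: (fins_nat (b := d)) => j dj; exact: hd.
- move=> t'; apply: (fins_nat (b := d)) => j dj.
  rewrite -(mop_zero (M := factor M M0) None t'); congr (mtensor_op _ t'); apply/funext => v; exact: hd.
Qed.

End Induction.

Section MainInduction.
Context {K : numFieldType} {L : vla K} (hL : vertex_lie_algebra L) {T : nat} {w : K}
  (hw : T.-primitive_root w) (hS : vla_automorphism L T).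
Context {N : nat} {z : 'I_N -> K} (z0 : forall i, z i != 0)
  (zd : forall i j k l, i != j -> w ^+ k * z i != w ^+ l * z j).
Context {M : 'I_N -> lmodType K} {M0 : lmodType K}.
Context {act : forall i, loop L -> M i -> M i} {act0 : loop L -> M0 -> M0}.
Context (hm : forall i, smooth_module (@act i)) (hm0 : smooth_moduleG T w act0).
Let hX := vla_graded_vla hL hS.
Let hV := vacm_vacuum (L := L).
Let gV := vac_vla_graded hL hS.
Let T0 : (0 < T)%N := prim_order_gt0 hw.
Let w0 : w != 0 := prim_neq0 hw.
Local Notation P := (poles T w z).
Local Notation W := (mtensor (factor M M0)).
Local Notation R k := (@vR _ L w k).
Local Notation RV k := (@vR _ (vac_vla L) w k).
Local Notation small_field := (@pfield K L T w N M M0 (fun i a n v => @act i (mode a n) v) (fun a n v => act0 (modeG T w a n) v)).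
Local Notation big_field := (@pfield K (vac_vla L) T w N M M0 (fun i A n v => YM (@act i) A n v) (fun A n v => YW T w act0 A n v)).
Local Notation small_omega := (@omega K L T w N z M M0 (fun i a n v => @act i (mode a n) v) (fun a n v => act0 (modeG T w a n) v)).
Local Notation big_omega := (@omega K (vac_vla L) T w N z M M0 (fun i A n v => YM (@act i) A n v) (fun A n v => YW T w act0 A n v)).
Let sm := small_system hL hw hS hm hm0.
Let bg := big_system hL hw hS hm hm0.
Local Notation pc := (@pcoord K T w N z).
Local Notation pt := (@gpoint T N).

Local Notation shift_point := (@shift_point K T w hw N).
Let smallf := @smallf K L hL T w hw hS N M M0 act act0 hm hm0.
Let bigf := @bigf K L hL T w hw hS N M M0 act act0 hm hm0.
Let vR_mode := @vR_mode K L hL T w hw hS.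

Lemma YM_commutator i a B (q : nat) m v :
  @act i (mode a q%:Z) (YM (@act i) B m v) - YM (@act i) B m (@act i (mode a q%:Z) v) =
  \sum_(j < q.+1) 'C(q, j)%:R *: YM (@act i) (vact (mode a j%:Z) B) (m + q%:Z - j%:Z) v.
Proof.
have tw := smooth_twisted hL hX (hm i); have hY := YM_map hL hS hm i.
apply: (etrans (loc1_comm tw a q m v (stm_smooth hY B))); apply: eq_bigr => j _; congr (_ *: _).
by have /esym := stm_mode (prim1 (K := K)) tw hY a j%:Z B => ->.
Qed.

(** Operators on different tensor factors commute, so only two points of one orbit interact, both
    acting on M_(z_i). There the commutator of Y_M applies to R_(w^l') a and R_(w^l) B, and R_(w^l')
    = R_(w^l) R_(w^k) expresses the result through states at r. *)
Lemma F2_small r s a (B : vac_vla L) (q : nat) m t : s != r ->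
  small_field s a q%:Z (big_field r B m t) - big_field r B m (small_field s a q%:Z t) =
  (if r == None then 0 else \sum_(k < T | (0 < k)%N) if s == shift_point k r then
      \sum_(j < q.+1) ('C(q, j)%:R * ((w ^+ k) ^+ q.+1)^-1) *: big_field r (vact (mode (R k a) j%:Z) B) (m + q%:Z - j%:Z) t else 0).
Proof.
have ls i k n : linear (fun v : M i => (w ^+ k) ^ (- n - 1) *: @act i (mode (R k a) n) v).
  by apply: lin_scale; exact: (as_field sm _ _).1.
have lb i k n (C : vac_vla L) : linear (fun v : M i => (w ^+ k) ^ (- n - 1) *: YM (@act i) (RV k C) n v).
  by apply: lin_scale; exact: (as_field bg _ _).1.
have ls0 n : linear (fun v : M0 => act0 (modeG T w a n) v) by exact: (as_field0 sm a).1.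
have lb0 n : linear (fun v : M0 => YW T w act0 B n v) by exact: (as_field0 bg B).1.
case: r => [[i l]|]; last first.
  case: s => [[i k]|] // _ /=; apply/eqP; rewrite subr_eq0; apply/eqP.
  exact: (mop_comm (i := Some i) (j := None) t (ls i k q%:Z) (lb0 m)).
case: s => [[i' l']|]; last first.
  move=> _ /=; rewrite big1 // [LHS](_ : _ = 0) //; apply/eqP; rewrite subr_eq0; apply/eqP.
  exact: (mop_comm (i := None) (j := Some i) t (ls0 q%:Z) (lb i l m B)).
case: (eqVneq i' i) => [e|ii] sr; last first.
  rewrite [LHS](_ : _ = 0); last first.
    apply/eqP; rewrite subr_eq0; apply/eqP.
    apply: (mop_comm (i := Some i') (j := Some i) t (ls i' l' q%:Z) (lb i l m B)).
    by rewrite eq_sym; apply: contra ii => /eqP [->].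
  rewrite big1 // => k _; case: eqP => // -[e _]; by rewrite e eqxx in ii.
subst i'; have ll : l' != l by apply: contra sr => /eqP ->.
(* The rotation k0 taking r to s, with l + k0 = l' modulo T; it is nonzero because s differs from
   r. *)
have k0T : ((l' + (T - l)) %% T < T)%N by rewrite ltn_pmod.
pose k0 : 'I_T := Ordinal k0T.
have k0E : ((l + k0) %% T = l')%N.
  rewrite /= modnDmr addnCA subnKC ?modnDr ?modn_small //; exact: ltnW.
have k00 : (0 < k0)%N.
  rewrite lt0n; apply: contra ll => /eqP e; apply/eqP/val_inj => /=.
  by rewrite -k0E e addn0 modn_small.
have sE (k : 'I_T) : (Some (i, l') == shift_point k (Some (i, l))) = (k == k0).
  apply/eqP/eqP => [[/(congr1 (@nat_of_ord _)) /= e]|->]; last first.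
    by congr (Some (_, _)); apply: val_inj; rewrite /= -[LHS]k0E.
  apply: val_inj; have /eqP : (l + k = l + k0 %[mod T])%N by rewrite -e k0E.
  by rewrite eqn_modDl => /eqP; rewrite !modn_small.
have -> : (Some (i, l) == None :> pt) = false by [].
pose G (k : 'I_T) : W := \sum_(j < q.+1) ('C(q, j)%:R * ((w ^+ k) ^+ q.+1)^-1) *:
  big_field (Some (i, l)) (vact (mode (R k a) j%:Z) B) (m + q%:Z - j%:Z) t.
transitivity (G k0); last first.
  rewrite -(sum_only G (a := k0) (Q := fun k : 'I_T => (0 < k)%N)) //.
  by apply: eq_bigr => k _; rewrite -sE.
rewrite /G {G}.
have Rl b : R l (R k0 b) = R l' b by rewrite vR_comp // -k0E (vR_mod hL hw hS).
have c0 : w ^+ l != 0 by rewrite expf_neq0.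
have wl : w ^+ l' = w ^+ l * w ^+ k0 by rewrite -exprD -k0E (prim_expr_mod hw).
pose h (j : nat) (v : M i) := (w ^+ l) ^ (- (m + q%:Z - j%:Z) - 1) *: YM (@act i) (RV l (vact (mode (R k0 a) j%:Z) B)) (m + q%:Z - j%:Z) v.
pose e (v : M i) := \sum_(j < q.+1) ('C(q, j)%:R * ((w ^+ k0) ^+ q.+1)^-1) *: h j v.
have hl j : linear (h j) by exact: lb.
have el : linear e by apply: lin_bigsum => j; exact: lin_scale.
rewrite (mop_commutator (I := option 'I_N) (F := factor M M0) (i := Some i) (e := e) t (ls i l' q%:Z) (lb i l m B) el) => [|v].
  rewrite (mop_sum (i := Some i) (s := index_enum 'I_q.+1) (G := fun (j : 'I_q.+1) v => ('C(q, j)%:R * ((w ^+ k0) ^+ q.+1)^-1) *: h j v)) //.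
    apply: eq_bigr => j _; exact: (mop_scale (i := Some i)).
  by move=> j; exact: lin_scale.
have yl := (as_field sm i (R l' a)).1; have Yl := (as_field bg i (RV l B)).1.
rewrite (linZ (yl q%:Z)) (linZ (Yl m)) !scalerA [X in _ - X *: _]mulrC -scalerBr.
transitivity (((w ^+ l') ^ (- q%:Z - 1) * (w ^+ l) ^ (- m - 1)) *: (\sum_(j < q.+1) 'C(q, j)%:R *: YM (@act i) (vact (mode (R l' a) j%:Z) (RV l B)) (m + q%:Z - j%:Z) v)).
  by congr (_ *: _); exact: YM_commutator.
rewrite scaler_sumr /e; apply: eq_bigr => j _.
rewrite /h vR_mode Rl (linZ (stm_linA (YM_map hL hS hm i) _ v)) !scalerA; congr (_ *: _).
have -> : (w ^+ l') ^ (- q%:Z - 1) = (w ^+ l) ^ (- q%:Z - 1) * ((w ^+ k0) ^+ q.+1)^-1.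
  by rewrite wl expfzMl; congr (_ * _); rewrite exprnN; congr (_ ^ _); lia.
have -> : (w ^+ l) ^ (- (m + q%:Z - j%:Z) - 1) = (w ^+ l) ^ (- q%:Z - 1) * (w ^+ l) ^ (- m - 1) / (w ^+ l) ^ (- j%:Z - 1).
  apply: (mulIf (x := (w ^+ l) ^ (- j%:Z - 1))); first by rewrite expfz_neq0.
  by rewrite mulfVK ?expfz_neq0 // -!expfzDr //; congr (_ ^ _); lia.
have := expfz_neq0 (- j%:Z - 1) c0.
move: ((w ^+ l) ^ (- q%:Z - 1)) ((w ^+ l) ^ (- m - 1)) ((w ^+ l) ^ (- j%:Z - 1)) (((w ^+ k0) ^+ q.+1)^-1) ('C(q, j)%:R) => x1 x2 x3 x4 x5 x30.
by field.
Qed.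

Lemma rpole_mul_van (f : rinf P) r q : ico (expinf (rval (rpole_mul f (pc r) q))) 1 = 0.
Proof.
rewrite (rpole_mulE hw) rmorphM /=.
have h := ordgeM (rinf_ordge (rval_in f)) (@ordge_expinf_rpw K (pc r) q.+1).
by apply: (h 1); lia.
Qed.

Lemma pair_omega (f : rinf P) r s q (B : vac_vla L) t :
  pair (expz (pc r) (rval f) * expz (pc r) (rpw (pc s) q.+1)) (big_field r B) 0 t =
  \sum_(n \in [set: int]) ico (expz (pc r) (rval (rpole_mul f (pc s) q))) n *: big_field r B n t.
Proof. by rewrite (rpole_mulE hw) rmorphM /pair; apply: eq_fsum => n; rewrite addr0. Qed.

Lemma psi_bound a (B : vac_vla L) : exists J, forall (s : pt) k j, (k < T)%N -> (J <= j)%N ->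
  forall m t, big_field s (vact (mode (R k a) j%:Z) B) m t = 0.
Proof.
have ex k : exists d : nat, forall j, (d <= j)%N -> vact (mode (R k a) j%:Z) B = 0.
  by have [d hd] := va_modes_trunc hL hV (R k a) B; exists `|d|%N => j dj; apply: hd; lia.
have [d hd] := choice ex; exists (\max_(k < T) d k) => s k j kT Jj m t.
rewrite hd; first exact: (lin0 (big_field_lin hL hw hS hm hm0 s m t)).
apply: leq_trans Jj; exact: (leq_bigmax (Ordinal kT) (F := fun k : 'I_T => d k)).
Qed.

Section Step.
Context (S : set W) (Ssub : subspace S) (a : L) (ha : forall f t, S (small_omega a f t)) (B : vac_vla L).
Context (hB : forall f t, ico (expinf (rval f)) 1 = 0 -> S (big_omega B f t))
  (hR : forall k (j : nat) f t, ico (expinf (rval f)) 1 = 0 -> S (big_omega (vact (mode (R k a) j%:Z) B) f t)).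

Lemma omega_step_at (f : rinf P) t r : S (\sum_(n \in [set: int]) ico (expz (pc r) (rval f)) n *: big_field r (vact (mode a (-1)) B) n t
   - \sum_s \sum_(q \in [set: nat]) pair (expz (pc r) (rval f) * expz (pc r) (rpw (pc s) q.+1)) (big_field r B) 0 (small_field s a q%:Z t)
   - \sum_(k < T | (0 < k)%N) \sum_(j \in [set: nat])
       ((w ^+ k - 1) ^+ j.+1)^-1 *: pair (expz (pc r) (rval f) * expz (pc r) (rpw 0 j.+1)) (big_field r (vact (mode (R k a) j%:Z) B)) 0 t).
Proof.
apply: (main_step w0 _ (r0 := None) (c := pc) _ _ (sh := shift_point) _ _ (y := fun r n => small_field r a n) (phi := fun r n => big_field r B n)
  (chi := fun r n => big_field r (vact (mode a (-1)) B) n) (psi := fun r k j n => big_field r (vact (mode (R k a) j%:Z) B) n) _ _ _ _ Ssub).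
- by move=> k kT; exact: (prim_lt_neq1 hw kT).
- exact: (pcoord_inj hw z0 zd).
- by [].
- by move=> r' k; exact: shift_ne.
- by move=> r' k; exact: shift_coord.
- by move=> s; exact: smallf.
- by move=> s; exact: bigf.
- by move=> s k j; exact: bigf.
- exact: psi_bound.
- move=> r' p t'; have := ha (mkrinf P (rpw (pc r') p.+1)) t'; rewrite /omega mkrinfE //.
  by apply: rpw_in; exact: pcoord_pole.
- by move=> r' m t'; exact: (F1_small hL hw hS hm hm0).
- by move=> r' s q m t' sr; exact: F2_small.
Qed.

(** Summing over r makes the subtracted families values of Omega at f/(t - c s)^(q+1) and at
    f/t^(j+1). Since f already vanishes at infinity, these have no 1/t term there, so the hypotheses
    on the shorter states apply. *)
Lemma omega_step (f : rinf P) t : S (big_omega (vact (mode a (-1)) B) f t).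
Proof.
have : S (\sum_r (\sum_(n \in [set: int]) ico (expz (pc r) (rval f)) n *: big_field r (vact (mode a (-1)) B) n t
   - \sum_s \sum_(q \in [set: nat]) pair (expz (pc r) (rval f) * expz (pc r) (rpw (pc s) q.+1)) (big_field r B) 0 (small_field s a q%:Z t)
   - \sum_(k < T | (0 < k)%N) \sum_(j \in [set: nat])
       ((w ^+ k - 1) ^+ j.+1)^-1 *: pair (expz (pc r) (rval f) * expz (pc r) (rpw 0 j.+1)) (big_field r (vact (mode (R k a) j%:Z) B)) 0 t)).
  by apply: (@subspace_sum K _ S) => // r _; exact: omega_step_at.
rewrite !sumrB; set U := big_omega _ _ _; rewrite -[X in S (X - _ - _)]/U.
have [S0 SD] := Ssub.
have SB x y : S x -> S y -> S (x + y) by move=> hx hy; have := SD 1 x y hx hy; rewrite scale1r.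
set V := (X in S (_ - X - _)); set Z := (X in S (_ - _ - X)) => hUVZ.
suff [hV' hZ] : S V /\ S Z by have := SB _ _ (SB _ _ hUVZ hZ) hV'; rewrite subrK subrK.
split.
  have -> : V = \sum_s \sum_(q \in [set: nat]) big_omega B (rpole_mul f (pc s) q) (small_field s a q%:Z t).
    rewrite /V exchange_big /=; apply: eq_bigr => s _.
    have fq r : fins (fun q : nat => pair (expz (pc r) (rval f) * expz (pc r) (rpw (pc s) q.+1)) (big_field r B) 0 (small_field s a q%:Z t)).
      have [d hd] := (smallf s a).2 t; apply: (fins_nat (b := `|d|%N)) => q dq.
      rewrite hd; last lia.
      by apply: fsum0 => n; rewrite (lin0 ((bigf r B).1 _)) scaler0.
    rewrite -(fsum_sum _ _ fq); apply: eq_fsum => q; apply: eq_bigr => r _; exact: pair_omega.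
  apply: (@subspace_sum K _ S) => // s _; apply: subspace_fsum => // q; apply: hB; exact: rpole_mul_van.
have -> : Z = \sum_(k < T | (0 < k)%N) \sum_(j \in [set: nat]) ((w ^+ k - 1) ^+ j.+1)^-1 *:
    big_omega (vact (mode (R k a) j%:Z) B) (rpole_mul f (pc None) j) t.
  rewrite /Z exchange_big /=; apply: eq_bigr => k _.
  have [J hJ] := psi_bound a B.
  have fj r : fins (fun j : nat => ((w ^+ k - 1) ^+ j.+1)^-1 *: pair (expz (pc r) (rval f) * expz (pc r) (rpw 0 j.+1)) (big_field r (vact (mode (R k a) j%:Z) B)) 0 t).
    apply: (fins_nat (b := J)) => j Jj; rewrite (_ : pair _ _ _ _ = 0) ?scaler0 //.
    by apply: fsum0 => n; rewrite hJ ?scaler0 //; exact: ltn_ord.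
  apply: (etrans (esym (fsum_sum _ _ fj))); apply: eq_fsum => j.
  apply: (etrans (esym (scaler_sumr _ _ _ _))).
  apply: (congr1 (fun x : W => ((w ^+ k - 1) ^+ j.+1)^-1 *: x)); rewrite /omega.
  apply: eq_bigr => r _; exact (pair_omega f r None j (vact (mode (R k a) j%:Z) B) t).
apply: (@subspace_sum K _ S) => // k _; apply: subspace_fsum => // j.
by have := SD ((w ^+ k - 1) ^+ j.+1)^-1 _ 0 (hR k j t (rpole_mul_van f None j)) S0; rewrite addr0.
Qed.

End Step.

Section FiltrationInduction.
Context (S : set W) (Ssub : subspace S) (Lo : set L) (hLo : forall a f t, Lo a -> S (small_omega a f t))
  (gLo : generates Lo).

Lemma SZ c x : S x -> S (c *: x).
Proof. by move=> hx; have := Ssub.2 c x 0 hx Ssub.1; rewrite addr0. Qed.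

Lemma small_iter_D k a f t : Lo a -> S (small_omega (iter k (@vD _ L) a) f t).
Proof.
move=> ha; elim: k f => [|k IH] f; first exact: hLo.
rewrite iterS (omega_D hX hw (vsigma_order hS) sm) -scaleN1r; exact: SZ.
Qed.

Lemma big_omega_lin f t : linear (fun A : vac_vla L => big_omega A f t).
Proof. exact: (omega_lina gV hw (vac_vla_order hL hS) bg). Qed.

(** The induction is asymmetric: from functions without a 1/t term at infinity for states of length
    at most j it passes to all f for words of length j + 1. The condition at infinity originates in
    the vacuum, and nonempty words are free of it. *)
Lemma word_omega j A : (forall B, neg_filt (va := vact (L := L)) (v0 := vacuum L) Lo j B ->
    forall f t, ico (expinf (rval f)) 1 = 0 -> S (big_omega B f t)) ->
  neg_word (va := vact (L := L)) (v0 := vacuum L) Lo j.+1 A -> forall f t, S (big_omega A f t).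
Proof.
move=> IH h f t; inversion h as [|j' n a C Sa hC]; subst.
have hC' : neg_filt (va := vact (L := L)) (v0 := vacuum L) Lo j C.
  by apply: lspan_incl; exists j.
have -> : vact (mode a (- n.+1%:Z)) C = (n`!%:R)^-1 *: vact (mode (iter n (@vD _ L) a) (-1)) C.
  have e := mode_iter_D (L := L) hw a n 0; rewrite fact0 scale1r add0n in e.
  rewrite e (linZ (vm_linx hV C)) scalerA mulVf ?scale1r // pnatr_eq0 -lt0n; exact: fact_gt0.
rewrite (linZ (big_omega_lin f t)); apply: SZ.
apply: (omega_step (S := S)) => //.
- by move=> f' t'; exact: small_iter_D.
- by move=> f' t'; exact: IH.
- by move=> k i f' t'; apply: IH; exact: (neg_filt_mode hL hV gLo).
Qed.

Lemma filt_omega j A : neg_filt (va := vact (L := L)) (v0 := vacuum L) Lo j A ->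
  forall f t, ico (expinf (rval f)) 1 = 0 -> S (big_omega A f t).
Proof.
elim: j A => [|j IH] A hA f t hf;
  apply: (subspace_lspan (P := [set A | S (big_omega A f t)]) _ _ hA); try exact: (subspace_preim (big_omega_lin f t) Ssub).
  move=> B [i [i0 hB]]; move: i0; rewrite leqn0 => /eqP e; rewrite e in hB; have -> : B = vacuum L by inversion hB.
  by rewrite /= (omega_vac hL hw hS z0 zd hm hm0) hf scale0r; exact: Ssub.1.
move=> B [i [ij hB]]; case: (ltnP i j.+1) => [ij'|ji].
  by apply: IH => //; apply: lspan_incl; exists i.
have e : i = j.+1 by apply/eqP; rewrite eqn_leq ij ji.
by rewrite e in hB; exact: (word_omega IH hB).
Qed.

Lemma pos_omega A f t : lspan (vac_pos Lo) A -> S (big_omega A f t).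
Proof.
apply: (subspace_lspan (P := [set A | S (big_omega A f t)])); first exact: (subspace_preim (big_omega_lin f t) Ssub).
move=> B hB; suff [j hj] : exists j, neg_word (va := vact (L := L)) (v0 := vacuum L) Lo j.+1 B.
  by apply: (word_omega _ hj) => C hC; exact: filt_omega hC.
elim: hB => [n a ha|n a C ha _ [j hj]].
  by exists 0%N; apply: neg_wordS => //; exact: neg_word0.
by exists j.+1; apply: neg_wordS.
Qed.

End FiltrationInduction.

End MainInduction.

Lemma vR_stable (K : numFieldType) (X : vla K) (hX : graded_vla X) (S : set X) (w : K) k a :
  subspace S -> vla_graded S -> (forall a, S a -> S (vsigma a)) -> S a -> S (vR w k a).
Proof.
move=> sS gS iS Sa; have [h [ha Sh]] := gS a Sa.
have Sk b j : S b -> S (iter j (@vsigma _ X) b) by move=> Sb; elim: j => //= j IH; exact: iS.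
apply: subspace_fsum => // n; rewrite (vcomp_eq hX ha).
by have := sS.2 (w ^+ (k * n)) _ 0 (Sk _ k (Sh n)) sS.1; rewrite addr0.
Qed.

(** * Quotients by two sets with the same span *)

Section SameSpan.
Context {K : numFieldType} {V : lmodType K} (A B : set V).
Context (AB : A `<=` lspan B).

Definition quot_change (q : quot A) : quot B := qpi B (repr q).

Lemma quot_changeE x : quot_change (qpi A x) = qpi B x.
Proof. by apply/qpiP; apply: (lspan_sub AB); apply/qpiP; rewrite qpiK. Qed.

Lemma quot_change_linear : linear quot_change.
Proof.
move=> c p q; rewrite -(qpiK p) -(qpiK q).
rewrite -[c *: qpi A _ + _](@qpi_linear K V A c) !quot_changeE; exact: (@qpi_linear K V B).
Qed.

End SameSpan.

Lemma quot_same_span (K : numFieldType) (V : lmodType K) (A B : set V) :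
  A `<=` lspan B -> B `<=` lspan A -> exists f : {linear quot A -> quot B}, bijective f.
Proof.
move=> AB BA.
pose m := GRing.isLinear.Build K (quot A) (quot B) *:%R (@quot_change _ _ A B) (quot_change_linear AB).
pose f : {linear quot A -> quot B} := HB.pack (@quot_change _ _ A B) m.
exists f; exists (@quot_change _ _ B A) => q.
  by rewrite -(qpiK q) [f _](quot_changeE AB) (quot_changeE BA).
by rewrite -(qpiK q) (quot_changeE BA) [f _](quot_changeE AB).
Qed.

(** * Comparison of the two spaces of coinvariants *)

Section Coinvariants.
Context {K : numFieldType} {L : vla K} (hL : vertex_lie_algebra L) {T : nat} {w : K}
  (hw : T.-primitive_root w) (hS : vla_automorphism L T).
Context {N : nat} {z : 'I_N -> K} (z0 : forall i, z i != 0)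
  (zd : forall i j k l, i != j -> w ^+ k * z i != w ^+ l * z j).
Context {M : 'I_N -> lmodType K} {M0 : lmodType K}.
Context {act : forall i, loop L -> M i -> M i} {act0 : loop L -> M0 -> M0}.
Context (hm : forall i, smooth_module (@act i)) (hm0 : smooth_moduleG T w act0).
Context {Lo : set L} {Vo : set (vac_vla L) } (hC : vla_complement Lo) (gC : vla_graded Lo)
  (iC : forall a, Lo a -> Lo (vsigma a)) (cV : vla_complement Vo) (gVo : vla_graded Vo)
  (sV : Vo `<=` lspan (vac_pos Lo)).
Let hX := vla_graded_vla hL hS.
Let gV := vac_vla_graded hL hS.
Let sm := small_system hL hw hS hm hm0.
Let bg := big_system hL hw hS hm hm0.
Local Notation W := (mtensor (factor M M0)).
Local Notation small_omega := (@omega K L T w N z M M0 (fun i a n v => @act i (mode a n) v) (fun a n v => act0 (modeG T w a n) v)).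
Local Notation big_omega := (@omega K (vac_vla L) T w N z M M0 (fun i A n v => YM (@act i) A n v) (fun A n v => YW T w act0 A n v)).

Definition small_span : set W := [set s | exists q t, @globG K L Lo T w N z q /\ s = glob_act (@act) act0 q t].
Definition big_span : set W := [set s | exists q t, @globG K (vac_vla L) Vo T w N z q /\
  s = glob_act (fun i => big_act (@act i)) (big_actG T w act0) q t].

Lemma small_omega_span a f t : Lo a -> small_span (small_omega a f t).
Proof.
move=> ha; have [q [hq e]] := omega_globG hX hw (vsigma_order hS) z0 zd
  (as_x sm) (as_v sm) (as_E sm) (as_field sm) (as_c sm) (as_x0 sm) (as_v0 sm) (as_E0 sm) (as_field0 sm) (as_c0 sm)
  (Lo := Lo) (a := a) f
  (fun k g => lspan_incl (ex_intro _ _ (ex_intro _ _ (conj (vR_stable hX w k (compl_subspace hC) gC iC ha) erefl)))).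
by exists q, t; split=> //; exact: esym (e t).
Qed.

Lemma big_omega_span A f t : (forall k, lspan (vac_pos Lo) (vR (L := vac_vla L) w k A)) ->
  big_span (big_omega A f t).
Proof.
move=> hA; have [q [hq e]] := omega_globG gV hw (vac_vla_order hL hS) z0 zd
  (as_x bg) (as_v bg) (as_E bg) (as_field bg) (as_c bg) (as_x0 bg) (as_v0 bg) (as_E0 bg) (as_field0 bg) (as_c0 bg)
  (Lo := Vo) (a := A) f (fun k g => vac_pos_rho hL hS g hC cV gVo sV (hA k)).
by exists q, t; split=> //; exact: esym (e t).
Qed.

Lemma big_sub_small : big_span `<=` lspan small_span.
Proof.
move=> s [q [t [hq ->]]].
have := globG_omega gV hw (vac_vla_order hL hS) z0 zd
  (as_x bg) (as_v bg) (as_E bg) (as_field bg) (as_c bg) (as_x0 bg) (as_v0 bg) (as_E0 bg) (as_field0 bg) (as_c0 bg) t hq.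
apply: lspan_sub => u [A [f [hA ->]]].
apply: (pos_omega hL hw hS z0 zd hm hm0 (lspan_subspace small_span) (Lo := Lo) _ (complement_span hX hC gC) f t (sV hA)).
by move=> a g t' ha; apply: lspan_incl; exact: small_omega_span.
Qed.

(** The state a(-1)|0> need not lie in Vo. Each of its rotations (R_(w^k) a)(-1)|0> is in the span
    of [vac_pos Lo], as Lo is graded and stable under sigma, and [vac_pos_rho] rewrites it through
    Vo without a vacuum term. *)
Lemma small_sub_big : small_span `<=` lspan big_span.
Proof.
move=> s [q [t [hq ->]]].
have := globG_omega hX hw (vsigma_order hS) z0 zd
  (as_x sm) (as_v sm) (as_E sm) (as_field sm) (as_c sm) (as_x0 sm) (as_v0 sm) (as_E0 sm) (as_field0 sm) (as_c0 sm) t hq.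
apply: lspan_sub => u [a [f [ha ->]]].
have -> : small_omega a f t = big_omega (vact (mode a (-1)) (vacuum L)) f t.
  apply: eq_bigr => r _; apply: eq_fsum => n; congr (_ *: _).
  exact: esym (small_big_field hL hw hS hm hm0 r a n t).
apply: lspan_incl; apply: big_omega_span => k.
have e := vR_mode hL hw hS k a (-1) (vacuum L).
rewrite e scale1r [vR (L := vac_vla L) w k (vacuum L)](vR_c gV).
apply: lspan_incl; apply: (vac_pos1 0); exact: (vR_stable hX w k (compl_subspace hC) gC iC ha).
Qed.

End Coinvariants.

Theorem theorem6p2 (R : realType) (T : nat) (w : R[i]) (L : vla R[i])
    (Lo : set L) (Vo : set (vac_vla L)) (N : nat) (z : 'I_N -> R[i])
    (M : 'I_N -> lmodType R[i]) (act : forall i, loop L -> M i -> M i)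
    (M0 : lmodType R[i]) (act0 : loop L -> M0 -> M0) :
  T.-primitive_root w ->
  vertex_lie_algebra L ->
  vla_automorphism L T ->
  vla_complement Lo -> vla_graded Lo -> (forall a, Lo a -> Lo (vsigma a)) ->
  vla_complement Vo -> vla_graded Vo -> Vo `<=` lspan (vac_pos Lo) ->
  (forall i, z i != 0) ->
  (forall i j k l, i != j -> w ^+ k * z i != w ^+ l * z j) ->
  (forall i, smooth_module (act i)) ->
  smooth_moduleG T w act0 ->
  exists f : {linear
      coinvariants Vo T w z (fun i => big_act (act i)) (big_actG T w act0) ->
      coinvariants Lo T w z act act0},
    bijective f.
Proof.
move=> hw hL hS hC gC iC cV gVo sV z0 zd hm hm0; apply: quot_same_span.
  exact: (big_sub_small (K := R[i]) hL hw hS z0 zd hm hm0 hC gC iC sV).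
exact: (small_sub_big (K := R[i]) hL hw hS z0 zd hm hm0 hC gC iC cV gVo sV).
Qed.
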